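(* Suppose that $\sigma_0\in(\frac12,1)$. There exists $\theta\in\mathring{\mathcal H}^{2,\Sigma_0}_{\tan,3}(\Omega)$ for which there cannot exist a curve $\varepsilon\mapsto(v(\varepsilon),q(\varepsilon),\xi(\varepsilon))$, defined for $\varepsilon$ near $0$, with $$v(\varepsilon)\in\mathbf E,\qquad q(\varepsilon)\in L^2_{\rm loc}([0,+\infty);\mathcal H^1_{\tan,3}(\Omega)),$$ $$\xi(\varepsilon)\in\mathcal C([0,+\infty);\mathring{\mathcal H}^{2,\Sigma_0}_{\tan,3}(\Omega))\cap\mathcal C_b([0,+\infty);H^4(\Sigma_0))\cap\mathcal C_b([0,+\infty);\mathring{\mathcal H}^{2,\Sigma_0}_{\tan,2}(\Omega)),$$ such that for each such $\varepsilon$ the viscous surface wave problem (VSW) holds with initial data $\xi_0=\varepsilon\theta$, $v_0=0$, and $$\|\xi^1(t)\|_{H^2(\Sigma_0)}\to0\quad\text{as }t\to+\infty,$$ and such that $v(\varepsilon)$ is of the form $$v(\varepsilon)=\varepsilon v^{(1)}+\varepsilon^2v^{(2)}+\varepsilon^3v^{(3)}$$ in the space $\mathbf E$, where $$\mathbf E=\mathcal C_b([0,+\infty);\mathcal H^1_{0,\tan,3}(\Omega))\cap L^2_{\rm loc}([0,+\infty);\mathcal H^2_{\tan,3}(\Omega))\cap L^1([0,+\infty);\dot\Lambda_h^{-\sigma_0}\mathcal H^2_{\tan,2}(\Omega))\cap L^2([0,+\infty);\dot\Lambda_h^{-1}\mathcal H^1_{\tan,3}(\Omega)).$$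
   Context: Fix $\underline b,\nu>0$. $\Omega=\{x=(x_1,x_h):-\underline b<x_1<0,\ x_h=(x_2,x_3)\in\mathbb R^2\}$, $\Sigma_0=\{x_1=0\}$, $\Sigma_b=\{x_1=-\underline b\}$. Repeated Latin indices are summed over $1,2,3$. $\partial_h^k$ denotes all derivatives of order $k$ in $x_2,x_3$; $\dot\Lambda_h^s$ is the Fourier multiplier in $x_h$ with symbol $|\varsigma_h|^s$. The unknowns are the displacement $\xi(t,x)\in\mathbb R^3$, velocity $v(t,x)\in\mathbb R^3$ and pressure $q(t,x)\in\mathbb R$ on $\Omega$. $\eta=x+\xi$, $(D\eta)_{ij}=\partial_j\eta^i$, $J=\det D\eta$, $\mathcal A=(D\eta)^{-T}$ with $(i,j)$ entry $\mathcal A_i^j$, $(\nabla_{\mathcal A}f)_i=\mathcal A_i^j\partial_jf$, $\nabla_{\mathcal A}\cdot v=\mathcal A_i^j\partial_jv^i$, $(\mathbb D_{\mathcal A}(v))_{ij}=\mathcal A_i^k\partial_kv^j+\mathcal A_j^k\partial_kv^i$, $(\nabla_{\mathcal A}\cdot M)_i=\mathcal A_j^k\partial_kM_{ij}$, $\mathcal N=J\mathcal A\,e_1$. The problem (VSW) is $$\partial_t\xi=v,\quad \partial_tv+\nabla_{\mathcal A}q-\nu\nabla_{\mathcal A}\cdot\mathbb D_{\mathcal A}(v)=0,\quad \nabla_{\mathcal A}\cdot v=0\ \text{ in }\Omega,$$ $$(q-\xi^1)\mathcal N-\nu\mathbb D_{\mathcal A}(v)\mathcal N=0\ \text{ on }\Sigma_0,\quad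 v|_{\Sigma_b}=0,\quad \xi|_{t=0}=\xi_0,\ v|_{t=0}=v_0.$$ Function spaces, for $N\in\mathbb N$: $\mathcal H^s_{\tan,N}(\Omega)=\{f\in H^s(\Omega):\sum_{i=0}^N\|\partial_h^if\|_{H^s(\Omega)}^2<\infty\}$; $\mathcal H^s_{0,\tan,N}(\Omega)$ is the subspace of those $f$ with $f|_{\Sigma_b}=0$; $\mathring{\mathcal H}^{2,\Sigma_0}_{\tan,N}(\Omega)=\{f\in H^2(\Omega):\sum_{i=0}^N(\|\partial_h^if^1\|_{H^1(\Sigma_0)}^2+\|\partial_h^i\nabla f\|_{H^1(\Omega)}^2)<\infty\}$; each is normed by the square root of the displayed sum. $\mathcal C_b$ denotes bounded continuous functions, $L^2_{\rm loc}([0,+\infty);X)$ functions square integrable on bounded time intervals. $v\in L^p([0,+\infty);\dot\Lambda_h^{-s}X)$ means $\dot\Lambda_h^sv\in L^p([0,+\infty);X)$. *)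

(* Defs.v *)
From HB Require Import structures.
From mathcomp Require Import all_boot all_order all_algebra.
From mathcomp Require Import all_classical all_reals all_analysis.

Set Implicit Arguments.
Unset Strict Implicit.
Unset Printing Implicit Defensive.

Import Order.TTheory GRing.Theory Num.Theory numFieldNormedType.Exports.
Local Open Scope classical_set_scope.
Local Open Scope ring_scope.

(** ** Test functions *)

Section test_functions.
Variables (R : realType) (E : normedModType R) (n : nat) (e : 'I_n -> E).

Definition pd (j : 'I_n) (f : E -> R) : E -> R := fun x => 'D_(e j) f x.

(* When [e] is a basis of [E], this is C^oo. *)
Definition smooth (f : E -> R) : Prop :=
  forall (w : seq 'I_n) (x : E), differentiable (foldr pd f w) x.

(* C_c^oo(U) *)
Definition testfun (U : set E) : set (E -> R) :=
  [set f | smooth f /\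
    exists K : set E, [/\ compact K, K `<=` U & forall x, ~ K x -> f x = 0]].

End test_functions.

(** ** Weak derivatives and Sobolev norms

   An order-k derivative is indexed by a word of length k in the coordinate
   indices, so a sum over [k.-tuple 'I_n] is the squared norm of the full
   tensor of derivatives of order k. *)

Section weak_derivatives.
Context (R : realType) (d : measure_display) (T : measurableType d).
Variables (mu : {measure set T -> \bar R}) (U : set T) (n : nat).
Variables (test : set (T -> R)) (D : 'I_n -> (T -> R) -> (T -> R)).

(* L^1_loc(U): some test function is >= 1 on any given compact subset of U. *)
Definition locint (f : T -> R) : Prop :=
  measurable_fun U f /\
  forall phi, test phi -> mu.-integrable U (EFin \o (f \* phi)).

Definition is_wderiv (w : seq 'I_n) (f g : T -> R) : Prop :=
  [/\ locint f, locint g & forall phi, test phi ->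
    \int[mu]_(x in U) (f x * foldr D phi w x) =
    (-1) ^+ size w * \int[mu]_(x in U) (g x * phi x)].

(* A representative of the weak derivative; 0 if there is none. *)
Definition wderiv (w : seq 'I_n) (f : T -> R) : T -> R :=
  xget (cst 0) [set g | is_wderiv w f g].

(* Squared L^2(U) norm of the weak derivative; +oo if there is none. *)
Definition dnorm2 (w : seq 'I_n) (f : T -> R) : \bar R :=
  if `[< exists g, is_wderiv w f g >]
  then (\int[mu]_(x in U) ((wderiv w f x) ^+ 2)%:E)%E else +oo%E.

Definition sob2 (s : nat) (f : T -> R) : \bar R :=
  (\sum_(k < s.+1) \sum_(w : k.-tuple 'I_n) dnorm2 w f)%E.

(* sum_(i <= N) ||d_h^i f||_{H^s}^2, where [h] embeds the horizontal indices
   into the coordinate indices. *)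
Definition tan2 (h : 'I_2 -> 'I_n) (s N : nat) (f : T -> R) : \bar R :=
  (\sum_(i < N.+1) \sum_(u : i.-tuple 'I_2)
     \sum_(k < s.+1) \sum_(w : k.-tuple 'I_n) dnorm2 (w ++ map h u) f)%E.

End weak_derivatives.

(** ** Functions of time with values in a normed space

   The space is given by an extended norm on [V] (+oo outside of the space);
   elements of [V] are representatives. *)

Section bochner.
Context (R : realType) (V : lmodType R).
Variable nrm : V -> \bar R.
Implicit Types (u : R -> V) (I : set R).

(* C([0,+oo); X) *)
Definition ccont u : Prop :=
  (forall t : R, 0 <= t -> (nrm (u t) < +oo)%E) /\
  (forall t : R, 0 <= t ->
    nrm (u s - u t) @[s --> within [set s | 0 <= s] (nbhs t)] --> 0%E).

(* C_b([0,+oo); X) *)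
Definition cbcont u : Prop :=
  ccont u /\ exists M : R, forall t : R, 0 <= t -> (nrm (u t) <= M%:E)%E.

Definition vsimple u : Prop :=
  exists (m : nat) (A : 'I_m -> set R) (c : 'I_m -> V),
    [/\ forall k, measurable (A k : set (measurableTypeR R)),
        forall k, (nrm (c k) < +oo)%E
      & forall t, u t = \sum_(k < m) (\1_(A k) t : R) *: c k].

Definition strongly_measurable I u : Prop :=
  exists s : nat -> R -> V, (forall m, vsimple (s m)) /\
    {ae @lebesgue_measure R, forall t : R, I t ->
       nrm (s m t - u t) @[m --> \oo] --> 0%E}.

(* L^p(I; X) *)
Definition bochner_Lp (p : nat) I u : Prop :=
  strongly_measurable I u /\
  (\int[@lebesgue_measure R]_(t in I) (nrm (u t) ^+ p) < +oo)%E.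

(* L^2_loc([0,+oo); X) *)
Definition bochner_L2loc u : Prop :=
  forall t1 : R, 0 < t1 -> bochner_Lp 2 `[0, t1] u.

End bochner.

(** ** Lebesgue measure on R^2 and R^3

   Points of R^3 are x = (x_1, x_h) : R * (R * R).  [mplane] and [mspace] are
   convertible to [R * R] and [R * (R * R)]; they carry the sigma-algebra on
   which Lebesgue measure is defined. *)

Section lebesgue.
Variable R : realType.

Definition mplane := (measurableTypeR R * measurableTypeR R)%type.
HB.instance Definition _ := Measurable.on mplane.
Definition mspace := (measurableTypeR R * mplane)%type.
HB.instance Definition _ := Measurable.on mspace.

Let mu1 : {sigma_finite_measure set (measurableTypeR R) -> \bar R} :=
  @lebesgue_measure R.

Definition mu2 : set mplane -> \bar R := (mu1 \x mu1)%E.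
HB.instance Definition _ := Measure.on mu2.

Let mu2_sigma_finite : sigma_finite setT mu2.
Proof.
have /sigma_finiteP[F [TF ndF Foo]] := sigma_finiteT mu1.
exists (fun n => F n `*` F n).
  rewrite -setXTT TF predeqE => -[x y]; split.
    move=> [/= [n _ Fnx] [k _ Fky]]; exists (maxn n k) => //; split.
    - by move: x Fnx; exact/subsetPset/ndF/leq_maxl.
    - by move: y Fky; exact/subsetPset/ndF/leq_maxr.
  by move=> [n _ []/= ? ?]; split; exists n.
move=> k; have [? ?] := Foo k.
split; first exact: measurableX.
by rewrite /mu2 product_measure1E// lte_mul_pinfty// ge0_fin_numE.
Qed.
HB.instance Definition _ :=
  Measure_isSigmaFinite.Build _ _ _ mu2 mu2_sigma_finite.

Definition mu3 : set mspace -> \bar R := (mu1 \x mu2)%E.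
HB.instance Definition _ := Measure.on mu3.

End lebesgue.
Arguments mu2 {R}.
Arguments mu3 {R}.

(** ** Function spaces on the slab *)

Section slab.
Variables (R : realType) (b : R).

Local Notation plane := (R * R)%type.
Local Notation space := (R * (R * R))%type.
Local Notation field := ('I_3 -> space -> R).

Definition Omega : set space := [set x | - b < x.1 < 0].

(* e_1, e_2, e_3, with indices starting from 0. *)
Definition dir3 (j : 'I_3) : space :=
  ((val j == 0)%N%:R, ((val j == 1)%N%:R, (val j == 2)%N%:R)).
Definition dir2 (j : 'I_2) : plane := ((val j == 0)%N%:R, (val j == 1)%N%:R).

Definition test3 : set (space -> R) := testfun dir3 Omega.
Definition test2 : set (plane -> R) := testfun dir2 setT.

Definition locint3 : (space -> R) -> Prop := locint mu3 Omega test3.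

Definition wd3 : seq 'I_3 -> (space -> R) -> space -> R :=
  wderiv mu3 Omega test3 (pd dir3).
Definition has_wd3 (w : seq 'I_3) (f : space -> R) : Prop :=
  exists g, is_wderiv mu3 Omega test3 (pd dir3) w f g.

(* Squared norm of H^s(Omega). *)
Definition Hs2 : nat -> (space -> R) -> \bar R :=
  sob2 mu3 Omega test3 (pd dir3).

(* Squared norm of H^s_{tan,N}(Omega). *)
Definition Htan2 : nat -> nat -> (space -> R) -> \bar R :=
  tan2 mu3 Omega test3 (pd dir3) (lift ord0).

(* Squared norm of H^s(R^2). *)
Definition Hplane2 : nat -> (plane -> R) -> \bar R :=
  sob2 mu2 setT test2 (pd dir2).

(* sum_(i <= N) ||d_h^i g||_{H^s(R^2)}^2 *)
Definition Hplane_tan2 : nat -> nat -> (plane -> R) -> \bar R :=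
  tan2 mu2 setT test2 (pd dir2) id.

(* [g] is the trace of [f] on {x_1 = a}: the limit of the restrictions of
   smooth functions converging to [f] in H^1(Omega). *)
Definition is_trace (a : R) (f : space -> R) (g : plane -> R) : Prop :=
  measurable_fun (setT : set (mplane R)) g /\
  exists phi : nat -> space -> R,
    [/\ forall m, testfun dir3 setT (phi m),
        Hs2 1 (phi m \- f) @[m --> \oo] --> 0%E
      & (\int[mu2]_y ((phi m (a, y) - g y) ^+ 2)%:E)%E @[m --> \oo] --> 0%E].

(* A representative of the trace on Sigma_0; 0 if there is none. *)
Definition trace0 (f : space -> R) : plane -> R :=
  xget (cst 0) [set g | is_trace 0 f g].

(* [N2] of the trace on Sigma_0; +oo if there is none. *)
Definition on_Sigma0 (N2 : (plane -> R) -> \bar R) (f : space -> R) : \bar R :=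
  if `[< exists g, is_trace 0 f g >] then N2 (trace0 f) else +oo%E.

(* From squared norms of scalar functions to norms of scalar functions and of
   vector fields. *)
Definition snorm (N2 : (space -> R) -> \bar R) (f : space -> R) : \bar R :=
  sqrte (N2 f).
Definition vnorm (N2 : (space -> R) -> \bar R) (f : field) : \bar R :=
  sqrte (\sum_i N2 (f i))%E.

(* H^s_{0,tan,N}(Omega) *)
Definition vnorm0tan (s N : nat) (f : field) : \bar R :=
  if `[< forall i, is_trace (- b) (f i) (cst 0) >]
  then vnorm (Htan2 s N) f else +oo%E.

(* The ringed space of order (2, Sigma_0), tan, N: the L^2 norm of f is required
   to be finite, but it is not part of the norm. *)
Definition vnorm_ring (N : nat) (f : field) : \bar R :=
  if `[< forall i, (Hs2 2 (f i) < +oo)%E >]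
  then sqrte (on_Sigma0 (Hplane_tan2 1 N) (f ord0) +
              \sum_(i < 3) \sum_(j < 3) Htan2 1 N (wd3 [:: j] (f i)))%E
  else +oo%E.

(** ** The multiplier |varsigma_h|^s *)

Definition dotp (y z : plane) : R := y.1 * z.1 + y.2 * z.2.

Definition cos_transform (psi : space -> R) (x : space) : R :=
  \int[mu2]_z (psi (x.1, z) * cos (dotp x.2 z)).
Definition sin_transform (psi : space -> R) (x : space) : R :=
  \int[mu2]_z (psi (x.1, z) * sin (dotp x.2 z)).

(* The horizontal Fourier transform
     F(x_1, z) = int f(x_1, y) exp(- i y . z) dy
   of f in L^2(Omega) is F = p + i q, defined by duality. *)
Definition is_hfourier (f p q : space -> R) : Prop :=
  [/\ (Hs2 0 f < +oo)%E, locint3 p, locint3 q & forall psi, test3 psi ->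
    \int[mu3]_(x in Omega) (p x * psi x) =
      \int[mu3]_(x in Omega) (f x * cos_transform psi x) /\
    \int[mu3]_(x in Omega) (q x * psi x) =
      - \int[mu3]_(x in Omega) (f x * sin_transform psi x)].

(* g = Lambda_h^s f *)
Definition is_Lambda (s : R) (f g : space -> R) : Prop :=
  let m (x : space) := Num.sqrt (dotp x.2 x.2) `^ s in
  exists p q, is_hfourier f p q /\ is_hfourier g (m \* p) (m \* q).

(* L^p([0,+oo); Lambda_h^{-s} X) *)
Definition bochner_Lp_Lambda (p : nat) (s : R) (nrm : field -> \bar R)
    (u : R -> field) : Prop :=
  exists w : R -> field, bochner_Lp nrm p `[0, +oo[ w /\
    {ae @lebesgue_measure R, forall t : R, 0 <= t ->
       forall i, is_Lambda s (u t i) (w t i)}.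

Definition spaceE (sigma0 : R) (v : R -> field) : Prop :=
  [/\ cbcont (vnorm0tan 1 3) v,
      bochner_L2loc (vnorm (Htan2 2 3)) v,
      bochner_Lp_Lambda 1 sigma0 (vnorm (Htan2 2 2)) v
    & bochner_Lp_Lambda 2 1 (vnorm (Htan2 1 3)) v].

(** ** The viscous surface wave problem *)

(* d_t u = g in the sense of distributions on (0,+oo) x Omega, tested against
   tensor products. *)
Definition is_dt (u g : R -> space -> R) : Prop :=
  {ae @lebesgue_measure R, forall t : R, 0 < t ->
     locint3 (u t) /\ locint3 (g t)} /\
  forall (psi : R -> R) (phi : space -> R),
    testfun (fun _ : 'I_1 => 1 : R^o) [set t | 0 < t] psi -> test3 phi ->
    let U (t : R) := derive1 psi t * \int[mu3]_(x in Omega) (u t x * phi x) in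
    let G (t : R) := psi t * \int[mu3]_(x in Omega) (g t x * phi x) in
    [/\ (@lebesgue_measure R).-integrable `]0, +oo[ (EFin \o U),
        (@lebesgue_measure R).-integrable `]0, +oo[ (EFin \o G)
      & \int[@lebesgue_measure R]_(t in `]0, +oo[) U t =
        - \int[@lebesgue_measure R]_(t in `]0, +oo[) G t].

(* (i, j) entry: d_j f^i *)
Definition grad (f : field) (x : space) : 'M[R]_3 :=
  \matrix_(i, j) wd3 [:: j] (f i) x.
Definition grad_Sigma0 (f : field) (y : plane) : 'M[R]_3 :=
  \matrix_(i, j) trace0 (wd3 [:: j] (f i)) y.

(* J and A as functions of the displacement gradient, and D_A(v) as a function
   of A and of the velocity gradient. *)
Definition Jof (G : 'M[R]_3) : R := \det (1%:M + G).
Definition Aof (G : 'M[R]_3) : 'M[R]_3 := (invmx (1%:M + G))^T.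
Definition symgradA (A H : 'M[R]_3) : 'M[R]_3 :=
  \matrix_(i, j) \sum_(k < 3) (A i k * H j k + A j k * H i k).

Definition DA (xi v : field) (i j : 'I_3) (x : space) : R :=
  symgradA (Aof (grad xi x)) (grad v x) i j.

Record VSW (nu : R) (xi0 v0 : field)
    (xi v : R -> field) (q : R -> space -> R) : Prop := {
  vsw_displacement : forall i, is_dt (fun t => xi t i) (fun t => v t i);
  vsw_momentum : exists dtv : R -> field,
    (forall i, is_dt (fun t => v t i) (fun t => dtv t i)) /\
    {ae @lebesgue_measure R, forall t : R, 0 <= t ->
      (forall i j k, has_wd3 [:: k] (DA (xi t) (v t) i j)) /\
      {ae mu3, forall x : space, Omega x ->
        let A := Aof (grad (xi t) x) in
        Jof (grad (xi t) x) != 0 /\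
        forall i,
          dtv t i x + \sum_(j < 3) A i j * wd3 [:: j] (q t) x
          - nu * (\sum_(j < 3) \sum_(k < 3)
                    A j k * wd3 [:: k] (DA (xi t) (v t) i j) x) = 0}};
  vsw_incompressible :
    {ae @lebesgue_measure R, forall t : R, 0 <= t ->
      {ae mu3, forall x : space, Omega x ->
        \sum_(i < 3) \sum_(j < 3)
          Aof (grad (xi t) x) i j * grad (v t) x i j = 0}};
  vsw_Sigma0 :
    {ae @lebesgue_measure R, forall t : R, 0 <= t ->
      {ae mu2, forall y : plane,
        let G := grad_Sigma0 (xi t) y in
        let N := (fun i => Jof G * Aof G i ord0) in
        let S := symgradA (Aof G) (grad_Sigma0 (v t) y) in
        Jof G != 0 /\
        forall i, (trace0 (q t) y - trace0 (xi t ord0) y) * N i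
                  - nu * (\sum_(j < 3) S i j * N j) = 0}};
  vsw_Sigmab : forall t : R, 0 <= t ->
    forall i, is_trace (- b) (v t i) (cst 0);
  vsw_init_xi :
    {ae mu3, forall x : space, Omega x -> forall i, xi 0 i x = xi0 i x};
  vsw_init_v :
    {ae mu3, forall x : space, Omega x -> forall i, v 0 i x = v0 i x}
}.

End slab.

(* Main.v *)
(** Only the linear low-frequency behaviour matters. Write [c_r] for the pairing
    of the trace of [theta^1] with the product Poisson kernel of scale [r], a
    test function concentrated at horizontal frequencies of size [1/r].
    Dividing the displacement equation by [eps] along [eps -> 0], the
    displacement gradients tend to 0, so [div v1 = 0]. Pairing
    [d_t xi^1 = v^1] with the kernel on [Sigma_0], letting [t -> +oo] and
    extracting the coefficient of [eps] gives
    [c_r = - int_0^oo int_Omega d_1 v1^1 kernel]. Since [v1] is divergence free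
    the flux equals [int v1^h . grad_h kernel], and the multiplier bound
    [v1 in L^1(Lambda_h^{-sigma0} ...)] forces [|c_r| <= C r^{sigma0}]. For
    [theta^1 = (1 + x_2^2)^{-s} (1 + x_3^2)^{-s}] with [s > 1/4] close to [1/4],
    however, [c_r >= c r^{2 - 4 s}] and [2 - 4 s > sigma0]. *)

Require Import Defs.
From HB Require Import structures.
From mathcomp Require Import all_boot all_order all_algebra.
From mathcomp Require Import all_classical all_reals all_analysis.
From mathcomp Require Import measurable_realfun ring lra.
Set Implicit Arguments.
Unset Strict Implicit.
Unset Printing Implicit Defensive.
Import Order.TTheory GRing.Theory Num.Theory numFieldNormedType.Exports.
Local Open Scope classical_set_scope.
Local Open Scope ring_scope.

(** The exponents leave just enough room: [(1 + y^2)^(-s)] is square integrable on the line exactly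
    for s > 1/4, so the lower exponent 2 - 4 s can be brought as close to 1 as desired, while the
    upper one is sigma0 < 1. The gain comes from the horizontal gradient of the kernel, whose size
    at frequency z is |z| exp(- r (|z_1| + |z_2|)) up to powers of r: division by |z|^sigma0 leaves
    a positive power of |z|, absorbed by half of the exponential. Product Poisson kernels serve
    because they and their Fourier transforms are explicit.

    The obstacle is that the multiplier is defined by duality with test functions of the slab,
    whereas the frequency profile of the kernel is neither smooth nor compactly supported. Extending
    the duality requires an L^2 bound for the Fourier transform. As the gradient of an even kernel
    is odd, the sine transform suffices, and its bound is proved directly by a T T^* argument with
    Schur's test. The kernel is extended to Omega constantly in x_1; traces enter through identities
    whose weights are affine in x_1. *)

(** * Square-integrable functions on a measurable set *)

Section square_integrable.
Context (R : realType) (d : measure_display) (T : measurableType d).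
Variables (mu : {measure set T -> \bar R}) (D : set T).
Hypothesis mD : measurable D.
Implicit Types f g h : T -> R.

Local Notation itg f := (mu.-integrable D (EFin \o f)).

Lemma itgD f g : itg f -> itg g -> itg (fun x => f x + g x).
Proof. by move=> fi gi; have := integrableD mD fi gi; apply: eq_integrable. Qed.

Lemma itgB f g : itg f -> itg g -> itg (fun x => f x - g x).
Proof. by move=> fi gi; have := integrableB mD fi gi; apply: eq_integrable. Qed.

Lemma itgZ (c : R) f : itg f -> itg (fun x => c * f x).
Proof. by move=> fi; have := integrableZl mD c fi; apply: eq_integrable. Qed.

Lemma itg_meas f : itg f -> measurable_fun D f.
Proof. by move/measurable_int/measurable_EFinP. Qed.

Lemma itg_le f g : measurable_fun D f -> (forall x, D x -> `|f x| <= g x) ->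
  itg g -> itg f.
Proof.
move=> mf fg; apply: le_integrable => //; first exact/measurable_EFinP.
by move=> x Dx; rewrite /= lee_fin (le_trans (fg _ Dx))// ler_norm.
Qed.

Lemma itgP f : measurable_fun D f -> (\int[mu]_(x in D) `|f x|%:E < +oo)%E ->
  itg f.
Proof. by move=> mf fi; apply/integrableP; split => //; exact/measurable_EFinP. Qed.

Lemma ae_eqP f g : {ae mu, forall x, D x -> f x = g x} ->
  ae_eq mu D (EFin \o f) (EFin \o g).
Proof. by apply: filterS => x + Dx => /(_ Dx) /= ->. Qed.

Lemma ae_eq_itg f g : measurable_fun D g ->
  {ae mu, forall x, D x -> f x = g x} -> itg f -> itg g.
Proof.
move=> mg fg fi; apply: itgP => //.
have /integrableP[mf foo] := fi.
rewrite (@ge0_ae_eq_integral _ _ _ mu D _ (fun x => `|(f x)%:E|%E))//.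
- by apply/measurable_EFinP; exact: measurableT_comp.
- exact: measurableT_comp.
- by apply: filterS fg => x + Dx => /(_ Dx) ->.
Qed.

Lemma ae_eq_Rint f g : measurable_fun D f -> measurable_fun D g ->
  {ae mu, forall x, D x -> f x = g x} ->
  \int[mu]_(x in D) f x = \int[mu]_(x in D) g x.
Proof.
move=> mf mg fg; rewrite /Rintegral; congr fine; apply: ae_eq_integral => //.
- exact/measurable_EFinP.
- exact/measurable_EFinP.
- exact: ae_eqP.
Qed.

Lemma itgE f : itg f ->
  (\int[mu]_(x in D) (f x)%:E)%E = (\int[mu]_(x in D) f x)%:E.
Proof. by move=> fi; rewrite fineK// integrable_fin_num. Qed.

Lemma le_Rint_ae f g : itg f -> itg g ->
  {ae mu, forall x, D x -> f x <= g x} ->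
  \int[mu]_(x in D) f x <= \int[mu]_(x in D) g x.
Proof.
move=> fi gi fg.
(* The a.e. inequality becomes a pointwise one once [g] is replaced by [max f g], which equals [g]
   a.e. *)
have mfg : measurable_fun D (fun x => Num.max (f x) (g x)).
  by apply: measurable_maxr; exact: itg_meas.
have eg : {ae mu, forall x, D x -> g x = Num.max (f x) (g x)}.
  by apply: filterS fg => x + Dx => /(_ Dx) h; rewrite (max_idPr h).
rewrite (ae_eq_Rint (itg_meas gi) mfg eg); apply: le_Rintegral => //.
  exact: ae_eq_itg eg gi.
by move=> x _; rewrite le_max lexx.
Qed.

Lemma Rint_dct (f_ : nat -> T -> R) f g :
  (forall n, measurable_fun D (f_ n)) -> measurable_fun D f -> itg g ->
  {ae mu, forall x, D x -> f_ ^~ x @ \oo --> f x} ->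
  {ae mu, forall x, D x -> forall n, `|f_ n x| <= g x} ->
  itg f /\ \int[mu]_(x in D) f_ n x @[n --> \oo] --> \int[mu]_(x in D) f x.
Proof.
move=> mf_ mf gi cf fg.
have cf' : {ae mu, forall x, D x -> (f_ n x)%:E @[n --> \oo] --> (f x)%:E}.
  by apply: filterS cf => x + Dx => /(_ Dx) c; apply: cvg_EFin => //; exact: nearW.
have fg' : {ae mu, forall x n, D x -> (`|(f_ n x)%:E| <= (g x)%:E)%E}.
  by apply: filterS fg => x h n Dx; rewrite lee_fin; exact: h.
have mE n : measurable_fun D (EFin \o f_ n) by exact/measurable_EFinP.
have mE' : measurable_fun D (EFin \o f) by exact/measurable_EFinP.
have [fi _ c] := dominated_convergence mD mE mE' cf' gi fg'.
split => //; apply: fine_cvg.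
rewrite -itgE//; exact: c.
Qed.

(** Functions are used rather than classes modulo a.e. equality, to match weak derivatives and
    traces, which are representatives chosen by [xget]. Finiteness is stated with the extended
    integral, since the real-valued one is 0 when the integral diverges. *)
Definition L2 f :=
  measurable_fun D f /\ (\int[mu]_(x in D) ((f x) ^+ 2)%:E < +oo)%E.

Definition ip f g := \int[mu]_(x in D) (f x * g x).

Lemma L2_meas f : L2 f -> measurable_fun D f. Proof. by case. Qed.

Lemma L2_sq f : L2 f <-> measurable_fun D f /\ itg (fun x => f x ^+ 2).
Proof.
split=> -[mf h]; split => //.
  apply: itgP; first exact: measurable_funX.
  by under eq_integral => x _ do rewrite ger0_norm ?sqr_ge0//.
have /integrableP[_] := h.
by under eq_integral => x _ do rewrite /= ger0_norm ?sqr_ge0//.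
Qed.

Lemma L2_itgM f g : L2 f -> L2 g -> itg (fun x => f x * g x).
Proof.
move=> /L2_sq[mf fi] /L2_sq[mg gi].
apply: (@itg_le _ (fun x => f x ^+ 2 + g x ^+ 2)); last exact: itgD.
  exact: measurable_funM.
move=> x _; rewrite normrM -(real_normK (num_real (f x))).
rewrite -(real_normK (num_real (g x))).
by have := normr_ge0 (f x); have := normr_ge0 (g x); nra.
Qed.

Lemma L2_le f g : measurable_fun D f -> (forall x, D x -> `|f x| <= `|g x|) ->
  L2 g -> L2 f.
Proof.
move=> mf fg /L2_sq[mg gi]; apply/L2_sq; split => //.
apply: itg_le gi; first exact: measurable_funX.
move=> x Dx; rewrite ger0_norm ?sqr_ge0//.
by rewrite -(real_normK (num_real (f x))) -(real_normK (num_real (g x))) lerXn2r ?nnegrE ?fg.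
Qed.

Lemma L2D f g : L2 f -> L2 g -> L2 (fun x => f x + g x).
Proof.
move=> Lf Lg; have ifg := L2_itgM Lf Lg.
move: Lf Lg => /L2_sq[mf fi] /L2_sq[mg gi]; apply/L2_sq; split.
  exact: measurable_funD.
have := itgD (itgD fi gi) (itgZ 2 ifg); apply: eq_integrable => // x _ /=.
by congr EFin; ring.
Qed.

Lemma L2Z (c : R) f : L2 f -> L2 (fun x => c * f x).
Proof.
move=> /L2_sq[mf fi]; apply/L2_sq; split; first exact: measurable_funM.
have := itgZ (c ^+ 2) fi; apply: eq_integrable => // x _ /=.
by congr EFin; ring.
Qed.

Lemma L2N f : L2 f -> L2 (fun x => - f x).
Proof. by move=> /(L2Z (-1)); under eq_fun do rewrite mulN1r. Qed.

Lemma L2B f g : L2 f -> L2 g -> L2 (fun x => f x - g x).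
Proof. by move=> Lf /L2N; exact: L2D. Qed.

Lemma L2_ae f g : measurable_fun D g -> {ae mu, forall x, D x -> f x = g x} ->
  L2 f -> L2 g.
Proof.
move=> mg fg /L2_sq[mf fi]; apply/L2_sq; split => //.
apply: ae_eq_itg fi; first exact: measurable_funX.
by apply: filterS fg => x + Dx => /(_ Dx) ->.
Qed.

Lemma ipC f g : ip f g = ip g f.
Proof. by apply: eq_Rintegral => x _; rewrite mulrC. Qed.

Lemma ipDl f g h : L2 f -> L2 g -> L2 h ->
  ip (fun x => f x + g x) h = ip f h + ip g h.
Proof.
move=> Lf Lg Lh; rewrite /ip -RintegralD//; try exact: L2_itgM.
by apply: eq_Rintegral => x _; rewrite mulrDl.
Qed.

Lemma ipZl c f h : L2 f -> L2 h -> ip (fun x => c * f x) h = c * ip f h.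
Proof.
move=> Lf Lh; rewrite /ip -RintegralZl//; try exact: L2_itgM.
by apply: eq_Rintegral => x _; rewrite mulrA.
Qed.

Lemma ipNl f h : L2 f -> L2 h -> ip (fun x => - f x) h = - ip f h.
Proof.
by move=> Lf Lh; rewrite -mulN1r -ipZl//; apply: eq_Rintegral => x _; rewrite mulN1r.
Qed.

Lemma ipBl f g h : L2 f -> L2 g -> L2 h ->
  ip (fun x => f x - g x) h = ip f h - ip g h.
Proof. by move=> Lf Lg Lh; rewrite ipDl ?ipNl//; exact: L2N. Qed.

Lemma ipDr f g h : L2 f -> L2 g -> L2 h ->
  ip h (fun x => f x + g x) = ip h f + ip h g.
Proof. by move=> *; rewrite ipC ipDl// !(ipC h). Qed.

Lemma ipZr c f h : L2 f -> L2 h -> ip h (fun x => c * f x) = c * ip h f.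
Proof. by move=> *; rewrite ipC ipZl// !(ipC h). Qed.

Lemma ipBr f g h : L2 f -> L2 g -> L2 h ->
  ip h (fun x => f x - g x) = ip h f - ip h g.
Proof. by move=> *; rewrite ipC ipBl// !(ipC h). Qed.

Lemma ip_ge0 f : 0 <= ip f f.
Proof. by apply: Rintegral_ge0 => x _; rewrite -expr2 sqr_ge0. Qed.

Lemma ip_ae f f' g : measurable_fun D f -> measurable_fun D f' ->
  measurable_fun D g ->
  {ae mu, forall x, D x -> f x = f' x} -> ip f g = ip f' g.
Proof.
move=> mf mf' mg ff'; apply: ae_eq_Rint; try exact: measurable_funM.
by apply: filterS ff' => x + Dx => /(_ Dx) ->.
Qed.

Lemma ip_EFin f : L2 f -> (\int[mu]_(x in D) ((f x) ^+ 2)%:E)%E = (ip f f)%:E.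
Proof.
by move=> Lf; rewrite /ip -itgE; [apply: eq_integral|exact: L2_itgM].
Qed.

Definition nrm f := Num.sqrt (ip f f).

Lemma nrm_ge0 f : 0 <= nrm f. Proof. exact: sqrtr_ge0. Qed.

Lemma nrm2 f : nrm f ^+ 2 = ip f f.
Proof. by rewrite sqr_sqrtr// ip_ge0. Qed.

Lemma cauchy_schwarz f g : L2 f -> L2 g -> `|ip f g| <= nrm f * nrm g.
Proof.
move=> Lf Lg.
have h (t : R) : 0 <= ip f f - 2 * t * ip f g + t ^+ 2 * ip g g.
  have := ip_ge0 (fun x => f x - t * g x).
  have Ltg := L2Z t Lg.
  rewrite ipBl//; last exact: L2B.
  rewrite !ipBr// !ipZl// !ipZr// (ipC g f) => /le_trans; apply.
  by rewrite le_eqVlt; apply/orP; left; apply/eqP; ring.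
rewrite -(@ler_pXn2r _ 2)// ?nnegrE ?mulr_ge0 ?nrm_ge0//.
rewrite real_normK ?num_real// exprMn !nrm2.
have fge := ip_ge0 f; have := ip_ge0 g; rewrite le_eqVlt => /predU1P[g0|g0].
  rewrite -g0 mulr0.
  have [->|n0] := eqVneq (ip f g) 0; first by rewrite expr0n.
  (* When [g] has norm 0 the polynomial in [h] is affine in [t], and this [t] would give it the
     value -1. *)
  have := h ((ip f f + 1) / (2 * ip f g)); rewrite -g0 mulr0 addr0.
  rewrite (_ : 2 * _ * ip f g = ip f f + 1); last by field.
  by lra.
(* The minimiser of the quadratic polynomial. *)
have := h (ip f g / ip g g).
rewrite (_ : _ + _ = ip f f - ip f g ^+ 2 / ip g g); last by field; rewrite gt_eqF.
by rewrite subr_ge0 ler_pdivrMr.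
Qed.

Lemma nrmD f g : L2 f -> L2 g -> nrm (fun x => f x + g x) <= nrm f + nrm g.
Proof.
move=> Lf Lg; rewrite -(@ler_pXn2r _ 2)// ?nnegrE ?addr_ge0 ?nrm_ge0//.
rewrite nrm2 ipDl//; last exact: L2D.
rewrite !ipDr// (ipC g f) sqrrD !nrm2.
have := cauchy_schwarz Lf Lg; have := ler_norm (ip f g); lra.
Qed.

Lemma nrmZ c f : L2 f -> nrm (fun x => c * f x) = `|c| * nrm f.
Proof.
move=> Lf; rewrite /nrm ipZl//; last exact: L2Z.
by rewrite ipZr// mulrA -expr2 sqrtrM ?sqr_ge0// sqrtr_sqr.
Qed.

Lemma nrmN f : L2 f -> nrm (fun x => - f x) = nrm f.
Proof.
move=> Lf; rewrite -[RHS]mul1r -(normrN1 R) -nrmZ// /nrm /ip.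
by congr Num.sqrt; apply: eq_Rintegral => x _; rewrite mulN1r.
Qed.

Lemma nrmB f g : L2 f -> L2 g -> nrm (fun x => f x - g x) <= nrm f + nrm g.
Proof. by move=> Lf Lg; rewrite -(nrmN Lg); apply: nrmD => //; exact: L2N. Qed.

Lemma nrm_ae f g : measurable_fun D f -> measurable_fun D g ->
  {ae mu, forall x, D x -> f x = g x} -> nrm f = nrm g.
Proof. by move=> mf mg fg; rewrite /nrm (ip_ae mf mg mf fg) ipC (ip_ae mf mg mg fg). Qed.

Lemma nrm_le f g : L2 f -> L2 g -> {ae mu, forall x, D x -> `|f x| <= `|g x|} ->
  nrm f <= nrm g.
Proof.
move=> Lf Lg fg; rewrite /nrm ler_wsqrtr//; apply: le_Rint_ae; try exact: L2_itgM.
apply: filterS fg => x + Dx => /(_ Dx) h.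
by rewrite -!expr2 -(real_normK (num_real (f x))) -(real_normK (num_real (g x))) lerXn2r ?nnegrE.
Qed.

Lemma nrm0_ae f : L2 f -> nrm f = 0 -> {ae mu, forall x, D x -> f x = 0}.
Proof.
move=> Lf f0.
have h0 : (\int[mu]_(x in D) `|((f x) ^+ 2)%:E|)%E = 0%E.
  under eq_integral => x _ do rewrite /= ger0_norm ?sqr_ge0//.
  by rewrite ip_EFin// -nrm2 f0 expr0n.
have [|h _] := @ae_eq_integral_abs _ _ _ mu D mD (fun x => ((f x) ^+ 2)%:E).
  apply/measurable_EFinP; apply: measurable_funX; exact: L2_meas Lf.
have := h h0; apply: filterS => x + Dx => /(_ Dx) /= [] /eqP.
by rewrite sqrf_eq0 => /eqP.
Qed.

Lemma nrm_dct (f_ : nat -> T -> R) f g :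
  (forall n, measurable_fun D (f_ n)) -> measurable_fun D f -> L2 g ->
  {ae mu, forall x, D x -> f_ ^~ x @ \oo --> f x} ->
  {ae mu, forall x, D x -> forall n, `|f_ n x| <= g x} ->
  L2 f /\ nrm (fun x => f_ n x - f x) @[n --> \oo] --> 0.
Proof.
move=> mf_ mf Lg cf fg.
have fle : {ae mu, forall x, D x -> `|f x| <= g x}.
  apply: filterS2 cf fg => x c l Dx.
  have c' : `|f_ n x| @[n --> \oo] --> `|f x| by apply: cvg_norm; exact: c.
  by apply: (cvgr_to_le c'); apply: nearW => n; exact: l.
have Lf : L2 f.
  (* [f] is bounded by [g] only a.e., so the pointwise comparison is applied to its truncation
     between [- g] and [g], which equals [f] a.e. *)
  apply: (@L2_ae (fun x => Num.max (- g x) (Num.min (f x) (g x)))) => //.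
    apply: filterS fle => x + Dx => /(_ Dx); rewrite ler_norml => /andP[h1 h2].
    by rewrite (min_idPl h2) (max_idPr h1).
  apply: (L2_le _ _ Lg).
    apply: measurable_maxr; first exact/measurable_funN/L2_meas.
    by apply: measurable_minr => //; exact: L2_meas.
  move=> x _; rewrite ler_norml ge_max le_max; have := ler_norm (g x).
  have := ler_norm (- g x); rewrite normrN => h1 h2.
  by rewrite lerN2 h2 h1 /= ge_min h2 orbT.
split => //.
have [] := @Rint_dct (fun n x => (f_ n x - f x) ^+ 2) (fun=> 0) (fun x => 4 * g x ^+ 2).
- by move=> n; apply: measurable_funX; exact: measurable_funB.
- exact: measurable_cst.
- by apply: itgZ; case/L2_sq : Lg.
- apply: filterS cf => x + Dx => /(_ Dx) c.
  have h : (f_ n x - f x) * (f_ n x - f x) @[n --> \oo] --> (f x - f x) * (f x - f x).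
    by apply: cvgM; apply: cvgB => //; exact: cvg_cst.
  by move: h; rewrite subrr mulr0.
- apply: filterS2 fle fg => x h1 h2 Dx n; rewrite ger0_norm ?sqr_ge0//.
  move: (h1 Dx) (h2 Dx n); rewrite !ler_norml => /andP[a1 a2] /andP[b1 b2].
  have : 0 <= (2 * g x - (f_ n x - f x)) * (2 * g x + (f_ n x - f x)).
    by apply: mulr_ge0; lra.
  nra.
move=> _; rewrite /Rintegral integral0 /= => h.
rewrite -[0 in X in _ --> X](sqrtr0 R).
have -> : (fun n => nrm (fun x => f_ n x - f x)) =
  (fun n => Num.sqrt (fine (\int[mu]_(x in D) ((f_ n x - f x) ^+ 2)%:E))).
  by apply/funext => n; congr Num.sqrt; apply: eq_Rintegral => x _; rewrite expr2.
by apply: continuous_cvg h; exact: sqrt_continuous.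
Qed.

Lemma cvg_ip (f_ : nat -> T -> R) f g : (forall n, L2 (f_ n)) -> L2 f -> L2 g ->
  nrm (fun x => f_ n x - f x) @[n --> \oo] --> 0 ->
  ip (f_ n) g @[n --> \oo] --> ip f g.
Proof.
move=> Lf_ Lf Lg h.
have h' : nrm (fun x => f_ n x - f x) * nrm g @[n --> \oo] --> 0.
  by rewrite -(mul0r (nrm g)); apply: cvgMr_tmp.
apply/subr_cvg0; apply: norm_cvg0; apply: (squeeze_cvgr _ (cvg_cst 0) h').
apply: nearW => n; rewrite normr_ge0 /= -ipBl//.
by apply: cauchy_schwarz => //; exact: L2B.
Qed.

Lemma cvg_nrm (f_ : nat -> T -> R) f : (forall n, L2 (f_ n)) -> L2 f ->
  nrm (fun x => f_ n x - f x) @[n --> \oo] --> 0 ->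
  nrm (f_ n) @[n --> \oo] --> nrm f.
Proof.
move=> Lf_ Lf h; apply/subr_cvg0; apply: norm_cvg0.
apply: (squeeze_cvgr _ (cvg_cst 0) h); apply: nearW => n; rewrite normr_ge0 /=.
have h1 := nrmD (L2B (Lf_ n) Lf) Lf.
have h2 := nrmB (Lf_ n) (L2B (Lf_ n) Lf).
have e1 : (fun x => f_ n x - f x + f x) = f_ n by apply/funext => x; ring.
have e2 : (fun x => f_ n x - (f_ n x - f x)) = f by apply/funext => x; ring.
by rewrite e1 in h1; rewrite e2 in h2; rewrite ler_norml; lra.
Qed.

End square_integrable.

(** * Smooth functions of one variable and a smooth step *)

Section smooth_real_functions.
Variable R : realType.
Implicit Types f g : R -> R.

(** The derivative appears as a witness, so that stability under sums, products, inverses and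
    composition goes by induction on [k]. *)
Fixpoint Ck (k : nat) f : Prop :=
  if k is k'.+1 then
    exists2 f', (forall x, is_derive x (1 : R) f (f' x)) & Ck k' f'
  else True.

Definition smooth1 f := forall k, Ck k f.

Lemma is_derive_derive1 f f' : (forall x, is_derive x (1 : R) f (f' x)) ->
  (derive1 f) = f'.
Proof. by move=> h; apply/funext => x; rewrite derive1E; apply: derive_val. Qed.

Lemma CkW k f : Ck k.+1 f -> Ck k f.
Proof.
by elim: k f => // k IH f [f' h c]; exists f' => //; exact: IH.
Qed.

Lemma smooth1_derive f : smooth1 f ->
  (forall x, is_derive x (1 : R) f (derive1 f x)) /\ smooth1 (derive1 f).
Proof.
move=> sf; split.
  by have [f' h _] := sf 1%N; rewrite (is_derive_derive1 h).
by move=> k; have [f' h] := sf k.+1; rewrite (is_derive_derive1 h).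
Qed.

Lemma smooth1_cont f : smooth1 f -> continuous f.
Proof.
move=> /smooth1_derive[h _] x.
by apply/differentiable_continuous/derivable1_diffP; have [] := h x.
Qed.

Lemma Ck_cst k c : Ck k (fun=> c).
Proof.
elim: k c => // k IH c; exists (fun=> 0); last exact: IH.
by move=> x; exact: is_derive_cst.
Qed.

Lemma Ck_id k : Ck k id.
Proof.
case: k => // k; exists (fun=> 1); last exact: Ck_cst.
by move=> x; exact: is_derive_id.
Qed.

Lemma CkD k f g : Ck k f -> Ck k g -> Ck k (fun x => f x + g x).
Proof.
elim: k f g => // k IH f g [f' hf cf] [g' hg cg].
exists (fun x => f' x + g' x); last exact: IH.
by move=> x; exact: is_deriveD.
Qed.

Lemma CkM k f g : Ck k f -> Ck k g -> Ck k (fun x => f x * g x).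
Proof.
elim: k f g => // k IH f g Cf Cg; have := Cf; have := Cg.
move=> [g' hg cg] [f' hf cf].
exists (fun x => f x * g' x + g x * f' x); last first.
  by apply: CkD; apply: IH => //; exact: CkW.
by move=> x; exact: is_deriveM.
Qed.

Lemma Ck_comp k f g : Ck k f -> Ck k g -> Ck k (f \o g).
Proof.
elim: k f g => // k IH f g [f' hf cf] Cg; have [g' hg cg] := Cg.
exists (fun x => (f' \o g) x * g' x); last by apply: CkM => //; apply: IH => //; exact: CkW.
by move=> x; apply: is_derive1_comp.
Qed.

Lemma CkV k f : (forall x, f x != 0) -> Ck k f -> Ck k (fun x => (f x)^-1).
Proof.
move=> f0; elim: k => // k IH Cf; have [f' hf cf] := Cf.
exists (fun x => (-1 * ((f x)^-1 * (f x)^-1)) * f' x); last first.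
  by do 3?apply: CkM => //; [exact: Ck_cst| |]; exact/IH/CkW.
move=> x; apply: (is_derive_eq (is_deriveV (f0 x) (hf x))).
by rewrite /GRing.scale/= mulN1r expr2 invfM.
Qed.

Lemma smooth1_cst c : smooth1 (fun=> c). Proof. by move=> k; exact: Ck_cst. Qed.
Lemma smooth1_id : smooth1 id. Proof. by move=> k; exact: Ck_id. Qed.
Lemma smooth1D f g : smooth1 f -> smooth1 g -> smooth1 (fun x => f x + g x).
Proof. by move=> sf sg k; exact: CkD. Qed.
Lemma smooth1M f g : smooth1 f -> smooth1 g -> smooth1 (fun x => f x * g x).
Proof. by move=> sf sg k; exact: CkM. Qed.
Lemma smooth1_comp f g : smooth1 f -> smooth1 g -> smooth1 (f \o g).
Proof. by move=> sf sg k; exact: Ck_comp. Qed.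
Lemma smooth1V f : (forall x, f x != 0) -> smooth1 f -> smooth1 (fun x => (f x)^-1).
Proof. by move=> f0 sf k; exact: CkV. Qed.
Lemma smooth1_affine f a c : smooth1 f -> smooth1 (fun x => f (a * x + c)).
Proof.
move=> sf; apply: (smooth1_comp sf); apply: smooth1D; last exact: smooth1_cst.
by apply: smooth1M; [exact: smooth1_cst|exact: smooth1_id].
Qed.

Lemma is_derive_cvg f x l :
  h^-1 * (f (h + x) - f x) @[h --> (0 : R)^'] --> l -> is_derive x (1 : R) f l.
Proof.
move=> h; have e : (fun h => h^-1 *: ((f \o shift x) (h *: (1 : R)) - f x)) =
    (fun h => h^-1 * (f (h + x) - f x)).
  by apply/funext => y; rewrite /= [y *: 1]mulr1.
by apply: DeriveDef; [rewrite /derivable e; exact: cvgP h|rewrite /derive e; exact: cvg_lim h].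
Qed.

Lemma is_derive_quadratic f x (C : R) : (forall y, `|f y| <= C * (y - x) ^+ 2) ->
  is_derive x (1 : R) f 0.
Proof.
move=> fC; apply: is_derive_cvg.
have fx0 : f x = 0.
  by apply/eqP; rewrite -normr_le0 (le_trans (fC x))// subrr expr0n mulr0.
have h0 : C * `|h| @[h --> (0 : R)^'] --> (0 : R).
  rewrite -[X in _ --> X](mulr0 C); apply: cvgMl_tmp.
  by rewrite -[X in _ --> X](normr0 R); apply: cvg_norm; exact: cvg_within.
apply: norm_cvg0; apply: (squeeze_cvgr _ (cvg_cst 0) h0).
near=> h; rewrite normr_ge0 /= fx0 subr0 normrM normfV.
have hn0 : h != 0 by near: h; exact: nbhs_dnbhs_neq.
rewrite mulrC ler_pdivrMr ?normr_gt0// -mulrA -expr2 real_normK ?num_real//.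
by rewrite (le_trans (fC _))// addrK.
Unshelve. all: by end_near. Qed.

(** Each power [u ^ i] is at most [i!] times [expR u], by a single term of the exponential
    series. *)
Lemma poly_exp_bounded (p : {poly R}) :
  exists C, forall u, 0 <= u -> `|p.[u]| * expR (- u) <= C.
Proof.
exists (\sum_(i < size p) `|p`_i| * i`!%:R) => u u0.
rewrite horner_coef (le_trans (ler_wpM2r (expR_ge0 _) (ler_norm_sum _ _ _)))//.
rewrite mulr_suml ler_sum// => i _; rewrite normrM -mulrA ler_wpM2l//.
rewrite normrX ger0_norm// expRN ler_pdivrMr ?expR_gt0//.
case: (nat_of_ord i) => [|n]; first by rewrite expr0 fact0 mul1r -expR0 ler_expR.
have := expR_ge1Dxn n u0.
by rewrite -ler_pdivrMl ?ltr0n ?fact_gt0// mulrC; apply: le_trans; rewrite lerDr.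
Qed.

(** These functions are stable under differentiation, the derivative for [p] being the function for
    [X^2 (p - p')]. Smoothness at the origin thus needs only one first-order argument, valid for
    every [p]. *)
Definition flat (p : {poly R}) (x : R) : R :=
  if 0 < x then p.[x^-1] * expR (- x^-1) else 0.

(** Applied to [p X^2], the comparison of polynomials with exponentials gives quadratic vanishing at
    the origin, hence differentiability there with derivative 0. *)
Lemma flat_bound p : exists C, forall x, `|flat p x| <= C * x ^+ 2.
Proof.
have [C hC] := poly_exp_bounded (p * 'X^2).
exists C => x; rewrite /flat; case: ifPn => [x0|]; last first.
  move=> _; rewrite normr0 mulr_ge0 ?sqr_ge0//.
  have := hC 0 (lexx 0); apply: le_trans; rewrite mulr_ge0// expR_ge0.
have := hC x^-1 (ltW _); rewrite invr_gt0 x0 => /(_ isT).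
rewrite hornerM hornerXn normrM (ger0_norm (exprn_ge0 _ _)) ?invr_ge0 ?(ltW x0)//.
rewrite normrM (ger0_norm (expR_ge0 _)) -ler_pdivrMr ?exprn_gt0//.
by apply: le_trans; rewrite exprVn -!mulrA (mulrC (expR _)).
Qed.

Lemma is_derive_flat p x :
  is_derive x (1 : R) (flat p) (flat ('X^2 * (p - p^`())) x).
Proof.
have [x0|x0|x0] := ltrgtP 0 x.
- have d1 := is_deriveV (lt0r_neq0 x0) (is_derive_id x (1 : R)).
  have d2 : is_derive x (1 : R) (horner p \o GRing.inv) _ :=
    is_derive1_comp (is_derive_poly p x^-1) d1.
  have d3 : is_derive x (1 : R) (expR \o (fun y => - y^-1)) _ :=
    @is_derive1_comp _ expR (fun y => - y^-1) x _ _ (is_derive_expR _) (is_deriveN d1).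
  apply: (@near_eq_is_derive _ R R (fun y => p.[y^-1] * expR (- y^-1))).
    near=> y; rewrite /flat ifT//; near: y; exact: lt_nbhsr.
  apply: (is_derive_eq (is_deriveM d2 d3)).
  rewrite /flat x0 hornerM hornerXn hornerD hornerN /GRing.scale/= exprVn expr2.
  by ring.
- rewrite {2}/flat ltNge (ltW x0) /=.
  apply: (@near_eq_is_derive _ R R (fun=> 0) (flat p) x 1 0).
  near=> y; rewrite /flat ltNge ifF// ltW//; near: y; exact: lt_nbhsl.
- rewrite -x0 {2}/flat ltxx; have [C hC] := flat_bound p.
  by apply: (@is_derive_quadratic _ _ C) => y; rewrite subr0.
Unshelve. all: by end_near. Qed.

Lemma smooth1_flat p : smooth1 (flat p).
Proof.
move=> k; elim: k p => // k IH p.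
by exists (flat ('X^2 * (p - p^`()))) => // x; exact: is_derive_flat.
Qed.

Let e := flat 1.

Let e_ge0 x : 0 <= e x.
Proof. by rewrite /e /flat; case: ifP => // _; rewrite hornerC mul1r expR_ge0. Qed.

Let e_gt0 x : 0 < x -> 0 < e x.
Proof. by rewrite /e /flat => ->; rewrite hornerC mul1r expR_gt0. Qed.

Let e_eq0 x : x <= 0 -> e x = 0.
Proof. by rewrite /e /flat ltNge => ->. Qed.

Let de_ge0 x : 0 <= (derive1 e) x.
Proof.
rewrite (is_derive_derive1 (is_derive_flat 1)) /flat; case: ifP => // _.
by rewrite mulr_ge0 ?expR_ge0// derivC subr0 mulr1 hornerXn sqr_ge0.
Qed.

(** The classical smooth transition, 0 for [x <= 0] and 1 for [1 <= x]. Cutoffs in space and ramps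
    in time are built from its rescalings. *)
Definition step x := e x / (e x + e (1 - x)).

Let den_gt0 x : 0 < e x + e (1 - x).
Proof.
have [x0|x0] := ltP 0 x; first by rewrite ltr_pwDl ?e_gt0.
by rewrite ltr_wpDl// e_gt0//; lra.
Qed.

Lemma smooth1_step_fun : smooth1 step.
Proof.
apply: smooth1M; first exact: smooth1_flat.
apply: smooth1V; first by move=> x; rewrite gt_eqF.
apply: smooth1D; first exact: smooth1_flat.
have -> : (fun x => e (1 - x)) = (fun x => e ((-1) * x + 1)).
  by apply/funext => x; congr e; ring.
by apply: smooth1_affine; exact: smooth1_flat.
Qed.

Lemma step_ge0 x : 0 <= step x.
Proof. by rewrite /step divr_ge0// ltW. Qed.

Lemma step_le1 x : step x <= 1.
Proof. by rewrite /step ler_pdivrMr// mul1r lerDl. Qed.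

Lemma step_le0 x : x <= 0 -> step x = 0.
Proof. by move=> x0; rewrite /step e_eq0// mul0r. Qed.

Lemma step_ge1 x : 1 <= x -> step x = 1.
Proof.
move=> x1; rewrite /step (e_eq0 (x := 1 - x)) ?addr0; last lra.
by rewrite divff// gt_eqF// e_gt0//; lra.
Qed.

(** Monotonicity makes the derivatives of the rescaled steps nonnegative, hence approximate
    identities of mass 1. *)
Lemma step_derive_ge0 x : 0 <= (derive1 step) x.
Proof.
have [de _] := smooth1_derive (smooth1_flat 1).
have d1 : is_derive x (1 : R) (fun y => e (1 - y)) (- (derive1 e) (1 - x)).
  apply: (is_derive_eq (@is_derive1_comp _ e (fun y => 1 - y) x _ _ (de (1 - x)) (is_deriveB (is_derive_cst (1 : R) x (1 : R)) (is_derive_id x (1 : R))))).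
  by rewrite sub0r mulrN1.
have d2 := is_deriveV (f := fun y => e y + e (1 - y)) (lt0r_neq0 (den_gt0 x)) (is_deriveD (de x) d1).
have d3 : is_derive x (1 : R) step _ := is_deriveM (de x) d2.
rewrite derive1E (@derive_val _ _ _ _ _ _ _ d3) /GRing.scale /=.
have -> : e x * (- (e x + e (1 - x)) ^- 2 * ((derive1 e) x - (derive1 e) (1 - x))) +
   (e x + e (1 - x))^-1 * (derive1 e) x =
   (e x + e (1 - x))^-2 * (e x * (derive1 e) (1 - x) + e (1 - x) * (derive1 e) x).
  by field; rewrite gt_eqF.
by rewrite mulr_ge0 ?invr_ge0 ?sqr_ge0// addr_ge0 ?mulr_ge0.
Qed.

End smooth_real_functions.

(** * Measurability of continuous functions on products *)

Section caratheodory_functions.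
Context (R : realType) (d : measure_display) (T : measurableType d).

(** With [x] replaced by the grid point [r n x] below it, preimages are countable unions of product
    sets; continuity in [x] passes to the limit. The sigma-algebra is the product one, which carries
    Lebesgue measure, not the Borel one of the product topology. *)
Lemma measurable_caratheodory (f : measurableTypeR R * T -> R) :
  (forall y, continuous (fun x : R => f (x, y))) ->
  (forall x, measurable_fun setT (fun y => f (x, y))) ->
  measurable_fun setT f.
Proof.
move=> cf mf; pose r n (x : R) : R := (Num.floor (n.+1%:R * x))%:~R / n.+1%:R.
apply: (@measurable_fun_cvg _ _ _ _ (fun n z => f (r n z.1, z.2))).
  move=> n _ A mA; rewrite setTI.
  have -> : (fun z => f (r n z.1, z.2)) @^-1` A = \bigcup_(k : int)
      ([set x | k%:~R <= n.+1%:R * x < (k + 1)%:~R] `*`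
        ((fun y => f (k%:~R / n.+1%:R, y)) @^-1` A)).
    apply/seteqP; split=> [[x y] /= Axy|[x y] /= [k _ [/= hk Ak]]].
      exists (Num.floor (n.+1%:R * x)) => //; split => //=.
      by rewrite ge_floor// floorD1_gt.
    by rewrite /r (floor_def hk).
  apply: countable_bigcupT_measurable => // k; apply: measurableX; last first.
    by have := mf (k%:~R / n.+1%:R) measurableT _ mA; rewrite setTI.
  rewrite (_ : [set x | _] = `[(k%:~R / n.+1%:R), ((k + 1)%:~R / n.+1%:R)[%classic).
    exact: measurable_itv.
  apply/seteqP; split => x /=; rewrite in_itv/= ler_pdivrMr ?ltr0n// ltr_pdivlMr ?ltr0n//.
    by rewrite mulrC.
  by rewrite mulrC.
move=> [x y] _ /=; apply: (@cvg_comp _ _ _ _ (fun t => f (t, y)) _ (nbhs x)); last exact: cf.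
have h : n.+1%:R^-1 @[n --> \oo] --> (0 : R) by exact: cvg_harmonic.
apply/subr_cvg0; apply: norm_cvg0; apply: (squeeze_cvgr _ (cvg_cst 0) h).
apply: nearW => n; rewrite normr_ge0 /= /r distrC.
have -> : x - (Num.floor (n.+1%:R * x))%:~R / n.+1%:R =
    (n.+1%:R * x - (Num.floor (n.+1%:R * x))%:~R) / n.+1%:R.
  by rewrite mulrBl mulrAC divff ?mul1r// pnatr_eq0.
rewrite normrM normfV ger0_norm; last by rewrite subr_ge0 ge_floor.
rewrite (ger0_norm (ler0n _ _)) -[leRHS]mul1r ler_wpM2r ?invr_ge0//.
by rewrite lerBlDl -(intrD _ _ 1) ltW// floorD1_gt.
Qed.

End caratheodory_functions.

Lemma pairl_continuous (U V : topologicalType) (y : V) :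
  continuous (fun x : U => (x, y)).
Proof. by move=> x; apply: cvg_pair; [exact: cvg_id|exact: cvg_cst]. Qed.

Lemma pairr_continuous (U V : topologicalType) (x : U) :
  continuous (fun y : V => (x, y)).
Proof. by move=> y; apply: cvg_pair; [exact: cvg_cst|exact: cvg_id]. Qed.

Section smooth_functions.
Variable R : realType.
Local Notation plane := (R * R)%type.
Local Notation space := (R * (R * R))%type.

Lemma measurable_cont2 (f : mplane R -> R) :
  continuous (f : plane -> R) -> measurable_fun setT f.
Proof.
move=> cf; apply: measurable_caratheodory => [y x|x].
  apply: (@continuous_comp _ _ _ (fun t : R => (t, y)) f); last exact: cf.
  exact: pairl_continuous.
apply: continuous_measurable_fun => y.
apply: (@continuous_comp _ _ _ (fun t : R => (x, t)) f); last exact: cf.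
exact: pairr_continuous.
Qed.

Lemma measurable_cont3 (f : mspace R -> R) :
  continuous (f : space -> R) -> measurable_fun setT f.
Proof.
move=> cf; apply: measurable_caratheodory => [y x|x].
  apply: (@continuous_comp _ _ _ (fun t : R => (t, y)) f); last exact: cf.
  exact: pairl_continuous.
apply: measurable_cont2 => y.
apply: (@continuous_comp _ _ _ (fun t : plane => (x, t)) f); last exact: cf.
exact: pairr_continuous.
Qed.

End smooth_functions.

(** * Smooth functions and test functions on a normed space *)

Section smooth_general.
Context (R : realType) (E : normedModType R) (n : nat) (e : 'I_n -> E).
Implicit Types f g : E -> R.

Lemma smooth_pd f j : smooth e f -> smooth e (pd e j f).
Proof. by move=> sf w x; have := sf (rcons w j) x; rewrite foldr_rcons. Qed.

Lemma smooth_foldr f w : smooth e f -> smooth e (foldr (pd e) f w).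
Proof. by move=> sf; elim: w => //= j w IH; exact: smooth_pd. Qed.

Lemma smooth_diff f x : smooth e f -> differentiable f x.
Proof. by move=> sf; exact: (sf [::]). Qed.

Lemma smooth_cont f : smooth e f -> continuous f.
Proof. by move=> sf x; apply: differentiable_continuous; exact: smooth_diff. Qed.

Lemma pd_is_derive f j x : smooth e f -> is_derive x (e j) f (pd e j f x).
Proof. by move=> sf; apply: DeriveDef => //; apply: diff_derivable; exact: smooth_diff. Qed.

Lemma pd_support f j (K : set E) : closed K -> (forall x, ~ K x -> f x = 0) ->
  forall x, ~ K x -> pd e j f x = 0.
Proof.
move=> cK f0 x nKx; rewrite /pd (@near_eq_derive _ _ _ f (fun=> 0)).
  by rewrite derive_cst.
have oK : open (~` K) by exact: closed_openC.
have h : nbhs x (~` K) by apply: open_nbhs_nbhs; split.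
by apply: filterS h => y; exact: f0.
Qed.

Lemma testfun_pd f j U : testfun e U f -> testfun e U (pd e j f).
Proof.
move=> [sf [K [cK KU f0]]]; split; first exact: smooth_pd.
exists K; split => //; apply: pd_support => //; apply: compact_closed cK.
exact: norm_hausdorff.
Qed.

Lemma testfun_foldr f w U : testfun e U f -> testfun e U (foldr (pd e) f w).
Proof. by move=> tf; elim: w => //= j w IH; exact: testfun_pd. Qed.

Lemma testfunS f U V : U `<=` V -> testfun e U f -> testfun e V f.
Proof. by move=> UV [sf [K [cK KU f0]]]; split => //; exists K; split => // x /KU /UV. Qed.

Lemma testfun_bounded f U : testfun e U f -> exists2 M, 0 <= M & forall x, `|f x| <= M.
Proof.
move=> [sf [K [cK _ f0]]].
have : compact (f @` K).
  apply: continuous_compact => //; apply: continuous_subspaceT => x; exact: smooth_cont.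
move=> /compact_bounded[M [_ hM]]; exists (`|M| + 1) => [|x].
  by rewrite addr_ge0.
have [Kx|nKx] := pselect (K x); last by rewrite f0// normr0 addr_ge0.
by apply: (hM (`|M| + 1)); [rewrite (le_lt_trans (ler_norm _))// ltrDl|exists x].
Qed.

End smooth_general.

Lemma continuous_fst (U V : topologicalType) : continuous (@fst U V).
Proof. by move=> x; exact: cvg_fst. Qed.

Lemma continuous_snd (U V : topologicalType) : continuous (@snd U V).
Proof. by move=> x; exact: cvg_snd. Qed.

(** * Tensor products and smooth approximations of indicators *)

Section tensors.
Variable R : realType.
Local Notation plane := (R * R)%type.
Local Notation space := (R * (R * R))%type.
Implicit Types f g h : R -> R.

Lemma is_derive_linear (E : normedModType R) (L : {linear E -> R}) f x v :
  continuous L -> smooth1 f ->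
  differentiable (f \o L) x /\ is_derive x v (f \o L) (L v * derive1 f (L x)).
Proof.
move=> cL sf; have [df _] := smooth1_derive sf.
have dL : differentiable L x by exact: linear_differentiable.
have dfL : differentiable f (L x) by apply/derivable1_diffP; have [] := df (L x).
have dc : differentiable (f \o L) x by exact: differentiable_comp.
split => //; apply: DeriveDef; first exact: diff_derivable.
by rewrite deriveE// diff_comp//= diff_lin// diff1E.
Qed.

Definition tens2 f g (y : plane) : R := f y.1 * g y.2.
Definition tens3 f g h (x : space) : R := f x.1 * (g x.2.1 * h x.2.2).

Lemma tens2_derive f g x (v : plane) : smooth1 f -> smooth1 g ->
  differentiable (tens2 f g) x /\
  is_derive x v (tens2 f g) (v.1 * tens2 (derive1 f) g x + v.2 * tens2 f (derive1 g) x).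
Proof.
move=> sf sg.
have [d1 i1] := @is_derive_linear _ (fst : {linear plane -> R}) f x v (@continuous_fst _ _) sf.
have [d2 i2] := @is_derive_linear _ (snd : {linear plane -> R}) g x v (@continuous_snd _ _) sg.
split; first exact: (differentiableM d1 d2).
apply: (is_derive_eq (is_deriveM i1 i2)); rewrite /tens2 /GRing.scale /=; ring.
Qed.

Lemma tens3_derive f g h x (v : space) : smooth1 f -> smooth1 g -> smooth1 h ->
  differentiable (tens3 f g h) x /\
  is_derive x v (tens3 f g h) (v.1 * tens3 (derive1 f) g h x +
    v.2.1 * tens3 f (derive1 g) h x + v.2.2 * tens3 f g (derive1 h) x).
Proof.
move=> sf sg sh.
have [d1 i1] := @is_derive_linear _ (fst : {linear space -> R}) f x v (@continuous_fst _ _) sf.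
have c2 : continuous (fst \o snd : {linear space -> R}).
  by move=> y; apply: continuous_comp; [exact: continuous_snd|exact: continuous_fst].
have c3 : continuous (snd \o snd : {linear space -> R}).
  by move=> y; apply: continuous_comp; [exact: continuous_snd|exact: continuous_snd].
have [d2 i2] := is_derive_linear x v c2 sg.
have [d3 i3] := is_derive_linear x v c3 sh.
split; first exact: (differentiableM d1 (differentiableM d2 d3)).
apply: (is_derive_eq (is_deriveM i1 (is_deriveM i2 i3))).
rewrite /tens3.
change (f x.1 * (g x.2.1 * (v.2.2 * derive1 h x.2.2) +
  h x.2.2 * (v.2.1 * derive1 g x.2.1)) +
  (g x.2.1 * h x.2.2) * (v.1 * derive1 f x.1) =
  v.1 * (derive1 f x.1 * (g x.2.1 * h x.2.2)) +
  v.2.1 * (f x.1 * (derive1 g x.2.1 * h x.2.2)) +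
  v.2.2 * (f x.1 * (g x.2.1 * derive1 h x.2.2))).
ring.
Qed.

Lemma smooth1_iter f k : smooth1 f -> smooth1 (iter k (@derive1 R R) f).
Proof. by move=> sf; elim: k => //= k /smooth1_derive[]. Qed.

(** Partial derivatives act on separate factors, so only the number of occurrences of each index in
    [w] matters. *)
Lemma pd_tens2 f g w : smooth1 f -> smooth1 g ->
  foldr (pd (@dir2 R)) (tens2 f g) w =
  tens2 (iter (count_mem ord0 w) (@derive1 R R) f)
        (iter (count_mem ord_max w) (@derive1 R R) g).
Proof.
move=> sf sg; elim: w => //= j w ->; apply/funext => x.
set F := iter _ _ f; set G := iter _ _ g.
have sF : smooth1 F by exact: smooth1_iter.
have sG : smooth1 G by exact: smooth1_iter.
have [_ i] := tens2_derive x (dir2 R j) sF sG.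
rewrite /pd (@derive_val _ _ _ _ _ _ _ i) /dir2 /=.
by case: j i => -[|[|//]] ? ? /=; rewrite !(mul0r, mul1r, add0r, addr0).
Qed.

Lemma pd_tens3 f g h w : smooth1 f -> smooth1 g -> smooth1 h ->
  foldr (pd (@dir3 R)) (tens3 f g h) w =
  tens3 (iter (count_mem ord0 w) (@derive1 R R) f)
        (iter (count_mem (lift ord0 ord0) w) (@derive1 R R) g)
        (iter (count_mem ord_max w) (@derive1 R R) h).
Proof.
move=> sf sg sh; elim: w => //= j w ->; apply/funext => x.
set F := iter _ _ f; set G := iter _ _ g; set H := iter _ _ h.
have sF : smooth1 F by exact: smooth1_iter.
have sG : smooth1 G by exact: smooth1_iter.
have sH : smooth1 H by exact: smooth1_iter.
have [_ i] := tens3_derive x (dir3 R j) sF sG sH.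
rewrite /pd (@derive_val _ _ _ _ _ _ _ i) /dir3 /=.
by case: j i => -[|[|[|//]]] ? ? /=; rewrite !(mul0r, mul1r, add0r, addr0).
Qed.

Lemma smooth_tens2 f g : smooth1 f -> smooth1 g -> smooth (@dir2 R) (tens2 f g).
Proof.
move=> sf sg w x; rewrite pd_tens2//.
by have [] := tens2_derive x 0 (smooth1_iter (count_mem ord0 w) sf)
  (smooth1_iter (count_mem ord_max w) sg).
Qed.

Lemma smooth_tens3 f g h : smooth1 f -> smooth1 g -> smooth1 h ->
  smooth (@dir3 R) (tens3 f g h).
Proof.
move=> sf sg sh w x; rewrite pd_tens3//.
by have [] := tens3_derive x 0 (smooth1_iter (count_mem ord0 w) sf)
  (smooth1_iter (count_mem (lift ord0 ord0) w) sg)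
  (smooth1_iter (count_mem ord_max w) sh).
Qed.

Lemma testfun_tens2 (a b c d : R) f g (U : set plane) :
  smooth1 f -> smooth1 g ->
  (forall x, ~ (a <= x <= b) -> f x = 0) ->
  (forall x, ~ (c <= x <= d) -> g x = 0) ->
  `[a, b] `*` `[c, d] `<=` U -> testfun (@dir2 R) U (tens2 f g).
Proof.
move=> sf sg f0 g0 KU; split; first exact: smooth_tens2.
exists (`[a, b] `*` `[c, d]); split => //.
  by apply: compact_setX; exact: segment_compact.
move=> [x y] /= n; rewrite /tens2 /=.
have [hx|hx] := pselect (a <= x <= b); last by rewrite f0// mul0r.
rewrite g0 ?mulr0// => hy; apply: n; split; rewrite /= in_itv/=//.
Qed.

Lemma testfun_tens3 (a b c d p q : R) f g h (U : set space) :
  smooth1 f -> smooth1 g -> smooth1 h ->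
  (forall x, ~ (a <= x <= b) -> f x = 0) ->
  (forall x, ~ (c <= x <= d) -> g x = 0) ->
  (forall x, ~ (p <= x <= q) -> h x = 0) ->
  `[a, b] `*` (`[c, d] `*` `[p, q]) `<=` U -> testfun (@dir3 R) U (tens3 f g h).
Proof.
move=> sf sg sh f0 g0 h0 KU; split; first exact: smooth_tens3.
exists (`[a, b] `*` (`[c, d] `*` `[p, q])); split => //.
  apply: compact_setX; first exact: segment_compact.
  by apply: compact_setX; exact: segment_compact.
move=> [x [y z]] /= n; rewrite /tens3 /=.
have [hx|hx] := pselect (a <= x <= b); last by rewrite f0// mul0r.
have [hy|hy] := pselect (c <= y <= d); last by rewrite g0// mul0r mulr0.
rewrite h0 ?mulr0// => hz; apply: n; split; [|split]; rewrite /= in_itv/=//.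
Qed.

(** Vanishes off []a, c[] for every [n]; only the steepness at the two ends grows. Hence it stays
    below the indicator to which it converges, and limits are dominated. *)
Definition bump (a c : R) (n : nat) (x : R) : R :=
  step (n%:R * (x - a)) * step (n%:R * (c - x)).

Lemma smooth1_bump a c n : smooth1 (bump a c n).
Proof.
apply: smooth1M.
  have -> : (fun x => step (n%:R * (x - a))) = (fun x => step (n%:R * x + - (n%:R * a))).
    by apply/funext => x; congr step; ring.
  by apply: smooth1_affine; exact: smooth1_step_fun.
have -> : (fun x => step (n%:R * (c - x))) = (fun x => step ((- n%:R) * x + n%:R * c)).
  by apply/funext => x; congr step; ring.
by apply: smooth1_affine; exact: smooth1_step_fun.
Qed.

Lemma bump_ge0 a c n x : 0 <= bump a c n x.
Proof. by rewrite mulr_ge0 ?step_ge0. Qed.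

Lemma bump_le1 a c n x : bump a c n x <= 1.
Proof. by rewrite mulr_ile1 ?step_ge0 ?step_le1. Qed.

Lemma bump_out a c n x : ~ (a < x < c) -> bump a c n x = 0.
Proof.
move=> h; rewrite /bump.
have [xa|ax] := leP x a; first by rewrite step_le0 ?mul0r// mulr_ge0_le0// subr_le0.
rewrite (step_le0 (x := _ * (c - x))) ?mulr0// mulr_ge0_le0// subr_le0 leNgt.
by apply/negP => xc; apply: h; rewrite ax xc.
Qed.

Lemma bump_cvg a c x : bump a c n x @[n --> \oo] --> (\1_`]a, c[%classic x : R).
Proof.
rewrite indicE; have [/andP[ax xc]|h] := pselect (a < x < c).
  rewrite mem_set/=; last by rewrite in_itv/= ax xc.
  have u (t : R) : 0 < t -> \forall n \near \oo, step (n%:R * t) = 1.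
    move=> t0; near=> n; apply: step_ge1; rewrite -ler_pdivrMr// div1r.
    by near: n; exact: nbhs_infty_ger.
  have u1 : \forall n \near \oo, bump a c n x = 1.
    have h1 : 0 < x - a by rewrite subr_gt0.
    have h2 : 0 < c - x by rewrite subr_gt0.
    by apply: filterS2 (u _ h1) (u _ h2) => n; rewrite /bump => -> ->; rewrite mulr1.
  exact: cvg_near_cst.
rewrite memNset/=; last by rewrite in_itv/= => /h.
by under eq_fun do rewrite bump_out//; exact: cvg_cst.
Unshelve. all: by end_near. Qed.

End tensors.

Import HBNNSimple.

(** * Dynkin classes and monotone classes of functions *)

Section dynkin_classes.
Context (d : measure_display) (T : measurableType d).
Implicit Type Q : set (set T).

Definition dynkin_class Q := [/\ Q setT,
  forall A, measurable A -> Q A -> Q (~` A) &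
  forall F : (set T)^nat, (forall n, measurable (F n)) -> trivIset setT F ->
    (forall n, Q (F n)) -> Q (\bigcup_k F k)].

Lemma dynkin_classD Q A B : dynkin_class Q -> measurable A -> measurable B ->
  A `<=` B -> Q A -> Q B -> Q (B `\` A).
Proof.
move=> [QT QC QU] mA mB AB QA QB; have mBC : measurable (~` B) by exact: measurableC.
suff h : Q (~` B `|` A).
  by rewrite setDE -[B]setCK -setCU; apply: QC => //; exact: measurableU.
rewrite -bigcup2E; apply: QU.
- by move=> [|[|n]] //=.
- apply/trivIsetP => -[|[|i]] [|[|j]] //= _ _ _; rewrite ?set0I ?setI0//.
    by apply/seteqP; split => // x [+ /AB].
  by apply/seteqP; split => // x [/AB].
- move=> [|[|n]] //=; first exact: QC.
  by rewrite -setCT; apply: QC.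
Qed.

Lemma dynkin_class_measurable Q (G : set (set T)) :
  @measurable _ T = <<s G >> -> setI_closed G -> dynkin_class Q -> G `<=` Q ->
  forall A, measurable A -> Q A.
Proof.
move=> mG GI [QT QC QU] GQ A; rewrite mG => GA.
by apply: (dynkin_induction mG GI _ _ _ _ GA).
Qed.

End dynkin_classes.

Section dynkin_products.
Context (d1 d2 : measure_display) (T1 : measurableType d1) (T2 : measurableType d2).
Variable Q : set (set (T1 * T2)).
Hypothesis QD : dynkin_class Q.

Lemma dynkin_class_section1 A : measurable A -> Q (A `*` setT) ->
  dynkin_class (fun B : set T2 => Q (A `*` B)).
Proof.
move=> mA QA; have [QT QC QU] := QD; split => //.
  move=> B mB QAB; have -> : A `*` ~` B = (A `*` setT) `\` (A `*` B).
    apply/seteqP; split=> [[x y] [/= Ax nBy]|[x y] [[/= Ax _] h]].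
      by split=> // -[].
    by split=> // By; apply: h.
  by apply: dynkin_classD => //; [exact: measurableX|exact: measurableX|move=> [x y] []].
move=> F mF tF QF; have -> : A `*` \bigcup_k F k = \bigcup_k (A `*` F k).
  by apply/seteqP; split=> [[x y] [/= Ax [k _ Fy]]|[x y] [k _ [/= Ax Fy]]]; [exists k|split=> //; exists k].
apply: QU => //; first by move=> k; exact: measurableX.
apply/trivIsetP => i j _ _ ij; rewrite -setXI.
by move/trivIsetP : tF => /(_ i j Logic.I Logic.I ij) ->; rewrite setX0.
Qed.

Lemma dynkin_class_section2 B : measurable B -> Q (setT `*` B) ->
  dynkin_class (fun A : set T1 => Q (A `*` B)).
Proof.
move=> mB QB; have [QT QC QU] := QD; split => //.
  move=> A mA QAB; have -> : ~` A `*` B = (setT `*` B) `\` (A `*` B).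
    apply/seteqP; split=> [[x y] [/= nAx By]|[x y] [[/= _ By] h]].
      by split=> // -[].
    by split=> // Ax; apply: h.
  by apply: dynkin_classD => //; [exact: measurableX|exact: measurableX|move=> [x y] []].
move=> F mF tF QF; have -> : (\bigcup_k F k) `*` B = \bigcup_k (F k `*` B).
  by apply/seteqP; split=> [[x y] [[k _ Fx] /= By]|[x y] [k _ [/= Fx By]]]; [exists k|split=> //; exists k].
apply: QU => //; first by move=> k; exact: measurableX.
apply/trivIsetP => i j _ _ ij; rewrite -setXI.
by move/trivIsetP : tF => /(_ i j Logic.I Logic.I ij) ->; rewrite set0X.
Qed.

(** The pi-lambda theorem is used twice: in the first factor with the second one fixed, then on the
    product, with measurable rectangles as pi-system. *)
Lemma dynkin_class_prod (G1 : set (set T1)) :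
  @measurable _ T1 = <<s G1 >> -> setI_closed G1 ->
  (forall B, measurable B -> Q (setT `*` B)) ->
  (forall A B, G1 A -> measurable B -> Q (A `*` B)) ->
  forall X, measurable X -> Q X.
Proof.
move=> mG1 G1I QT QG; apply: (@dynkin_class_measurable _ _ _
    [set A `*` B | A in measurable & B in measurable]) => //.
- by rewrite measurable_prod_measurableType.
- move=> _ _ [A1 mA1 [A2 mA2 <-]] [B1 mB1 [B2 mB2 <-]].
  exists (A1 `&` B1); first exact: measurableI.
  exists (A2 `&` B2); first exact: measurableI.
  by rewrite setXI.
- move=> _ [A mA [B mB <-]].
  apply: (dynkin_class_measurable mG1 G1I (dynkin_class_section2 mB (QT _ mB)) _ mA).
  by move=> A' GA'; exact: QG.
Qed.

End dynkin_products.

Section monotone_classes.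
Context (R : realType) (d : measure_display) (T : measurableType d).
Variable K : set T.
Hypothesis mK : measurable K.
Implicit Types f g : T -> R.

Definition bounded_on f :=
  measurable_fun setT f /\ exists M, forall x, `|f x| <= M * \1_K x.

(* Vector spaces of bounded functions supported in K that are closed under
   bounded pointwise limits. *)
Record monotone_class (P : (T -> R) -> Prop) : Prop := MonotoneClass {
  mclassD : forall f g, bounded_on f -> bounded_on g -> P f -> P g ->
    P (fun x => f x + g x);
  mclassZ : forall c f, bounded_on f -> P f -> P (fun x => c * f x);
  mclass_lim : forall (f_ : nat -> T -> R) f (M : R),
    (forall n, measurable_fun setT (f_ n)) ->
    (forall n x, `|f_ n x| <= M * \1_K x) ->
    (forall x, f_ n x @[n --> \oo] --> f x) ->
    (forall n, P (f_ n)) -> P f }.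

Variable P : (T -> R) -> Prop.
Hypothesis PM : monotone_class P.

Lemma bounded_on_indic A : measurable A -> bounded_on (\1_(A `&` K)).
Proof.
move=> mA; split; first by apply: measurable_indic; exact: measurableI.
exists 1 => x; rewrite mul1r ger0_norm// !indicE ler_nat in_setI.
by case: (x \in A) => //; case: (x \in K).
Qed.

Lemma bounded_onD f g : bounded_on f -> bounded_on g ->
  bounded_on (fun x => f x + g x).
Proof.
move=> [mf [M fM]] [mg [N gN]]; split; first exact: measurable_funD.
by exists (M + N) => x; rewrite mulrDl (le_trans (ler_normD _ _))// lerD.
Qed.

Lemma bounded_onZ c f : bounded_on f -> bounded_on (fun x => c * f x).
Proof.
move=> [mf [M fM]]; split; first exact: measurable_funM.
by exists (`|c| * M) => x; rewrite normrM -mulrA ler_wpM2l.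
Qed.

Lemma mclass0 f : bounded_on f -> P f -> P (fun=> 0).
Proof.
by move=> bf Pf; have := mclassZ PM 0 bf Pf; under eq_fun do rewrite mul0r.
Qed.

(** Complements follow from linearity by subtraction from the indicator of [K]; countable disjoint
    unions are bounded limits of finite ones, whose indicators are sums. *)
Lemma mclass_dynkin : P \1_K -> dynkin_class (fun A => P \1_(A `&` K)).
Proof.
move=> PK; have bK : bounded_on \1_K by rewrite -[K in \1_K]setTI; exact: bounded_on_indic.
split; first by rewrite setTI.
  move=> A mA PA.
  have -> : \1_(~` A `&` K) = (fun x => \1_K x + -1 * \1_(A `&` K) x) :> (T -> R).
    apply/funext => x; rewrite !indicE !in_setI in_setC.
    by case: (x \in A); case: (x \in K) => /=; ring.
  apply: (mclassD PM) => //; [exact/bounded_onZ/bounded_on_indic|].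
  by apply: (mclassZ PM) => //; exact: bounded_on_indic.
move=> F mF tF PF; pose U n := \bigcup_(k < n) F k.
have mU n : measurable (U n) by apply: bigcup_measurable.
apply: (mclass_lim PM (f_ := fun n => \1_(U n `&` K)) (M := 1)).
- by move=> n; apply: measurable_indic; exact: measurableI.
- move=> n x; rewrite mul1r ger0_norm// !indicE ler_nat in_setI.
  by case: (x \in U n) => //; case: (x \in K).
- move=> x; rewrite !indicE; have [Kx|nKx] := pselect (K x); last first.
    rewrite memNset; last by case.
    by apply: cvg_near_cst; apply: nearW => n; rewrite indicE memNset//; case.
  have [[k _ Fkx]|nFx] := pselect ((\bigcup_k F k) x); last first.
    rewrite memNset; last by case.
    apply: cvg_near_cst; apply: nearW => n; rewrite indicE memNset//.
    by move=> [[k _ Fk] _]; apply: nFx; exists k.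
  rewrite (mem_set (_ : (\bigcup_k F k `&` K) x)); last by split=> //; exists k.
  apply: cvg_near_cst; exists k.+1 => // n /= kn; rewrite indicE mem_set//.
  by split => //; exists k.
- elim=> [|n IH].
    have -> : U 0%N = set0 by apply/seteqP; split => // x [].
    by rewrite set0I; have := mclass0 bK PK; congr P; apply/funext => x; rewrite indic0.
  have -> : \1_(U n.+1 `&` K) = (fun x => \1_(U n `&` K) x + \1_(F n `&` K) x) :> (T -> R).
    apply/funext => x; rewrite !indicE !in_setI.
    have -> : (x \in U n.+1) = (x \in U n) || (x \in F n).
      apply/idP/idP => [/set_mem[k /= kn Fk]|/orP[/set_mem[k /= kn Fk]|/set_mem Fn]].
      - move: kn; rewrite ltnS leq_eqVlt => /predU1P[kn|kn]; apply/orP.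
          by right; rewrite -kn inE.
        by left; rewrite inE; exists k.
      - by rewrite inE; exists k => //=; rewrite ltnS ltnW.
      - by rewrite inE; exists n => /=.
    have : ~~ ((x \in U n) && (x \in F n)).
      apply/negP => /andP[/set_mem[k /= kn Fk] /set_mem Fn].
      have := tF k n Logic.I Logic.I; have h : (F k `&` F n) !=set0 by exists x.
      by move=> /(_ h) e; move: kn; rewrite e ltnn.
    by case: (x \in U n); case: (x \in F n); case: (x \in K) => //= _; rewrite ?addr0 ?add0r.
  by apply: (mclassD PM) => //; exact: bounded_on_indic.
Qed.

Lemma mclass_sum I (s : seq I) (F : I -> T -> R) : P (fun=> 0) ->
  (forall i, bounded_on (F i)) -> (forall i, P (F i)) ->
  bounded_on (fun x => \sum_(i <- s) F i x) /\ P (fun x => \sum_(i <- s) F i x).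
Proof.
move=> P0 bF PF; elim: s => [|i s [b IH]].
  under eq_fun do rewrite big_nil; split => //; split; first exact: measurable_cst.
  by exists 0 => x; rewrite normr0 mul0r.
under eq_fun do rewrite big_cons.
by split; [exact: bounded_onD|apply: (mclassD PM)].
Qed.

(** Nonnegative functions are bounded limits of simple functions vanishing off [K]; the general case
    splits into positive and negative parts. *)
Lemma mclass_indic_all : (forall A, measurable A -> P \1_(A `&` K)) ->
  forall f, bounded_on f -> P f.
Proof.
move=> PA.
have P0 : P (fun=> 0).
  by apply: (@mclass0 \1_(setT `&` K)); [exact: bounded_on_indic|exact: PA].
have pos f : bounded_on f -> (forall x, 0 <= f x) -> P f.
  move=> [mf [M fM]] f0.
  have mEf : measurable_fun setT (EFin \o f) by exact/measurable_EFinP.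
  pose g := nnsfun_approx measurableT mEf.
  have cg x : g n x @[n --> \oo] --> f x.
    have /fine_cvg := @cvg_nnsfun_approx _ _ _ _ measurableT _ mEf (fun x _ => f0 x) x Logic.I.
    exact.
  have gf n x : g n x <= f x.
    have nd : nondecreasing_seq (fun n => g n x).
      by move=> i j ij; have /lefP := nd_nnsfun_approx measurableT mEf ij; exact.
    by have := nondecreasing_cvgn_le nd (cvgP _ (cg x)) n; rewrite (cvg_lim _ (cg x)).
  apply: (mclass_lim PM (f_ := fun n => g n) (M := M)) => //.
    by move=> n x; rewrite ger0_norm// (le_trans (gf n x))// (le_trans _ (fM x))// ler_norm.
  (* The simple function lies between 0 and [f], so it vanishes off [K] and its level sets may be
     cut down to [K]. *)
  move=> n; pose F (y : R) (x : T) := y * \1_(g n @^-1` [set y] `&` K) x.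
  have -> : (g n : T -> R) = (fun x => \sum_(y <- finmap.enum_fset (fset_set (range (g n)))) F y x).
    apply/funext => x; rewrite /F; have [Kx|nKx] := pselect (K x).
      rewrite fimfunE fsbig_finite//; apply: eq_bigr => y _.
      by rewrite !indicE in_setI (mem_set Kx) andbT.
    rewrite big1 => [|y _]; last by rewrite indicE memNset ?mulr0//; case.
    apply/eqP; rewrite eq_le; apply/andP; split => //.
    rewrite (le_trans (gf n x))// (le_trans (ler_norm _))// (le_trans (fM x))//.
    by rewrite indicE memNset// mulr0.
  have [] // := @mclass_sum _ (finmap.enum_fset (fset_set (range (g n)))) F P0.
    by move=> y; apply: bounded_onZ; apply: bounded_on_indic; rewrite -[X in measurable X]setTI; exact: measurable_funP.
  move=> y; have m : measurable (g n @^-1` [set y]).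
    by rewrite -[X in measurable X]setTI; exact: measurable_funP.
  by apply: (mclassZ PM); [exact: bounded_on_indic|exact: PA].
move=> f [mf [M fM]].
have bp : bounded_on (fun x => Num.max (f x) 0).
  split; first exact: measurable_maxr.
  exists M => x; apply: le_trans (fM x); rewrite ger0_norm ?le_max ?lexx ?orbT//.
  by rewrite ge_max ler_norm normr_ge0.
have bn : bounded_on (fun x => Num.max (- f x) 0).
  split; first by apply: measurable_maxr => //; exact: measurable_funN.
  exists M => x; apply: le_trans (fM x); rewrite ger0_norm ?le_max ?lexx ?orbT//.
  by rewrite ge_max -normrN ler_norm normr_ge0.
have -> : f = (fun x => Num.max (f x) 0 + -1 * Num.max (- f x) 0).
  apply/funext => x; case: (leP (f x) 0) => h.
    by rewrite (max_idPl _) ?oppr_ge0//; ring.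
  by rewrite (max_idPr _) ?oppr_le0 ?ltW//; ring.
apply: (mclassD PM) => //; first exact: bounded_onZ.
  by apply: pos => // x; rewrite le_max lexx orbT.
by apply: (mclassZ PM) => //; apply: pos => // x; rewrite le_max lexx orbT.
Qed.

End monotone_classes.

(** * Reduction to boxes and to tensor products of bumps *)

Section rays.
Variable R : realType.
Local Notation mR := (measurableTypeR R).

(** [None] stands for the whole line, so that one family of products covers the total space as well
    as the pi-system of open rays. *)
Definition ray (o : option R) : set mR := if o is Some x then `]x, +oo[%classic else setT.

Let measurable_rays : @measurable _ mR = <<s @RGenOInfty.G R >>.
Proof. exact: RGenOInfty.measurableE. Qed.

Let rays_setI : setI_closed (@RGenOInfty.G R).
Proof.
move=> _ _ [x ->] [y ->]; exists (Num.max x y); apply/seteqP; split => z /=.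
  by rewrite !in_itv/= !andbT gt_max => -[-> ->].
by rewrite !in_itv/= !andbT gt_max => /andP[-> ->].
Qed.

Lemma measurable_ray o : measurable (ray o).
Proof. by case: o => [x|] /=; [exact: measurable_itv|exact: measurableT]. Qed.

Lemma dynkin_real (Q : set (set mR)) : dynkin_class Q ->
  (forall o, Q (ray o)) -> forall A, measurable A -> Q A.
Proof.
move=> QD Qr; apply: (dynkin_class_measurable measurable_rays rays_setI QD).
by move=> _ [x ->]; exact: (Qr (Some x)).
Qed.

Lemma dynkin_plane (Q : set (set (mplane R))) : dynkin_class Q ->
  (forall o1 o2, Q (ray o1 `*` ray o2)) -> forall A, measurable A -> Q A.
Proof.
move=> QD Qr.
have h o B : measurable B -> Q (ray o `*` B).
  move: B; apply: dynkin_real; last by move=> o2; exact: Qr.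
  by apply: dynkin_class_section1 => //; [exact: measurable_ray|exact: (Qr o None)].
apply: (dynkin_class_prod QD measurable_rays rays_setI) => [B|_ B [x ->]]; first exact: (h None).
exact: (h (Some x)).
Qed.

Lemma dynkin_space (Q : set (set (mspace R))) : dynkin_class Q ->
  (forall o1 o2 o3, Q (ray o1 `*` (ray o2 `*` ray o3))) ->
  forall A, measurable A -> Q A.
Proof.
move=> QD Qr.
have h o B : measurable B -> Q (ray o `*` B).
  move: B; apply: dynkin_plane; last by move=> o2 o3; exact: Qr.
  apply: dynkin_class_section1 => //; first exact: measurable_ray.
  by have := Qr o None None; rewrite setXTT.
apply: (dynkin_class_prod QD measurable_rays rays_setI) => [B|_ B [x ->]]; first exact: (h None).
exact: (h (Some x)).
Qed.

Definition ray_lb (a : R) (o : option R) := if o is Some x then Num.max x a else a.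

Lemma ray_lb_ge a o : a <= ray_lb a o.
Proof. by case: o => [x|] //=; rewrite le_max lexx orbT. Qed.

Lemma ray_itv o a c : ray o `&` `]a, c[%classic = `]ray_lb a o, c[%classic.
Proof.
case: o => [x|] /=; last by rewrite setTI.
apply/seteqP; split => z /=; rewrite !in_itv/= gt_max andbT.
  by move=> [-> /andP[-> ->]].
by move=> /andP[/andP[-> ->] ->].
Qed.

Definition box2 (a1 c1 a2 c2 : R) : set (mplane R) := `]a1, c1[ `*` `]a2, c2[.
Definition box3 (a1 c1 a2 c2 a3 c3 : R) : set (mspace R) :=
  `]a1, c1[ `*` (`]a2, c2[ `*` `]a3, c3[).

Lemma measurable_box2 a1 c1 a2 c2 : measurable (box2 a1 c1 a2 c2).
Proof. by apply: measurableX; exact: measurable_itv. Qed.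

Lemma measurable_box3 a1 c1 a2 c2 a3 c3 : measurable (box3 a1 c1 a2 c2 a3 c3).
Proof. by apply: measurableX; [exact: measurable_itv|exact: measurable_box2]. Qed.

Lemma indic_setX (T1 T2 : Type) (A : set T1) (B : set T2) (x : T1 * T2) :
  \1_(A `*` B) x = \1_A x.1 * \1_B x.2 :> R.
Proof. by rewrite !indicE in_setX -natrM mulnb. Qed.

Lemma bump_mono (a a' c : R) n x : a <= a' ->
  `|bump a' c n x| <= \1_`]a, c[%classic x.
Proof.
move=> aa'; rewrite ger0_norm ?bump_ge0// indicE.
have [h|h] := pselect (a < x < c); last first.
  rewrite bump_out// => /andP[h1 h2]; apply: h; rewrite h2 andbT.
  exact: le_lt_trans h1.
by rewrite mem_set ?bump_le1//= in_itv.
Qed.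

Lemma measurable_tens2 (f g : R -> R) : smooth1 f -> smooth1 g ->
  measurable_fun setT (tens2 f g : mplane R -> R).
Proof.
by move=> sf sg; apply: measurable_cont2; apply: smooth_cont; exact: smooth_tens2.
Qed.

Lemma measurable_tens3 (f g h : R -> R) : smooth1 f -> smooth1 g -> smooth1 h ->
  measurable_fun setT (tens3 f g h : mspace R -> R).
Proof.
by move=> sf sg sh; apply: measurable_cont3; apply: smooth_cont; exact: smooth_tens3.
Qed.

(** The intersection of [K] with a product of rays is an open box with the same upper corner, whose
    indicator is a bounded limit of tensor products of bumps. A property stable under bounded limits
    therefore need only be checked on these smooth functions. *)
Lemma mclass_plane (a1 c1 a2 c2 : R) (P : (mplane R -> R) -> Prop) :
  let K := box2 a1 c1 a2 c2 in
  monotone_class K P ->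
  (forall a1' a2' n, a1 <= a1' -> a2 <= a2' ->
    bounded_on K (tens2 (bump a1' c1 n) (bump a2' c2 n)) ->
    P (tens2 (bump a1' c1 n) (bump a2' c2 n))) ->
  forall f, bounded_on K f -> P f.
Proof.
move=> K PM Pb; have mK : measurable K by exact: measurable_box2.
have Pr o1 o2 : P \1_((ray o1 `*` ray o2) `&` K).
  rewrite /K /box2 -setXI !ray_itv.
  pose a1' := ray_lb a1 o1; pose a2' := ray_lb a2 o2.
  have h1 : a1 <= a1' by exact: ray_lb_ge.
  have h2 : a2 <= a2' by exact: ray_lb_ge.
  pose f_ n : mplane R -> R := tens2 (bump a1' c1 n) (bump a2' c2 n).
  have mf_ n : measurable_fun setT (f_ n).
    by apply: measurable_tens2; exact: smooth1_bump.
  have f_K n x : `|f_ n x| <= 1 * \1_K x.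
    rewrite mul1r indic_setX normrM; apply: ler_pM => //; exact: bump_mono.
  apply: (mclass_lim PM (f_ := f_) (M := 1)) => //.
    by move=> x; rewrite indic_setX; apply: cvgM; exact: bump_cvg.
  by move=> n; apply: Pb => //; split; [exact: mf_|exists 1; exact: f_K].
apply: mclass_indic_all => //.
have PK : P \1_K by have := Pr None None; rewrite /= setXTT setTI.
by apply: dynkin_plane; [exact: mclass_dynkin|exact: Pr].
Qed.

Lemma mclass_space (a1 c1 a2 c2 a3 c3 : R) (P : (mspace R -> R) -> Prop) :
  let K := box3 a1 c1 a2 c2 a3 c3 in
  monotone_class K P ->
  (forall a1' a2' a3' n, a1 <= a1' -> a2 <= a2' -> a3 <= a3' ->
    bounded_on K (tens3 (bump a1' c1 n) (bump a2' c2 n) (bump a3' c3 n)) ->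
    P (tens3 (bump a1' c1 n) (bump a2' c2 n) (bump a3' c3 n))) ->
  forall f, bounded_on K f -> P f.
Proof.
move=> K PM Pb; have mK : measurable K by exact: measurable_box3.
have Pr o1 o2 o3 : P \1_((ray o1 `*` (ray o2 `*` ray o3)) `&` K).
  rewrite /K /box3 -!setXI !ray_itv.
  pose a1' := ray_lb a1 o1; pose a2' := ray_lb a2 o2; pose a3' := ray_lb a3 o3.
  have h1 : a1 <= a1' by exact: ray_lb_ge.
  have h2 : a2 <= a2' by exact: ray_lb_ge.
  have h3 : a3 <= a3' by exact: ray_lb_ge.
  pose f_ n : mspace R -> R := tens3 (bump a1' c1 n) (bump a2' c2 n) (bump a3' c3 n).
  have mf_ n : measurable_fun setT (f_ n).
    by apply: measurable_tens3; exact: smooth1_bump.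
  have f_K n x : `|f_ n x| <= 1 * \1_K x.
    rewrite mul1r !indic_setX normrM; apply: ler_pM => //; first exact: bump_mono.
    by rewrite normrM; apply: ler_pM => //; exact: bump_mono.
  apply: (mclass_lim PM (f_ := f_) (M := 1)) => //.
    by move=> x; rewrite !indic_setX; do 2?[apply: cvgM]; exact: bump_cvg.
  by move=> n; apply: Pb => //; split; [exact: mf_|exists 1; exact: f_K].
apply: mclass_indic_all => //.
have PK : P \1_K by have := Pr None None None; rewrite /= !setXTT setTI.
by apply: dynkin_space; [exact: mclass_dynkin|exact: Pr].
Qed.

End rays.

Lemma itg_norm (R : realType) (d : measure_display) (T : measurableType d)
    (mu : {measure set T -> \bar R}) (U : set T) (f : T -> R) :
  mu.-integrable U (EFin \o f) -> mu.-integrable U (EFin \o (fun x => `|f x|)).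
Proof. by move/integrable_norm. Qed.

Lemma bounded_on_sqint (R : realType) (d : measure_display) (T : measurableType d)
    (mu : {measure set T -> \bar R}) (U K : set T) (f : T -> R) :
  measurable U -> measurable K -> (mu K < +oo)%E -> bounded_on K f -> L2 mu U f.
Proof.
move=> mU mK fK [mf [M fM]]; have mfU : measurable_fun U f by exact: measurable_funTS.
apply: (@L2_le _ _ _ mu U mU _ (fun x => M * \1_K x)) => //.
  by move=> x _; rewrite (le_trans (fM x))// ler_norm.
apply: (@L2Z _ _ _ mu U mU); split; first exact: measurable_indic.
under eq_integral => x _.
  rewrite (_ : \1_K x ^+ 2 = \1_K x); first over.
  by rewrite indicE; case: (x \in K); rewrite ?expr1n ?expr0n.
rewrite integral_indic//; apply: le_lt_trans fK.
by apply: le_measure; [rewrite inE; exact: measurableI|rewrite inE|move=> x []].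
Qed.

(** * Fundamental lemma and density of test functions *)

Section test_functions.
Context (R : realType) (d : measure_display) (T : measurableType d).
Variables (mu : {measure set T -> \bar R}) (U : set T).
Variables (test : set (T -> R)) (Km : nat -> set T).
Implicit Types f g h phi : T -> R.

Local Notation itg f := (mu.-integrable U (EFin \o f)).
Local Notation L2 := (L2 mu U).
Local Notation ip := (ip mu U).
Local Notation nrm := (nrm mu U).
Local Notation locint := (locint mu U test).

(** A common interface for the plane and the slab: pieces [Km m] of finite measure, each with a test
    function equal to 1 on it and a monotone class principle starting from test functions. *)
Record exhaustion : Prop := Exhaustion {
  exh_mU : measurable U;
  exh_meas : forall m, measurable (Km m);
  exh_sub : forall m, Km m `<=` U;
  exh_cover : forall x, U x -> \forall m \near \oo, Km m x;
  exh_fin : forall m, (mu (Km m) < +oo)%E;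
  exh_one : forall m, exists2 phi, test phi & forall x, Km m x -> phi x = 1;
  exh_mclass : forall m (P : (T -> R) -> Prop), monotone_class (Km m) P ->
    (forall phi, test phi -> bounded_on (Km m) phi -> P phi) ->
    forall f, bounded_on (Km m) f -> P f;
  exh_L2 : forall phi, test phi -> L2 phi;
  exh_testD : forall phi psi, test phi -> test psi -> test (fun x => phi x + psi x);
  exh_testZ : forall c phi, test phi -> test (fun x => c * phi x) }.

Hypothesis E : exhaustion.

Let mU := exh_mU E.

Lemma test_meas phi : test phi -> measurable_fun U phi.
Proof. by move=> /(exh_L2 E) []. Qed.

Lemma bounded_on_L2 m f : bounded_on (Km m) f -> L2 f.
Proof. exact: bounded_on_sqint mU (exh_meas E m) (exh_fin E m). Qed.

Lemma locint_bounded_on h m f : locint h -> bounded_on (Km m) f ->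
  itg (fun x => h x * f x).
Proof.
move=> [mh lh] [mf [M fM]]; have [phi tphi phi1] := exh_one E m.
apply: (@itg_le _ _ _ mu U mU _ (fun x => `|M| * `|h x * phi x|)).
- by apply: measurable_funM => //; exact: measurable_funTS.
- move=> x Ux; have := fM x; rewrite indicE.
  have [Kx|nKx] := pselect (Km m x).
    rewrite mem_set// mulr1 !normrM phi1// normr1 mulr1 mulrC => h1.
    by rewrite ler_wpM2r// (le_trans h1)// ler_norm.
  by rewrite memNset// mulr0 normr_le0 => /eqP ->; rewrite mulr0 normr0 mulr_ge0.
- by apply: itgZ => //; apply: itg_norm; exact: lh.
Qed.

Lemma mclass_pairing h m : locint h ->
  monotone_class (Km m) (fun f => \int[mu]_(x in U) (h x * f x) = 0).
Proof.
move=> lh; split.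
- move=> f g bf bg f0 g0; under eq_Rintegral do rewrite mulrDr.
  have i1 := locint_bounded_on lh bf; have i2 := locint_bounded_on lh bg.
  by rewrite (RintegralD mU i1 i2) f0 g0 addr0.
- move=> c f bf f0; under eq_Rintegral do rewrite mulrCA.
  by rewrite (RintegralZl c mU (locint_bounded_on lh bf)) f0 mulr0.
- move=> f_ f M mf_ fM cf P0.
  have bK : bounded_on (Km m) (fun x => `|M| * \1_(Km m) x).
    apply: bounded_onZ; rewrite -[X in \1_X]setTI; apply: bounded_on_indic => //.
    exact: exh_meas.
  have mh : measurable_fun U h by case: lh.
  have mf : measurable_fun setT f by apply: measurable_fun_cvg (fun x _ => cf x).
  have [] := @Rint_dct _ _ _ mu U mU (fun n x => h x * f_ n x) (fun x => h x * f x)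
      (fun x => `|h x * (`|M| * \1_(Km m) x)|).
  + by move=> n; apply: measurable_funM => //; exact: measurable_funTS.
  + by apply: measurable_funM => //; exact: measurable_funTS.
  + by apply: itg_norm; exact: locint_bounded_on lh bK.
  + by apply: aeW => x _; apply: cvgMl_tmp; exact: cf.
  + apply: aeW => x _ n; rewrite !normrM ler_wpM2l// normr_id.
    by rewrite (le_trans (fM n x))// -normrM ler_norm.
  + move=> _; under eq_fun do rewrite P0.
    by move=> /cvg_lim <-//; rewrite lim_cst.
Qed.

(** The functions whose pairing with [h] vanishes form a monotone class containing the test
    functions supported in [Km m]. It contains the sign of [h] cut off to [Km m], whose pairing is
    the integral of the absolute value of [h] there. *)
Lemma fundamental_lemma h : locint h ->
  (forall phi, test phi -> \int[mu]_(x in U) (h x * phi x) = 0) ->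
  {ae mu, forall x, U x -> h x = 0}.
Proof.
move=> lh h0; have mh : measurable_fun U h by case: lh.
have key m : {ae mu, forall x, U x -> `|h x| * \1_(Km m) x = 0}.
  have mK := exh_meas E m.
  pose hU := h \_ U.
  have mhU : measurable_fun setT hU by apply/(measurable_restrictT _ mU).
  pose f x := Num.sg (hU x) * \1_(Km m) x.
  have bf : bounded_on (Km m) f.
    split.
      apply: measurable_funM; last exact: measurable_indic.
      (* The sign is a difference of two indicators, whence its measurability. *)
      rewrite (_ : (fun x => _) = (fun x => \1_(hU @^-1` `]0, +oo[) x - \1_(hU @^-1` `]-oo, 0[) x)).
        apply: measurable_funB; apply: measurable_indic;
          rewrite -[X in measurable X]setTI; apply: mhU => //; exact: measurable_itv.
      apply/funext => x; rewrite !indicE.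
      have -> : (x \in hU @^-1` `]0, +oo[) = (0 < hU x).
        by apply/idP/idP => [/set_mem|]; rewrite ?inE /= in_itv/= andbT.
      have -> : (x \in hU @^-1` `]-oo, 0[) = (hU x < 0).
        by apply/idP/idP => [/set_mem|]; rewrite ?inE /= in_itv/=.
      case: (ltrgtP (hU x) 0) => [a|a|->]; [rewrite (ltr0_sg a)|rewrite (gtr0_sg a)|rewrite sgr0].
      + by rewrite sub0r.
      + by rewrite subr0.
      + by rewrite subr0.
    exists 1 => x; rewrite mul1r normrM (ger0_norm (_ : 0 <= \1_(Km m) x)); last by rewrite indicE.
    by rewrite -[leRHS]mul1r ler_wpM2r ?indicE// normr_sg lern1; case: eqP.
  have := exh_mclass E (mclass_pairing m lh) (fun phi tphi _ => h0 phi tphi) bf.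
  have e : {in U, (fun x => h x * f x) =1 (fun x => `|h x| * \1_(Km m) x)}.
    move=> x /set_mem Ux; rewrite /f mulrA /hU patchE mem_set//.
    by rewrite mulrC -[in LHS](mulrC (Num.sg _)) -normrEsg mulrC.
  rewrite (eq_Rintegral _ e) => I0.
  have i1 : itg (fun x => `|h x| * \1_(Km m) x).
    have := locint_bounded_on lh bf; apply: eq_integrable => // x xU.
    by rewrite /= e.
  have := itgE mU i1; rewrite I0 => I0'.
  have h1 : (\int[mu]_(x in U) `|(`|h x| * \1_(Km m) x)%:E|)%E = 0%E.
    under eq_integral => x _ do rewrite /= ger0_norm ?mulr_ge0 ?indicE//.
    by apply: etrans I0'; apply: eq_integral => x _; rewrite indicE.
  have [|k _] := @ae_eq_integral_abs _ _ _ mu U mU (fun x => (`|h x| * \1_(Km m) x)%:E).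
    by apply/measurable_EFinP; exact: itg_meas i1.
  by have := k h1; apply: filterS => x + Ux => /(_ Ux) /= [].
have := ae_foralln key; apply: filterS => x hx Ux.
have [m _ /(_ m (leqnn m)) Km_x] := exh_cover E Ux.
have := hx m Ux; rewrite indicE mem_set// mulr1 => /eqP.
by rewrite normr_eq0 => /eqP.
Qed.

Lemma L2_locint f : L2 f -> locint f.
Proof.
move=> Lf; split; first by case: Lf.
by move=> phi tphi; apply: L2_itgM => //; exact: exh_L2.
Qed.

(** The functions approximable by test functions form a monotone class, hence include all bounded
    functions supported in some [Km m]. A general [f] is reached by truncating both its values and
    its domain at level [m]. *)
Lemma test_density f : L2 f -> forall e, 0 < e ->
  exists phi, [/\ test phi, L2 phi & nrm (fun x => f x - phi x) < e].
Proof.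
pose P f := forall e, 0 < e ->
  exists phi, [/\ test phi, L2 phi & nrm (fun x => f x - phi x) < e].
have Plim (f_ : nat -> T -> R) g : (forall n, L2 (f_ n)) -> L2 g ->
    nrm (fun x => f_ n x - g x) @[n --> \oo] --> 0 -> (forall n, P (f_ n)) -> P g.
  move=> Lf_ Lg c Pf_ e e0; have e2 : 0 < e / 2 by rewrite divr_gt0.
  have [n _ /(_ n (leqnn n))] : \forall n \near \oo, nrm (fun x => f_ n x - g x) < e / 2.
    by apply: cvgr_lt c _ _.
  move=> /= hn; have [phi [tphi Lphi hphi]] := Pf_ n _ e2.
  exists phi; split => //.
  have := nrmB mU (L2B mU (Lf_ n) Lphi) (L2B mU (Lf_ n) Lg).
  rewrite (_ : (fun x => f_ n x - phi x - (f_ n x - g x)) = (fun x => g x - phi x)); last first.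
    by apply/funext => x; ring.
  by move=> h; apply: le_lt_trans h _; rewrite [ltRHS]splitr ltrD.
have PK m : monotone_class (Km m) P.
  split.
  - move=> {}f g /bounded_on_L2 Lf /bounded_on_L2 Lg Pf Pg e e0.
    have e2 : 0 < e / 2 by rewrite divr_gt0.
    have [phi [t1 L1 h1]] := Pf _ e2; have [psi [t2 L2' h2]] := Pg _ e2.
    exists (fun x => phi x + psi x); split; [exact: exh_testD|exact: L2D|].
    have := nrmD mU (L2B mU Lf L1) (L2B mU Lg L2').
    rewrite (_ : (fun x => f x - phi x + (g x - psi x)) = (fun x => f x + g x - (phi x + psi x))); last first.
      by apply/funext => x; ring.
    by move=> h; apply: le_lt_trans h _; rewrite [ltRHS]splitr ltrD.
  - move=> c {}f /bounded_on_L2 Lf Pf e e0.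
    have e2 : 0 < e / (`|c| + 1) by rewrite divr_gt0// ltr_pwDr.
    have [phi [t1 L1 h1]] := Pf _ e2.
    exists (fun x => c * phi x); split; [exact: exh_testZ|exact: L2Z|].
    rewrite (_ : (fun x => _) = (fun x => c * (f x - phi x))); last by apply/funext => x; ring.
    rewrite nrmZ//; last exact: L2B.
    apply: (@le_lt_trans _ _ (`|c| * (e / (`|c| + 1)))).
      by rewrite ler_wpM2l// ltW.
    by rewrite mulrA ltr_pdivrMr ?ltr_pwDr// mulrC ltr_pM2l// ltrDl.
  - move=> f_ {}f M mf_ fM cf Pf_.
    have mf : measurable_fun setT f by apply: measurable_fun_cvg (fun x _ => cf x).
    have bK : bounded_on (Km m) (fun x => `|M| * \1_(Km m) x).
      apply: bounded_onZ; rewrite -[X in \1_X]setTI; apply: bounded_on_indic => //.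
      exact: exh_meas.
    have fM' n x : `|f_ n x| <= `|M| * \1_(Km m) x.
      by rewrite (le_trans (fM n x))// ler_wpM2r ?indicE// ler_norm.
    have [||||| Lf c] := @nrm_dct _ _ _ mu U mU f_ f (fun x => `|M| * \1_(Km m) x).
    + by move=> n; exact: measurable_funTS.
    + exact: measurable_funTS.
    + exact: bounded_on_L2 bK.
    + by apply: aeW => x _; exact: cf.
    + by apply: aeW => x _ n.
    apply: Plim c Pf_ => // n; apply: (@bounded_on_L2 m); split => //.
    by exists `|M|.
have Pb m f' : bounded_on (Km m) f' -> P f'.
  apply: (exh_mclass E (PK m)) => phi tphi _ e e0.
  exists phi; split => //; first exact: exh_L2.
  under eq_fun do rewrite subrr.
  by rewrite /nrm /ip /Rintegral; under eq_integral do rewrite mulr0;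
    rewrite integral0/= sqrtr0.
move=> Lf; suff : P f by [].
have mf := L2_meas Lf; pose fU := f \_ U.
have mfU : measurable_fun setT fU by apply/(measurable_restrictT _ mU).
pose f_ m x := fU x * \1_((fU @^-1` `[- m%:R, m%:R]) `&` Km m) x.
have mA m : measurable (fU @^-1` `[- m%:R, m%:R]).
  by rewrite -[X in measurable X]setTI; apply: mfU => //; exact: measurable_itv.
have mf_ m : measurable_fun setT (f_ m).
  apply: measurable_funM => //; apply: measurable_indic.
  by apply: measurableI => //; exact: exh_meas.
have bf_ m : bounded_on (Km m) (f_ m).
  split => //; exists m%:R => x; rewrite /f_ !indicE in_setI.
  have [/set_mem/=|] := boolP (x \in fU @^-1` _); last by rewrite /= mulr0 normr0 mulr_ge0.
  rewrite in_itv/= => h; rewrite normrM (ger0_norm (_ : 0 <= (_ && _)%:R))//.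
  by rewrite ler_wpM2r// ler_norml.
have [||||| _ c] := @nrm_dct _ _ _ mu U mU f_ f (fun x => `|f x|).
- by move=> m; exact: measurable_funTS.
- exact: mf.
- apply: (L2_le mU _ _ Lf); last by move=> x _; rewrite normr_id.
  exact: measurableT_comp.
- apply: aeW => x Ux; apply: cvg_near_cst.
  near=> m; rewrite /f_ indicE mem_set/=.
    by rewrite mulr1 /fU patchE mem_set.
  split.
    rewrite /= in_itv/= -ler_norml /fU patchE mem_set//.
    by near: m; exact: nbhs_infty_ger.
  by near: m; exact: exh_cover.
- apply: aeW => x Ux m; rewrite /f_ normrM /fU patchE mem_set//.
  by rewrite -[leRHS]mulr1 ler_wpM2l// indicE ger0_norm// lern1; case: (_ \in _).
- by apply: Plim c _ => // m; [exact: bounded_on_L2 (bf_ m)|exact: Pb (bf_ m)].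
Unshelve. all: by end_near. Qed.

Lemma test_density_seq f : L2 f -> exists phi : nat -> T -> R,
  [/\ forall n, test (phi n), forall n, L2 (phi n) &
      nrm (fun x => phi n x - f x) @[n --> \oo] --> 0].
Proof.
move=> Lf; have h n : exists phi, [/\ test phi, L2 phi & nrm (fun x => f x - phi x) < n.+1%:R^-1].
  by apply: test_density => //; rewrite invr_gt0.
have [phi hphi] := choice h; exists phi; split=> [n|n|]; [by case: (hphi n)|by case: (hphi n)|].
apply: (squeeze_cvgr _ (cvg_cst 0) (@cvg_harmonic R)); apply: nearW => n.
have [_ Lp /ltW hn] := hphi n; rewrite nrm_ge0 /=.
rewrite -(nrmN mU)//; last exact: L2B.
by under eq_fun do rewrite opprB.
Qed.

(** Along test functions that approximate [f] itself, the hypothesis tends to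
    [ip f f <= C * nrm f]. *)
Lemma nrm_le_test f C : L2 f -> 0 <= C ->
  (forall phi, test phi -> `|ip f phi| <= C * nrm phi) -> nrm f <= C.
Proof.
move=> Lf C0 h; have [phi [tphi Lphi c]] := test_density_seq Lf.
have c1 : `|ip f (phi n)| @[n --> \oo] --> `|ip f f|.
  have c0 : ip f (phi n) @[n --> \oo] --> ip f f.
    by under eq_fun do rewrite ipC; exact: cvg_ip.
  exact: cvg_norm c0.
have c2 : C * nrm (phi n) @[n --> \oo] --> C * nrm f.
  by apply: cvgMl_tmp; exact: cvg_nrm.
have : `|ip f f| <= C * nrm f.
  by apply: (ler_cvg_to c1 c2); apply: nearW => n; exact: h.
rewrite ger0_norm ?ip_ge0// -nrm2 expr2.
have := nrm_ge0 mu U f; rewrite le_eqVlt => /predU1P[<-//|n0].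
by rewrite ler_pM2r.
Qed.

End test_functions.

Section smooth_linear.
Context (R : realType) (E : normedModType R) (n : nat) (e : 'I_n -> E).
Implicit Types f g : E -> R.

Lemma foldr_pdD f g w : smooth e f -> smooth e g ->
  foldr (pd e) (fun x => f x + g x) w =
  (fun x => foldr (pd e) f w x + foldr (pd e) g w x).
Proof.
move=> sf sg; elim: w => //= j w ->; apply/funext => x.
have h1 := pd_is_derive j x (smooth_foldr w sf).
have h2 := pd_is_derive j x (smooth_foldr w sg).
by have /(@derive_val _ _ _ _ _ _ _) := is_deriveD h1 h2.
Qed.

Lemma foldr_pdZ c f w : smooth e f ->
  foldr (pd e) (fun x => c * f x) w = (fun x => c * foldr (pd e) f w x).
Proof.
move=> sf; elim: w => //= j w ->; apply/funext => x.
have h1 := pd_is_derive j x (smooth_foldr w sf).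
by have /(@derive_val _ _ _ _ _ _ _) := is_deriveZ c h1.
Qed.

Lemma smoothD f g : smooth e f -> smooth e g -> smooth e (fun x => f x + g x).
Proof.
move=> sf sg w x; rewrite foldr_pdD//.
by apply: differentiableD; [exact: sf|exact: sg].
Qed.

Lemma smoothZ c f : smooth e f -> smooth e (fun x => c * f x).
Proof. by move=> sf w x; rewrite foldr_pdZ//; apply: differentiableZ; exact: sf. Qed.

Lemma testfunD U f g : testfun e U f -> testfun e U g -> testfun e U (fun x => f x + g x).
Proof.
move=> [sf [K [cK KU f0]]] [sg [L [cL LU g0]]]; split; first exact: smoothD.
exists (K `|` L); split; first exact: compactU.
  by move=> x [/KU|/LU].
by move=> x /not_orP[nK nL]; rewrite f0// g0// addr0.
Qed.

Lemma testfunZ U c f : testfun e U f -> testfun e U (fun x => c * f x).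
Proof.
move=> [sf [K [cK KU f0]]]; split; first exact: smoothZ.
by exists K; split => // x /f0 ->; rewrite mulr0.
Qed.

End smooth_linear.

(** * Exhaustions of the plane and of the slab *)

Section plane_and_slab.
Variables (R : realType) (b : R).
Local Notation plane := (R * R)%type.
Local Notation space := (R * (R * R))%type.

Lemma measurable_Omega : measurable (Omega b : set (mspace R)).
Proof.
rewrite (_ : Omega b = `]-b, 0[ `*` setT); first by apply: measurableX => //; exact: measurable_itv.
by apply/seteqP; split => -[x y] /=; rewrite /Omega /= in_itv/= => // -[].
Qed.

Lemma mu2_setX (A B : set (measurableTypeR R)) : measurable A -> measurable B ->
  mu2 (A `*` B : set (mplane R)) = (lebesgue_measure A * lebesgue_measure B)%E.
Proof. by move=> mA mB; rewrite /mu2 product_measure1E. Qed.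

Lemma mu3_setX (A : set (measurableTypeR R)) (B : set (mplane R)) :
  measurable A -> measurable B ->
  mu3 (A `*` B : set (mspace R)) = (lebesgue_measure A * mu2 B)%E.
Proof. by move=> mA mB; rewrite /mu3 product_measure1E. Qed.

Lemma lebesgue_itv_fin (a c : R) : lebesgue_measure (`]a, c[%classic : set (measurableTypeR R)) \is a fin_num.
Proof. by rewrite lebesgue_measure_itv/=; case: ifPn. Qed.

Lemma mu2_box_lty (a1 c1 a2 c2 : R) : (mu2 (box2 a1 c1 a2 c2) < +oo)%E.
Proof.
rewrite mu2_setX; try exact: measurable_itv.
by rewrite ltey_eq fin_numM// lebesgue_itv_fin.
Qed.

Lemma mu3_box_lty (a1 c1 a2 c2 a3 c3 : R) : (mu3 (box3 a1 c1 a2 c2 a3 c3) < +oo)%E.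
Proof.
rewrite mu3_setX; [|exact: measurable_itv|exact: measurable_box2].
rewrite ltey_eq fin_numM ?lebesgue_itv_fin// ge0_fin_numE ?measure_ge0//.
exact: mu2_box_lty.
Qed.

Lemma testfun2_bounded_on (U : set plane) phi : testfun (@dir2 R) U phi ->
  exists m : nat, let M : R := m%:R in bounded_on (box2 (- M) M (- M) M) phi.
Proof.
move=> tphi; have [M M0 hM] := testfun_bounded tphi.
have [sphi [K [cK KU phi0]]] := tphi.
have [N [_ hN]] := compact_bounded cK.
have [m Nm] : exists m : nat, N + 1 < m%:R by exists (Num.truncn (N + 1)).+1; exact: truncnS_gt.
exists m; split; first by apply: measurable_cont2; exact: smooth_cont.
exists M => -[x y]; rewrite indicE.
have [Kx|nKx] := pselect (K (x, y)); last first.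
  by rewrite phi0// normr0 mulr_ge0.
rewrite mem_set ?mulr1//=.
have N1 : N < N + 1 by rewrite ltrDl.
have /= := hN (N + 1) N1 (x, y) Kx.
rewrite prod_normE/= ge_max => /andP[h1 h2].
by split; rewrite /= in_itv/= -ltr_norml (le_lt_trans _ Nm).
Qed.

Lemma testfun3_bounded_on (U : set space) phi : testfun (@dir3 R) U phi ->
  exists m : nat, let M : R := m%:R in bounded_on (box3 (- M) M (- M) M (- M) M) phi.
Proof.
move=> tphi; have [M M0 hM] := testfun_bounded tphi.
have [sphi [K [cK KU phi0]]] := tphi.
have [N [_ hN]] := compact_bounded cK.
have [m Nm] : exists m : nat, N + 1 < m%:R by exists (Num.truncn (N + 1)).+1; exact: truncnS_gt.
exists m; split; first by apply: measurable_cont3; exact: smooth_cont.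
exists M => -[x [y z]]; rewrite indicE.
have [Kx|nKx] := pselect (K (x, (y, z))); last first.
  by rewrite phi0// normr0 mulr_ge0.
rewrite mem_set ?mulr1//=.
have N1 : N < N + 1 by rewrite ltrDl.
have /= := hN (N + 1) N1 (x, (y, z)) Kx.
rewrite prod_normE/= ge_max => /andP[h1]; rewrite prod_normE/= ge_max => /andP[h2 h3].
by split; [|split]; rewrite /= in_itv/= -ltr_norml (le_lt_trans _ Nm).
Qed.

Lemma testfun2_L2 (U : set plane) phi (D : set (mplane R)) : measurable D ->
  testfun (@dir2 R) U phi -> L2 mu2 D phi.
Proof.
move=> mD /testfun2_bounded_on[m]; apply: bounded_on_sqint => //.
  exact: measurable_box2.
exact: mu2_box_lty.
Qed.

Lemma testfun3_L2 (U : set space) phi (D : set (mspace R)) : measurable D ->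
  testfun (@dir3 R) U phi -> L2 mu3 D phi.
Proof.
move=> mD /testfun3_bounded_on[m]; apply: bounded_on_sqint => //.
  exact: measurable_box3.
exact: mu3_box_lty.
Qed.

Lemma bump_one (a c r : R) n x : 0 < r -> r^-1 <= n%:R -> a + r <= x <= c - r ->
  bump a c n x = 1.
Proof.
move=> r0 hn /andP[h1 h2].
have k t : r <= t -> 1 <= n%:R * t.
  move=> rt; rewrite -[leLHS](mulVf (lt0r_neq0 r0)).
  by apply: ler_pM => //; [rewrite invr_ge0 ltW|exact: ltW].
by rewrite /bump !step_ge1 ?mulr1//; apply: k; lra.
Qed.

Lemma bump_outc (a c : R) n x : ~ (a <= x <= c) -> bump a c n x = 0.
Proof. by move=> h; apply: bump_out => /andP[/ltW h1 /ltW h2]; apply: h; rewrite h1. Qed.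

Definition K2 (m : nat) : set (mplane R) := let M := m%:R in box2 (- M) M (- M) M.

(** The margin [1/(m+1)] at both faces leaves room for a test function of the open slab that equals
    1 on this piece. *)
Definition K3 (m : nat) : set (mspace R) :=
  let M := m%:R in box3 (- b + m.+1%:R^-1) (- m.+1%:R^-1) (- M) M (- M) M.

Lemma exhaustion_plane : exhaustion mu2 setT (@test2 R) K2.
Proof.
split.
- exact: measurableT.
- by move=> m; exact: measurable_box2.
- by [].
- move=> [x y] _; near=> m; split; rewrite /= in_itv/= -ltr_norml; near: m; exact: nbhs_infty_gtr.
- by move=> m; exact: mu2_box_lty.
- move=> m; pose f := bump (- m%:R - 1) (m%:R + 1 : R) 1.
  exists (tens2 f f).
    apply: (@testfun_tens2 _ (- m%:R - 1) (m%:R + 1) (- m%:R - 1) (m%:R + 1)) => //;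
      by [exact: smooth1_bump|move=> x; exact: bump_outc].
  move=> [x y] [/=]; rewrite !in_itv/= => /andP[h1 h2] /andP[h3 h4].
  by rewrite /tens2 /f !(@bump_one _ _ 1) ?mulr1 ?invr1//=; apply/andP; lra.
- move=> m P PM Pt; apply: mclass_plane PM _ => a1 a2 n h1 h2 bf; apply: Pt => //.
  apply: (@testfun_tens2 _ a1 m%:R a2 m%:R) => //;
    by [exact: smooth1_bump|move=> x; exact: bump_outc].
- by move=> phi; exact: testfun2_L2.
- by move=> phi psi; exact: testfunD.
- by move=> c phi; exact: testfunZ.
Unshelve. all: by end_near. Qed.

Lemma slab_cover (x : R) : - b < x -> x < 0 ->
  \forall m \near \oo, - b + m.+1%:R^-1 < x < - m.+1%:R^-1.
Proof.
move=> h1 h2; have e0 : 0 < Num.min (x + b) (- x).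
  by rewrite lt_min; apply/andP; split; lra.
near=> m; have : m.+1%:R^-1 < Num.min (x + b) (- x).
  by near: m; exact: (cvgr_lt _ (@cvg_harmonic R)).
set e : R := _^-1; rewrite lt_min => /andP[h3 h4].
by apply/andP; split; lra.
Unshelve. all: by end_near. Qed.

Lemma exhaustion_slab : exhaustion mu3 (Omega b) (test3 b) K3.
Proof.
have mO := measurable_Omega.
have tens_test (a1 c1 a2 c2 a3 c3 : R) n : - b < a1 -> c1 < 0 ->
    test3 b (tens3 (bump a1 c1 n) (bump a2 c2 n) (bump a3 c3 n)).
  move=> h1 h2; apply: (@testfun_tens3 _ a1 c1 a2 c2 a3 c3); try exact: smooth1_bump;
    try by move=> x; exact: bump_outc.
  move=> [x [y z]] [/=]; rewrite in_itv/= => /andP[h3 h4] _.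
  by rewrite /Omega/= (lt_le_trans h1 h3) (le_lt_trans h4 h2).
split.
- exact: mO.
- by move=> m; exact: measurable_box3.
- move=> m [x [y z]] [/=]; rewrite in_itv/= => /andP[h1 h2] _; rewrite /Omega/=.
  have m0 : 0 < m.+1%:R^-1 :> R by rewrite invr_gt0.
  by rewrite (lt_trans _ h1) ?(lt_trans h2)// ?oppr_lt0// ltrDl.
- move=> [x [y z]] /andP[/= h1 h2].
  near=> m; split; [|split]; rewrite /= in_itv/=.
  + by near: m; exact: slab_cover.
  + by rewrite -ltr_norml; near: m; exact: nbhs_infty_gtr.
  + by rewrite -ltr_norml; near: m; exact: nbhs_infty_gtr.
- by move=> m; exact: mu3_box_lty.
(* The margin [1/(m+1)] is halved: the test function vanishes within distance [r] of a face and
   rises from 0 to 1 over the next [r], with slope [n = 1/r]. *)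
- move=> m; pose r : R := m.+1%:R^-1 / 2; pose n := (2 * m.+1)%N.
  have r0 : 0 < r by rewrite divr_gt0.
  have rn : r^-1 <= n%:R by rewrite /r /n natrM invfM !invrK mulrC.
  have r1 : r <= 1 by rewrite -invf_ge1// /r invfM !invrK mulrC -natrM ler1n.
  pose f := bump (- m%:R - 1) (m%:R + 1 : R) n.
  exists (tens3 (bump (- b + r) (- r) n) f f).
    by apply: tens_test; lra.
  move=> [x [y z]] [/=]; rewrite !in_itv/= => /andP[h1 h2] [/=].
  move=> /andP[h3 h4] /andP[h5 h6].
  have rr : m.+1%:R^-1 = r + r by rewrite /r -splitr.
  rewrite rr in h1 h2.
  by rewrite /tens3 /f !(@bump_one _ _ r) ?mulr1//=; apply/andP; lra.
- move=> m P PM Pt; apply: mclass_space PM _ => a1 a2 a3 n h1 h2 h3 bf; apply: Pt => //.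
  have m0 : 0 < m.+1%:R^-1 :> R by rewrite invr_gt0.
  by apply: tens_test; [rewrite (lt_le_trans _ h1)// ltrDl|rewrite oppr_lt0].
- by move=> phi; exact: testfun3_L2.
- by move=> phi psi; exact: testfunD.
- by move=> c phi; exact: testfunZ.
Unshelve. all: by end_near. Qed.

End plane_and_slab.

Lemma sume_ge_term (R : realType) (I : finType) (F : I -> \bar R) j :
  (forall i, 0 <= F i)%E -> (F j <= \sum_i F i)%E.
Proof. by move=> F0; rewrite (bigD1 j)//= leeDl// sume_ge0. Qed.

(** * Weak derivatives and the norms built from them *)

Section weak_derivative_theory.
Context (R : realType) (d : measure_display) (T : measurableType d).
Variables (mu : {measure set T -> \bar R}) (U : set T) (n : nat).
Variables (test : set (T -> R)) (D : 'I_n -> (T -> R) -> (T -> R)).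
Variable Km : nat -> set T.
Hypothesis E : exhaustion mu U test Km.
Hypothesis testD : forall w phi, test phi -> test (foldr D phi w).
Implicit Types f g h phi : T -> R.

Local Notation locint := (locint mu U test).
Local Notation is_wderiv := (is_wderiv mu U test D).
Local Notation wderiv := (wderiv mu U test D).
Local Notation dnorm2 := (dnorm2 mu U test D).
Local Notation L2 := (L2 mu U).
Local Notation ip := (ip mu U).

Let mU : measurable U := exh_mU E.

Lemma locint_meas f : locint f -> measurable_fun U f. Proof. by case. Qed.

Lemma locint_itg f phi : locint f -> test phi ->
  mu.-integrable U (EFin \o (fun x => f x * phi x)).
Proof. by case=> _ h /h. Qed.

Lemma locintD f g : locint f -> locint g -> locint (fun x => f x + g x).
Proof.
move=> lf lg; split; first by apply: measurable_funD; exact: locint_meas.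
move=> phi tphi; have := itgD mU (locint_itg lf tphi) (locint_itg lg tphi).
by apply: eq_integrable => // x _ /=; rewrite mulrDl.
Qed.

Lemma locintZ c f : locint f -> locint (fun x => c * f x).
Proof.
move=> lf; split; first by apply: measurable_funM => //; exact: locint_meas.
move=> phi tphi; have := itgZ mU c (locint_itg lf tphi).
by apply: eq_integrable => // x _ /=; rewrite mulrA.
Qed.

Lemma locint_ae f g : measurable_fun U g -> {ae mu, forall x, U x -> f x = g x} ->
  locint f -> locint g.
Proof.
move=> mg fg lf; split => // phi tphi.
apply: (ae_eq_itg mU _ _ (locint_itg lf tphi)).
  by apply: measurable_funM => //; exact: (test_meas E tphi).
by apply: filterS fg => x + Ux => /(_ Ux) ->.
Qed.

Lemma wderiv_unique w f g g' : is_wderiv w f g -> is_wderiv w f g' ->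
  {ae mu, forall x, U x -> g x = g' x}.
Proof.
move=> [_ lg hg] [_ lg' hg'].
have : {ae mu, forall x, U x -> g x + -1 * g' x = 0}.
  apply: (fundamental_lemma E); first by apply: locintD => //; exact: locintZ.
  move=> phi tphi; have i1 := locint_itg lg tphi; have i2 := locint_itg lg' tphi.
  under eq_Rintegral do rewrite mulN1r mulrBl.
  rewrite RintegralB//; apply/eqP; rewrite subr_eq0; apply/eqP.
  apply: (@mulfI _ ((-1) ^+ size w)); first by rewrite signr_eq0.
  by rewrite -hg// -hg'.
by apply: filterS => x + Ux => /(_ Ux); rewrite mulN1r => /subr0_eq.
Qed.

Lemma wderivP w f g : is_wderiv w f g -> is_wderiv w f (wderiv w f).
Proof. by move=> h; rewrite /wderiv /Defs.wderiv; exact: (xgetPex _ (ex_intro _ g h)). Qed.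

Lemma wderiv_ae w f g : is_wderiv w f g ->
  {ae mu, forall x, U x -> wderiv w f x = g x}.
Proof. by move=> h; apply: wderiv_unique (wderivP h) h. Qed.

Lemma is_wderiv_ae w f f' g g' : measurable_fun U f' -> measurable_fun U g' ->
  {ae mu, forall x, U x -> f x = f' x} -> {ae mu, forall x, U x -> g x = g' x} ->
  is_wderiv w f g -> is_wderiv w f' g'.
Proof.
move=> mf' mg' ff' gg' [lf lg h]; split.
- exact: locint_ae lf.
- exact: locint_ae lg.
- move=> phi tphi; have tw := testD w tphi.
  rewrite -(@ae_eq_Rint _ _ _ mu U mU (fun x => f x * foldr D phi w x)); first last.
  + by apply: filterS ff' => x + Ux => /(_ Ux) ->.
  + by apply: measurable_funM => //; exact: (test_meas E tw).
  + by apply: measurable_funM; [exact: locint_meas|exact: (test_meas E tw)].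
  rewrite h//; congr (_ * _); apply: ae_eq_Rint => //.
  + by apply: measurable_funM; [exact: locint_meas|exact: (test_meas E tphi)].
  + by apply: measurable_funM => //; exact: (test_meas E tphi).
  + by apply: filterS gg' => x + Ux => /(_ Ux) ->.
Qed.

Lemma is_wderivD w f g f' g' : is_wderiv w f f' -> is_wderiv w g g' ->
  is_wderiv w (fun x => f x + g x) (fun x => f' x + g' x).
Proof.
move=> [lf lf' hf] [lg lg' hg]; split; [exact: locintD|exact: locintD|].
move=> phi tphi; have tw := testD w tphi.
under eq_Rintegral do rewrite mulrDl.
under [in RHS]eq_Rintegral do rewrite mulrDl.
rewrite !RintegralD//; try exact: locint_itg.
by rewrite hf// hg// mulrDr.
Qed.

Lemma is_wderivZ w c f f' : is_wderiv w f f' ->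
  is_wderiv w (fun x => c * f x) (fun x => c * f' x).
Proof.
move=> [lf lf' hf]; split; [exact: locintZ|exact: locintZ|].
move=> phi tphi; have tw := testD w tphi.
under eq_Rintegral do rewrite -mulrA.
under [in RHS]eq_Rintegral do rewrite -mulrA.
rewrite !RintegralZl//; try exact: locint_itg.
by rewrite hf// mulrCA.
Qed.

Lemma is_wderivB w f g f' g' : is_wderiv w f f' -> is_wderiv w g g' ->
  is_wderiv w (fun x => f x - g x) (fun x => f' x - g' x).
Proof.
move=> hf /(is_wderivZ (-1)) hg; have := is_wderivD hf hg.
by congr is_wderiv; apply/funext => x; rewrite mulN1r.
Qed.

Lemma is_wderiv_nil f : locint f -> is_wderiv [::] f f.
Proof. by move=> lf; split => // phi tphi; rewrite expr0 mul1r. Qed.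

Lemma is_wderiv_nil_ae f g : is_wderiv [::] f g -> {ae mu, forall x, U x -> f x = g x}.
Proof. by move=> h; have [lf _ _] := h; apply: wderiv_unique (is_wderiv_nil lf) h. Qed.

Lemma dnorm2_ge0 w f : (0 <= dnorm2 w f)%E.
Proof.
rewrite /dnorm2 /Defs.dnorm2; case: ifPn => // _.
by apply: integral_ge0 => x _; rewrite lee_fin sqr_ge0.
Qed.

Lemma dnorm2_lty w f : (dnorm2 w f < +oo)%E ->
  is_wderiv w f (wderiv w f) /\ L2 (wderiv w f).
Proof.
rewrite /dnorm2 /Defs.dnorm2; case: ifPn => [/asboolP[g hg] h|//].
have hw := wderivP hg; split => //; split => //.
by case: hw => _ /locint_meas.
Qed.

Lemma dnorm2E w f g : is_wderiv w f g ->
  dnorm2 w f = (\int[mu]_(x in U) ((g x) ^+ 2)%:E)%E.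
Proof.
move=> h; rewrite /dnorm2 /Defs.dnorm2 ifT; last by apply/asboolP; exists g.
have hw := wderivP h.
apply: ge0_ae_eq_integral => //.
- by apply/measurable_EFinP; apply: measurable_funX; case: hw => _ /locint_meas.
- by apply/measurable_EFinP; apply: measurable_funX; case: h => _ /locint_meas.
- by move=> x _; rewrite lee_fin sqr_ge0.
- by move=> x _; rewrite lee_fin sqr_ge0.
- by apply: filterS (wderiv_ae h) => x + Ux => /(_ Ux) /= ->.
Qed.

Lemma dnorm2_L2 w f g : is_wderiv w f g -> L2 g -> dnorm2 w f = (ip g g)%:E.
Proof. by move=> h Lg; rewrite (dnorm2E h) ip_EFin. Qed.

Lemma dnorm2_nil f : (dnorm2 [::] f < +oo)%E -> L2 f.
Proof.
move=> h; have [hw Lw] := dnorm2_lty h.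
have mf : measurable_fun U f by case: hw => /locint_meas.
apply: (L2_ae mU mf _ Lw).
by apply: filterS (is_wderiv_nil_ae hw) => x + Ux => /(_ Ux) ->.
Qed.

Lemma dnorm2_nilE f : L2 f -> dnorm2 [::] f = (ip f f)%:E.
Proof. by move=> Lf; apply: dnorm2_L2 => //; apply: is_wderiv_nil; exact: (L2_locint E). Qed.

Lemma sob2_ge s k (w : k.-tuple 'I_n) f : (k < s.+1)%N ->
  (dnorm2 w f <= sob2 mu U test D s f)%E.
Proof.
move=> ks; rewrite /sob2.
have F0 (i : 'I_s.+1) : (0 <= \sum_(w : i.-tuple 'I_n) dnorm2 w f)%E.
  by apply: sume_ge0 => ? _; exact: dnorm2_ge0.
apply: le_trans (sume_ge_term (Ordinal ks) F0) => /=.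
by apply: (sume_ge_term w) => ?; exact: dnorm2_ge0.
Qed.

(** Only the summand with the empty horizontal word is kept. *)
Lemma tan2_ge (h : 'I_2 -> 'I_n) s N k (w : k.-tuple 'I_n) f : (k < s.+1)%N ->
  (dnorm2 w f <= tan2 mu U test D h s N f)%E.
Proof.
move=> ks; rewrite /tan2.
have F3 (i : nat) (u : i.-tuple 'I_2) (l : nat) :
    (0 <= \sum_(w : l.-tuple 'I_n) dnorm2 (w ++ map h u) f)%E.
  by apply: sume_ge0 => ? _; exact: dnorm2_ge0.
have F2 (i : nat) (u : i.-tuple 'I_2) :
    (0 <= \sum_(k < s.+1) \sum_(w : k.-tuple 'I_n) dnorm2 (w ++ map h u) f)%E.
  by apply: sume_ge0 => ? _; exact: F3.
have F1 (i : 'I_N.+1) : (0 <= \sum_(u : i.-tuple 'I_2)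
    \sum_(k < s.+1) \sum_(w : k.-tuple 'I_n) dnorm2 (w ++ map h u) f)%E.
  by apply: sume_ge0 => ? _; exact: F2.
apply: le_trans (sume_ge_term ord0 F1) => /=.
apply: le_trans (sume_ge_term [tuple] (F2 0%N)) => /=.
apply: le_trans (sume_ge_term (Ordinal ks) (F3 0%N [tuple])) => /=.
have := sume_ge_term w (F := fun w : k.-tuple 'I_n => dnorm2 (w ++ [::]) f).
by rewrite cats0; apply => ?; exact: dnorm2_ge0.
Qed.

End weak_derivative_theory.

(** * Fubini, and integrals of derivatives of test functions *)

Section fubini_real.
Context (R : realType) (d1 d2 : measure_display).
Context (T1 : measurableType d1) (T2 : measurableType d2).
Variables (m1 : {sigma_finite_measure set T1 -> \bar R}).
Variables (m2 : {sigma_finite_measure set T2 -> \bar R}).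
Variable f : T1 * T2 -> R.
Hypothesis fi : (m1 \x m2)%E.-integrable setT (EFin \o f).

Lemma Rint_prod12 : (forall x, m2.-integrable setT (EFin \o (fun y => f (x, y)))) ->
  m1.-integrable setT (EFin \o (fun x => \int[m2]_y f (x, y))) /\
  \int[(m1 \x m2)%E]_z f z = \int[m1]_x \int[m2]_y f (x, y).
Proof.
move=> h; have e : fubini_F m2 (EFin \o f) = EFin \o (fun x => \int[m2]_y f (x, y)).
  by apply/funext => x; rewrite /fubini_F /= -itgE.
split; first by rewrite -e; exact: integrable_fubini_F.
by rewrite /Rintegral -(integral12_prod_meas1 fi) e.
Qed.

Lemma Rint_prod21 : (forall y, m1.-integrable setT (EFin \o (fun x => f (x, y)))) ->
  \int[(m1 \x m2)%E]_z f z = \int[m2]_y \int[m1]_x f (x, y).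
Proof.
move=> h; have e : fubini_G m1 (EFin \o f) = EFin \o (fun y => \int[m1]_x f (x, y)).
  by apply/funext => y; rewrite /fubini_G /= -itgE.
by rewrite /Rintegral -(integral21_prod_meas1 fi) e.
Qed.

End fubini_real.

Lemma Rint0 (R : realType) (d : measure_display) (T : measurableType d)
    (mu : {measure set T -> \bar R}) (D : set T) : \int[mu]_(x in D) (0 : R) = 0.
Proof. by rewrite /Rintegral integral0. Qed.

Section calculus.
Variable R : realType.
Local Notation mu1 := (@lebesgue_measure R).
Local Notation plane := (R * R)%type.
Local Notation space := (R * (R * R))%type.

Lemma is_derive_continuous (f f' : R -> R) :
  (forall x, is_derive x (1 : R) f (f' x)) -> continuous f.
Proof.
move=> h x; apply/differentiable_continuous/derivable1_diffP.
by have [] := h x.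
Qed.

Lemma continuous_itv_integrable (f : R -> R) a b : continuous f ->
  mu1.-integrable `[a, b] (EFin \o f).
Proof.
move=> cf; apply: continuous_compact_integrable; first exact: segment_compact.
exact: continuous_subspaceT.
Qed.

Lemma FTC (F f : R -> R) a b : (forall x, is_derive x (1 : R) F (f x)) ->
  continuous f -> a <= b -> \int[mu1]_(x in `[a, b]) f x = F b - F a.
Proof.
move=> h cf; rewrite le_eqVlt => /predU1P[<-|ab].
  by rewrite set_itv1 Rintegral_set1 subrr.
rewrite /Rintegral (@continuous_FTC2 _ f F a b)//.
- exact: continuous_subspaceT.
- split => [x _| |].
  + by have [] := h x.
  + by apply: cvg_at_right_filter; exact: is_derive_continuous h a.
  + by apply: cvg_at_left_filter; exact: is_derive_continuous h b.
- by move=> x _; rewrite derive1E; apply: derive_val.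
Qed.

Lemma Rint_supported (d : measure_display) (T : measurableType d)
    (mu : {measure set T -> \bar R}) (f : T -> R) (A : set T) :
  (forall x, ~ A x -> f x = 0) -> \int[mu]_x f x = \int[mu]_(x in A) f x.
Proof.
move=> f0; rewrite [RHS]Rintegral_mkcond; apply: eq_Rintegral => x _.
by rewrite patchE; case: ifPn => // /negP xA; rewrite f0// => /mem_set.
Qed.

Lemma integral_derive_compact (F f : R -> R) (M : R) :
  (forall x, is_derive x (1 : R) F (f x)) -> continuous f ->
  (forall x, ~ (- M < x < M) -> F x = 0) -> (forall x, ~ (- M < x < M) -> f x = 0) ->
  \int[mu1]_x f x = 0.
Proof.
move=> h cf F0 f0; have [M0|M0] := leP 0 M; last first.
  under eq_Rintegral => x _.
    rewrite f0; first over.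
    by move=> /andP[h1 h2]; have := lt_trans h1 h2; lra.
  by rewrite /Rintegral integral0.
rewrite (@Rint_supported _ _ mu1 f `[- M, M]).
  rewrite (FTC h cf) ?ge0_cp// !F0 ?subrr//.
    by rewrite ltxx.
  by rewrite ltxx andbF.
move=> x /= nx; apply: f0 => /andP[h1 h2]; apply: nx.
by rewrite in_itv/= !ltW.
Qed.

(** Turns a directional derivative into the derivative of a function of one real variable along the
    line [g], the form needed for the fundamental theorem after Fubini. *)
Lemma section_is_derive (E : normedModType R) (f : E -> R) (v p : E) (g : R -> E) x :
  (forall h, g (h + x) = h *: v + p) -> g x = p -> derivable f p v ->
  is_derive x (1 : R) (f \o g) ('D_v f p).
Proof.
move=> gE gx df; apply: is_derive_cvg => /=; rewrite gx.
rewrite (_ : (fun h => _) = (fun h => h^-1 *: ((f \o shift p) (h *: v) - f p))); first exact: df.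
by apply/funext => h /=; rewrite gE.
Qed.

Lemma bounded_on_itg (d : measure_display) (T : measurableType d)
    (mu : {measure set T -> \bar R}) (K : set T) (f : T -> R) :
  measurable K -> (mu K < +oo)%E -> bounded_on K f -> mu.-integrable setT (EFin \o f).
Proof.
move=> mK fK bf.
have L1 : L2 mu setT f by exact: bounded_on_sqint bf.
have L2 : L2 mu setT \1_K.
  by apply: (@bounded_on_sqint _ _ _ mu setT K) => //; rewrite -[X in \1_X]setTI; exact: bounded_on_indic.
have := L2_itgM measurableT L1 L2; apply: eq_integrable => // x _ /=.
have [_ [M fM]] := bf; have := fM x; rewrite indicE.
by case: (x \in K); rewrite ?mulr1 ?mulr0 ?normr_le0// => /eqP ->.
Qed.

Lemma itv_lty (a c : R) : (mu1 `]a, c[ < +oo)%E.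
Proof. by rewrite ltey_eq lebesgue_itv_fin. Qed.

Lemma testfun2_itg (U : set plane) (phi : mplane R -> R) :
  testfun (@dir2 R) U phi -> mu2.-integrable setT (EFin \o phi).
Proof.
move=> /testfun2_bounded_on[m]; apply: bounded_on_itg; first exact: measurable_box2.
exact: mu2_box_lty.
Qed.

Lemma testfun3_itg (U : set space) (phi : mspace R -> R) :
  testfun (@dir3 R) U phi -> mu3.-integrable setT (EFin \o phi).
Proof.
move=> /testfun3_bounded_on[m]; apply: bounded_on_itg; first exact: measurable_box3.
exact: mu3_box_lty.
Qed.

Lemma box2P (M x y : R) : box2 (- M) M (- M) M (x, y) <-> - M < x < M /\ - M < y < M.
Proof. by rewrite /box2 /=; split => -[/=]; rewrite !in_itv. Qed.

Lemma box2_bounded_on (M : R) (psi : mplane R -> R) : continuous (psi : plane -> R) ->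
  (exists B, forall x, `|psi x| <= B) ->
  (forall x, ~ box2 (- M) M (- M) M x -> psi x = 0) ->
  bounded_on (box2 (- M) M (- M) M) psi.
Proof.
move=> cpsi [B hB] psi0; split; first exact: measurable_cont2.
exists `|B| => x; rewrite indicE; have [h|h] := pselect (box2 (- M) M (- M) M x).
  by rewrite mem_set// mulr1 (le_trans (hB x))// ler_norm.
by rewrite psi0// normr0 mulr_ge0.
Qed.

Lemma itv_bounded_on (M : R) (psi : R -> R) : continuous psi ->
  (exists B, forall x, `|psi x| <= B) -> (forall x, ~ (- M < x < M) -> psi x = 0) ->
  mu1.-integrable setT (EFin \o psi).
Proof.
move=> cpsi [B hB] psi0.
apply: (@bounded_on_itg _ _ mu1 _ _ (measurable_itv `]- M, M[) (itv_lty _ _)).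
split; first exact: continuous_measurable_fun.
exists `|B| => x; rewrite indicE; have [h|h] := pselect (- M < x < M).
  by rewrite mem_set ?mulr1/= ?in_itv//= (le_trans (hB x))// ler_norm.
by rewrite psi0// normr0 mulr_ge0.
Qed.

Section divergence_plane.
Variables (M : R) (phi psi : mplane R -> R).
Hypothesis cpsi : continuous (psi : plane -> R).
Hypothesis bpsi : exists B, forall x, `|psi x| <= B.
Hypothesis phi0 : forall x, ~ box2 (- M) M (- M) M x -> phi x = 0.
Hypothesis psi0 : forall x, ~ box2 (- M) M (- M) M x -> psi x = 0.

Let ipsi : mu2.-integrable setT (EFin \o psi).
Proof.
exact: (bounded_on_itg (measurable_box2 _ _ _ _) (mu2_box_lty _ _ _ _) (box2_bounded_on cpsi bpsi psi0)).
Qed.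

Let c1 (y : R) : continuous (fun x : R => psi (x, y)).
Proof.
move=> x; apply: (@continuous_comp _ _ _ (fun t : R => (t, y)) psi); last exact: cpsi.
exact: pairl_continuous.
Qed.

Let c2 (x : R) : continuous (fun y : R => psi (x, y)).
Proof.
move=> y; apply: (@continuous_comp _ _ _ (fun t : R => (x, t)) psi); last exact: cpsi.
exact: pairr_continuous.
Qed.

Lemma Rint_derive_fst :
  (forall x y : R, is_derive x (1 : R) (fun t => phi (t, y)) (psi (x, y))) ->
  \int[mu2]_y psi y = 0.
Proof.
move=> h; have i1 y : mu1.-integrable setT (EFin \o (fun x => psi (x, y))).
  apply: (@itv_bounded_on M) => //; first by have [B hB] := bpsi; exists B.
  by move=> x nx; apply: psi0 => /box2P[].
rewrite /mu2 (Rint_prod21 ipsi i1); apply: etrans (Rint0 mu1 setT).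
apply: eq_Rintegral => y _.
apply: (@integral_derive_compact (fun x => phi (x, y)) _ M) => //.
  by move=> x nx; apply: phi0 => /box2P[].
by move=> x nx; apply: psi0 => /box2P[].
Qed.

Lemma Rint_derive_snd :
  (forall x y : R, is_derive y (1 : R) (fun t => phi (x, t)) (psi (x, y))) ->
  \int[mu2]_y psi y = 0.
Proof.
move=> h; have i1 x : mu1.-integrable setT (EFin \o (fun y => psi (x, y))).
  apply: (@itv_bounded_on M) => //; first by have [B hB] := bpsi; exists B.
  by move=> y ny; apply: psi0 => /box2P[].
rewrite /mu2 (Rint_prod12 ipsi i1).2; apply: etrans (Rint0 mu1 setT).
apply: eq_Rintegral => x _.
apply: (@integral_derive_compact (fun y => phi (x, y)) _ M) => //.
  by move=> y ny; apply: phi0 => /box2P[].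
by move=> y ny; apply: psi0 => /box2P[].
Qed.

End divergence_plane.

Lemma testfun2_support (U : set plane) (phi : mplane R -> R) : testfun (@dir2 R) U phi ->
  exists m : nat, forall M : R, m%:R <= M -> forall x, ~ box2 (- M) M (- M) M x -> phi x = 0.
Proof.
move=> /testfun2_bounded_on[m [_ [B hB]]]; exists m => M mM x nx.
apply/eqP; rewrite -normr_le0 (le_trans (hB x))// indicE memNset ?mulr0//.
case: x nx => x y nx /box2P[]; rewrite -!ltr_norml => h1 h2; apply: nx.
by apply/box2P; rewrite -!ltr_norml; split; exact: lt_le_trans mM.
Qed.

Lemma testfun3_support (U : set space) (phi : mspace R -> R) : testfun (@dir3 R) U phi ->
  exists m : nat, forall M : R, m%:R <= M -> forall x y,
    ~ (- M < x < M /\ box2 (- M) M (- M) M y) -> phi (x, y) = 0.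
Proof.
move=> /testfun3_bounded_on[m [_ [B hB]]]; exists m => M mM x y nx.
apply/eqP; rewrite -normr_le0 (le_trans (hB _))// indicE memNset ?mulr0//.
case: y nx => y z nx [/=]; rewrite in_itv/= => h1 /box2P[h2 h3]; apply: nx.
move: h1 h2 h3; rewrite -!ltr_norml => h1 h2 h3; split; first exact: lt_le_trans mM.
by apply/box2P; rewrite -!ltr_norml; split; exact: lt_le_trans mM.
Qed.

Let addz (h k : R) : k = h * 0 + k. Proof. by rewrite mulr0 add0r. Qed.
Let addo (h k : R) : h + k = h * 1 + k. Proof. by rewrite mulr1. Qed.

Lemma Rint_pd2 (U : set plane) phi j : testfun (@dir2 R) U phi ->
  \int[mu2]_y pd (@dir2 R) j phi y = 0.
Proof.
move=> tphi; have tpsi := testfun_pd j tphi.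
have [m1 h1] := testfun2_support tphi; have [m2 h2] := testfun2_support tpsi.
pose M : R := (maxn m1 m2)%:R.
have {}h1 := h1 M; have {}h2 := h2 M.
rewrite ler_nat leq_maxl in h1; rewrite ler_nat leq_maxr in h2.
have [sphi _] := tphi; have [spsi _] := tpsi.
have dphi p : derivable phi p (dir2 R j) by apply: diff_derivable; exact: smooth_diff.
have bpsi : exists B, forall x, `|pd (@dir2 R) j phi x| <= B.
  by have [B _ hB] := testfun_bounded tpsi; exists B.
have cpsi := smooth_cont spsi.
have [j0|j1] := eqVneq (val j) 0%N.
  apply: (@Rint_derive_fst M phi _ cpsi bpsi (h1 isT) (h2 isT)) => x y.
  apply: (@section_is_derive _ phi (dir2 R j) (x, y) (fun t => (t, y))) => // h.
  by rewrite /dir2 j0/=; congr pair; [exact: addo|exact: addz].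
have {}j1 : val j = 1%N by case: j j1 {tpsi h2 spsi dphi bpsi cpsi} => -[|[|]].
apply: (@Rint_derive_snd M phi _ cpsi bpsi (h1 isT) (h2 isT)) => x y.
apply: (@section_is_derive _ phi (dir2 R j) (x, y) (fun t => (x, t))) => // h.
by rewrite /dir2 j1/=; congr pair; [exact: addz|exact: addo].
Qed.

Lemma Rint_pd3 (U : set space) phi j : testfun (@dir3 R) U phi ->
  \int[mu3]_y pd (@dir3 R) j phi y = 0.
Proof.
move=> tphi; have tpsi := testfun_pd j tphi; pose psi : mspace R -> R := pd (@dir3 R) j phi.
have [m1 h1] := testfun3_support tphi; have [m2 h2] := testfun3_support tpsi.
pose M : R := (maxn m1 m2)%:R.
have {}h1 := h1 M; have {}h2 := h2 M.
rewrite ler_nat leq_maxl in h1; rewrite ler_nat leq_maxr in h2.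
have {}h1 := h1 isT; have {}h2 := h2 isT.
have [sphi _] := tphi; have [spsi _] := tpsi.
have dphi p : derivable phi p (dir3 R j) by apply: diff_derivable; exact: smooth_diff.
have bpsi : exists B, forall x, `|psi x| <= B.
  by have [B _ hB] := testfun_bounded tpsi; exists B.
have cpsi : continuous (psi : space -> R) := smooth_cont spsi.
have ipsi : mu3.-integrable setT (EFin \o psi) by exact: testfun3_itg tpsi.
have c1 (y : plane) : continuous (fun x : R => psi (x, y)).
  move=> x; apply: (@continuous_comp _ _ _ (fun t : R => (t, y)) psi); last exact: cpsi.
  exact: pairl_continuous.
have c2 (x : R) : continuous (fun y : plane => psi (x, y)).
  move=> y; apply: (@continuous_comp _ _ _ (fun t : plane => (x, t)) psi); last exact: cpsi.
  exact: pairr_continuous.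
have [j0|j0] := eqVneq (val j) 0%N.
  have i1 y : mu1.-integrable setT (EFin \o (fun x => psi (x, y))).
    apply: (@itv_bounded_on M) => //; first by have [B hB] := bpsi; exists B.
    by move=> x nx; apply: h2 => -[].
  rewrite /mu3 (Rint_prod21 ipsi i1); apply: etrans (Rint0 mu2 setT).
  apply: eq_Rintegral => y _.
  apply: (@integral_derive_compact (fun x => phi (x, y)) _ M) => //.
  - move=> x; apply: (@section_is_derive _ phi (dir3 R j) (x, y) (fun t => (t, y))) => // h.
    case: y => y z; rewrite /dir3 j0/=; congr pair; first exact: addo.
    by congr pair; exact: addz.
  - by move=> x nx; apply: h1 => -[].
  - by move=> x nx; apply: h2 => -[].
have i2 x : mu2.-integrable setT (EFin \o (fun y => psi (x, y))).
  apply: (bounded_on_itg (measurable_box2 (- M) M (- M) M) (mu2_box_lty _ _ _ _)).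
  apply: box2_bounded_on; [exact: c2|by have [B hB] := bpsi; exists B|].
  by move=> y ny; apply: h2 => -[].
rewrite /mu3 (Rint_prod12 ipsi i2).2; apply: etrans (Rint0 mu1 setT).
apply: eq_Rintegral => x _.
have h1' y : ~ box2 (- M) M (- M) M y -> phi (x, y) = 0 by move=> ny; apply: h1 => -[].
have h2' y : ~ box2 (- M) M (- M) M y -> psi (x, y) = 0 by move=> ny; apply: h2 => -[].
have b' : exists B, forall y, `|psi (x, y)| <= B by have [B hB] := bpsi; exists B.
have [j1|j1] := eqVneq (val j) 1%N.
  apply: (@Rint_derive_fst M (fun y => phi (x, y)) _ (c2 x) b' h1' h2') => y z.
  apply: (@section_is_derive _ phi (dir3 R j) (x, (y, z)) (fun t => (x, (t, z)))) => // h.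
  rewrite /dir3 j1/=; congr pair; first exact: addz.
  by congr pair; [exact: addo|exact: addz].
have {}j1 : val j = 2%N.
  by case: j j0 j1 {tpsi h2 h2' spsi dphi bpsi cpsi psi ipsi c1 c2 i2 b'} => -[|[|[|]]].
apply: (@Rint_derive_snd M (fun y => phi (x, y)) _ (c2 x) b' h1' h2') => y z.
apply: (@section_is_derive _ phi (dir3 R j) (x, (y, z)) (fun t => (x, (y, t)))) => // h.
rewrite /dir3 j1/=; congr pair; first exact: addz.
by congr pair; [exact: addz|exact: addo].
Qed.

End calculus.

(** * Classical derivatives as weak derivatives *)

Section classical_derivatives.
Context (R : realType) (d : measure_display) (T : measurableType d).
Variables (mu : {measure set T -> \bar R}) (U : set T) (n : nat).
Variables (test smoothT : set (T -> R)) (D : 'I_n -> (T -> R) -> (T -> R)).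
Hypothesis mU : measurable U.
Hypothesis smooth_meas : forall f, smoothT f -> measurable_fun U f.
Hypothesis smooth_D : forall j f, smoothT f -> smoothT (D j f).
Hypothesis test_D : forall j f, test f -> test (D j f).
Hypothesis test_mul : forall f phi, smoothT f -> test phi -> test (fun x => f x * phi x).
Hypothesis leibniz : forall j f phi, smoothT f -> test phi ->
  D j (fun x => f x * phi x) = (fun x => f x * D j phi x + D j f x * phi x).
Hypothesis test_itg : forall phi, test phi -> mu.-integrable U (EFin \o phi).
Hypothesis int_D : forall j phi, test phi -> \int[mu]_(x in U) D j phi x = 0.

(** Integration by parts removes the outermost derivative of the test function first, that is, the
    head of [w]; the word is therefore reversed on the side of [f]. *)
Lemma classical_wderiv w f : smoothT f ->
  is_wderiv mu U test D w f (foldr D f (rev w)).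
Proof.
have li g : smoothT g -> locint mu U test g.
  by move=> sg; split; [exact: smooth_meas|move=> phi tphi; exact: test_itg (test_mul sg tphi)].
have sfold v g : smoothT g -> smoothT (foldr D g v).
  by move=> sg; elim: v => //= j v; exact: smooth_D.
have tfold v phi : test phi -> test (foldr D phi v).
  by move=> tphi; elim: v => //= j v; exact: test_D.
move=> sf; split; [exact: li|exact/li/sfold|].
move=> phi tphi; elim: w f sf => [|j w IH] f sf /=; first by rewrite expr0 mul1r.
have tw : test (foldr D phi w) by exact: tfold.
have := int_D j (test_mul sf tw); rewrite leibniz//.
rewrite RintegralD//; last 2 first.
- exact: test_itg (test_mul sf (test_D j tw)).
- exact: test_itg (test_mul (smooth_D j sf) tw).
move/eqP; rewrite addr_eq0 => /eqP ->.
by rewrite (IH _ (smooth_D j sf)) rev_cons foldr_rcons exprS mulN1r mulNr.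
Qed.

End classical_derivatives.

Section smooth_products.
Context (R : realType) (E : normedModType R) (n : nat) (e : 'I_n -> E).
Implicit Types f g : E -> R.

(** Bounding the order turns the Leibniz rule into an induction: order [k + 1] for a product reduces
    to order [k] for a sum of two products. *)
Definition smooth_upto k f :=
  forall w, (size w <= k)%N -> forall x, differentiable (foldr (pd e) f w) x.

Lemma smooth_uptoS k f : smooth_upto k.+1 f <->
  (forall x, differentiable f x) /\ forall j, smooth_upto k (pd e j f).
Proof.
split=> [sf|[df sf] w].
  by split=> [|j w wk x]; [exact: (sf [::])|rewrite -foldr_rcons; apply: sf; rewrite size_rcons].
by elim/last_ind: w => [_|w j _]; rewrite ?size_rcons ?foldr_rcons//; exact: sf.
Qed.

Lemma smooth_uptoW k f : smooth_upto k.+1 f -> smooth_upto k f.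
Proof. by move=> sf w wk; apply: sf; exact: leqW. Qed.

Lemma pd_add f g j : (forall x, differentiable f x) -> (forall x, differentiable g x) ->
  pd e j (fun x => f x + g x) = (fun x => pd e j f x + pd e j g x).
Proof. by move=> df dg; apply/funext => x; apply: deriveD; exact: diff_derivable. Qed.

Lemma pd_mul f g j : (forall x, differentiable f x) -> (forall x, differentiable g x) ->
  pd e j (fun x => f x * g x) = (fun x => f x * pd e j g x + pd e j f x * g x).
Proof.
move=> df dg; apply/funext => x; rewrite [X in _ + X]mulrC.
by apply: deriveM; exact: diff_derivable.
Qed.

Lemma smooth_uptoD k f g : smooth_upto k f -> smooth_upto k g ->
  smooth_upto k (fun x => f x + g x).
Proof.
elim: k f g => [|k IH] f g.
  move=> sf sg [] // _ x; apply: differentiableD; [exact: (sf [::])|exact: (sg [::])].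
move=> /smooth_uptoS[df sf] /smooth_uptoS[dg sg]; apply/smooth_uptoS; split=> [x|j].
  exact: differentiableD.
by rewrite pd_add//; exact: IH.
Qed.

Lemma smooth_uptoM k f g : smooth_upto k f -> smooth_upto k g ->
  smooth_upto k (fun x => f x * g x).
Proof.
elim: k f g => [|k IH] f g.
  move=> sf sg [] // _ x; apply: differentiableM; [exact: (sf [::])|exact: (sg [::])].
move=> Sf Sg; have /smooth_uptoS[df sf] := Sf; have /smooth_uptoS[dg sg] := Sg.
apply/smooth_uptoS; split=> [x|j]; first exact: differentiableM.
rewrite pd_mul//; apply: smooth_uptoD; apply: IH => //; exact: smooth_uptoW.
Qed.

Lemma smoothM f g : smooth e f -> smooth e g -> smooth e (fun x => f x * g x).
Proof.
move=> sf sg w; apply: (@smooth_uptoM (size w)) (leqnn _) => v _; [exact: sf|exact: sg].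
Qed.

Lemma testfunMl U f phi : smooth e f -> testfun e U phi ->
  testfun e U (fun x => f x * phi x).
Proof.
move=> sf [sphi [K [cK KU p0]]]; split; first exact: smoothM.
by exists K; split => // x /p0 ->; rewrite mulr0.
Qed.

End smooth_products.

Section smooth_weak_derivatives.
Variables (R : realType) (b : R).
Local Notation mu1 := (@lebesgue_measure R).
Local Notation plane := (R * R)%type.
Local Notation space := (R * (R * R))%type.

Lemma smooth_wderiv3 (f : mspace R -> R) w : smooth (@dir3 R) f ->
  is_wderiv mu3 (Omega b) (test3 b) (pd (@dir3 R)) w f (foldr (pd (@dir3 R)) f (rev w)).
Proof.
have mO := measurable_Omega b.
apply: (@classical_wderiv _ _ _ mu3 (Omega b) 3 (test3 b) (smooth (@dir3 R))) => //.
- by move=> g sg; apply: measurable_funTS; apply: measurable_cont3; exact: smooth_cont.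
- by move=> j g; exact: smooth_pd.
- by move=> j g; exact: testfun_pd.
- by move=> g phi; exact: testfunMl.
- by move=> j g phi sg [sphi _]; apply: pd_mul => x; exact: smooth_diff.
- move=> phi tphi; apply: (integrableS measurableT) => //; exact: testfun3_itg tphi.
- move=> j phi tphi; rewrite -(Rint_pd3 j tphi); apply/esym; apply: Rint_supported => x nx.
  have [_ [K [cK KU p0]]] := testfun_pd j tphi.
  by apply: p0 => /KU.
Qed.

Lemma smooth_wderiv2 (f : mplane R -> R) w : smooth (@dir2 R) f ->
  is_wderiv mu2 setT (@test2 R) (pd (@dir2 R)) w f (foldr (pd (@dir2 R)) f (rev w)).
Proof.
apply: (@classical_wderiv _ _ _ mu2 setT 2 (@test2 R) (smooth (@dir2 R))) => //.
- by move=> g sg; apply: measurable_cont2; exact: smooth_cont.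
- by move=> j g; exact: smooth_pd.
- by move=> j g; exact: testfun_pd.
- by move=> g phi; exact: testfunMl.
- by move=> j g phi sg [sphi _]; apply: pd_mul => x; exact: smooth_diff.
- by move=> phi tphi; exact: testfun2_itg tphi.
- by move=> j phi tphi; exact: (Rint_pd2 j tphi).
Qed.

Lemma L2_tens2 (g h : R -> R) : L2 mu1 setT g -> L2 mu1 setT h ->
  L2 mu2 setT (tens2 g h : mplane R -> R).
Proof.
move=> [mg gi] [mh hi]; split.
  by apply: measurable_funM; exact: measurableT_comp.
rewrite /mu2 fubini_tonelli1//=; last first.
- by move=> x; rewrite lee_fin sqr_ge0.
- apply/measurable_EFinP; apply: measurable_funX.
  by apply: measurable_funM; exact: measurableT_comp.
rewrite /fubini_F /tens2 /=.
under eq_integral => x _.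
  under eq_integral => y _ do rewrite exprMn EFinM.
  rewrite ge0_integralZl//; first over.
  - by apply/measurable_EFinP; apply: measurable_funX.
  - by move=> y _; rewrite lee_fin sqr_ge0.
  - by rewrite lee_fin sqr_ge0.
rewrite ge0_integralZr//; first last.
- by apply: integral_ge0 => y _; rewrite lee_fin sqr_ge0.
- by move=> y _; rewrite lee_fin sqr_ge0.
- by apply/measurable_EFinP; apply: measurable_funX.
rewrite ltey_eq fin_numM// ge0_fin_numE//; apply: integral_ge0 => y _;
  by rewrite lee_fin sqr_ge0.
Qed.

Lemma integral_lift (F : mplane R -> \bar R) : 0 < b -> measurable_fun setT F ->
  (forall y, 0 <= F y)%E ->
  (\int[mu3]_(x in Omega b) F x.2 = b%:E * \int[mu2]_y F y)%E.
Proof.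
move=> b0 mF F0.
have mO := measurable_Omega b.
rewrite integral_mkcond /mu3 fubini_tonelli1//=; last first.
- by move=> x; rewrite patchE; case: ifP.
- apply/(measurable_restrictT _ mO); apply: measurable_funTS.
  by apply: measurableT_comp => //; exact: measurable_snd.
rewrite /fubini_F /=.
transitivity (\int[mu1]_x (\int[mu2]_y F y * (\1_`]- b, 0[%classic x)%:E))%E.
  apply: eq_integral => x _; have [xO|xO] := boolP (x \in `]- b, 0[%classic).
    rewrite indicE xO mule1; apply: eq_integral => y _.
    by rewrite patchE mem_set//; move: xO; rewrite inE /= in_itv.
  rewrite indicE (negbTE xO) mule0 integral0_eq// => y _.
  rewrite patchE memNset// => h; move/negP: xO; apply.
  by rewrite inE /= in_itv.
rewrite ge0_integralZl//; last 2 first.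
- by apply/measurable_EFinP; apply: measurable_indic; exact: measurable_itv.
- by apply: integral_ge0 => y _.
rewrite integral_indic//.
have hb : mu1 `]- b, 0[%classic = b%:E.
  by rewrite lebesgue_measure_itv/= lte_fin ltrNl oppr0 b0 -EFinB; congr EFin; ring.
by rewrite setIT muleC; congr (_ * _)%E; exact: hb.
Qed.

Lemma L2_lift (G : mplane R -> R) : 0 < b -> L2 mu2 setT G ->
  L2 mu3 (Omega b) (fun x : mspace R => G x.2).
Proof.
move=> b0 [mG Gi]; split.
  by apply: measurable_funTS; apply: measurableT_comp => //; exact: measurable_snd.
rewrite (@integral_lift (fun y => ((G y) ^+ 2)%:E))//.
- by rewrite lte_mul_pinfty// lee_fin ltW.
- by apply/measurable_EFinP; apply: measurable_funX.
- by move=> y; rewrite lee_fin sqr_ge0.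
Qed.

(** Tonelli gives the case of equal arguments; applied to [F], [G] and [F + G], it gives the general
    one by polarization. *)
Lemma ip_lift (F G : mplane R -> R) : 0 < b -> L2 mu2 setT F -> L2 mu2 setT G ->
  ip mu3 (Omega b) (fun x => F x.2) (fun x => G x.2) = b * ip mu2 setT F G.
Proof.
move=> b0 LF LG.
have sq H : L2 mu2 setT H -> ip mu3 (Omega b) (fun x => H x.2) (fun x => H x.2) = b * ip mu2 setT H H.
  move=> LH; apply: EFin_inj; rewrite EFinM -!ip_EFin//; last first.
  - exact: L2_lift.
  - exact: measurable_Omega.
  rewrite (@integral_lift (fun y => ((H y) ^+ 2)%:E))//.
  - by apply/measurable_EFinP; apply: measurable_funX; case: LH.
  - by move=> y; rewrite lee_fin sqr_ge0.
have mO := measurable_Omega b; have mT := @measurableT _ (mplane R).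
have lF := L2_lift b0 LF; have lG := L2_lift b0 LG.
have := sq _ (L2D mT LF LG).
rewrite !(ipDl mO) ?(ipDl mT)//; try exact: L2D; try exact: (L2_lift b0 (L2D mT LF LG)).
rewrite !(ipDr mO) ?(ipDr mT)// !sq//.
rewrite (ipC _ _ (fun x => G x.2)) (ipC _ _ G F) => h.
lra.
Qed.

End smooth_weak_derivatives.

(** * Limits of square-integrable functions *)

Lemma cvge0_lt1 (R : realType) (T : Type) (F : set_system T) (u : T -> \bar R) :
  u @ F --> 0%E -> \forall t \near F, (u t < 1)%E.
Proof.
move=> h; apply: (h [set y : \bar R | (y < 1)%E]).
by apply: open_ereal_lt'; rewrite lte_fin.
Qed.

Lemma cvg_sumr (R : realType) (T : Type) (F : set_system T) (FF : Filter F) (I : Type)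
    (r : seq I) (f : I -> T -> R) (l : I -> R) :
  (forall i, f i t @[t --> F] --> l i) ->
  \sum_(i <- r) f i t @[t --> F] --> \sum_(i <- r) l i.
Proof.
move=> h; elim: r => [|i r IH].
  by rewrite big_nil; under eq_fun do rewrite big_nil; exact: cvg_cst.
by rewrite big_cons; under eq_fun do rewrite big_cons; exact: cvgD.
Qed.

Section square_integrable_limits.
Context (R : realType) (d : measure_display) (T : measurableType d).
Variables (mu : {measure set T -> \bar R}) (D : set T).
Hypothesis mD : measurable D.

Lemma sq_cvg_nrm (f_ : nat -> T -> R) : (forall m, L2 mu D (f_ m)) ->
  (\int[mu]_(x in D) ((f_ m x) ^+ 2)%:E)%E @[m --> \oo] --> 0%E ->
  nrm mu D (f_ m) @[m --> \oo] --> 0.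
Proof.
move=> Lf h0.
have {}h0 : (ip mu D (f_ m) (f_ m))%:E @[m --> \oo] --> 0%E.
  by move: h0; under eq_fun do rewrite ip_EFin//.
have h : ip mu D (f_ m) (f_ m) @[m --> \oo] --> (0 : R) by exact: fine_cvg h0.
by rewrite -[X in _ --> X](sqrtr0 R); apply: continuous_cvg h; exact: sqrt_continuous.
Qed.

Lemma nrm_cvg_sq (f_ : nat -> T -> R) : (forall m, L2 mu D (f_ m)) ->
  nrm mu D (f_ m) @[m --> \oo] --> 0 ->
  (\int[mu]_(x in D) ((f_ m x) ^+ 2)%:E)%E @[m --> \oo] --> 0%E.
Proof.
move=> Lf h; under eq_fun do rewrite ip_EFin// -nrm2 expr2.
apply: cvg_EFin; first exact: nearW.
by rewrite -[X in _ --> X](mulr0 0); apply: cvgM.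
Qed.

Lemma L2_cvg_closed (F : nat -> T -> R) (f : T -> R) : (forall m, L2 mu D (F m)) ->
  measurable_fun D f ->
  (\int[mu]_(x in D) ((F m x - f x) ^+ 2)%:E)%E @[m --> \oo] --> 0%E ->
  L2 mu D f /\ nrm mu D (fun x => F m x - f x) @[m --> \oo] --> 0.
Proof.
move=> LF mf h; have Lf : L2 mu D f.
  have [m _ /(_ m (leqnn m))/= hm] : \forall m \near \oo,
      ((\int[mu]_(x in D) ((F m x - f x) ^+ 2)%:E) < 1)%E.
    exact: cvge0_lt1 h.
  have Ld : L2 mu D (fun x => F m x - f x).
    split; first by apply: measurable_funB => //; exact: L2_meas.
    by apply: lt_trans hm _; rewrite ltry.
  have := L2B mD (LF m) Ld; congr L2; apply/funext => x; ring.
by split => //; apply: sq_cvg_nrm h => m; exact: L2B.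
Qed.

Lemma cvg_ip2 (f_ g_ : nat -> T -> R) f g : (forall n, L2 mu D (f_ n)) ->
  (forall n, L2 mu D (g_ n)) -> L2 mu D f -> L2 mu D g ->
  nrm mu D (fun x => f_ n x - f x) @[n --> \oo] --> 0 ->
  nrm mu D (fun x => g_ n x - g x) @[n --> \oo] --> 0 ->
  ip mu D (f_ n) (g_ n) @[n --> \oo] --> ip mu D f g.
Proof.
move=> Lf_ Lg_ Lf Lg cf cg.
have cn := cvg_nrm mD Lf_ Lf cf.
have c0 : nrm mu D (f_ n) * nrm mu D (fun x => g_ n x - g x) @[n --> \oo] --> 0.
  by rewrite -(mulr0 (nrm mu D f)); apply: cvgM.
have c1 : ip mu D (f_ n) (fun x => g_ n x - g x) @[n --> \oo] --> 0.
  apply: norm_cvg0; apply: (squeeze_cvgr _ (cvg_cst 0) c0); apply: nearW => n.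
  by rewrite normr_ge0/=; apply: (cauchy_schwarz mD) => //; exact: (L2B mD).
rewrite -[ip mu D f g]addr0.
rewrite (_ : (fun n => _) = fun n => ip mu D (f_ n) g + ip mu D (f_ n) (fun x => g_ n x - g x)).
  by apply: cvgD c1; exact: (cvg_ip mD).
by apply/funext => n; rewrite (ipBr mD)//; ring.
Qed.

Lemma ipDD f g f' g' : L2 mu D f -> L2 mu D g -> L2 mu D f' -> L2 mu D g' ->
  ip mu D (fun x => f x + g x) (fun x => f' x + g' x) =
  (ip mu D f f' + ip mu D g g') + (ip mu D f g' + ip mu D g f').
Proof.
move=> Lf Lg Lf' Lg'; rewrite (ipDl mD) //; last exact: (L2D mD).
by rewrite !(ipDr mD)//; ring.
Qed.

End square_integrable_limits.

Lemma cvg_eq_lim (R : realType) (u v : nat -> R) (l l' : R) : (forall m, u m = v m) ->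
  u m @[m --> \oo] --> l -> v m @[m --> \oo] --> l' -> l = l'.
Proof.
move=> uv ul vl; have {}uv : u = v by apply/funext.
by rewrite uv in ul; exact: (cvg_unique _ ul vl).
Qed.

Fact polarization_arith (R : realType) (b A1 A2 A3 A3' B1 B2 B3 B3' C1 C2 C3 C4 A B C : R) :
  b * A1 = B1 + 2 * C1 -> b * A2 = B2 + 2 * C2 -> b * A = B + 2 * C ->
  A = (A1 + A2) + (A3 + A3') -> B = (B1 + B2) + (B3 + B3') ->
  C = (C1 + C2) + (C3 + C4) -> B3' = B3 -> A3' = A3 -> b * A3 = B3 + (C3 + C4).
Proof. by move=> h1 h2 h + + + e e'; rewrite e e' => e1 e2 e3; rewrite e1 e2 e3 in h; lra. Qed.

(** * Traces on the faces of the slab *)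

Section traces.
Variables (R : realType) (b : R).
Hypothesis b0 : 0 < b.
Local Notation mu1 := (@lebesgue_measure R).
Local Notation plane := (R * R)%type.
Local Notation space := (R * (R * R))%type.
Local Notation L2s := (L2 mu3 (Omega b)).
Local Notation L2p := (L2 mu2 setT).
Local Notation ips := (ip mu3 (Omega b)).
Local Notation ipp := (ip mu2 setT).
Local Notation nrms := (nrm mu3 (Omega b)).
Local Notation nrmp := (nrm mu2 setT).
Local Notation d1 := (pd (@dir3 R) ord0).
Local Notation isw := (is_wderiv mu3 (Omega b) (test3 b) (pd (@dir3 R))).

Let mO : measurable (Omega b : set (mspace R)) := measurable_Omega b.
Let mT : measurable (setT : set (mplane R)) := measurableT.

(* Multiplication by the distance to the face {x_1 = - b - a} opposite to
   {x_1 = a}, up to sign. *)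
Definition wgt (a : R) (f : mspace R -> R) (x : mspace R) : R := (x.1 + b + a) * f x.

Lemma wgt_L2 a f : a = 0 \/ a = - b -> L2s f -> L2s (wgt a f).
Proof.
move=> ha Lf; apply: (@L2_le _ _ _ _ _ mO _ (fun x => b * f x)); last exact: L2Z.
  apply: measurable_funM; last exact: L2_meas Lf.
  apply: measurable_funTS; apply: measurable_funD => //.
  by apply: measurable_funD => //; exact: measurable_fst.
move=> [x y] /andP[/= h1 h2]; rewrite /wgt !normrM ler_wpM2r//= (gtr0_norm b0).
have {}h1 : - b < (x : R) := h1; have {}h2 : (x : R) < 0 := h2.
by rewrite ler_norml; apply/andP; case: ha => ->; split; lra.
Qed.

Lemma wgt_le a f : a = 0 \/ a = - b -> L2s f -> nrms (wgt a f) <= b * nrms f.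
Proof.
move=> ha Lf; have <- : nrms (fun x => b * f x) = b * nrms f.
  by rewrite (nrmZ mO)// gtr0_norm.
apply: (nrm_le mO); [exact: wgt_L2|exact: L2Z|].
apply: aeW => -[x y] /andP[/= h1 h2]; rewrite /wgt !normrM ler_wpM2r//= (gtr0_norm b0).
have {}h1 : - b < (x : R) := h1; have {}h2 : (x : R) < 0 := h2.
by rewrite ler_norml; apply/andP; case: ha => ->; split; lra.
Qed.

Lemma section_L2 (U : set space) phi (a : R) : testfun (@dir3 R) U phi ->
  L2p (fun y => phi (a, y)).
Proof.
move=> tphi; have [m hm] := testfun3_support tphi; have [sphi _] := tphi.
have [B B0 hB] := testfun_bounded tphi.
apply: (@bounded_on_sqint _ _ _ mu2 setT (box2 (- m%:R) m%:R (- m%:R) m%:R)) => //.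
- exact: measurable_box2.
- exact: mu2_box_lty.
- apply: box2_bounded_on => [y||y ny]; last by apply: (hm m%:R) => // -[].
    apply: (@continuous_comp _ _ _ (fun t : plane => (a, t)) phi); last exact: smooth_cont.
    exact: pairr_continuous.
  by exists B => y.
Qed.

(** On each vertical line the derivative of [(x_1 + b + a) phi^2] is integrated over [[-b, 0]]. The
    weight vanishes on the opposite face, and for both values of [a] the boundary term is [b] times
    the square of [phi] on [x_1 = a]. *)
Lemma slab_identity (U : set space) phi a : a = 0 \/ a = - b ->
  testfun (@dir3 R) U phi ->
  b * ipp (fun y => phi (a, y)) (fun y => phi (a, y)) =
  ips phi phi + 2 * ips (wgt a phi) (d1 phi).
Proof.
move=> ha tphi; have td := testfun_pd ord0 tphi.
have [sphi _] := tphi; have [sd _] := td.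
have Lphi : L2s phi by exact: testfun3_L2 tphi.
have Ld : L2s (d1 phi) by exact: testfun3_L2 td.
have Lw : L2s (wgt a phi) by exact: wgt_L2.
pose H (x : mspace R) : R := phi x * phi x + 2 * (wgt a phi x * d1 phi x).
have iH : mu3.-integrable (Omega b) (EFin \o H).
  by apply: itgD => //; [exact: L2_itgM|apply: itgZ => //; exact: L2_itgM].
have cphi (y : plane) : continuous (fun x : R => phi (x, y)).
  move=> x; apply: (@continuous_comp _ _ _ (fun t : R => (t, y)) phi); last exact: smooth_cont.
  exact: pairl_continuous.
have cd (y : plane) : continuous (fun x : R => d1 phi (x, y)).
  move=> x; apply: (@continuous_comp _ _ _ (fun t : R => (t, y)) (d1 phi)); last exact: smooth_cont.
  exact: pairl_continuous.
have cw : continuous (fun x : R => x + b + a).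
  by move=> x; apply: cvgD; [apply: cvgD; [exact: cvg_id|exact: cvg_cst]|exact: cvg_cst].
have cH (y : plane) : continuous (fun x : R => H (x, y)).
  move=> x; apply: cvgD; first by apply: cvgM; exact: cphi.
  apply: cvgMl_tmp; apply: cvgM; last exact: cd.
  by apply: cvgM; [exact: cw|exact: cphi].
transitivity (\int[mu3]_(x in Omega b) H x); last first.
  rewrite /ip -RintegralZl//; last exact: L2_itgM.
  by rewrite -RintegralD//; [exact: L2_itgM|apply: itgZ => //; exact: L2_itgM].
have HO x (y : plane) : (H \_ (Omega b)) (x, y) = ((fun x => H (x, y)) \_ `]- b, 0[%classic) x.
  rewrite !patchE; have -> // : ((x, y) \in Omega b) = (x \in `]- b, 0[%classic).
  by apply/idP/idP => /set_mem h; apply/mem_set; move: h; rewrite /Omega/= in_itv.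
have iH2 (y : plane) : mu1.-integrable setT (EFin \o (fun x => (H \_ (Omega b)) (x, y))).
  rewrite (_ : EFin \o _ = (EFin \o (fun x => H (x, y))) \_ `]- b, 0[%classic); last first.
    apply/funext => x; rewrite /= HO !patchE.
    by case: ifP.
  have [+ _] := @integrable_mkcond _ _ _ mu1 `]- b, 0[%classic (EFin \o (fun x => H (x, y))) (measurable_itv _).
  apply.
  apply: (@integrableS _ _ _ mu1 `[- b, 0]%classic); [exact: measurable_itv|exact: measurable_itv| |].
    by apply: subset_itv_oo_cc.
  exact: continuous_itv_integrable.
have iH3 : mu3.-integrable setT (EFin \o (H \_ (Omega b))).
  rewrite (_ : EFin \o _ = (EFin \o H) \_ (Omega b)); last first.
    by apply/funext => x; rewrite /= !patchE; case: ifP.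
  exact: (proj1 (integrable_mkcond _ mO)).
have Ls := section_L2 a tphi.
rewrite Rintegral_mkcond /mu3 (Rint_prod21 iH3 iH2) /ip -RintegralZl//; last exact: L2_itgM.
apply: eq_Rintegral => y _.
transitivity (\int[mu1]_(x in `]- b, 0[) H (x, y)); last first.
  by rewrite [LHS]Rintegral_mkcond; apply: eq_Rintegral => x _; rewrite HO.
have i1 (i : interval R) : [set` i] `<=` `[- b, 0]%classic -> measurable [set` i] ->
    mu1.-integrable [set` i] (EFin \o (fun x => H (x, y))).
  move=> hi mi; apply: (@integrableS _ _ _ mu1 `[- b, 0]%classic) => //.
  exact: continuous_itv_integrable.
rewrite Rintegral_itv_bndo_bndc; last by apply: i1; [exact: subset_itv_oo_cc|exact: measurable_itv].
rewrite Rintegral_itv_obnd_cbnd; last first.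
  by apply: i1; [exact: subset_itv_oc_cc|exact: measurable_itv].
have dF (x : R) : is_derive x (1 : R) (fun x => (x + b + a) * (phi (x, y) * phi (x, y))) (H (x, y)).
  have dx : is_derive x (1 : R) (fun x => phi (x, y)) (d1 phi (x, y)).
    apply: (@section_is_derive _ _ phi (dir3 R ord0) (x, y) (fun t => (t, y))) => //.
      move=> h; case: y {cphi cd cH HO iH2 i1} => y z; rewrite /dir3/=.
      have zz (k : R) : k = h * 0 + k by rewrite mulr0 add0r.
      have oo (k : R) : h + k = h * 1 + k by rewrite mulr1.
      by congr pair; [exact: oo|congr pair; exact: zz].
    by apply: diff_derivable; exact: smooth_diff.
  have dw : is_derive x (1 : R) (fun x => x + b + a) 1.
    apply: (is_derive_eq (is_deriveD (is_deriveD (is_derive_id x (1 : R)) (is_derive_cst b x 1)) (is_derive_cst a x 1))).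
    by rewrite !addr0.
  apply: (is_derive_eq (is_deriveM dw (is_deriveM dx dx))).
  pose P : R := phi (x, y); pose Q : R := d1 phi (x, y).
  change ((x + b + a) * (P * Q + P * Q) + (P * P) * 1 = P * P + 2 * (((x + b + a) * P) * Q)).
  ring.
have b0' : - b <= 0 by rewrite oppr_le0 ltW.
rewrite (FTC dF (cH y) b0').
by case: ha => ->; ring.
Qed.

Let E3 := exhaustion_slab b.
Let tD3 : forall w phi, test3 b phi -> test3 b (foldr (pd (@dir3 R)) phi w).
Proof. by move=> w phi; exact: testfun_foldr. Qed.

Local Notation dn := (dnorm2 mu3 (Omega b) (test3 b) (pd (@dir3 R))).

(** A single approximant at finite distance shows that [f] has the weak derivative, being the
    difference of two functions that have it. *)
Lemma smooth_approx_wderiv w (phi : nat -> space -> R) f :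
  (forall m, testfun (@dir3 R) setT (phi m)) ->
  dn w (phi m \- f) @[m --> \oo] --> 0%E ->
  [/\ isw w f (wd3 b w f), L2s (wd3 b w f) &
      nrms (fun x => foldr (pd (@dir3 R)) (phi m) (rev w) x - wd3 b w f x)
        @[m --> \oo] --> 0].
Proof.
move=> tphi h; pose D m := foldr (pd (@dir3 R)) (phi m) (rev w).
have isD m : isw w (phi m) (D m) by apply: smooth_wderiv3; have [] := tphi m.
have LD m : L2s (D m) by apply: testfun3_L2 => //; exact: testfun_foldr (tphi m).
have [m _ /(_ m (leqnn m))/= hm] : \forall m \near \oo, (dn w (phi m \- f)%R < 1)%E.
  exact: cvge0_lt1 h.
have [isG LG] := dnorm2_lty (lt_trans hm (ltry 1)).
have isf : isw w f (fun x => D m x - wd3 b w (phi m \- f) x).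
  have := is_wderivB E3 tD3 (isD m) isG; congr (isw w _ _); apply/funext => x /=; ring.
have isf' := wderivP isf.
have Lf' : L2s (wd3 b w f).
  apply: (L2_ae mO _ _ (L2B mO (LD m) LG)).
    by case: isf' => _ /locint_meas.
  by apply: filterS (wderiv_ae E3 isf) => x h' Ox; exact: esym (h' Ox).
split => //; apply: (sq_cvg_nrm mO) => [k|]; first exact: (L2B mO (LD k) Lf').
move: h; under eq_fun => k do rewrite (dnorm2E E3 (is_wderivB E3 tD3 (isD k) isf')).
exact.
Qed.

(** Real L^2 norms, one derivative at a time, replace the extended norm in the definition of a
    trace; in this form inner products pass to the limit. *)
Record trace_approx a f g (phi : nat -> space -> R) : Prop := TraceApprox {
  tra_test : forall m, testfun (@dir3 R) setT (phi m);
  tra_L2 : L2s f;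
  tra_is : forall j, isw [:: j] f (wd3 b [:: j] f);
  tra_L2d : forall j, L2s (wd3 b [:: j] f);
  tra_cvg : nrms (fun x => phi m x - f x) @[m --> \oo] --> 0;
  tra_cvgd : forall j, nrms (fun x => pd (@dir3 R) j (phi m) x - wd3 b [:: j] f x)
    @[m --> \oo] --> 0;
  tra_L2g : L2p g;
  tra_cvgg : nrmp (fun y => phi m (a, y) - g y) @[m --> \oo] --> 0 }.

Lemma is_traceP a f g : is_trace b a f g <-> exists phi, trace_approx a f g phi.
Proof.
split=> [[mg [phi [tphi h hg]]]|[phi [tphi Lf isf Lf' c cd Lg cg]]].
  have hw k (w : k.-tuple 'I_3) : (k < 2)%N -> dn w (phi m \- f) @[m --> \oo] --> 0%E.
    move=> k2; apply: (squeeze_cvge _ (cvg_cst 0%E) h); apply: nearW => m.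
    by rewrite dnorm2_ge0/=; apply: sob2_ge.
  have [is0 L0 c0] := smooth_approx_wderiv tphi (hw 0%N [tuple] isT).
  have mf : measurable_fun (Omega b) f by case: is0 => /locint_meas.
  have ef := is_wderiv_nil_ae E3 is0.
  have Lf : L2s f.
    apply: (L2_ae mO mf _ L0).
    by apply: filterS ef => x + Ox => /(_ Ox) ->.
  have [Lg cg] := L2_cvg_closed mT (fun m => section_L2 a (tphi m)) mg hg.
  have hj j := smooth_approx_wderiv tphi (hw 1%N [tuple j] isT).
  exists phi; apply: (TraceApprox tphi Lf _ _ _ _ Lg cg).
  - by move=> j; have [+ _ _] := hj j; exact.
  - by move=> j; have [_ + _] := hj j; exact.
  - move: c0 => /=; apply: cvg_trans; apply: near_eq_cvg; apply: nearW => m.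
    apply: (nrm_ae mO).
    + apply: measurable_funB; last exact: L2_meas L0.
      by apply: L2_meas (testfun3_L2 mO (tphi m)).
    + apply: measurable_funB => //.
      by apply: L2_meas (testfun3_L2 mO (tphi m)).
    + by apply: filterS ef => x + Ox => /(_ Ox) ->.
  - by move=> j; have [_ _ +] := hj j; exact.
split; first exact: L2_meas Lg.
exists phi; split => //; last first.
  by apply: nrm_cvg_sq cg => // m; apply: L2B => //; exact: section_L2 (tphi m).
pose D m (w : seq 'I_3) : mspace R -> R := foldr (pd (@dir3 R)) (phi m) (rev w).
pose fw (w : seq 'I_3) := if w is [::] then f else wd3 b w f.
have LD m w : L2s (D m w) by apply: testfun3_L2 => //; exact: testfun_foldr (tphi m).
have key k (w : k.-tuple 'I_3) : (k < 2)%N ->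
    [/\ isw w f (fw w), L2s (fw w) & nrms (fun x => D m w x - fw w x) @[m --> \oo] --> 0].
  case: k w => [|[|//]] w _.
    rewrite tuple0; split; [|exact: Lf|exact: c].
    by apply: is_wderiv_nil; exact: (L2_locint E3).
  case/tupleP: w => j w; rewrite tuple0.
  by split; [exact: isf|exact: Lf'|exact: cd].
pose r k m := \sum_(w : k.-tuple 'I_3) nrms (fun x => D m w x - fw w x) ^+ 2.
have rE m : Hs2 b 1 (phi m \- f) = (\sum_(k < 2) r k m)%:E.
  rewrite /Hs2 /sob2 -sumEFin; apply: eq_bigr => k _.
  rewrite /r -sumEFin; apply: eq_bigr => w _; have [isw' Lw _] := key k w (ltn_ord k).
  rewrite (@dnorm2_L2 _ _ _ _ _ _ _ _ _ E3 _ _ (fun x => D m w x - fw w x)) ?nrm2//.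
    apply: (is_wderivB E3 tD3 _ isw').
    by apply: smooth_wderiv3; have [] := tphi m.
  exact: L2B.
under eq_fun do rewrite rE.
apply: cvg_EFin; first exact: nearW.
rewrite [X in _ --> X](_ : _ = \sum_(k < 2) \sum_(w : k.-tuple 'I_3) (0 : R)); last first.
  by rewrite big1// => k _; rewrite big1.
apply: cvg_sumr => k; apply: cvg_sumr => w.
have [_ _ h] := key k w (ltn_ord k).
by rewrite -[X in _ --> X](mulr0 0); apply: cvgM.
Qed.

Lemma pdD3 j (f g : space -> R) x : smooth (@dir3 R) f -> smooth (@dir3 R) g ->
  pd (@dir3 R) j (fun x => f x + g x) x = pd (@dir3 R) j f x + pd (@dir3 R) j g x.
Proof. by move=> sf sg; have /(congr1 (@^~ x)) := foldr_pdD [:: j] sf sg. Qed.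

(** Polarization of [slab_identity], applied to [phi], [psi] and their sum. *)
Lemma slab_bilinear_test (U V : set space) phi psi a : a = 0 \/ a = - b ->
  testfun (@dir3 R) U phi -> testfun (@dir3 R) V psi ->
  b * ipp (fun y => phi (a, y)) (fun y => psi (a, y)) =
  ips phi psi + (ips (wgt a phi) (d1 psi) + ips (wgt a psi) (d1 phi)).
Proof.
move=> ha tphi tpsi.
have Lphi : L2s phi by exact: (testfun3_L2 mO tphi).
have Lpsi : L2s psi by exact: (testfun3_L2 mO tpsi).
have Ldphi : L2s (d1 phi) by exact: (testfun3_L2 mO (testfun_pd ord0 tphi)).
have Ldpsi : L2s (d1 psi) by exact: (testfun3_L2 mO (testfun_pd ord0 tpsi)).
have Lsphi := section_L2 a tphi.
have Lspsi := section_L2 a tpsi.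
have h1 := slab_identity ha tphi.
have h2 := slab_identity ha tpsi.
have tT (W : set space) f : testfun (@dir3 R) W f -> testfun (@dir3 R) setT f.
  by exact: testfunS.
have h3 := slab_identity ha (testfunD (tT _ _ tphi) (tT _ _ tpsi)).
have Ew : wgt a (fun x => phi x + psi x) = fun x => wgt a phi x + wgt a psi x.
  by apply/funext => x; rewrite /wgt mulrDr.
have Ed : d1 (fun x => phi x + psi x) = fun x => d1 phi x + d1 psi x.
  by apply/funext => x; apply: pdD3; [have [] := tphi|have [] := tpsi].
have Lwphi := wgt_L2 ha Lphi; have Lwpsi := wgt_L2 ha Lpsi.
have e1 := ipDD mT Lsphi Lspsi Lsphi Lspsi.
have e2 := ipDD mO Lphi Lpsi Lphi Lpsi.
have e3 := ipDD mO Lwphi Lwpsi Ldphi Ldpsi.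
have e4 := ipC mu3 (Omega b) psi phi.
have e5 := ipC mu2 setT (fun y => psi (a, y)) (fun y => phi (a, y)).
rewrite Ew Ed in h3.
exact: (polarization_arith h1 h2 h3 e1 e2 e3 e4 e5).
Qed.

Lemma trace_bilinear f g phi f' g' psi a : a = 0 \/ a = - b ->
  trace_approx a f g phi -> trace_approx a f' g' psi ->
  b * ipp g g' = ips f f' + (ips (wgt a f) (wd3 b [:: ord0] f') +
                             ips (wgt a f') (wd3 b [:: ord0] f)).
Proof.
move=> ha [tphi Lf _ /(_ ord0) Ldf cf /(_ ord0) cdf Lg cg]
  [tpsi Lf' _ /(_ ord0) Ldf' cf' /(_ ord0) cdf' Lg' cg'].
have Lphi m : L2s (phi m) by exact: (testfun3_L2 mO (tphi m)).
have Lpsi m : L2s (psi m) by exact: (testfun3_L2 mO (tpsi m)).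
have Ldphi m : L2s (d1 (phi m)) by exact: (testfun3_L2 mO (testfun_pd ord0 (tphi m))).
have Ldpsi m : L2s (d1 (psi m)) by exact: (testfun3_L2 mO (testfun_pd ord0 (tpsi m))).
have Lsphi m := section_L2 a (tphi m).
have Lspsi m := section_L2 a (tpsi m).
have cw h (hm : nat -> space -> R) : L2s h -> (forall m, L2s (hm m)) ->
    nrms (fun x => hm m x - h x) @[m --> \oo] --> 0 ->
    nrms (fun x => wgt a (hm m) x - wgt a h x) @[m --> \oo] --> 0.
  move=> Lh Lhm ch.
  have cb : b * nrms (fun x => hm m x - h x) @[m --> \oo] --> 0.
    by rewrite -(mulr0 b); apply: cvgM => //; exact: cvg_cst.
  apply: (squeeze_cvgr _ (cvg_cst 0) cb); apply: nearW => m.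
  rewrite nrm_ge0/= (_ : (fun x => _ - _) = wgt a (fun x => hm m x - h x)).
    by apply: wgt_le => //; exact: (L2B mO).
  by apply/funext => x; rewrite /wgt mulrBr.
have cL : b * ipp (fun y => phi m (a, y)) (fun y => psi m (a, y)) @[m --> \oo] --> b * ipp g g'.
  by apply: cvgM; [exact: cvg_cst|exact: (cvg_ip2 mT Lsphi Lspsi Lg Lg' cg cg')].
have cR : ips (phi m) (psi m) + (ips (wgt a (phi m)) (d1 (psi m)) +
    ips (wgt a (psi m)) (d1 (phi m))) @[m --> \oo] -->
    ips f f' + (ips (wgt a f) (wd3 b [:: ord0] f') + ips (wgt a f') (wd3 b [:: ord0] f)).
  apply: cvgD; first exact: (cvg_ip2 mO Lphi Lpsi Lf Lf' cf cf').
  apply: cvgD.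
    exact: (cvg_ip2 mO (fun m => wgt_L2 ha (Lphi m)) Ldpsi (wgt_L2 ha Lf) Ldf' (cw _ _ Lf Lphi cf) cdf').
  exact: (cvg_ip2 mO (fun m => wgt_L2 ha (Lpsi m)) Ldphi (wgt_L2 ha Lf') Ldf (cw _ _ Lf' Lpsi cf') cdf).
have E m := slab_bilinear_test ha (tphi m) (tpsi m).
exact: (cvg_eq_lim E cL cR).
Qed.

(** The right-hand side of [trace_bilinear] does not involve the traces, so all inner products
    between [g] and [g'] coincide and [g - g'] has norm 0. *)
Lemma trace_unique f g phi g' psi a : a = 0 \/ a = - b ->
  trace_approx a f g phi -> trace_approx a f g' psi ->
  {ae mu2, forall y : mplane R, setT y -> g y = g' y}.
Proof.
move=> ha h h'; have Lg := tra_L2g h; have Lg' := tra_L2g h'.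
have e1 := trace_bilinear ha h h; have e2 := trace_bilinear ha h h'.
have e3 := trace_bilinear ha h' h'.
have d0 : nrmp (fun y => g y - g' y) = 0.
  apply/eqP; rewrite -sqrf_eq0; apply/eqP.
  rewrite nrm2 (ipBl mT Lg Lg' (L2B mT Lg Lg')) (ipBr mT Lg Lg' Lg) (ipBr mT Lg Lg' Lg') (ipC _ _ g' g).
  have : b * (ipp g g - ipp g g' - (ipp g g' - ipp g' g')) = 0.
    by rewrite !mulrBr e1 e2 e3; ring.
  by move/eqP; rewrite mulf_eq0 (gt_eqF b0)/= => /eqP.
have := nrm0_ae mT (L2B mT Lg Lg') d0.
by apply: filterS => y + Ty => /(_ Ty) /eqP; rewrite subr_eq0 => /eqP.
Qed.

(** The ringed norm contains no L^2 norm of the function itself; this recovers it from the trace on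
    Sigma_0 and the vertical derivative. *)
Lemma trace_poincare f g phi : trace_approx 0 f g phi ->
  nrms f ^+ 2 <= 2 * b * nrmp g ^+ 2 + 4 * b ^+ 2 * nrms (wd3 b [:: ord0] f) ^+ 2.
Proof.
move=> h; have Lf := tra_L2 h; have Ld := tra_L2d h ord0.
have a0 : (0 : R) = 0 \/ (0 : R) = - b by left.
have := trace_bilinear a0 h h; rewrite -!nrm2.
set I := ips _ _ => e.
have : `|I| <= b * nrms f * nrms (wd3 b [:: ord0] f).
  apply: le_trans (cauchy_schwarz mO (wgt_L2 a0 Lf) Ld) _.
  by rewrite ler_wpM2r ?nrm_ge0//; exact: wgt_le.
rewrite ler_norml => /andP[hI _].
rewrite -mulrA e; set w := nrms (wd3 _ _ _) in hI *; set z := nrms f in hI *.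
(* The cross term of the identity is absorbed by completing this square, at the price of doubling
   the trace term. *)
have : 0 <= (z - 2 * b * w) ^+ 2 by exact: sqr_ge0.
rewrite sqrrB; lra.
Qed.

End traces.

(** * Cutoffs of decaying functions *)

Section cutoffs.
Variable R : realType.
Local Notation mu1 := (@lebesgue_measure R).
Local Notation L21 := (L2 mu1 setT).
Implicit Types g h : R -> R.

(** Equal to 1 for [|x| <= m + 1], with a derivative of order [1/(m+1)]. *)
Definition cut (m : nat) (x : R) : R := bump (-2) 2 1 (m.+1%:R^-1 * x + 0).

Lemma smooth1_cut m : smooth1 (cut m).
Proof. by apply: smooth1_affine; exact: smooth1_bump. Qed.

Lemma cut_ge0 m x : 0 <= cut m x. Proof. exact: bump_ge0. Qed.

Lemma cut_le1 m x : cut m x <= 1. Proof. exact: bump_le1. Qed.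

Lemma cut_out m x : ~ (- (2 * m.+1%:R) <= x <= 2 * m.+1%:R) -> cut m x = 0.
Proof.
move=> h; apply: bump_outc => /andP[h1 h2]; apply: h; rewrite addr0 in h1 h2.
have k0 : 0 < m.+1%:R :> R by rewrite ltr0n.
move: h1 h2; rewrite mulrC ler_pdivrMr// ler_pdivlMr// => h1 h2.
by rewrite -mulNr h1 h2.
Qed.

Let bump_bound : exists2 B : R, 0 <= B & forall x, `|derive1 (bump (-2) 2 1) x| <= B.
Proof.
have s := @smooth1_bump R (-2) 2 1.
(* The boundedness of test functions is used through the tensor square of the bump, read off where
   the second factor equals 1. *)
have t : testfun (@dir2 R) setT (tens2 (bump (-2) 2 1) (bump (-2) 2 1)).
  by apply: (@testfun_tens2 _ (-2) 2 (-2) 2) => //; move=> x; exact: bump_outc.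
have [B B0 hB] := testfun_bounded (testfun_foldr [:: ord0] t).
exists B => // x; have := hB (x, 0); rewrite pd_tens2// /tens2 /= (_ : bump _ _ _ 0 = 1) ?mulr1//.
by apply: (@bump_one _ _ _ 1); rewrite ?ltr01 ?invr1//; lra.
Qed.

Lemma cut_derive m x :
  derive1 (cut m) x = m.+1%:R^-1 * derive1 (bump (-2) 2 1) (m.+1%:R^-1 * x + 0).
Proof.
have [d _] := smooth1_derive (@smooth1_bump R (-2) 2 1).
have dl : is_derive x (1 : R) (fun x => m.+1%:R^-1 * x + 0) (m.+1%:R^-1 : R).
  apply: (is_derive_eq (is_deriveD (is_deriveZ (m.+1%:R^-1 : R) (is_derive_id x (1 : R))) (is_derive_cst 0 x 1))).
  by rewrite addr0 /GRing.scale/= mulr1.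
have dd := @is_derive1_comp _ (bump (-2) 2 1) _ x _ _ (d _) dl.
rewrite derive1E; have -> : cut m = bump (-2) 2 1 \o (fun x => m.+1%:R^-1 * x + 0) by [].
by rewrite (@derive_val _ _ _ _ _ _ _ dd) mulrC.
Qed.

Lemma cut_derive_bound : exists2 B : R, 0 <= B & forall m x, `|derive1 (cut m) x| <= m.+1%:R^-1 * B.
Proof.
have [B B0 hB] := bump_bound; exists B => // m x.
by rewrite cut_derive normrM ger0_norm ?invr_ge0// ler_wpM2l ?invr_ge0.
Qed.

Lemma cut_cvg x : cut m x @[m --> \oo] --> (1 : R).
Proof.
apply: cvg_near_cst; near=> m; apply: (@bump_one _ _ _ 1); rewrite ?ltr01 ?invr1//.
have k0 : 0 < m.+1%:R :> R by rewrite ltr0n.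
have : `|m.+1%:R^-1 * x| <= 1.
  rewrite normrM ger0_norm ?invr_ge0// mulrC ler_pdivrMr// mul1r.
  apply: (@le_trans _ _ m%:R); last by rewrite ler_nat.
  by near: m; exact: nbhs_infty_ger.
by rewrite ler_norml addr0 => /andP[]; set z := _ * x => h1 h2; apply/andP; lra.
Unshelve. all: by end_near. Qed.

Lemma cut_derive_cvg x : derive1 (cut m) x @[m --> \oo] --> (0 : R).
Proof.
have [B B0 hB] := cut_derive_bound.
apply: norm_cvg0; apply: (squeeze_cvgr _ (cvg_cst 0) (_ : m.+1%:R^-1 * B @[m --> \oo] --> (0 : R))).
  by apply: nearW => m; rewrite normr_ge0 hB.
by rewrite -(mul0r B); apply: cvgMr_tmp; exact: cvg_harmonic.
Qed.

Definition cutM m g x := g x * cut m x.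

Lemma smooth1_cutM m g : smooth1 g -> smooth1 (cutM m g).
Proof. by move=> sg; apply: smooth1M => //; exact: smooth1_cut. Qed.

Lemma cutM_out m g x : ~ (- (2 * m.+1%:R) <= x <= 2 * m.+1%:R) -> cutM m g x = 0.
Proof. by move=> h; rewrite /cutM cut_out ?mulr0. Qed.

Lemma cutM_le m g x : `|cutM m g x| <= `|g x|.
Proof. by rewrite normrM (ger0_norm (cut_ge0 _ _)) ler_piMr// cut_le1. Qed.

Lemma cutM_cvg g x : cutM m g x @[m --> \oo] --> g x.
Proof. by rewrite -[X in _ --> X]mulr1; apply: cvgM; [exact: cvg_cst|exact: cut_cvg]. Qed.

Lemma cutM_derive m g x : smooth1 g ->
  derive1 (cutM m g) x = derive1 g x * cut m x + g x * derive1 (cut m) x.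
Proof.
move=> /smooth1_derive[dg _]; have [dc _] := smooth1_derive (smooth1_cut m).
rewrite derive1E (@derive_val _ _ _ _ _ _ _ (is_deriveM (dg x) (dc x))).
by rewrite /GRing.scale/=; ring.
Qed.

Lemma cutM_derive_cvg g x : smooth1 g -> derive1 (cutM m g) x @[m --> \oo] --> derive1 g x.
Proof.
move=> sg; under eq_fun do rewrite cutM_derive//.
have : derive1 g x * cut m x + g x * derive1 (cut m) x @[m --> \oo] -->
    derive1 g x * 1 + g x * 0.
  by apply: cvgD; apply: cvgM; [exact: cvg_cst|exact: cut_cvg|exact: cvg_cst|exact: cut_derive_cvg].
by rewrite mulr1 mulr0 addr0.
Qed.

Lemma cutM_derive_le : exists2 B : R, 0 <= B & forall g m x, smooth1 g ->
  `|derive1 (cutM m g) x| <= `|derive1 g x| + B * `|g x|.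
Proof.
have [B B0 hB] := cut_derive_bound; exists B => // g m x sg.
rewrite cutM_derive// (le_trans (ler_normD _ _))// lerD//.
  by rewrite normrM (ger0_norm (cut_ge0 _ _)) ler_piMr// cut_le1.
rewrite normrM mulrC ler_wpM2r// (le_trans (hB m x))// ler_piMl// invf_le1//.
by rewrite ler1n.
Qed.

(** Enough for [cutM m g] and its derivative to converge, dominated by a square-integrable function,
    to [g] and its derivative. *)
Definition decays g := [/\ smooth1 g, L21 g & L21 (derive1 g)].

Lemma L2_norm1 g : L21 g -> L21 (fun x => `|g x|).
Proof.
move=> Lg; apply: (L2_le measurableT _ _ Lg); last by move=> x _; rewrite normr_id.
by apply: measurableT_comp => //; exact: L2_meas Lg.
Qed.

Lemma cutM_derive_dominated g : decays g ->
  exists2 G, L21 G & forall m x, `|derive1 (cutM m g) x| <= G x.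
Proof.
move=> [sg Lg Lg']; have [B B0 hB] := cutM_derive_le.
exists (fun x => `|derive1 g x| + B * `|g x|); last by move=> m x; exact: hB.
by apply: (L2D measurableT); [exact: L2_norm1|apply: (L2Z measurableT); exact: L2_norm1].
Qed.

End cutoffs.

(** * Functions of the horizontal variables extended constantly in x_1 *)

Section horizontal_lifts.
Variables (R : realType) (b : R).
Hypothesis b0 : 0 < b.
Local Notation mu1 := (@lebesgue_measure R).
Local Notation space := (R * (R * R))%type.
Local Notation L21 := (L2 mu1 setT).
Local Notation L2s := (L2 mu3 (Omega b)).
Local Notation L2p := (L2 mu2 setT).
Local Notation ips := (ip mu3 (Omega b)).
Local Notation nrms := (nrm mu3 (Omega b)).
Local Notation nrmp := (nrm mu2 setT).
Local Notation isw := (is_wderiv mu3 (Omega b) (test3 b) (pd (@dir3 R))).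
Implicit Types f g h G H : R -> R.

Let mO : measurable (Omega b : set (mspace R)) := measurable_Omega b.
Let mT : measurable (setT : set (mplane R)) := measurableT.
Let E3 := exhaustion_slab b.

Lemma tens2_dct (g_ h_ : nat -> R -> R) g h G H :
  (forall m, smooth1 (g_ m)) -> (forall m, smooth1 (h_ m)) -> smooth1 g -> smooth1 h ->
  L21 G -> L21 H -> (forall m x, `|g_ m x| <= G x) -> (forall m x, `|h_ m x| <= H x) ->
  (forall x, g_ m x @[m --> \oo] --> g x) -> (forall x, h_ m x @[m --> \oo] --> h x) ->
  L2p (tens2 g h) /\ nrmp (fun y => tens2 (g_ m) (h_ m) y - tens2 g h y) @[m --> \oo] --> 0.
Proof.
move=> sg_ sh_ sg sh LG LH gG hH cg ch.
apply: (nrm_dct mT _ _ (L2_tens2 LG LH)).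
- by move=> m; apply: measurable_cont2; exact: smooth_cont (smooth_tens2 (sg_ m) (sh_ m)).
- by apply: measurable_cont2; exact: smooth_cont (smooth_tens2 sg sh).
- by apply: aeW => y _; apply: cvgM; [exact: cg|exact: ch].
- by apply: aeW => y _ m; rewrite /tens2 normrM ler_pM.
Qed.

Lemma tens3_dct (f_ g_ h_ : nat -> R -> R) f g h (C : R) G H :
  (forall m, smooth1 (f_ m)) ->
  (forall m, smooth1 (g_ m)) -> (forall m, smooth1 (h_ m)) ->
  smooth1 f -> smooth1 g -> smooth1 h ->
  L21 G -> L21 H -> (forall m x, - b < x < 0 -> `|f_ m x| <= C) ->
  (forall m x, `|g_ m x| <= G x) -> (forall m x, `|h_ m x| <= H x) ->
  (forall x, - b < x < 0 -> f_ m x @[m --> \oo] --> f x) ->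
  (forall x, g_ m x @[m --> \oo] --> g x) -> (forall x, h_ m x @[m --> \oo] --> h x) ->
  L2s (tens3 f g h) /\ nrms (fun y => tens3 (f_ m) (g_ m) (h_ m) y - tens3 f g h y) @[m --> \oo] --> 0.
Proof.
move=> sf_ sg_ sh_ sf sg sh LG LH fC gG hH cf cg ch.
have LL : L2s (fun x : mspace R => C * tens2 G H x.2).
  by apply: (L2Z mO); exact: (L2_lift b0 (L2_tens2 LG LH)).
apply: (nrm_dct mO _ _ LL).
- by move=> m; apply: measurable_funTS; apply: measurable_cont3; exact: smooth_cont (smooth_tens3 (sf_ m) (sg_ m) (sh_ m)).
- by apply: measurable_funTS; apply: measurable_cont3; exact: smooth_cont (smooth_tens3 sf sg sh).
- by apply: aeW => y Oy; apply: cvgM; [exact: cf|apply: cvgM; [exact: cg|exact: ch]].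
- by apply: aeW => y Oy m; rewrite /tens3 !normrM; apply: ler_pM => //;
    [exact: fC|exact: ler_pM].
Qed.

(** Test functions of the whole space approximate the constant extension: [k] equals [c] on a
    neighbourhood of the closed slab, and [cutM] truncates horizontally. *)
Lemma lift_trace c g h a : a = 0 \/ a = - b -> decays g -> decays h ->
  exists phi, trace_approx b a (tens3 (cst c) g h) (fun y => c * tens2 g h y) phi.
Proof.
move=> ha dg dh; have [sg Lg Lg'] := dg; have [sh Lh Lh'] := dh.
have [dsg sg'] := smooth1_derive sg; have [dsh sh'] := smooth1_derive sh.
pose k : R -> R := fun x => c * bump (- b - 2) 2 1 x.
have sk : smooth1 k by apply: smooth1M; [exact: smooth1_cst|exact: smooth1_bump].
have k1 x : - b - 1 <= x <= 1 -> k x = c.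
  by move=> hx; rewrite /k (@bump_one _ _ _ 1) ?mulr1 ?ltr01 ?invr1//; lra.
pose phi m : space -> R := tens3 k (cutM m g) (cutM m h).
have sphi m : smooth (@dir3 R) (phi m).
  by apply: smooth_tens3 => //; exact: smooth1_cutM.
have sc : smooth1 (cst c : R -> R) by exact: smooth1_cst.
have st : smooth (@dir3 R) (tens3 (cst c) g h) by exact: smooth_tens3.
have [G LG hG] := cutM_derive_dominated dg.
have [H LH hH] := cutM_derive_dominated dh.
(* Inside the slab [k] is locally constant, so its derivative there is bounded by 0 and only the
   horizontal cutoffs matter. *)
have k' x : - b < x < 0 -> derive1 k x = derive1 (cst c : R -> R) x.
  move=> hx; rewrite !derive1E; apply: near_eq_derive => //.
  near=> y; apply: k1.
  have : `|x - y| < 1 by near: y; apply: cvgr_dist_lt => //; exact: cvg_id.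
  by rewrite ltr_norml => /andP[h1 h2]; lra.
have dominated_cutM p : decays p -> [/\ L21 (fun x => `|p x|), forall m x, `|cutM m p x| <= `|p x|
    & forall x, cutM m p x @[m --> \oo] --> p x].
  by move=> [_ Lp _]; split; [exact: L2_norm1|move=> m x; exact: cutM_le|exact: cutM_cvg].
have [LGg hGg cGg] := dominated_cutM _ dg.
have [LHh hHh cHh] := dominated_cutM _ dh.
have hk x : - b < x < 0 -> `|k x| <= `|c| by move=> hx; rewrite k1//; lra.
have hk' x : - b < x < 0 -> `|derive1 k x| <= 0.
  by move=> hx; rewrite k'// derive1_cst normr0.
have ck x : - b < x < 0 -> (k x) @[m --> \oo] --> cst c x.
  by move=> hx; rewrite k1; [exact: cvg_cst|lra].
have ck' x : - b < x < 0 -> (derive1 k x) @[m --> \oo] --> derive1 (cst c : R -> R) x.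
  by move=> hx; rewrite k'//; exact: cvg_cst.
have [dsk sk'] := smooth1_derive sk; have [dsc sc'] := smooth1_derive sc.
have sm := @smooth1_cutM R.
have sm' m (p : R -> R) : smooth1 p -> smooth1 (derive1 (cutM m p)).
  by move=> sp; have [] := smooth1_derive (sm m p sp).
have cm' (p : R -> R) x : smooth1 p -> derive1 (cutM m p) x @[m --> \oo] --> derive1 p x.
  exact: cutM_derive_cvg.
have [L0 c0] := tens3_dct (fun=> sk) (fun m => sm m _ sg) (fun m => sm m _ sh) sc sg sh
  LGg LHh (fun _ => hk) hGg hHh ck cGg cHh.
have Dj j : L2s (pd (@dir3 R) j (tens3 (cst c) g h)) /\
    nrms (fun x => pd (@dir3 R) j (phi m) x - pd (@dir3 R) j (tens3 (cst c) g h) x) @[m --> \oo] --> 0.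
  have e := pd_tens3 [:: j] sc sg sh.
  have em m := pd_tens3 [:: j] sk (sm m _ sg) (sm m _ sh).
  rewrite /= in e em; rewrite e /phi; under eq_fun do rewrite em.
  case: j {e em} => -[|[|[|//]]] ? /=.
  - exact: (tens3_dct (fun=> sk') (fun m => sm m _ sg) (fun m => sm m _ sh) sc' sg sh
      LGg LHh (fun _ => hk') hGg hHh ck' cGg cHh).
  - exact: (tens3_dct (fun=> sk) (fun m => sm' m _ sg) (fun m => sm m _ sh) sc sg' sh
      LG LHh (fun _ => hk) hG hHh ck (fun x => cm' _ x sg) cHh).
  - exact: (tens3_dct (fun=> sk) (fun m => sm m _ sg) (fun m => sm' m _ sh) sc sg sh'
      LGg LH (fun _ => hk) hGg hH ck cGg (fun x => cm' _ x sh)).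
have [Lp cp] := tens2_dct (fun m => sm m _ sg) (fun m => sm m _ sh) sg sh LGg LHh hGg hHh cGg cHh.
have ew j := wderiv_ae E3 (smooth_wderiv3 b [:: j] st).
have Lw j : L2s (wd3 b [:: j] (tens3 (cst c) g h)).
  apply: (L2_ae mO _ _ (proj1 (Dj j))).
    by case: (wderivP (smooth_wderiv3 b [:: j] st)) => _ /locint_meas.
  by apply: filterS (ew j) => x h' Ox; exact: esym (h' Ox).
exists phi; apply: TraceApprox.
- move=> m; pose M : R := 2 * m.+1%:R.
  apply: (@testfun_tens3 _ (- b - 2) 2 (- M) M (- M) M) => //.
  + exact: sm.
  + exact: sm.
  + by move=> x hx; rewrite /k bump_outc ?mulr0.
  + by move=> x; exact: cutM_out.
  + by move=> x; exact: cutM_out.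
- exact: L0.
- by move=> j; exact: wderivP (smooth_wderiv3 b [:: j] st).
- exact: Lw.
- exact: c0.
- move=> j; apply: cvg_trans (proj2 (Dj j)); apply: near_eq_cvg; apply: nearW => m.
  have md : measurable_fun (Omega b) (pd (@dir3 R) j (phi m)).
    by apply: measurable_funTS; apply: measurable_cont3; exact: smooth_cont (smooth_pd j (sphi m)).
  apply: (nrm_ae mO).
  + by apply: measurable_funB => //; exact: L2_meas (proj1 (Dj j)).
  + by apply: measurable_funB => //; exact: L2_meas (Lw j).
  + by apply: filterS (ew j) => x h' Ox; congr (_ - _); first [exact: (h' Ox)|exact: esym (h' Ox)].
- exact: (L2Z mT).
- have ca : k a = c by apply: k1; move: b0; case: ha => -> h0; apply/andP; split; lra.
  have : `|c| * nrmp (fun y => tens2 (cutM m g) (cutM m h) y - tens2 g h y) @[m --> \oo] --> 0.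
    by rewrite -(mulr0 `|c|); apply: cvgM => //; exact: cvg_cst.
  apply: cvg_trans; apply: near_eq_cvg; apply: nearW => m.
  have Lm : L2p (tens2 (cutM m g) (cutM m h)).
    have tm : testfun (@dir2 R) setT (tens2 (cutM m g) (cutM m h)).
      pose M : R := 2 * m.+1%:R.
      apply: (@testfun_tens2 _ (- M) M (- M) M) => //.
      * exact: sm.
      * exact: sm.
      * by move=> x; exact: cutM_out.
      * by move=> x; exact: cutM_out.
    exact: (testfun2_L2 mT tm).
  rewrite -(nrmZ mT c (L2B mT Lm Lp)); congr (nrm _ _ _); apply/funext => y.
  by rewrite /phi /tens3 /tens2 /= ca; ring.
Unshelve. all: by end_near. Qed.

(** A vertical cutoff with compact support in the open slab; by its slope [m + 1] it equals 1 at
    distance at least [2/(m+1)] from both faces. *)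
Definition inner (m : nat) : R -> R :=
  bump (- b + m.+1%:R^-1) (- m.+1%:R^-1) m.+1.

Lemma inner_cvg x : - b < x < 0 -> inner m x @[m --> \oo] --> (1 : R).
Proof.
move=> /andP[h1 h2]; apply: cvg_near_cst.
have h3 : 0 < (x + b) / 2 by lra.
have h4 : 0 < - x / 2 by lra.
near=> m.
have e0 : 0 < m.+1%:R^-1 :> R by rewrite invr_gt0 ltr0n.
rewrite /inner; apply: (@bump_one _ _ _ m.+1%:R^-1); rewrite ?invrK//.
have k1 : m.+1%:R^-1 <= (x + b) / 2.
  by apply: ltW; near: m; exact: (near_infty_natSinv_lt (PosNum h3)).
have k2 : m.+1%:R^-1 <= - x / 2.
  by apply: ltW; near: m; exact: (near_infty_natSinv_lt (PosNum h4)).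
by move: k1 k2; set z := m.+1%:R^-1 => k1 k2; apply/andP; lra.
Unshelve. all: by end_near. Qed.

Lemma testfun_inner m g h : smooth1 g -> smooth1 h ->
  test3 b (tens3 (inner m) (cutM m g) (cutM m h)).
Proof.
move=> sg sh; pose M : R := 2 * m.+1%:R.
apply: (@testfun_tens3 _ (- b + m.+1%:R^-1) (- m.+1%:R^-1) (- M) M (- M) M).
- exact: smooth1_bump.
- exact: smooth1_cutM.
- exact: smooth1_cutM.
- by move=> x; exact: bump_outc.
- by move=> x; exact: cutM_out.
- by move=> x; exact: cutM_out.
- move=> [x [y z]] [/=]; rewrite in_itv/= => /andP[h1 h2] _.
  have e0 : 0 < m.+1%:R^-1 :> R by rewrite invr_gt0 ltr0n.
  move: h1 h2; rewrite /Omega/=; set t := m.+1%:R^-1 in e0 * => h1 h2.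
  by apply/andP; split; lra.
Qed.

(** Horizontal derivatives do not act on the vertical cutoff [inner m], so its growing steepness
    never enters: the truncated kernels and their horizontal derivatives both converge in L^2. *)
Lemma horizontal_parts (f f' : mspace R -> R) g h : L2s f -> L2s f' -> decays g -> decays h ->
  (isw [:: lift ord0 ord0] f f' ->
   ips f (tens3 (cst 1) (derive1 g) h) = - ips f' (tens3 (cst 1) g h)) /\
  (isw [:: ord_max] f f' ->
   ips f (tens3 (cst 1) g (derive1 h)) = - ips f' (tens3 (cst 1) g h)).
Proof.
move=> Lf Lf' dg dh; have [sg Lg Lg'] := dg; have [sh Lh Lh'] := dh.
have [G LG hG] := cutM_derive_dominated dg.
have [H LH hH] := cutM_derive_dominated dh.
have [_ sg'] := smooth1_derive sg; have [_ sh'] := smooth1_derive sh.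
have s1 : smooth1 (cst 1 : R -> R) by exact: smooth1_cst.
have si m : smooth1 (inner m) by exact: smooth1_bump.
have hi m x : - b < x < 0 -> `|inner m x| <= 1.
  by move=> _; rewrite ger0_norm ?bump_ge0 ?bump_le1.
have sm := @smooth1_cutM R.
have sm' m (p : R -> R) : smooth1 p -> smooth1 (derive1 (cutM m p)).
  by move=> sp; have [] := smooth1_derive (sm m p sp).
have cm' (p : R -> R) x : smooth1 p -> derive1 (cutM m p) x @[m --> \oo] --> derive1 p x.
  exact: cutM_derive_cvg.
have LGg := L2_norm1 Lg; have LHh := L2_norm1 Lh.
have [L0 c0] := tens3_dct si (fun m => sm m _ sg) (fun m => sm m _ sh) s1 sg sh
  LGg LHh hi (fun m => @cutM_le R m g) (fun m => @cutM_le R m h) inner_cvg (@cutM_cvg R g) (@cutM_cvg R h).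
have [L1 c1] := tens3_dct si (fun m => sm' m _ sg) (fun m => sm m _ sh) s1 sg' sh
  LG LHh hi hG (fun m => @cutM_le R m h) inner_cvg (fun x => cm' _ x sg) (@cutM_cvg R h).
have [L2 c2] := tens3_dct si (fun m => sm m _ sg) (fun m => sm' m _ sh) s1 sg sh'
  LGg LH hi (fun m => @cutM_le R m g) hH inner_cvg (@cutM_cvg R g) (fun x => cm' _ x sh).
pose phi m : mspace R -> R := tens3 (inner m) (cutM m g) (cutM m h).
have tphi m : test3 b (phi m) by exact: testfun_inner.
have Lphi m : L2s (phi m) by exact: (testfun3_L2 mO (tphi m)).
have cL : - ips (phi m) f' @[m --> \oo] --> - ips (tens3 (cst 1) g h) f'.
  by apply: cvgN; exact: (cvg_ip mO Lphi L0 Lf' c0).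
split=> -[_ _ hw].
- have Ld m : L2s (tens3 (inner m) (derive1 (cutM m g)) (cutM m h)).
    have := testfun3_L2 mO (testfun_foldr [:: lift ord0 ord0] (tphi m)).
    by rewrite /phi pd_tens3//=; exact: sm.
  rewrite ipC (ipC _ _ f'); apply: (cvg_eq_lim _ (cvg_ip mO Ld L1 Lf c1) cL) => m.
   have := hw _ (tphi m); rewrite /phi pd_tens3//=; try exact: sm.
  by rewrite expr1 mulN1r => hh; rewrite ipC (ipC _ _ _ f').
- have Ld m : L2s (tens3 (inner m) (cutM m g) (derive1 (cutM m h))).
    have := testfun3_L2 mO (testfun_foldr [:: ord_max] (tphi m)).
    by rewrite /phi pd_tens3//=; exact: sm.
  rewrite ipC (ipC _ _ f'); apply: (cvg_eq_lim _ (cvg_ip mO Ld L2 Lf c2) cL) => m.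
   have := hw _ (tphi m); rewrite /phi pd_tens3//=; try exact: sm.
  by rewrite expr1 mulN1r => hh; rewrite ipC (ipC _ _ _ f').
Qed.

End horizontal_lifts.

(** * Powers of c + y^2 *)

Section bracket_powers.
Variable R : realType.
Local Notation mu1 := (@lebesgue_measure R).
Local Notation L21 := (L2 mu1 setT).
Implicit Types (c t y : R) (p : {poly R}).

(** The parameter [c] serves the initial profile, with [c = 1], as well as the Poisson kernel of
    scale [r], with [c = r^2]. *)
Definition pw c t y : R := (c + y ^+ 2) `^ t.

Lemma pw_base c y : 1 <= c -> 1 <= c + y ^+ 2.
Proof. by move=> c1; have := sqr_ge0 y; lra. Qed.

Lemma pw_gt0 c t y : 1 <= c -> 0 < pw c t y.
Proof. by move=> c1; apply: powR_gt0; apply: lt_le_trans (pw_base y c1). Qed.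

(** The polynomial that appears in the derivative of [p(y) (c + y^2)^t] once the power [t - 1] is
    factored out. *)
Definition pw_next c t p : {poly R} := p^`() * ('X^2 + c%:P) + (2 * t) *: ('X * p).

Lemma is_derive_pw c t p y : 1 <= c ->
  is_derive y (1 : R) (fun x => p.[x] * pw c t x) ((pw_next c t p).[y] * pw c (t - 1) y).
Proof.
move=> c1; have y1 := pw_base y c1.
have y0 : 0 < c + y ^+ 2 by lra.
have d2 : is_derive y (1 : R) (fun x => c + x ^+ 2) (2 * y).
  apply: (is_derive_eq (is_deriveD (is_derive_cst c y 1) (is_deriveM (is_derive_id y (1 : R)) (is_derive_id y (1 : R))))).
  by rewrite /GRing.scale/=; ring.
have dp := @is_derive1_comp _ (fun x => x `^ t) (fun x => c + x ^+ 2) y _ _ (is_derive1_powR t y0) d2.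
apply: (is_derive_eq (is_deriveM (is_derive_poly p y) dp)).
have e : pw c t y = (c + y ^+ 2) * pw c (t - 1) y.
  by rewrite /pw powRB ?powRr1 ?ltW//; [rewrite mulrCA divff ?mulr1// gt_eqF|by rewrite (gt_eqF y0) implybT].
rewrite /GRing.scale/= -/(pw c t y) e /pw_next !(hornerD, hornerM, hornerZ, hornerX, hornerXn, hornerC) /pw.
by set P := _ `^ (t - 1); set q := p.[y]; set q' := _.[y]; ring.
Qed.

Lemma Ck_pw c k t p : 1 <= c -> Ck k (fun y => p.[y] * pw c t y).
Proof.
move=> c1; elim: k t p => // k IH t p.
by exists (fun y => (pw_next c t p).[y] * pw c (t - 1) y) => // y; exact: is_derive_pw.
Qed.

Lemma size_pw_next c t p n : (size p <= n.+1)%N -> (size (pw_next c t p) <= n.+2)%N.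
Proof.
move=> hp; rewrite /pw_next (leq_trans (size_polyD _ _))// geq_max; apply/andP; split.
  have [->|p0] := eqVneq (p^`()) 0; first by rewrite mul0r size_poly0.
  rewrite (leq_trans (size_polyMleq _ _))// size_XnaddC//.
  have : (size p^`() <= n)%N.
    have [/eqP|p1] := eqVneq p 0; first by move=> /eqP q; rewrite q deriv0 eqxx in p0.
    by rewrite -ltnS (leq_trans (lt_size_deriv p1)).
  by rewrite addnC /= => h; rewrite (leq_trans (leq_add (leqnn 2) h)).
rewrite (leq_trans (size_scale_leq _ _))// (leq_trans (size_polyMleq _ _))// size_polyX.
by rewrite /= ltnS.
Qed.

Lemma iter_derive1_pw c t n : 1 <= c -> exists2 p : {poly R}, (size p <= n.+1)%N &
  iter n (@derive1 R R) (pw c t) = fun y => p.[y] * pw c (t - n%:R) y.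
Proof.
move=> c1; elim: n => [|n [p sp IH]].
  exists 1; first by rewrite size_poly1.
  by apply/funext => y; rewrite hornerC mul1r subr0.
exists (pw_next c (t - n%:R) p); first exact: size_pw_next.
rewrite iterS IH; have e : t - n.+1%:R = t - n%:R - 1 by rewrite -natr1; ring.
by rewrite e; apply: is_derive_derive1 => y; exact: is_derive_pw.
Qed.

Lemma smooth1_pw c t : 1 <= c -> smooth1 (pw c t).
Proof.
move=> c1 k; have := Ck_pw k t 1 c1; congr Ck.
by apply/funext => y; rewrite hornerC mul1r.
Qed.

(** The derivative of order [n] is a polynomial of degree at most [n] times [(c + y^2)^(t - n)], and
    every [|y|^i] with [i <= n] is at most [(c + y^2)^n]. *)
Lemma iter_derive1_pw_le c t n : 1 <= c ->
  exists2 C : R, 0 <= C & forall y, `|iter n (@derive1 R R) (pw c t) y| <= C * pw c t y.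
Proof.
move=> c1; have [p sp ->] := iter_derive1_pw t n c1.
exists (\sum_(i < size p) `|p`_i|); first by apply: sumr_ge0.
move=> y; rewrite normrM (ger0_norm (ltW (pw_gt0 _ y c1))).
have y1 := pw_base y c1; set B := c + y ^+ 2 in y1.
have B0 : 0 < B := lt_le_trans ltr01 y1.
have yB : `|y| <= B.
  rewrite /B; have := sqr_ge0 (`|y| - 1); rewrite sqrrB1 real_normK ?num_real//.
  by have := normr_ge0 y; lra.
have -> : pw c t y = B ^+ n * pw c (t - n%:R) y.
  rewrite /pw -/B powRB; last by rewrite (gt_eqF B0) implybT.
  by rewrite powR_mulrn ?(ltW B0)// mulrCA divff ?mulr1// expf_neq0// gt_eqF.
rewrite mulrA ler_wpM2r ?(ltW (pw_gt0 _ _ _))// horner_coef.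
rewrite (le_trans (ler_norm_sum _ _ _))// mulr_suml ler_sum// => i _.
rewrite normrM ler_wpM2l// normrX (@le_trans _ _ (B ^+ i))// ?lerXn2r ?nnegrE//; try lra.
by rewrite ler_weXn2l// -ltnS (leq_trans _ sp).
Qed.

Lemma powR_cvg0y (r : R) : 0 < r -> (1 + x) `^ (- r) @[x --> +oo] --> 0.
Proof.
move=> r0; apply/cvgrPdist_lt => e e0; near=> x.
have x0 : 0 <= x by near: x; apply: nbhs_pinfty_ge; exact: num_real.
rewrite sub0r normrN ger0_norm ?powR_ge0// powRN -(invrK e) ltf_pV2 ?posrE ?invr_gt0//; last first.
  by apply: powR_gt0; lra.
have hx : e^-1 `^ (r^-1) < 1 + x.
  rewrite -ltrBlDl; near: x; apply: nbhs_pinfty_gt; exact: num_real.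
have -> : e^-1 = (e^-1 `^ (r^-1)) `^ r.
  by rewrite -powRrM mulVf ?gt_eqF// powRr1// invr_ge0 ltW.
by apply: gt0_ltr_powR => //; rewrite nnegrE ?powR_ge0//; lra.
Unshelve. all: by end_near. Qed.

(** On the positive half-line [(1 + y)^2 <= 2 (1 + y^2)], which reduces the claim to
    [(1 + y)^(- 2 u)], a power with an explicit antiderivative that tends to 0 at infinity. *)
Lemma pw_integral_lty (u : R) : 2^-1 < u ->
  (\int[mu1]_y (pw 1 (- u) y)%:E < +oo)%E.
Proof.
move=> u1.
have cp : continuous (pw 1 (- u)) by apply: smooth1_cont; apply: smooth1_pw.
have s1 : forall y, 0 <= pw 1 (- u) y by move=> y; exact: powR_ge0.
rewrite ge0_symfun_integralT//; last by move=> y; rewrite /pw /= sqrrN.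
apply: lte_mul_pinfty => //; rewrite -set_itvcy.
pose f (y : R) : R := (1 + y) `^ (- (2 * u)).
pose r := 2 * u - 1; have r0 : 0 < r by rewrite /r; lra.
pose F (y : R) : R := (- r^-1) * (1 + y) `^ (- r).
have dF (y : R) : 0 < 1 + y -> is_derive y (1 : R) F (f y).
  move=> y0; have d1 : is_derive y (1 : R) (fun x : R => 1 + x) 1.
    by apply: (is_derive_eq (is_deriveD (is_derive_cst (1 : R) y (1 : R)) (is_derive_id y (1 : R)))); rewrite add0r.
  have dp := @is_derive1_comp _ (fun x => x `^ (- r)) (fun x => 1 + x) y _ _ (is_derive1_powR (- r) y0) d1.
  apply: (is_derive_eq (is_deriveZ (- r^-1) dp)).
  rewrite /GRing.scale/= mulr1 mulrA mulrNN mulVf ?gt_eqF// mul1r /f.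
  by congr (_ `^ _); rewrite /r; ring.
have cf (y : R) : 0 < 1 + y -> {for y, continuous f}.
  move=> y0; have d1 : is_derive y (1 : R) (fun x : R => 1 + x) 1.
    by apply: (is_derive_eq (is_deriveD (is_derive_cst (1 : R) y (1 : R)) (is_derive_id y (1 : R)))); rewrite add0r.
  have dp := @is_derive1_comp _ (fun x => x `^ (- (2 * u))) (fun x => 1 + x) y _ _ (is_derive1_powR (- (2 * u)) y0) d1.
  by apply/differentiable_continuous/derivable1_diffP; have [] := dp.
have IF : (\int[mu1]_(x in `[0%R, +oo[) (f x)%:E = 0%R%:E - (F 0%R)%:E)%E.
  apply: ge0_continuous_FTC2y.
  - by move=> x _; exact: powR_ge0.
  - by apply: continuous_in_subspaceT => x /set_mem/=; rewrite in_itv/= andbT => x0; apply: cf; lra.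
  - by rewrite -(mulr0 (- r^-1)); apply: cvgM; [exact: cvg_cst|exact: powR_cvg0y].
  - by move=> x x0; have [] : is_derive x (1 : R) F (f x) by apply: dF; lra.
  - apply: cvg_at_right_filter; have d0 : is_derive (0 : R) (1 : R) F (f 0) by apply: dF; lra.
    by apply/differentiable_continuous/derivable1_diffP; have [] := d0.
  - move=> x; rewrite in_itv/= andbT => x0; rewrite derive1E.
    by have h : is_derive x (1 : R) F (f x) by [apply: dF; lra]; exact: derive_val.
have mf : measurable_fun (`[0, +oo[%classic : set (measurableTypeR R)) f.
  apply: subspace_continuous_measurable_fun; first exact: measurable_itv.
  by apply: continuous_in_subspaceT => x /set_mem/=; rewrite in_itv/= andbT => x0; apply: cf; lra.
apply: (@le_lt_trans _ _ (\int[mu1]_(x in `[0%R, +oo[) ((2 `^ u)%:E * (f x)%:E))%E).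
  apply: ge0_le_integral => //.
  - by move=> x _; rewrite lee_fin.
  - by apply/measurable_EFinP; apply: measurable_funTS; exact: continuous_measurable_fun.
  - by apply: measurable_funeM; exact/measurable_EFinP.
  - move=> x; rewrite /= in_itv/= andbT => x0; rewrite -EFinM lee_fin /pw /f mulrC.
    have {}x0 : 0 <= (x : R) := x0.
    set A : R := 1 + x ^+ 2; have A1 : 0 < A by rewrite /A; have := sqr_ge0 (x : R); lra.
    have B0 : 0 < 1 + (x : R) by lra.
    rewrite !powRN powRrM ler_pdivlMl; last by rewrite powR_gt0// powR_gt0.
    rewrite ler_pdivrMr; last by rewrite powR_gt0.
    rewrite -powRM ?(ltW A1)//.
    apply: ge0_ler_powR; rewrite ?nnegrE ?powR_ge0// ?mulr_ge0 ?(ltW A1)//; try lra.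
    rewrite powR_mulrn ?(ltW B0)// /A.
    have := sqr_ge0 ((x : R) - 1); move: (x : R) => z; rewrite !expr2; lra.
rewrite ge0_integralZl//.
- by rewrite IF -EFinB -EFinM ltry.
- exact/measurable_EFinP.
- by move=> x _; rewrite lee_fin powR_ge0.
Qed.

Lemma pw_L2 c t : 1 <= c -> t < - 4^-1 -> L21 (pw c t).
Proof.
move=> c1 ht; split.
  by apply: continuous_measurable_fun; apply: smooth1_cont; exact: smooth1_pw.
have hu : 2^-1 < - (2 * t) by lra.
apply: le_lt_trans (pw_integral_lty hu); apply: ge0_le_integral => //.
- by move=> x _; rewrite lee_fin sqr_ge0.
- apply/measurable_EFinP; apply: measurable_funX; apply: continuous_measurable_fun.
  by apply: smooth1_cont; exact: smooth1_pw.
- by apply/measurable_EFinP; apply: continuous_measurable_fun; apply: smooth1_cont; exact: smooth1_pw.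
move=> x _; rewrite lee_fin opprK /pw mulrC powRrM powR_mulrn ?powR_ge0//.
have b1 := pw_base x c1; have b2 : 1 <= 1 + x ^+ 2 by exact: pw_base.
rewrite lerXn2r ?nnegrE ?powR_ge0// -(opprK t) !(powRN _ (- t)).
rewrite lef_pV2 ?posrE ?powR_gt0//; try lra.
by apply: ge0_ler_powR; rewrite ?nnegrE; lra.
Qed.

(** Being stable under differentiation, this class makes every derivative of a lifted profile a
    function of the same kind, so that all norms are finite by one argument. *)
Definition tame (g : R -> R) := forall n, decays (iter n (@derive1 R R) g).

Lemma tame_derive n g : tame g -> tame (iter n (@derive1 R R) g).
Proof. by move=> h k; rewrite -iterD. Qed.

Lemma tame_pw c t : 1 <= c -> t < - 4^-1 -> tame (pw c t).
Proof.
move=> c1 ht n; have s := smooth1_pw t c1.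
have L k : L21 (iter k (@derive1 R R) (pw c t)).
  have [C C0 hC] := iter_derive1_pw_le t k c1.
  apply: (L2_le measurableT _ _ (L2Z measurableT C (pw_L2 c1 ht))).
    by apply: continuous_measurable_fun; apply: smooth1_cont; exact: smooth1_iter.
  by move=> y _; rewrite (le_trans (hC y))// ler_norm.
by split; [exact: smooth1_iter|exact: L|exact: (L n.+1)].
Qed.

Lemma iter_derive1Z c g n : smooth1 g ->
  iter n (@derive1 R R) (fun x => c * g x) = fun x => c * iter n (@derive1 R R) g x.
Proof.
move=> sg; elim: n => // n IH; rewrite iterS IH; apply: is_derive_derive1 => x.
have [d _] := smooth1_derive (smooth1_iter n sg).
exact: is_deriveZ.
Qed.

Lemma tameZ c g : tame g -> tame (fun x => c * g x).
Proof.
move=> tg n; have [sg _ _] := tg 0%N; have [s L L'] := tg n.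
split.
- by rewrite iter_derive1Z//; apply: smooth1M => //; exact: smooth1_cst.
- by rewrite iter_derive1Z//; exact: (L2Z measurableT).
- by rewrite -iterS iter_derive1Z//; exact: (L2Z measurableT).
Qed.

End bracket_powers.

(** * Lifted profiles belong to the function spaces *)

Section lifted_profiles.
Variables (R : realType) (b : R).
Hypothesis b0 : 0 < b.
Local Notation mu1 := (@lebesgue_measure R).
Local Notation space := (R * (R * R))%type.
Local Notation L21 := (L2 mu1 setT).
Local Notation L2s := (L2 mu3 (Omega b)).
Local Notation L2p := (L2 mu2 setT).
Local Notation dn3 := (dnorm2 mu3 (Omega b) (test3 b) (pd (@dir3 R))).
Local Notation dn2 := (dnorm2 mu2 setT (@test2 R) (pd (@dir2 R))).
Implicit Types g h : R -> R.

Let mO : measurable (Omega b : set (mspace R)) := measurable_Omega b.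
Let mT : measurable (setT : set (mplane R)) := measurableT.
Let E3 := exhaustion_slab b.
Let E2 := exhaustion_plane R.
Let tD3 : forall w phi, test3 b phi -> test3 b (foldr (pd (@dir3 R)) phi w).
Proof. by move=> w phi; exact: testfun_foldr. Qed.
Let tD2 : forall w phi, @test2 R phi -> @test2 R (foldr (pd (@dir2 R)) phi w).
Proof. by move=> w phi; exact: testfun_foldr. Qed.

Lemma iter_derive1_cst (c : R) n : exists c', iter n (@derive1 R R) (cst c) = cst c'.
Proof.
elim: n => [|n [c' IH]]; first by exists c.
by exists 0; rewrite iterS IH; apply/funext => x; rewrite derive1_cst.
Qed.

Lemma smooth_tame (c : R) g h : tame g -> tame h -> smooth (@dir3 R) (tens3 (cst c) g h).
Proof.
move=> tg th; have [sg _ _] := tg 0%N; have [sh _ _] := th 0%N.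
by apply: smooth_tens3 => //; exact: smooth1_cst.
Qed.

Lemma foldr_pd_tame (c : R) g h w : tame g -> tame h -> exists c' g' h',
  [/\ foldr (pd (@dir3 R)) (tens3 (cst c) g h) w = tens3 (cst c') g' h', tame g' & tame h'].
Proof.
move=> tg th; have [sg _ _] := tg 0%N; have [sh _ _] := th 0%N.
have [c' e] := iter_derive1_cst c (count_mem ord0 w).
exists c', (iter (count_mem (lift ord0 ord0) w) (@derive1 R R) g),
  (iter (count_mem ord_max w) (@derive1 R R) h); split.
- by rewrite pd_tens3 ?e//; exact: smooth1_cst.
- exact: tame_derive.
- exact: tame_derive.
Qed.

Lemma tame_L2 (c : R) g h : tame g -> tame h -> L2s (tens3 (cst c) g h).
Proof.
move=> tg th; have [_ Lg _] := tg 0%N; have [_ Lh _] := th 0%N.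
exact: (L2Z mO c (L2_lift b0 (L2_tens2 Lg Lh))).
Qed.

(** Stated up to a.e. equality so as to apply to the chosen representatives of weak derivatives. *)
Lemma dnorm_tame w (c : R) g h (f : mspace R -> R) : tame g -> tame h -> measurable_fun (Omega b) f ->
  {ae mu3, forall x : mspace R, Omega b x -> tens3 (cst c) g h x = f x} ->
  (dn3 w f < +oo)%E.
Proof.
move=> tg th mf ef.
have st := smooth_tame c tg th.
have [c' [g' [h' [e tg' th']]]] := foldr_pd_tame c (rev w) tg th.
have L := tame_L2 c' tg' th'.
have h0 : is_wderiv mu3 (Omega b) (test3 b) (pd (@dir3 R)) w f (tens3 (cst c') g' h').
  have ee : {ae mu3, forall x : mspace R, Omega b x ->
      foldr (pd (@dir3 R)) (tens3 (cst c) g h) (rev w) x = tens3 (cst c') g' h' x}.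
    by apply: aeW => x _; rewrite e.
  exact: (is_wderiv_ae E3 tD3 mf (L2_meas L) ef ee (smooth_wderiv3 b w st)).
by rewrite (dnorm2_L2 E3 h0 L) ltry.
Qed.

Lemma dnorm_tame2 w (c : R) g h (f : mplane R -> R) : tame g -> tame h -> measurable_fun setT f ->
  {ae mu2, forall y : mplane R, setT y -> c * tens2 g h y = f y} ->
  (dn2 w f < +oo)%E.
Proof.
move=> tg th mf ef.
have [sg _ _] := tg 0%N; have [sh _ _] := th 0%N.
have tcg := tameZ c tg; have [scg _ _] := tcg 0%N.
have e : (fun y => c * tens2 g h y) = tens2 (fun x => c * g x) h.
  by apply/funext => y; rewrite /tens2 mulrA.
have st : smooth (@dir2 R) (fun y => c * tens2 g h y) by rewrite e; exact: smooth_tens2.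
have L : L2p (foldr (pd (@dir2 R)) (fun y => c * tens2 g h y) (rev w)).
  rewrite e pd_tens2//; apply: L2_tens2.
    by have [] := tcg (count_mem ord0 (rev w)).
  by have [] := th (count_mem ord_max (rev w)).
have h0 : is_wderiv mu2 setT (@test2 R) (pd (@dir2 R)) w f
    (foldr (pd (@dir2 R)) (fun y => c * tens2 g h y) (rev w)).
  pose F : mplane R -> R := foldr (pd (@dir2 R)) (fun y => c * tens2 g h y) (rev w).
  have ee : {ae mu2, forall x : mplane R, setT x -> F x = F x} by exact: aeW.
  exact: (is_wderiv_ae E2 tD2 mf (L2_meas L) ef ee (smooth_wderiv2 w st)).
by rewrite (dnorm2_L2 E2 h0 L) ltry.
Qed.

Lemma sume_lty (I : finType) (F : I -> \bar R) : (forall i, F i < +oo)%E ->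
  (\sum_i F i < +oo)%E.
Proof. by move=> h; apply: (big_ind (fun x => (x < +oo)%E)) => // x y; exact: lte_add_pinfty. Qed.

Lemma Htan2_tame s N (c : R) g h (f : mspace R -> R) : tame g -> tame h -> measurable_fun (Omega b) f ->
  {ae mu3, forall x : mspace R, Omega b x -> tens3 (cst c) g h x = f x} ->
  (Htan2 b s N f < +oo)%E.
Proof.
move=> tg th mf ef; rewrite /Htan2 /tan2.
do 4 (apply: sume_lty => ?); exact: dnorm_tame tg th mf ef.
Qed.

Lemma sqrte_lty (x : \bar R) : (x < +oo)%E -> (sqrte x < +oo)%E.
Proof. by case: x => //= r _; exact: ltry. Qed.

(** A purely vertical displacement, independent of [x_1]: its vertical derivative vanishes and its
    trace on Sigma_0 is the plane profile. *)
Definition profile g : 'I_3 -> space -> R := fun i => tens3 (cst ((i == ord0)%:R : R)) g g.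

Lemma trace0P f (g : R * R -> R) : is_trace b 0 f g -> is_trace b 0 f (trace0 b f).
Proof. by move=> h; rewrite /trace0; exact: (xgetPex _ (ex_intro _ g h)). Qed.

Lemma trace0_ae f (g : R * R -> R) phi : trace_approx b 0 f g phi ->
  {ae mu2, forall y : mplane R, setT y -> g y = trace0 b f y}.
Proof.
move=> h; have [//|psi h'] := proj1 (is_traceP b 0 f (trace0 b f)).
  by apply: (@trace0P f g); apply/is_traceP => //; exists phi.
by apply: (trace_unique b0 _ h h'); left.
Qed.

(** The trace of the first component is [tens2 g g] by [lift_trace]; uniqueness of traces carries
    the bounds over to the representative chosen by [trace0]. *)
Lemma vnorm_ring_profile N g : tame g -> (vnorm_ring b N (profile g) < +oo)%E.
Proof.
move=> tg; have dg : decays g := tg 0%N.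
have mt (c : R) : measurable_fun (Omega b : set (mspace R)) (tens3 (cst c) g g).
  exact: L2_meas (tame_L2 c tg tg).
rewrite /vnorm_ring ifT; last first.
  apply/asboolP => i; rewrite /Hs2 /sob2; do 2 (apply: sume_lty => ?).
  by apply: (dnorm_tame _ tg tg (mt _)); exact: aeW.
apply: sqrte_lty; apply: lte_add_pinfty.
  have [phi tr] := lift_trace b0 (1 : R) (or_introl erefl : (0 : R) = 0 \/ (0 : R) = - b) dg dg.
  rewrite /on_Sigma0 ifT; last first.
    by apply/asboolP; exists (fun y => 1 * tens2 g g y); apply/is_traceP => //; exists phi.
  rewrite /Hplane_tan2 /tan2; do 4 (apply: sume_lty => ?).
  apply: (@dnorm_tame2 _ 1 g g) => //; last exact: trace0_ae tr.
  by case: (@trace0P (profile g ord0) (fun y => 1 * tens2 g g y)) => //;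
    apply/is_traceP => //; exists phi.
apply: sume_lty => i; apply: sume_lty => j.
have st := smooth_tame ((i == ord0)%:R : R) tg tg.
have [c' [g' [h' [e tg' th']]]] := foldr_pd_tame ((i == ord0)%:R : R) [:: j] tg tg.
have hw := smooth_wderiv3 b [:: j] st.
apply: (Htan2_tame _ _ tg' th' (c := c')).
  by case: (wderivP hw) => _ /locint_meas.
by apply: filterS (wderiv_ae E3 hw) => x h0 Ox; rewrite -e; exact: esym (h0 Ox).
Qed.

End lifted_profiles.

(** * Lower bound for the pairing with the Poisson kernel *)

Section test_profile.
Variable R : realType.
Local Notation mu1 := (@lebesgue_measure R).

(** The Poisson kernel [r^2 / (r^2 + y^2)], normalised to be 1 at the origin; written with [pw] to
    inherit its estimates. *)
Definition kern (r y : R) : R := r ^+ 2 * pw (r ^+ 2) (-1) y.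

Lemma sqr_ge1 (r : R) : 1 <= r -> 1 <= r ^+ 2.
Proof. by move=> h; rewrite expr_ge1//; lra. Qed.

Lemma kernE (r y : R) : 1 <= r -> kern r y = r ^+ 2 / (r ^+ 2 + y ^+ 2).
Proof.
by move=> /sqr_ge1 r1; rewrite /kern /pw powR_inv1//; have := sqr_ge0 y; lra.
Qed.

Lemma tame_kern r : 1 <= r -> tame (kern r).
Proof. by move=> /sqr_ge1 r1; apply: tameZ; apply: tame_pw => //; lra. Qed.

(** On the square of side [r], each factor of the profile is at least [(2 r^2)^(- s)] and each
    factor of the kernel at least 1/2; the integrand is nonnegative elsewhere. *)
Lemma overlap_lower (r s : R) : 1 <= r -> 4^-1 < s ->
  (2^-1 * (2 `^ (- s))) ^+ 2 * r `^ (2 - 4 * s) <=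
  ip mu2 setT (tens2 (pw 1 (- s)) (pw 1 (- s))) (tens2 (kern r) (kern r)).
Proof.
move=> r1 hs; have r2 := sqr_ge1 r1.
have tA : tame (pw 1 (- s)) by apply: tame_pw => //; lra.
have tK := tame_kern r1.
have [sA LA _] := tA 0%N; have [sK LK _] := tK 0%N.
have mT : measurable (setT : set (mplane R)) by [].
have Lt := L2_tens2 LA LA; have Lk := L2_tens2 LK LK.
pose c := (2^-1 * (2 * r ^+ 2) `^ (- s)).
have c0 : 0 <= c by rewrite mulr_ge0 ?powR_ge0// invr_ge0.
have lo (y : R) : 0 < y < r -> c <= pw 1 (- s) y * kern r y.
  move=> /andP[/ltW y0 /ltW yr]; have y2 : y ^+ 2 <= r ^+ 2 by rewrite lerXn2r ?nnegrE//; lra.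
  have Y0 := sqr_ge0 y.
  rewrite /c mulrC ler_pM ?powR_ge0 ?invr_ge0//.
    rewrite /pw !powRN lef_pV2 ?posrE ?powR_gt0//; try lra.
    by apply: ge0_ler_powR; rewrite ?nnegrE; lra.
  rewrite kernE// ler_pdivlMr; last lra.
  by rewrite mulrC ler_pdivrMr//; lra.
have -> : (2^-1 * (2 `^ (- s))) ^+ 2 * r `^ (2 - 4 * s) = c ^+ 2 * r ^+ 2.
  have r0 : 0 < r by lra.
  have e1 : (2 * r ^+ 2) `^ (- s) = 2 `^ (- s) * r `^ (- (2 * s)).
    rewrite powRM//; last lra.
    by rewrite -(powR_mulrn 2 (ltW r0)) -powRrM mulrN.
  have e2 : r `^ (2 - 4 * s) = (r `^ (- (2 * s))) ^+ 2 * r ^+ 2.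
    rewrite -(powR_mulrn 2 (powR_ge0 _ _)) -(powR_mulrn 2 (ltW r0)) -powRrM -powRD ?(gt_eqF r0) ?implybT//.
    by congr (_ `^ _); ring.
  by rewrite /c e1 e2; ring.
have mb : measurable (box2 0 r 0 r : set (mplane R)) by exact: measurable_box2.
have mub : mu2 (box2 0 r 0 r) = (r ^+ 2)%:E.
  rewrite /box2 mu2_setX//; try exact: measurable_itv.
  have r0 : 0 < r by lra.
  by rewrite !lebesgue_measure_itv/= lte_fin r0 -EFinB subr0 -EFinM expr2.
have ii : mu2.-integrable setT (EFin \o (\1_(box2 0 r 0 r) : mplane R -> R)).
  apply/integrableP; split; first by apply/measurable_EFinP; exact: measurable_indic.
  under eq_integral => x _ do rewrite /= ger0_norm//.
  by rewrite integral_indic// setIT; have := ltry (r ^+ 2); rewrite -mub; exact.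
have ib : mu2.-integrable setT (EFin \o (fun y => c ^+ 2 * \1_(box2 0 r 0 r) y)).
  exact: (itgZ mT (c ^+ 2) ii).
rewrite (_ : c ^+ 2 * r ^+ 2 = \int[mu2]_y (c ^+ 2 * \1_(box2 0 r 0 r) y)).
  apply: (le_Rint_ae mT ib (L2_itgM mT Lt Lk)); apply: aeW => -[x y] _ /=.
  have k0 z : 0 <= pw 1 (- s) z * kern r z.
    by rewrite mulr_ge0 ?powR_ge0// /kern mulr_ge0 ?powR_ge0//; lra.
  rewrite /tens2 /= [leRHS](_ : _ = (pw 1 (- s) x * kern r x) * (pw 1 (- s) y * kern r y)); last by ring.
  rewrite indicE; case: (boolP (_ \in _)) => [|_]; last by rewrite mulr0 mulr_ge0.
  rewrite inE /box2 /= !in_itv/= mulr1 => -[hx hy].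
  by rewrite expr2 ler_pM//; exact: lo.
rewrite RintegralZl//.
by rewrite /Rintegral integral_indic// setIT [X in fine X]mub.
Qed.

End test_profile.

(** * Transforms of the two-sided exponential *)

Section two_sided_exponential.
Variable R : realType.
Local Notation mu1 := (@lebesgue_measure R).
Implicit Types (f g h F G : R -> R) (r y z : R).

(** Limits of [F] and [G] along integers suffice, because the integrals over [[-n, n]] already
    determine the whole integral. *)
Lemma Rint_two_sided h f g F G :
  mu1.-integrable setT (EFin \o h) ->
  (forall z, 0 <= z -> h z = f z) -> (forall z, z <= 0 -> h z = g z) ->
  (forall z, is_derive z (1 : R) F (f z)) -> (forall z, is_derive z (1 : R) G (g z)) ->
  continuous f -> continuous g ->
  F n%:R @[n --> \oo] --> (0 : R) -> G (- n%:R) @[n --> \oo] --> (0 : R) ->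
  \int[mu1]_z h z = G 0 - F 0.
Proof.
move=> hi hf hg dF dG cf cg F0 G0.
have hS (A : set (measurableTypeR R)) : measurable A -> mu1.-integrable A (EFin \o h).
  by move=> mA; apply: (@integrableS _ _ _ mu1 setT A).
have e n : \int[mu1]_(z in `[- n%:R, n%:R]) h z = (G 0 - G (- n%:R)) + (F n%:R - F 0).
  have n0 : 0 <= n%:R :> R by [].
  have -> : `[- n%:R, n%:R]%classic = `[- n%:R, 0[%classic `|` `[(0 : R), n%:R]%classic.
    by rewrite -itv_bndbnd_setU// bnd_simp// oppr_le0.
  rewrite Rintegral_setU//=; last 2 first.
  - by apply: hS; apply: measurableU; exact: measurable_itv.
  - apply/disj_setPS => z [/=]; rewrite !in_itv/= => /andP[_ z0] /andP[z0' _].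
    by move: (lt_le_trans z0 z0'); rewrite ltxx.
  congr (_ + _).
    rewrite Rintegral_itv_bndo_bndc; last by apply: hS; exact: measurable_itv.
    rewrite -(FTC dG cg); last by rewrite oppr_le0.
    by apply: eq_Rintegral => z /set_mem/=; rewrite in_itv/= => /andP[_ z0]; exact: hg.
  rewrite -(FTC dF cf)//.
  by apply: eq_Rintegral => z /set_mem/=; rewrite in_itv/= => /andP[z0 _]; exact: hf.
have c1 : \int[mu1]_(z in `[- n%:R, n%:R]) h z @[n --> \oo] --> G 0 - F 0.
  under eq_fun do rewrite e.
  have -> : G 0 - F 0 = (G 0 - 0) + (0 - F 0) by ring.
  by apply: cvgD; apply: cvgB => //; exact: cvg_cst.
have mh : measurable_fun setT h := itg_meas hi.
have mr n : measurable_fun setT (h \_ (`[- n%:R, n%:R]%classic : set (measurableTypeR R))).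
  by apply/(measurable_restrictT _ (measurable_itv _)); exact: measurable_funTS.
have cr : {ae mu1, forall z, setT z -> (h \_ `[- n%:R, n%:R]) z @[n --> \oo] --> h z}.
  apply: aeW => z _; apply: cvg_near_cst; near=> n.
  rewrite patchE mem_set//= in_itv/= -ler_norml.
  by near: n; exact: nbhs_infty_ger.
have br : {ae mu1, forall z, setT z -> forall n : nat, `|(h \_ `[- n%:R, n%:R]) z| <= `|h z|}.
  by apply: aeW => z _ n; rewrite patchE; case: ifP => //; rewrite normr0.
have [_ c2] := Rint_dct measurableT mr mh (itg_norm hi) cr br.
have e2 n : \int[mu1]_z (h \_ `[- n%:R, n%:R]) z = \int[mu1]_(z in `[- n%:R, n%:R]) h z.
  by rewrite [RHS]Rintegral_mkcond.
exact: cvg_eq_lim e2 c2 c1.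
Unshelve. all: by end_near. Qed.

Definition dexp r z : R := expR (- (r * `|z|)).

Lemma dexp_ge0 r z : 0 <= dexp r z. Proof. exact: expR_ge0. Qed.

(** The square of [1 + t/2 <= expR (t/2)]. *)
Lemma expR_le_inv (t : R) : 0 <= t -> expR (- t) <= (1 + t ^+ 2 / 4)^-1.
Proof.
move=> t0; rewrite expRN lef_pV2 ?posrE ?expR_gt0//; last by have := sqr_ge0 t; lra.
have h := expR_ge1Dx (t / 2); have -> : expR t = expR (t / 2) ^+ 2.
  by rewrite expr2 -expRD -splitr.
apply: (@le_trans _ _ ((1 + t / 2) ^+ 2)); last by rewrite lerXn2r ?nnegrE ?expR_ge0//; lra.
rewrite !expr2; lra.
Qed.

Lemma dexp_le r z : 0 < r -> dexp r z <= (1 + 4 / r ^+ 2) * pw 1 (-1) z.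
Proof.
move=> r0; have r2 : 0 < r ^+ 2 by rewrite exprn_gt0.
have h0 : 0 <= r * `|z| by rewrite mulr_ge0// ltW.
apply: (le_trans (expR_le_inv h0)).
have z2 := sqr_ge0 z; have q0 : 0 < 4 / r ^+ 2 by rewrite divr_gt0.
rewrite /pw powR_inv1; last by rewrite addr_ge0.
rewrite exprMn real_normK ?num_real// ler_pdivlMr; last lra.
rewrite mulrC ler_pdivrMr; last by have := mulr_ge0 (ltW r2) z2; lra.
rewrite mulrDl mul1r mulrDr mulr1.
have -> : 4 / r ^+ 2 * (r ^+ 2 * z ^+ 2 / 4) = z ^+ 2 by field; rewrite gt_eqF.
by have := mulr_ge0 (ltW r2) z2; lra.
Qed.

Lemma continuous_dexp r : continuous (dexp r).
Proof.
move=> z; apply: (@continuous_comp _ _ _ (fun z => - (r * `|z|)) expR); last exact: continuous_expR.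
by apply: cvgN; apply: cvgMl_tmp; exact: norm_continuous.
Qed.

Lemma measurable_dexp r : measurable_fun setT (dexp r).
Proof. exact: (continuous_measurable_fun (@continuous_dexp r)). Qed.

Lemma pw1_itg : mu1.-integrable setT (EFin \o pw 1 (-1)).
Proof.
apply: itgP => //.
  by apply: continuous_measurable_fun; apply: smooth1_cont; exact: smooth1_pw.
under eq_integral => x _ do rewrite ger0_norm ?powR_ge0//.
by apply: pw_integral_lty; lra.
Qed.

Lemma dexp_itg r : 0 < r -> mu1.-integrable setT (EFin \o dexp r).
Proof.
move=> r0; have i1 := itgZ measurableT (1 + 4 / r ^+ 2) pw1_itg.
apply: (itg_le measurableT _ _ i1); first exact: measurable_dexp.
by move=> z _; rewrite ger0_norm ?dexp_ge0//; exact: dexp_le.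
Qed.

(** Half of the exponential absorbs the linear factor. *)
Lemma norm_dexp_le r z : 0 < r -> `|z| * dexp r z <= 2 / r * dexp (r / 2) z.
Proof.
move=> r0; have e : dexp r z = dexp (r / 2) z * dexp (r / 2) z.
  by rewrite /dexp -expRD; congr expR; field.
rewrite e mulrA ler_wpM2r ?dexp_ge0//.
rewrite /dexp expRN ler_pdivrMr ?expR_gt0//.
have h := expR_ge1Dx (r / 2 * `|z|).
apply: (@le_trans _ _ (2 / r * (r / 2 * `|z|))).
  by rewrite le_eqVlt; apply/orP; left; apply/eqP; field; rewrite gt_eqF.
by rewrite ler_pM2l ?divr_gt0//; lra.
Qed.

Lemma dexpM_itg r (u : R -> R) : 0 < r -> measurable_fun setT u ->
  (forall z, `|u z| <= 1) -> mu1.-integrable setT (EFin \o (fun z => dexp r z * u z)).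
Proof.
move=> r0 mu u1; apply: (itg_le measurableT _ _ (dexp_itg r0)).
  by apply: measurable_funM => //; exact: measurable_dexp.
by move=> z _; rewrite normrM ger0_norm ?dexp_ge0// ler_piMr// dexp_ge0.
Qed.

Lemma dexpX_itg r (u : R -> R) : 0 < r -> measurable_fun setT u ->
  (forall z, `|u z| <= 1) -> mu1.-integrable setT (EFin \o (fun z => z * dexp r z * u z)).
Proof.
move=> r0 mu u1; have r2 : 0 < r / 2 by lra.
apply: (itg_le measurableT _ _ (itgZ measurableT (2 / r) (dexp_itg r2))).
  by apply: measurable_funM => //; apply: measurable_funM => //; exact: measurable_dexp.
move=> z _; rewrite !normrM (ger0_norm (dexp_ge0 _ _)) (le_trans _ (norm_dexp_le z r0))//.
by rewrite ler_piMr// mulr_ge0 ?dexp_ge0.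
Qed.

Section antiderivatives.
Variables r y : R.
Hypothesis r0 : r != 0.
Let D := r ^+ 2 + y ^+ 2.
Let D0 : D != 0.
Proof.
rewrite gt_eqF//; have r2 : 0 < r ^+ 2 by rewrite exprn_even_gt0.
by have := sqr_ge0 y; rewrite /D; lra.
Qed.

(** Antiderivatives of [expR (- r z)] times [cos (y z)], [sin (y z)] and [z sin (y z)], the third
    one obtained from the second by parts. The sign of [r] is free: the left half-line uses
    [- r]. *)
Definition acos_ z : R := expR (- (r * z)) * (y * sin (y * z) - r * cos (y * z)) / D.
Definition asin_ z : R := - (expR (- (r * z)) * (r * sin (y * z) + y * cos (y * z)) / D).
Definition azsin_ z : R := z * asin_ z + (r * asin_ z + y * acos_ z) / D.

Let de z : is_derive z (1 : R) (fun z => expR (- (r * z))) (- r * expR (- (r * z))).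
Proof.
have d1 : is_derive z (1 : R) (fun z => - (r * z)) (- r).
  apply: (is_derive_eq (is_deriveN (is_deriveZ r (is_derive_id z (1 : R))))).
  by rewrite /GRing.scale/= mulr1.
apply: (is_derive_eq (@is_derive1_comp _ expR (fun z => - (r * z)) z _ _ (is_derive_expR _) d1)).
by rewrite mulrC.
Qed.

Let ds z : is_derive z (1 : R) (fun z => sin (y * z)) (y * cos (y * z)).
Proof.
have d1 : is_derive z (1 : R) (fun z => y * z) y.
  by apply: (is_derive_eq (is_deriveZ y (is_derive_id z (1 : R)))); rewrite /GRing.scale/= mulr1.
apply: (is_derive_eq (@is_derive1_comp _ sin (fun z => y * z) z _ _ (is_derive_sin _) d1)).
by rewrite mulrC.
Qed.

Let dc z : is_derive z (1 : R) (fun z => cos (y * z)) (- (y * sin (y * z))).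
Proof.
have d1 : is_derive z (1 : R) (fun z => y * z) y.
  by apply: (is_derive_eq (is_deriveZ y (is_derive_id z (1 : R)))); rewrite /GRing.scale/= mulr1.
apply: (is_derive_eq (@is_derive1_comp _ cos (fun z => y * z) z _ _ (is_derive_cos _) d1)).
by rewrite mulNr mulrC.
Qed.

Lemma is_derive_acos z : is_derive z (1 : R) acos_ (expR (- (r * z)) * cos (y * z)).
Proof.
have h := is_deriveM (is_deriveM (de z) (is_deriveB (is_deriveZ y (ds z)) (is_deriveZ r (dc z)))) (is_derive_cst D^-1 z (1 : R)).
apply: (is_derive_eq h); rewrite /GRing.scale/=.
set e := expR _; set s := sin _; set c := cos _.
change ((e * (y * s - r * c)) * 0 + D^-1 * (e * (y * (y * c) - r * (- (y * s))) + (y * s - r * c) * (- r * e)) = e * c).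
rewrite mulr0 add0r; apply: (mulfI D0); rewrite mulVKf// /D; ring.
Qed.

Lemma is_derive_asin z : is_derive z (1 : R) asin_ (expR (- (r * z)) * sin (y * z)).
Proof.
have h := is_deriveN (is_deriveM (is_deriveM (de z) (is_deriveD (is_deriveZ r (ds z)) (is_deriveZ y (dc z)))) (is_derive_cst D^-1 z (1 : R))).
apply: (is_derive_eq h); rewrite /GRing.scale/=.
set e := expR _; set s := sin _; set c := cos _.
change (- ((e * (r * s + y * c)) * 0 + D^-1 * (e * (r * (y * c) + y * (- (y * s))) + (r * s + y * c) * (- r * e))) = e * s).
rewrite mulr0 add0r; apply: (mulfI D0); rewrite mulrN mulVKf// /D; ring.
Qed.

Lemma is_derive_azsin z : is_derive z (1 : R) azsin_ (z * (expR (- (r * z)) * sin (y * z))).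
Proof.
have h := is_deriveD (is_deriveM (is_derive_id z (1 : R)) (is_derive_asin z))
  (is_deriveM (is_deriveD (is_deriveZ r (is_derive_asin z)) (is_deriveZ y (is_derive_acos z))) (is_derive_cst D^-1 z (1 : R))).
apply: (is_derive_eq h); rewrite /GRing.scale/=.
set e := expR _; set s := sin _; set c := cos _.
change (z * (e * s) + asin_ z * 1 + ((r * asin_ z + y * acos_ z) * 0 + D^-1 * (r * (e * s) + y * (e * c))) = z * (e * s)).
rewrite mulr0 add0r mulr1 {1}/asin_ -/e -/s -/c; field.
exact: D0.
Qed.

Lemma antiderivative_bound : exists2 C : R, 0 <= C & forall z,
  [/\ `|acos_ z| <= C * expR (- (r * z)), `|asin_ z| <= C * expR (- (r * z)) &
      `|azsin_ z| <= C * ((1 + `|z|) * expR (- (r * z)))].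
Proof.
have Dp : 0 <= `|D^-1| by [].
pose B := (`|r| + `|y|) * `|D^-1|.
have B0 : 0 <= B by rewrite mulr_ge0// addr_ge0.
have s1 (t : R) : `|sin t| <= 1 by rewrite ler_norml sin_geN1 sin_le1.
have c1 (t : R) : `|cos t| <= 1 by rewrite ler_norml cos_geN1 cos_le1.
have hc z : `|acos_ z| <= B * expR (- (r * z)).
  rewrite /acos_ !normrM (ger0_norm (expR_ge0 _)) [leRHS]mulrC -mulrA ler_wpM2l ?expR_ge0//.
  rewrite ler_wpM2r// (le_trans (ler_normB _ _))// addrC !normrM.
  by apply: lerD; rewrite ler_piMr.
have hs z : `|asin_ z| <= B * expR (- (r * z)).
  rewrite /asin_ normrN !normrM (ger0_norm (expR_ge0 _)) [leRHS]mulrC -mulrA ler_wpM2l ?expR_ge0//.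
  rewrite ler_wpM2r// (le_trans (ler_normD _ _))// !normrM.
  by apply: lerD; rewrite ler_piMr.
exists (B + B * B); first by rewrite addr_ge0// mulr_ge0.
move=> z; have e0 := expR_ge0 (- (r * z)).
have BB : 0 <= B * B by rewrite mulr_ge0.
split.
- by rewrite (le_trans (hc z))// ler_wpM2r// lerDl.
- by rewrite (le_trans (hs z))// ler_wpM2r// lerDl.
rewrite /azsin_ (le_trans (ler_normD _ _))//.
have a1 : `|z * asin_ z| <= B * (`|z| * expR (- (r * z))).
  by rewrite normrM mulrCA ler_wpM2l.
have a2 : `|(r * asin_ z + y * acos_ z) / D| <= B * B * expR (- (r * z)).
  rewrite normrM (@le_trans _ _ ((`|r| * (B * expR (- (r * z))) + `|y| * (B * expR (- (r * z)))) * `|D^-1|))//.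
    rewrite ler_wpM2r// (le_trans (ler_normD _ _))// (normrM r) (normrM y).
    by apply: lerD; [exact: ler_wpM2l (hs z)|exact: ler_wpM2l (hc z)].
  by rewrite le_eqVlt; apply/orP; left; apply/eqP; rewrite /B; ring.
apply: (le_trans (lerD a1 a2)).
have n0 := normr_ge0 z.
have q1 := mulr_ge0 B0 e0; have q2 := mulr_ge0 BB (mulr_ge0 n0 e0).
move: q1 q2; set e := expR _; set n := `|z|; set B2 := B * B => q1 q2.
have -> : (B + B2) * ((1 + n) * e) = B * (n * e) + B2 * e + B * e + B2 * (n * e) by ring.
lra.
Qed.

Lemma antiderivatives0 : [/\ acos_ 0 = - (r / D), asin_ 0 = - (y / D) &
  azsin_ 0 = - (2 * r * y / D ^+ 2)].
Proof.
have E : [/\ acos_ 0 = - (r / D) & asin_ 0 = - (y / D)].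
  rewrite /acos_ /asin_ !mulr0 oppr0 expR0 sin0 cos0; split; ring.
case: E => E1 E2; split => //.
by rewrite /azsin_ E1 E2; field; exact: D0.
Qed.

End antiderivatives.

Lemma expRn_cvg0 (r : R) : 0 < r -> (1 + n%:R) * expR (- (r * n%:R)) @[n --> \oo] --> (0 : R).
Proof.
move=> r0; have r2 : 0 < r ^+ 2 by rewrite exprn_gt0.
have q0 : 0 < 4 / r ^+ 2 by rewrite divr_gt0.
have h : 2 * (1 + 4 / r ^+ 2) * n.+1%:R^-1 @[n --> \oo] --> (0 : R).
  rewrite -(mulr0 (2 * (1 + 4 / r ^+ 2))); apply: cvgM; first exact: cvg_cst.
  exact: cvg_harmonic.
apply: (squeeze_cvgr _ (cvg_cst 0) h); apply: nearW => n.
have n0 : 0 <= n%:R :> R by [].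
rewrite mulr_ge0 ?expR_ge0 ?addr_ge0//=.
have := dexp_le n%:R r0; rewrite /dexp (ger0_norm n0) /pw powR_inv1; last by have := sqr_ge0 (n%:R : R); lra.
move=> h1; apply: (@le_trans _ _ ((1 + n%:R) * ((1 + 4 / r ^+ 2) * (1 + n%:R ^+ 2)^-1))).
  by rewrite ler_wpM2l//; lra.
rewrite -natr1 mulrCA (mulrC 2) -!mulrA ler_wpM2l//; first lra.
have nn := sqr_ge0 (n%:R : R); rewrite ler_pdivrMr; last lra.
rewrite mulrAC ler_pdivlMr; last lra.
by have := sqr_ge0 (n%:R - 1 : R); rewrite !expr2; lra.
Qed.

Lemma continuous_sinM y : continuous (fun z : R => sin (y * z)).
Proof.
move=> z; apply: (@continuous_comp _ _ _ (fun z => y * z) (@sin R)); last exact: continuous_sin.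
by apply: cvgMl_tmp; exact: cvg_id.
Qed.

Lemma continuous_cosM y : continuous (fun z : R => cos (y * z)).
Proof.
move=> z; apply: (@continuous_comp _ _ _ (fun z => y * z) (@cos R)); last exact: continuous_cos.
by apply: cvgMl_tmp; exact: cvg_id.
Qed.

Lemma continuous_expRM r : continuous (fun z : R => expR (- (r * z))).
Proof.
move=> z; apply: (@continuous_comp _ _ _ (fun z => - (r * z)) expR); last exact: continuous_expR.
by apply: cvgN; apply: cvgMl_tmp; exact: cvg_id.
Qed.

Lemma norm_sin_le1 (t : R) : `|sin t| <= 1. Proof. by rewrite ler_norml sin_geN1 sin_le1. Qed.
Lemma norm_cos_le1 (t : R) : `|cos t| <= 1. Proof. by rewrite ler_norml cos_geN1 cos_le1. Qed.

Let pos_side r z : 0 <= z -> dexp r z = expR (- (r * z)).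
Proof. by move=> z0; rewrite /dexp ger0_norm. Qed.
Let neg_side r z : z <= 0 -> dexp r z = expR (- (- r * z)).
Proof. by move=> z0; rewrite /dexp ler0_norm// mulrN mulNr. Qed.

Lemma dexp_transforms r y : 0 < r ->
  [/\ \int[mu1]_z (dexp r z * cos (y * z)) = 2 * r / (r ^+ 2 + y ^+ 2),
      \int[mu1]_z (dexp r z * sin (y * z)) = 0 &
      \int[mu1]_z (z * dexp r z * sin (y * z)) = 4 * r * y / (r ^+ 2 + y ^+ 2) ^+ 2].
Proof.
move=> r0; have rn0 : r != 0 by rewrite gt_eqF.
have rN0 : - r != 0 by rewrite oppr_eq0.
have [C C0 hC] := @antiderivative_bound r y.
have [C' C'0 hC'] := @antiderivative_bound (- r) y.
have [a0 s0 z0] := antiderivatives0 y rn0.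
have [a0' s0' z0'] := antiderivatives0 y rN0.
have lim (F : R -> R) K : (forall z, `|F z| <= K * ((1 + `|z|) * expR (- (r * z)))) ->
    F n%:R @[n --> \oo] --> (0 : R).
  move=> hF; have h : K * ((1 + n%:R) * expR (- (r * n%:R))) @[n --> \oo] --> (0 : R).
    by rewrite -(mulr0 K); apply: cvgM; [exact: cvg_cst|exact: expRn_cvg0].
  apply: norm_cvg0; apply: (squeeze_cvgr _ (cvg_cst 0) h); apply: nearW => n.
  by rewrite normr_ge0/=; have := hF n%:R; rewrite (@ger0_norm _ n%:R).
have limN (F : R -> R) K : (forall z, `|F z| <= K * ((1 + `|z|) * expR (- (- r * z)))) ->
    F (- n%:R) @[n --> \oo] --> (0 : R).
  move=> hF; apply: (lim (fun z => F (- z)) K) => z.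
  by have := hF (- z); rewrite normrN mulrNN.
have up K z (e : R) : 0 <= K -> 0 <= e -> K * e <= K * ((1 + `|z|) * e).
  move=> K0 e0; rewrite ler_wpM2l// mulrDl mul1r lerDl mulr_ge0//.
have ms : measurable_fun setT (fun z : R => sin (y * z)).
  exact: (continuous_measurable_fun (@continuous_sinM y)).
have mc : measurable_fun setT (fun z : R => cos (y * z)).
  exact: (continuous_measurable_fun (@continuous_cosM y)).
have cM (f g : R -> R) : continuous f -> continuous g -> continuous (fun z => f z * g z).
  by move=> cf cg z; apply: cvgM; [exact: cf|exact: cg].
have ci : continuous (fun z : R => z) by move=> z; exact: cvg_id.
have [cs cc] := (@continuous_sinM y, @continuous_cosM y).
have [ce ce'] := (@continuous_expRM r, @continuous_expRM (- r)).
have bc u z (K : R) (F : R -> R) : 0 <= K -> `|F z| <= K * u z -> 0 <= u z ->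
    `|F z| <= K * ((1 + `|z|) * u z) by move=> K0 h u0; rewrite (le_trans h)// up.
split.
- have lF : acos_ r y n%:R @[n --> \oo] --> (0 : R).
    by apply: (lim _ C) => z; have [h _ _] := hC z; exact: (bc (fun z => expR (- (r * z)))) C0 h (expR_ge0 _).
  have lG : acos_ (- r) y (- n%:R) @[n --> \oo] --> (0 : R).
    by apply: (limN _ C') => z; have [h _ _] := hC' z; exact: (bc (fun z => expR (- (- r * z)))) C'0 h (expR_ge0 _).
  apply: (etrans (Rint_two_sided (dexpM_itg r0 mc (fun z => norm_cos_le1 _))
    (fun z hz => congr1 (fun e => e * cos (y * z)) (pos_side r hz))
    (fun z hz => congr1 (fun e => e * cos (y * z)) (neg_side r hz))
    (is_derive_acos y rn0) (is_derive_acos y rN0) (cM _ _ ce cc) (cM _ _ ce' cc) lF lG)).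
  by rewrite a0 a0' sqrrN; ring.
- have lF : asin_ r y n%:R @[n --> \oo] --> (0 : R).
    by apply: (lim _ C) => z; have [_ h _] := hC z; exact: (bc (fun z => expR (- (r * z)))) C0 h (expR_ge0 _).
  have lG : asin_ (- r) y (- n%:R) @[n --> \oo] --> (0 : R).
    by apply: (limN _ C') => z; have [_ h _] := hC' z; exact: (bc (fun z => expR (- (- r * z)))) C'0 h (expR_ge0 _).
  apply: (etrans (Rint_two_sided (dexpM_itg r0 ms (fun z => norm_sin_le1 _))
    (fun z hz => congr1 (fun e => e * sin (y * z)) (pos_side r hz))
    (fun z hz => congr1 (fun e => e * sin (y * z)) (neg_side r hz))
    (is_derive_asin y rn0) (is_derive_asin y rN0) (cM _ _ ce cs) (cM _ _ ce' cs) lF lG)).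
  by rewrite s0 s0' sqrrN; ring.
- have lF : azsin_ r y n%:R @[n --> \oo] --> (0 : R).
    by apply: (lim _ C) => z; have [_ _ h] := hC z.
  have lG : azsin_ (- r) y (- n%:R) @[n --> \oo] --> (0 : R).
    by apply: (limN _ C') => z; have [_ _ h] := hC' z.
  have ep z : 0 <= z -> z * dexp r z * sin (y * z) = z * (expR (- (r * z)) * sin (y * z)).
    by move=> hz; rewrite pos_side// mulrA.
  have en z : z <= 0 -> z * dexp r z * sin (y * z) = z * (expR (- (- r * z)) * sin (y * z)).
    by move=> hz; rewrite neg_side// mulrA.
  apply: (etrans (Rint_two_sided (dexpX_itg r0 ms (fun z => norm_sin_le1 _)) ep en
    (is_derive_azsin y rn0) (is_derive_azsin y rN0) (cM _ _ ci (cM _ _ ce cs)) (cM _ _ ci (cM _ _ ce' cs)) lF lG)).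
  by rewrite z0 z0' sqrrN; ring.
Qed.

End two_sided_exponential.

(** * A T T^* bound for integral operators with a bounded kernel *)

Lemma integral_le_monotone (R : realType) (d : measure_display) (T : measurableType d)
    (mu : {measure set T -> \bar R}) (f_ : nat -> T -> R) (f : T -> R) (C : \bar R) :
  (forall n, measurable_fun setT (f_ n)) -> (forall n x, 0 <= f_ n x) ->
  (forall x, {homo f_ ^~ x : m n / (m <= n)%N >-> m <= n}) ->
  (forall x, f_ n x @[n --> \oo] --> f x) ->
  (forall n, \int[mu]_x (f_ n x)%:E <= C)%E -> (\int[mu]_x (f x)%:E <= C)%E.
Proof.
move=> mf f0 nd cf hC.
have mc := @monotone_convergence _ _ _ mu setT measurableT (fun n x => (f_ n x)%:E)
  (fun n => (measurable_EFinP _ _).2 (mf n)) (fun n x _ => f0 n x : (0 <= (f_ n x)%:E)%E)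
  (fun x _ m n mn => nd x m n mn).
have -> : (\int[mu]_x (f x)%:E = \int[mu]_x limn (fun n => (f_ n x)%:E))%E.
  apply: eq_integral => x _; apply/esym/cvg_lim => //.
  by apply: cvg_EFin; [exact: nearW|exact: cf].
rewrite mc; apply: lime_le; last exact: nearW.
apply: ereal_nondecreasing_is_cvgn => m n mn; apply: ge0_le_integral => //.
- by move=> x _; rewrite lee_fin.
- by apply/measurable_EFinP.
- by apply/measurable_EFinP.
- by move=> x _; rewrite lee_fin; exact: nd.
Qed.

Lemma le_norm_Rint (R : realType) (d : measure_display) (T : measurableType d)
    (mu : {measure set T -> \bar R}) (D : set T) (f : T -> R) : measurable D ->
  mu.-integrable D (EFin \o f) ->
  (`|\int[mu]_(x in D) f x|%:E <= \int[mu]_(x in D) `|f x|%:E)%E.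
Proof.
move=> mD fi; rewrite (itgE mD (itg_norm fi)) lee_fin; exact: le_normr_Rintegral.
Qed.

Section abstract_bessel.
Context (R : realType) (d1 d2 : measure_display).
Context (Y : measurableType d1) (X : measurableType d2).
Variables (l : {sigma_finite_measure set Y -> \bar R}).
Variables (m : {sigma_finite_measure set X -> \bar R}).
Variable tau : Y * X -> R.
Hypothesis mtau : measurable_fun setT tau.
Hypothesis tau1 : forall p, `|tau p| <= 1.

Let mtau1 x : measurable_fun setT (fun y => tau (y, x)).
Proof. exact: measurableT_comp. Qed.
Let mtau2 y : measurable_fun setT (fun x => tau (y, x)).
Proof. exact: measurableT_comp. Qed.

Lemma bounded_kernel_itg (d : measure_display) (T : measurableType d)
    (mu : {measure set T -> \bar R}) (a t : T -> R) :
  mu.-integrable setT (EFin \o a) -> measurable_fun setT t -> (forall x, `|t x| <= 1) ->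
  mu.-integrable setT (EFin \o (fun x => a x * t x)).
Proof.
move=> ai mt t1; apply: (itg_le measurableT _ _ (itg_norm ai)).
  by apply: measurable_funM => //; exact: itg_meas ai.
by move=> x _; rewrite normrM ler_piMr.
Qed.

Lemma kernel_fubini (a : Y -> R) (g : X -> R) :
  l.-integrable setT (EFin \o a) -> m.-integrable setT (EFin \o g) ->
  [/\ l.-integrable setT (EFin \o (fun y => a y * \int[m]_x (g x * tau (y, x)))),
      m.-integrable setT (EFin \o (fun x => g x * \int[l]_y (a y * tau (y, x)))) &
      \int[l]_y (a y * \int[m]_x (g x * tau (y, x))) =
      \int[m]_x (g x * \int[l]_y (a y * tau (y, x)))].
Proof.
move=> ai gi; have ma := itg_meas ai; have mg := itg_meas gi.
pose F (p : Y * X) : R := a p.1 * (g p.2 * tau p).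
have mF : measurable_fun setT F.
  by apply: measurable_funM; [exact: measurableT_comp|apply: measurable_funM => //; exact: measurableT_comp].
have Fi : (l \x m)%E.-integrable setT (EFin \o F).
  apply: itgP => //.
  apply: (@le_lt_trans _ _ (\int[(l \x m)%E]_p (`|a p.1| * `|g p.2|)%:E)%E).
    apply: ge0_le_integral => //.
    - by apply/measurable_EFinP; exact: measurableT_comp.
    - apply/measurable_EFinP; apply: measurable_funM; apply: measurableT_comp => //; exact: measurableT_comp.
    - move=> p _; rewrite lee_fin !normrM; apply: ler_wpM2l => //.
      by rewrite ler_piMr.
  rewrite fubini_tonelli1//=; last first.
    apply/measurable_EFinP; apply: measurable_funM; apply: measurableT_comp => //; exact: measurableT_comp.
  rewrite /fubini_F /=.
  have gN := itgE measurableT (itg_norm gi).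
  under eq_integral => y _.
    under eq_integral => x _ do rewrite EFinM.
    rewrite ge0_integralZl//; first (rewrite gN; over).
    by apply/measurable_EFinP; exact: measurableT_comp.
  rewrite ge0_integralZr//.
  - by rewrite (itgE measurableT (itg_norm ai)) -EFinM ltry.
  - by apply/measurable_EFinP; exact: measurableT_comp.
  - by rewrite lee_fin; apply: Rintegral_ge0 => // x _.
have s1 y : m.-integrable setT (EFin \o (fun x => F (y, x))).
  rewrite /F /=; apply: (itgZ measurableT (a y) (f := fun x => g x * tau (y, x))).
  exact: bounded_kernel_itg.
have s2 x : l.-integrable setT (EFin \o (fun y => F (y, x))).
  rewrite (_ : (fun y => _) = (fun y => g x * (a y * tau (y, x)))); last first.
    by apply/funext => y; rewrite /F /= mulrCA.
  by apply: (itgZ measurableT); exact: bounded_kernel_itg.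
have [i1 e1] := Rint_prod12 Fi s1.
have e2 := Rint_prod21 Fi s2.
have E1 y : \int[m]_x F (y, x) = a y * \int[m]_x (g x * tau (y, x)).
  by rewrite /F /= RintegralZl//; exact: bounded_kernel_itg.
have E2 x : \int[l]_y F (y, x) = g x * \int[l]_y (a y * tau (y, x)).
  rewrite -RintegralZl//; last exact: bounded_kernel_itg.
  by apply: eq_Rintegral => y _; rewrite /F /= mulrCA.
have i2 : m.-integrable setT (EFin \o (fun x => \int[l]_y F (y, x))).
  have e : fubini_G l (EFin \o F) = EFin \o (fun x => \int[l]_y F (y, x)).
    by apply/funext => x; rewrite /fubini_G /= -itgE.
  apply: (itg_le measurableT _ _ (itgZ measurableT (\int[l]_y `|a y|) (itg_norm gi))).
    by have := measurable_fubini_G Fi; rewrite e => /measurable_EFinP.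
  move=> x _; rewrite E2 normrM mulrC ler_wpM2r//.
  have ix : l.-integrable setT (EFin \o (fun y => a y * tau (y, x))) by exact: bounded_kernel_itg.
  rewrite (le_trans (le_normr_Rintegral _ ix))//.
  apply: le_Rintegral => //; [exact: itg_norm|exact: itg_norm|].
  by move=> y _; rewrite normrM ler_piMr.
split.
- by move: i1; congr integrable; apply/funext => y /=; rewrite E1.
- by move: i2; congr integrable; apply/funext => x /=; rewrite E2.
- transitivity (\int[l]_y \int[m]_x F (y, x)); first by apply: eq_Rintegral => y _; rewrite E1.
  by rewrite -e1 e2; apply: eq_Rintegral => x _; rewrite E2.
Qed.

Variable rho : Y -> R.
Hypothesis rho0 : forall y, 0 < rho y.
Hypothesis rhoi : l.-integrable setT (EFin \o rho).
Hypothesis rhoV : measurable_fun setT (fun y => (rho y)^-1).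
Variables (k : X * X -> R) (B : R).
Hypothesis B0 : 0 <= B.
Hypothesis mk : measurable_fun setT k.
Hypothesis k0 : forall p, 0 <= k p.
Hypothesis kE : forall x x', `|\int[l]_y (rho y * tau (y, x) * tau (y, x'))| <= k (x, x').
Hypothesis kB1 : forall x, (\int[m]_x' (k (x, x'))%:E <= B%:E)%E.
Hypothesis kB2 : forall x', (\int[m]_x (k (x, x'))%:E <= B%:E)%E.

(** Fubini requires an integrable factor in [y]; measurability is obtained for the product with
    [rho], and the positive factor is then divided out. *)
Lemma measurable_transform (g : X -> R) : m.-integrable setT (EFin \o g) ->
  measurable_fun setT (fun y => \int[m]_x (g x * tau (y, x))).
Proof.
move=> gi; have [/itg_meas h _ _] := kernel_fubini rhoi gi.
have := measurable_funM rhoV h; congr measurable_fun; apply/funext => y /=.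
by rewrite mulKf// gt_eqF.
Qed.

(** Schur's test: the product of the two values of [g] is at most half the sum of their squares, and
    each square is integrated first in the variable that it does not contain. *)
Lemma schur (g : X -> R) : measurable_fun setT g ->
  (\int[m]_x \int[m]_x' (`|g x| * `|g x'| * k (x, x'))%:E <=
   B%:E * \int[m]_x ((g x) ^+ 2)%:E)%E.
Proof.
move=> mg.
have mN : measurable_fun setT (fun x => `|g x|) by exact: measurableT_comp.
have mk1 x : measurable_fun setT (fun x' => k (x, x')) by exact: measurableT_comp.
have mk2 x' : measurable_fun setT (fun x => k (x, x')) by exact: measurableT_comp.
have mg2 : measurable_fun setT (fun x => g x ^+ 2) by exact: measurable_funX.
pose F1 (p : X * X) : \bar R := ((2^-1 * g p.1 ^+ 2) * k p)%:E.
pose F2 (p : X * X) : \bar R := ((2^-1 * g p.2 ^+ 2) * k p)%:E.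
have mF1 : measurable_fun setT F1.
  apply/measurable_EFinP; apply: measurable_funM => //; apply: measurable_funM => //.
  exact: (measurableT_comp mg2).
have mF2 : measurable_fun setT F2.
  apply/measurable_EFinP; apply: measurable_funM => //; apply: measurable_funM => //.
  exact: (measurableT_comp mg2).
have hk p c : 0 <= 2^-1 * c ^+ 2 * k p.
  by apply: mulr_ge0 => //; apply: mulr_ge0; rewrite ?sqr_ge0// invr_ge0.
have F10 p : (0 <= F1 p)%E by rewrite lee_fin.
have F20 p : (0 <= F2 p)%E by rewrite lee_fin.
have mF : measurable_fun setT (fun p : X * X => (`|g p.1| * `|g p.2| * k p)%:E).
  apply/measurable_EFinP; apply: measurable_funM => //; apply: measurable_funM.
  - exact: (measurableT_comp mN).
  - exact: (measurableT_comp mN).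
apply: (@le_trans _ _ (\int[(m \x m)%E]_p (F1 p + F2 p))%E).
  rewrite -(@fubini_tonelli1 _ _ _ _ _ m m (fun p : X * X => (`|g p.1| * `|g p.2| * k p)%:E))//; last first.
    by move=> p; rewrite lee_fin; apply: mulr_ge0 => //; exact: mulr_ge0.
  apply: ge0_le_integral => //.
  - by move=> p _; rewrite lee_fin; apply: mulr_ge0 => //; exact: mulr_ge0.
  - exact: emeasurable_funD.
  - move=> p _; rewrite /F1 /F2 -EFinD lee_fin -mulrDl ler_wpM2r//.
    have := sqr_ge0 (`|g p.1| - `|g p.2|).
    rewrite sqrrB !real_normK ?num_real//; lra.
rewrite ge0_integralD//.
have mh : measurable_fun setT (fun x => (2^-1 * g x ^+ 2)%:E).
  by apply/measurable_EFinP; apply: measurable_funM.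
have h0 x : (0 <= (2^-1 * g x ^+ 2)%:E)%E.
  by rewrite lee_fin mulr_ge0 ?sqr_ge0// invr_ge0.
have half : (\int[m]_x ((2^-1 * g x ^+ 2)%:E * B%:E) + \int[m]_x ((2^-1 * g x ^+ 2)%:E * B%:E) =
    B%:E * \int[m]_x ((g x) ^+ 2)%:E)%E.
  rewrite -ge0_integralD//; last 4 first.
  - by move=> x _; rewrite mule_ge0// lee_fin.
  - by apply: emeasurable_funM => //.
  - by move=> x _; rewrite mule_ge0// lee_fin.
  - by apply: emeasurable_funM => //.
  rewrite -ge0_integralZl ?lee_fin//.
  - by apply: eq_integral => x _; rewrite -!EFinM -EFinD; congr EFin; field.
  - exact/measurable_EFinP.
  - by move=> x _; rewrite lee_fin sqr_ge0.
rewrite -half; apply: leeD.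
- rewrite fubini_tonelli1// /fubini_F; apply: ge0_le_integral => //.
  + by move=> x _; apply: integral_ge0 => x' _.
  + exact: measurable_fun_fubini_tonelli_F.
  + by apply: emeasurable_funM.
  + move=> x _; rewrite /F1 /=; under eq_integral do rewrite EFinM.
    rewrite ge0_integralZl//.
    * by rewrite lee_wpmul2l.
    * exact/measurable_EFinP.
    * by move=> x' _; rewrite lee_fin.
- rewrite fubini_tonelli2// /fubini_G; apply: ge0_le_integral => //.
  + by move=> x _; apply: integral_ge0 => x' _.
  + exact: measurable_fun_fubini_tonelli_G.
  + by apply: emeasurable_funM.
  + move=> x _; rewrite /F2 /=; under eq_integral do rewrite EFinM.
    rewrite ge0_integralZl//.
    * by rewrite lee_wpmul2l.
    * exact/measurable_EFinP.
    * by move=> x' _; rewrite lee_fin.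
Qed.

(** Expanding the square and exchanging the integrals gives the quadratic form of [g] with kernel
    the [rho]-weighted integral of the product of two values of [tau], to which Schur's test
    applies. The integrable weight [rho] makes the exchange legitimate. *)
Lemma abstract_bessel (g : X -> R) : m.-integrable setT (EFin \o g) ->
  (\int[l]_y (rho y * (\int[m]_x (g x * tau (y, x))) ^+ 2)%:E <=
   B%:E * \int[m]_x ((g x) ^+ 2)%:E)%E.
Proof.
move=> gi; have mg := itg_meas gi; pose h y := \int[m]_x (g x * tau (y, x)).
have mh : measurable_fun setT h by exact: measurable_transform.
have [i1 _ _] := kernel_fubini rhoi gi.
pose N := \int[m]_x `|g x|.
have hN y : `|h y| <= N.
  have iy := bounded_kernel_itg gi (mtau2 y) (fun x => tau1 (y, x)).
  rewrite (le_trans (le_normr_Rintegral _ iy))//.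
  apply: le_Rintegral => //; [exact: itg_norm|exact: itg_norm|].
  by move=> x _; rewrite normrM ler_piMr.
have [_ gH E] := kernel_fubini i1 gi.
pose H x := \int[l]_y (rho y * h y * tau (y, x)).
pose K x x' := \int[l]_y (rho y * tau (y, x) * tau (y, x')).
have rt x : l.-integrable setT (EFin \o (fun y => rho y * tau (y, x))).
  exact: bounded_kernel_itg.
have HE x : H x = \int[m]_x' (g x' * K x x').
  have [_ _ <-] := kernel_fubini (rt x) gi.
  by apply: eq_Rintegral => y _; rewrite /h mulrAC.
have gK x : m.-integrable setT (EFin \o (fun x' => g x' * K x x')).
  by have [_ ? _] := kernel_fubini (rt x) gi.
have E2 : \int[l]_y (rho y * h y ^+ 2) = \int[m]_x (g x * H x).
  by rewrite -E; apply: eq_Rintegral => y _; rewrite expr2 mulrA.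
have i2 : l.-integrable setT (EFin \o (fun y => rho y * h y ^+ 2)).
  apply: (itg_le measurableT _ _ (itgZ measurableT N (itg_norm i1))).
    apply: measurable_funM; [exact: itg_meas rhoi|exact: measurable_funX].
  move=> y _; rewrite expr2 mulrA normrM mulrC; exact: ler_wpM2r.
rewrite (itgE measurableT i2) E2; apply: le_trans (schur mg).
apply: (@le_trans _ _ (`|\int[m]_x (g x * H x)|%:E)); first by rewrite lee_fin ler_norm.
apply: (le_trans (le_norm_Rint measurableT gH)).
have mk1 x : measurable_fun setT (fun x' => k (x, x')) by exact: measurableT_comp.
have mN : measurable_fun setT (fun x => `|g x|) by exact: measurableT_comp.
have mF : measurable_fun setT (fun p : X * X => (`|g p.1| * `|g p.2| * k p)%:E).
  apply/measurable_EFinP; apply: measurable_funM => //; apply: measurable_funM.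
  - exact: (measurableT_comp mN).
  - exact: (measurableT_comp mN).
apply: ge0_le_integral => //.
- by apply/measurable_EFinP; apply: measurableT_comp => //; exact: itg_meas gH.
- have := @measurable_fun_fubini_tonelli_F _ _ _ _ _ m _ mF; apply => p.
  by rewrite lee_fin; apply: mulr_ge0 => //; exact: mulr_ge0.
- move=> x _; rewrite normrM.
  under eq_integral do rewrite -mulrA EFinM.
  rewrite ge0_integralZl//.
  + rewrite EFinM lee_wpmul2l ?lee_fin// -/(H x) HE.
    apply: (le_trans (le_norm_Rint measurableT (gK x))).
    apply: ge0_le_integral => //.
    * by apply/measurable_EFinP; apply: measurableT_comp => //; exact: itg_meas (gK x).
    * by apply/measurable_EFinP; exact: measurable_funM.
    * by move=> x' _; rewrite lee_fin (normrM (g x')); apply: ler_wpM2l => //; exact: kE.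
  + by apply/measurable_EFinP; exact: measurable_funM.
  + by move=> x' _; rewrite lee_fin mulr_ge0.
Qed.

End abstract_bessel.

(** * The L^2 bound for the sine transform in the plane *)

Lemma Rint_tens2 (R : realType) (f g : R -> R) :
  (@lebesgue_measure R).-integrable setT (EFin \o f) ->
  (@lebesgue_measure R).-integrable setT (EFin \o g) ->
  mu2.-integrable setT (EFin \o (tens2 f g : mplane R -> R)) /\
  \int[mu2]_y tens2 f g y =
    \int[@lebesgue_measure R]_x f x * \int[@lebesgue_measure R]_x g x.
Proof.
move=> fi gi; have mf := itg_meas fi; have mg := itg_meas gi.
have mt : measurable_fun setT (tens2 f g : mplane R -> R).
  by apply: measurable_funM; exact: measurableT_comp.
have ti : mu2.-integrable setT (EFin \o (tens2 f g : mplane R -> R)).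
  apply: itgP => //; rewrite /mu2 fubini_tonelli1//=; last first.
    by apply/measurable_EFinP; exact: measurableT_comp.
  rewrite /fubini_F /tens2 /=.
  have gN := itgE measurableT (itg_norm gi).
  under eq_integral => y _.
    under eq_integral => x _ do rewrite normrM EFinM.
    rewrite ge0_integralZl//; first (rewrite gN; over).
    by apply/measurable_EFinP; exact: measurableT_comp.
  rewrite ge0_integralZr//.
  - by rewrite (itgE measurableT (itg_norm fi)) -EFinM ltry.
  - by apply/measurable_EFinP; exact: measurableT_comp.
  - by rewrite lee_fin; apply: Rintegral_ge0 => // x _.
split => //.
have [|_ ->] := Rint_prod12 ti; first by move=> x; exact: (itgZ measurableT (f x) gi).
transitivity (\int[@lebesgue_measure R]_x (f x * \int[@lebesgue_measure R]_x g x)).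
  by apply: eq_Rintegral => x _; rewrite /tens2 /= RintegralZl.
by rewrite RintegralZr.
Qed.

Section plane_bessel.
Variable R : realType.
Local Notation mu1 := (@lebesgue_measure R).
Local Notation mu2 := (@mu2 R).
Implicit Types (e : R) (y z : mplane R).

Definition sinT (Z : mplane R -> R) y : R := \int[mu2]_z (Z z * sin (dotp y z)).

(** The cosine transform of the two-sided exponential of rate [e], of total mass [2 pi] for every
    [e]. *)
Definition poisson e (u : R) : R := 2 * e / (e ^+ 2 + u ^+ 2).

Lemma poisson_ge0 e u : 0 < e -> 0 <= poisson e u.
Proof. by move=> e0; rewrite /poisson divr_ge0 ?mulr_ge0 ?addr_ge0 ?sqr_ge0// ltW. Qed.

Let is_derive_atan_affine e a s (t : R) : 0 < e -> s ^+ 2 = 1 ->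
  is_derive t (1 : R) (fun t => 2 * s * atan (e^-1 * (s * t + a))) (poisson e (s * t + a)).
Proof.
move=> e0 s1.
have d1 : is_derive t (1 : R) (fun t => e^-1 * (s * t + a)) (e^-1 * s).
  apply: (is_derive_eq (is_deriveZ e^-1 (is_deriveD (is_deriveZ s (is_derive_id t (1 : R))) (is_derive_cst a t 1)))).
  by rewrite /GRing.scale/= addr0 mulr1.
have d2 := @is_derive1_comp _ atan (fun t => e^-1 * (s * t + a)) t _ _ (is_derive1_atan _) d1.
apply: (is_derive_eq (is_deriveZ (2 * s) d2)).
rewrite /GRing.scale/= /poisson; set u := s * t + a.
have h1 : e ^+ 2 + u ^+ 2 != 0 by rewrite gt_eqF// ltr_pwDl ?sqr_ge0// exprn_gt0.
have h2 : 1 + (e^-1 * u) ^+ 2 != 0 by rewrite gt_eqF// ltr_pwDl ?sqr_ge0.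
have -> : 1 + (e^-1 * u) ^+ 2 = (e ^+ 2 + u ^+ 2) / e ^+ 2.
  by field; rewrite gt_eqF.
transitivity (s ^+ 2 * (2 * e / (e ^+ 2 + u ^+ 2))); last by rewrite s1 mul1r.
by field; rewrite h1 gt_eqF.
Qed.

Lemma continuous_poisson e a s : 0 < e -> continuous (fun t : R => poisson e (s * t + a)).
Proof.
move=> e0 t; apply: cvgM; first exact: cvg_cst.
have h : e ^+ 2 + (s * t + a) ^+ 2 != 0 by rewrite gt_eqF// ltr_pwDl ?sqr_ge0// exprn_gt0.
apply: cvgV => //; apply: cvgD; first exact: cvg_cst.
have c : (s * t + a) @[t --> t] --> s * t + a.
  by apply: cvgD; [apply: cvgMl_tmp; exact: cvg_id|exact: cvg_cst].
by apply: (cvgM c c).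
Qed.

(** The antiderivative is twice an arctangent up to sign, so that the bound [2 pi] does not depend
    on [e]. The sign [s] covers both sums and differences of the two variables. *)
Lemma poisson_integral_le e a s : 0 < e -> s ^+ 2 = 1 ->
  (\int[mu1]_t (poisson e (s * t + a))%:E <= (2 * pi)%:E)%E.
Proof.
move=> e0 s1; have cp := @continuous_poisson e a s e0.
have p0 t := poisson_ge0 (s * t + a) e0.
have mp : measurable_fun setT (fun t => poisson e (s * t + a)) by exact: continuous_measurable_fun.
pose f_ n t : R := ((fun t => poisson e (s * t + a)) \_ `[- n%:R, n%:R]) t.
have mf n : measurable_fun setT (f_ n).
  by apply/(measurable_restrictT _ (measurable_itv _)); exact: measurable_funTS.
apply: (@integral_le_monotone _ _ _ mu1 f_) => //.
- by move=> n x; rewrite /f_ patchE; case: ifP.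
- move=> x m n mn; rewrite /f_ !patchE; case: ifPn => [|_]; last by case: ifP.
  rewrite inE/= in_itv/= => /andP[h1 h2]; rewrite mem_set//= in_itv/=.
  have hmn : m%:R <= n%:R :> R by rewrite ler_nat.
  by apply/andP; split; lra.
- move=> x; apply: cvg_near_cst; near=> n; rewrite /f_ patchE mem_set//= in_itv/= -ler_norml.
  by near: n; exact: nbhs_infty_ger.
move=> n; have dF t := is_derive_atan_affine a t e0 s1.
have n0 : - n%:R <= n%:R :> R by apply: (@le_trans _ _ 0); rewrite ?oppr_le0.
rewrite (_ : (fun x => _) = (EFin \o (fun t => poisson e (s * t + a))) \_ `[- n%:R, n%:R]); last first.
  by apply/funext => t; rewrite /f_ /= !patchE; case: ifP.
rewrite -integral_mkcond itgE//; last exact: continuous_itv_integrable.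
rewrite (FTC dF cp n0) lee_fin -mulrBr.
have [a1 a2] := (@atan_gtNpi2 R (e^-1 * (s * n%:R + a)), @atan_ltpi2 R (e^-1 * (s * n%:R + a))).
have [a3 a4] := (@atan_gtNpi2 R (e^-1 * (s * - n%:R + a)), @atan_ltpi2 R (e^-1 * (s * - n%:R + a))).
have : s = 1 \/ s = -1.
  by move/eqP: s1; rewrite sqrf_eq1 => /orP[/eqP|/eqP]; [left|right].
move: a1 a2 a3 a4; set A := atan _; set A' := atan _ => a1 a2 a3 a4.
by case=> ->; lra.
Unshelve. all: by end_near. Qed.

Lemma measurable_poisson e : 0 < e -> measurable_fun setT (poisson e).
Proof.
move=> e0; rewrite (_ : poisson e = fun t => poisson e (1 * t + 0)).
  by apply: continuous_measurable_fun; exact: continuous_poisson.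
by apply/funext => t; rewrite mul1r addr0.
Qed.

Definition poisson2 e (u : mplane R) : R := poisson e u.1 * poisson e u.2.

Lemma poisson2_integral_le e (a : mplane R) s : 0 < e -> s ^+ 2 = 1 ->
  (\int[mu2]_z (poisson2 e (s * z.1 + a.1, s * z.2 + a.2))%:E <= ((2 * pi) ^+ 2)%:E)%E.
Proof.
move=> e0 s1; pose p (c : R) (t : R) := poisson e (s * t + c).
have mp c : measurable_fun setT (p c).
  by apply: continuous_measurable_fun; exact: continuous_poisson.
have p0 c t : 0 <= p c t by exact: poisson_ge0.
rewrite /Defs.mu2 fubini_tonelli1//=; last 2 first.
- apply/measurable_EFinP; apply: measurable_funM.
    by apply: (measurableT_comp (mp a.1)).
  by apply: (measurableT_comp (mp a.2)).
- by move=> z; rewrite lee_fin mulr_ge0//; exact: poisson_ge0.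
rewrite /fubini_F /=.
apply: (@le_trans _ _ (\int[mu1]_x ((p a.1 x)%:E * (2 * pi)%:E))%E).
  have pp : 0 <= 2 * pi :> R by rewrite mulr_ge0 ?pi_ge0.
  apply: ge0_le_integral => //.
  - by move=> x _; apply: integral_ge0 => y _; rewrite lee_fin mulr_ge0//; exact: poisson_ge0.
  - apply: (@measurable_fun_fubini_tonelli_F _ _ _ _ _ mu1 (fun z : mplane R => (poisson2 e (s * z.1 + a.1, s * z.2 + a.2))%:E)).
    + apply/measurable_EFinP; apply: measurable_funM.
        by apply: (measurableT_comp (mp a.1)).
      by apply: (measurableT_comp (mp a.2)).
    + by move=> z; rewrite lee_fin mulr_ge0//; exact: poisson_ge0.
  - by apply: emeasurable_funM => //; apply/measurable_EFinP; exact: mp.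
  - move=> x _; rewrite /poisson2 /=.
    under eq_integral do rewrite EFinM.
    rewrite ge0_integralZl//.
    + by rewrite lee_wpmul2l ?lee_fin ?p0//; exact: poisson_integral_le.
    + by apply/measurable_EFinP; exact: mp a.2.
    + by move=> y _; rewrite lee_fin; exact: p0.
    + by rewrite lee_fin; exact: p0.
rewrite ge0_integralZr//.
- have -> : (((2 * pi) ^+ 2 : R)%:E = (2 * pi)%:E * (2 * pi)%:E)%E by rewrite -EFinM.
  by apply: lee_wpmul2r; [rewrite lee_fin mulr_ge0 ?pi_ge0|exact: poisson_integral_le].
- by apply/measurable_EFinP; exact: mp.
- by move=> x _; rewrite lee_fin; exact: p0.
- by rewrite lee_fin mulr_ge0 ?pi_ge0.
Qed.

Definition weight e y : R := dexp e y.1 * dexp e y.2.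

Lemma weight_gt0 e y : 0 < weight e y.
Proof. by rewrite mulr_gt0 ?expR_gt0. Qed.

Lemma weight_itg e : 0 < e -> mu2.-integrable setT (EFin \o weight e).
Proof. by move=> e0; have [] := Rint_tens2 (dexp_itg e0) (dexp_itg e0). Qed.

(** After expansion of the cosine of the sum, the product of the two sine transforms vanishes by
    parity. *)
Lemma weight_cos e (u : mplane R) : 0 < e ->
  \int[mu2]_y (weight e y * cos (dotp y u)) = poisson2 e u.
Proof.
move=> e0.
have mc c : measurable_fun setT (fun z : R => cos (c * z)).
  exact: (continuous_measurable_fun (@continuous_cosM R c)).
have ms c : measurable_fun setT (fun z : R => sin (c * z)).
  exact: (continuous_measurable_fun (@continuous_sinM R c)).
have ic c := dexpM_itg e0 (mc c) (fun t => norm_cos_le1 (c * t)).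
have is_ c := dexpM_itg e0 (ms c) (fun t => norm_sin_le1 (c * t)).
have [i1 E1] := Rint_tens2 (ic u.1) (ic u.2).
have [i2 E2] := Rint_tens2 (is_ u.1) (is_ u.2).
have [C1 S1 _] := dexp_transforms u.1 e0.
have [C2 S2 _] := dexp_transforms u.2 e0.
transitivity (\int[mu2]_y (tens2 (fun t => dexp e t * cos (u.1 * t)) (fun t => dexp e t * cos (u.2 * t)) y -
    tens2 (fun t => dexp e t * sin (u.1 * t)) (fun t => dexp e t * sin (u.2 * t)) y)).
  apply: eq_Rintegral => y _; rewrite /weight /dotp /tens2 cosD.
  by rewrite (mulrC y.1) (mulrC y.2); ring.
by rewrite RintegralB// E1 E2 C1 C2 S1 S2 mulr0 subr0.
Qed.

Let tau (p : mplane R * mplane R) : R := sin (dotp p.1 p.2).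

Let c1 (p : mplane R * mplane R) : R := p.1.1.
Let c2 (p : mplane R * mplane R) : R := p.1.2.
Let c3 (p : mplane R * mplane R) : R := p.2.1.
Let c4 (p : mplane R * mplane R) : R := p.2.2.

Let mcoord : [/\ measurable_fun setT c1, measurable_fun setT c2,
  measurable_fun setT c3 & measurable_fun setT c4].
Proof.
by split; [exact: (measurableT_comp measurable_fst measurable_fst)
  |exact: (measurableT_comp measurable_snd measurable_fst)
  |exact: (measurableT_comp measurable_fst measurable_snd)
  |exact: (measurableT_comp measurable_snd measurable_snd)].
Qed.

Let mtau : measurable_fun setT tau.
Proof.
have [h1 h2 h3 h4] := mcoord.
have md : measurable_fun setT (fun p : mplane R * mplane R => c1 p * c3 p + c2 p * c4 p).
  by apply: measurable_funD; exact: measurable_funM.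
have ms : measurable_fun setT (@sin R) by exact: (continuous_measurable_fun (@continuous_sin R)).
exact: (measurableT_comp ms md).
Qed.

Let tau1 p : `|tau p| <= 1. Proof. exact: norm_sin_le1. Qed.

(** As [2 sin a sin b = cos (a - b) - cos (a + b)], the kernel of the T T^* form is half a
    difference of product Poisson kernels. It is bounded here by half their sum, of mass at most
    [(2 pi)^2] in each variable. *)
Let bk e (p : mplane R * mplane R) : R :=
  2^-1 * (poisson2 e (c1 p - c3 p, c2 p - c4 p) + poisson2 e (c1 p + c3 p, c2 p + c4 p)).

Let poisson2_ge0 e u : 0 < e -> 0 <= poisson2 e u.
Proof. by move=> e0; rewrite mulr_ge0// poisson_ge0. Qed.

Let bk_bound e (u v : mplane R) (s : R) : 0 < e -> s ^+ 2 = 1 ->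
  (\int[mu2]_z (2^-1 * (poisson2 e ((s * z.1 + u.1, s * z.2 + u.2) : mplane R) +
     poisson2 e ((1 * z.1 + v.1, 1 * z.2 + v.2) : mplane R)))%:E <= ((2 * pi) ^+ 2)%:E)%E.
Proof.
move=> e0 s1.
have mp (w : mplane R) (c : R) : measurable_fun setT
    (fun z : mplane R => poisson2 e ((c * z.1 + w.1, c * z.2 + w.2) : mplane R)).
  apply: measurable_funM.
    apply: (measurableT_comp (measurable_poisson e0)).
    by apply: measurable_funD => //; apply: measurable_funM => //; exact: measurable_fst.
  apply: (measurableT_comp (measurable_poisson e0)).
  by apply: measurable_funD => //; apply: measurable_funM => //; exact: measurable_snd.
under eq_integral do rewrite EFinM.
have mS : measurable_fun setT (fun z : mplane R => (poisson2 e ((s * z.1 + u.1, s * z.2 + u.2) : mplane R) +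
     poisson2 e ((1 * z.1 + v.1, 1 * z.2 + v.2) : mplane R))%:E).
  by apply/measurable_EFinP; exact: (measurable_funD (mp u s) (mp v 1)).
rewrite (@ge0_integralZl _ _ _ mu2 setT measurableT _ mS); last 2 first.
- by move=> z _; rewrite lee_fin addr_ge0// poisson2_ge0.
- by rewrite lee_fin invr_ge0.
under eq_integral do rewrite EFinD.
have mu_ : measurable_fun setT (fun z : mplane R => (poisson2 e ((s * z.1 + u.1, s * z.2 + u.2) : mplane R))%:E).
  by apply/measurable_EFinP; exact: (mp u s).
have mv_ : measurable_fun setT (fun z : mplane R => (poisson2 e ((1 * z.1 + v.1, 1 * z.2 + v.2) : mplane R))%:E).
  by apply/measurable_EFinP; exact: (mp v 1).
rewrite (@ge0_integralD _ _ _ mu2 setT measurableT _ _ _ mu_ _ mv_); last 2 first.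
- by move=> z _; rewrite lee_fin poisson2_ge0.
- by move=> z _; rewrite lee_fin poisson2_ge0.
have a1 := poisson2_integral_le u e0 s1.
have a2 := poisson2_integral_le v e0 (expr1n R 2).
apply: (le_trans (lee_wpmul2l _ (leeD a1 a2))); first by rewrite lee_fin invr_ge0.
by rewrite -EFinD -EFinM lee_fin le_eqVlt; apply/orP; left; apply/eqP; field.
Qed.

Let bkB1 e x : 0 < e -> (\int[mu2]_z (bk e (x, z))%:E <= ((2 * pi) ^+ 2)%:E)%E.
Proof.
move=> e0; have h1 : (-1 : R) ^+ 2 = 1 by rewrite sqrrN expr1n.
apply: le_trans (bk_bound x x e0 h1); rewrite le_eqVlt; apply/orP; left; apply/eqP.
apply: eq_integral => z _; rewrite /bk /c1 /c2 /c3 /c4 /=.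
by congr (_ * (poisson2 e (_, _) + poisson2 e (_, _)))%:E; ring.
Qed.

Let bkB2 e z : 0 < e -> (\int[mu2]_x (bk e (x, z))%:E <= ((2 * pi) ^+ 2)%:E)%E.
Proof.
move=> e0; have h1 : (1 : R) ^+ 2 = 1 by rewrite expr1n.
pose nz : mplane R := (- z.1, - z.2).
apply: le_trans (bk_bound nz z e0 h1); rewrite le_eqVlt; apply/orP; left; apply/eqP.
apply: eq_integral => x _; rewrite /bk /c1 /c2 /c3 /c4 /=.
by congr (_ * (poisson2 e (_, _) + poisson2 e (_, _)))%:E; ring.
Qed.

Let mbk e : 0 < e -> measurable_fun setT (bk e).
Proof.
move=> e0; have [h1 h2 h3 h4] := mcoord.
have mp := measurable_poisson e0.
apply: measurable_funM => //; apply: measurable_funD; apply: measurable_funM.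
- by apply: (measurableT_comp mp); exact: measurable_funB.
- by apply: (measurableT_comp mp); exact: measurable_funB.
- by apply: (measurableT_comp mp); exact: measurable_funD.
- by apply: (measurableT_comp mp); exact: measurable_funD.
Qed.

Let mweightV e : measurable_fun setT (fun y => (weight e y)^-1).
Proof.
have mE : measurable_fun setT (fun t : R => (dexp e t)^-1).
  apply: continuous_measurable_fun => t; apply: cvgV; first by rewrite gt_eqF// expR_gt0.
  exact: continuous_dexp.
rewrite (_ : (fun y => _) = fun y : mplane R => (dexp e y.1)^-1 * (dexp e y.2)^-1); last first.
  by apply/funext => y; rewrite /weight invfM.
by apply: measurable_funM; [exact: (measurableT_comp mE measurable_fst)|exact: (measurableT_comp mE measurable_snd)].
Qed.

Let kE e x x' : 0 < e ->
  `|\int[mu2]_y (weight e y * tau (y, x) * tau (y, x'))| <= bk e (x, x').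
Proof.
move=> e0; pose u : mplane R := (x.1 - x'.1, x.2 - x'.2); pose v : mplane R := (x.1 + x'.1, x.2 + x'.2).
have ms (w : mplane R) : measurable_fun setT (fun y : mplane R => cos (dotp y w)).
  have mc : measurable_fun setT (@cos R) by exact: (continuous_measurable_fun (@continuous_cos R)).
  apply: (measurableT_comp mc).
  apply: (measurable_funD (f := fun y : mplane R => y.1 * w.1) (g := fun y : mplane R => y.2 * w.2)).
    exact: (measurable_funM (f := fun y : mplane R => y.1) (g := fun=> w.1) measurable_fst (measurable_cst _)).
  exact: (measurable_funM (f := fun y : mplane R => y.2) (g := fun=> w.2) measurable_snd (measurable_cst _)).
have iw w := bounded_kernel_itg (weight_itg e0) (ms w) (fun y => norm_cos_le1 _).
have -> : \int[mu2]_y (weight e y * tau (y, x) * tau (y, x')) =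
    2^-1 * (poisson2 e u - poisson2 e v).
  rewrite -!(weight_cos _ e0) -RintegralB// -RintegralZl//; last exact: itgB.
  apply: eq_Rintegral => y _; rewrite /tau /=.
  have -> : dotp y u = dotp y x - dotp y x' by rewrite /dotp /u /=; ring.
  have -> : dotp y v = dotp y x + dotp y x' by rewrite /dotp /v /=; ring.
  by rewrite cosB cosD; field.
rewrite /bk normrM ger0_norm ?invr_ge0// ler_wpM2l ?invr_ge0//.
rewrite (le_trans (ler_normB _ _))// !ger0_norm ?poisson2_ge0//.
Qed.

Lemma measurable_sinT Z : mu2.-integrable setT (EFin \o Z) -> measurable_fun setT (sinT Z).
Proof.
move=> Zi; have e1 : 0 < (1 : R) by [].
exact: (@measurable_transform _ _ _ _ _ mu2 mu2 tau mtau tau1 (weight 1)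
  (weight_gt0 1) (weight_itg e1) (mweightV 1) Z Zi).
Qed.

(** The bound for the weighted integral is uniform in the rate of the weight; the weights increase
    to 1 as the rate tends to 0, and monotone convergence removes them. *)
Lemma bessel Z : mu2.-integrable setT (EFin \o Z) ->
  (\int[mu2]_y ((sinT Z y) ^+ 2)%:E <= ((2 * pi) ^+ 2)%:E * \int[mu2]_z ((Z z) ^+ 2)%:E)%E.
Proof.
move=> Zi; pose e_ n : R := n.+1%:R^-1.
have e0 n : 0 < e_ n by rewrite invr_gt0 ltr0n.
pose f_ n y := weight (e_ n) y * sinT Z y ^+ 2.
have ms := measurable_sinT Zi.
have mw n : measurable_fun setT (weight (e_ n)) by exact: itg_meas (weight_itg (e0 n)).
have wE n y : weight (e_ n) y = expR (- (e_ n * (`|y.1| + `|y.2|))).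
  by rewrite /weight /dexp -expRD; congr expR; ring.
apply: (@integral_le_monotone _ _ _ mu2 f_).
- by move=> n; apply: measurable_funM => //; exact: measurable_funX.
- by move=> n y; rewrite mulr_ge0 ?sqr_ge0// ltW// weight_gt0.
- move=> y m n mn; rewrite /f_ ler_wpM2r ?sqr_ge0// !wE ler_expR lerN2.
  rewrite ler_wpM2r ?addr_ge0// /e_ lef_pV2 ?posrE ?ltr0n// ler_nat ltnS//.
- move=> y; have ce : e_ n * (`|y.1| + `|y.2|) @[n --> \oo] --> 0 * (`|y.1| + `|y.2|).
    by apply: cvgMr_tmp; exact: cvg_harmonic.
  have cw : weight (e_ n) y @[n --> \oo] --> expR (- (0 * (`|y.1| + `|y.2|))).
    under eq_fun do rewrite wE.
    by apply: continuous_cvg; [exact: continuous_expR|exact: cvgN].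
  rewrite mul0r oppr0 expR0 in cw.
  have := cvgMr_tmp (b := sinT Z y ^+ 2) cw; rewrite mul1r; exact.
- move=> n.
  have bk0 p : 0 <= bk (e_ n) p.
    by rewrite mulr_ge0 ?invr_ge0// addr_ge0// poisson2_ge0.
  exact: (@abstract_bessel _ _ _ _ _ mu2 mu2 tau mtau tau1 (weight (e_ n))
    (weight_gt0 _) (weight_itg (e0 n)) (mweightV _) (bk (e_ n)) ((2 * pi) ^+ 2) (sqr_ge0 _)
    (mbk (e0 n)) bk0 (fun x x' => kE x x' (e0 n)) (fun x => bkB1 x (e0 n)) (fun x => bkB2 x (e0 n)) Z Zi).
Qed.

Lemma sinT_L2 Z : mu2.-integrable setT (EFin \o Z) -> L2 mu2 setT Z ->
  L2 mu2 setT (sinT Z) /\ nrm mu2 setT (sinT Z) <= 2 * pi * nrm mu2 setT Z.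
Proof.
move=> Zi LZ; have mT : measurable (setT : set (mplane R)) by [].
have B := bessel Zi; rewrite (ip_EFin mT LZ) -EFinM in B.
have Ls : L2 mu2 setT (sinT Z).
  by split; [exact: measurable_sinT|exact: le_lt_trans B (ltry _)].
split => //; rewrite (ip_EFin mT Ls) lee_fin in B.
have p0 : 0 <= 2 * pi :> R by rewrite mulr_ge0 ?pi_ge0.
rewrite -(@ler_pXn2r _ 2)// ?nnegrE ?mulr_ge0 ?nrm_ge0 ?pi_ge0//.
by rewrite exprMn !nrm2.
Qed.

End plane_bessel.

(** * Extending the duality that defines the multiplier *)

Lemma norm_lim_le (R : realType) (u : nat -> R) (l C : R) :
  (forall m, `|u m| <= C) -> u m @[m --> \oo] --> l -> `|l| <= C.
Proof.
move=> uC ul; have cN : `|u m| @[m --> \oo] --> `|l| by exact: cvg_norm.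
rewrite -(cvg_lim (@Rhausdorff R) cN); apply: limr_le; [exact: cvgP cN|exact: nearW].
Qed.

Section fourier_duality.
Variables (R : realType) (b : R).
Hypothesis b0 : 0 < b.
Local Notation mu1 := (@lebesgue_measure R).
Local Notation mu2 := (@mu2 R).
Local Notation mu3 := (@mu3 R).
Local Notation space := (R * (R * R))%type.
Local Notation L2s := (L2 mu3 (Omega b)).
Local Notation L2p := (L2 mu2 setT).
Local Notation ips := (ip mu3 (Omega b)).
Local Notation ipp := (ip mu2 setT).
Local Notation nrms := (nrm mu3 (Omega b)).
Local Notation nrmp := (nrm mu2 setT).
Local Notation isw := (is_wderiv mu3 (Omega b) (test3 b) (pd (@dir3 R))).
Implicit Types (Z G : mplane R -> R) (f q : mspace R -> R).

Let mO : measurable (Omega b : set (mspace R)) := measurable_Omega b.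
Let mT : measurable (setT : set (mplane R)) := measurableT.
Let E3 := exhaustion_slab b.

(** The duality that defines the horizontal Fourier transform only sees functions supported in the
    open slab, hence the vertical cutoff. *)
Definition lk n G (x : mspace R) : R := inner b n x.1 * G x.2.

Lemma sinT_itg Z y : mu2.-integrable setT (EFin \o Z) ->
  mu2.-integrable setT (EFin \o (fun z => Z z * sin (dotp y z))).
Proof.
move=> Zi; apply: bounded_kernel_itg => //; last by move=> z; exact: norm_sin_le1.
have ms : measurable_fun setT (@sin R) by exact: (continuous_measurable_fun (@continuous_sin R)).
apply: (measurableT_comp ms).
apply: (measurable_funD (f := fun z : mplane R => y.1 * z.1) (g := fun z : mplane R => y.2 * z.2)).
  exact: (measurable_funM (f := fun=> y.1) (g := fun z : mplane R => z.1) (measurable_cst _) measurable_fst).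
exact: (measurable_funM (f := fun=> y.2) (g := fun z : mplane R => z.2) (measurable_cst _) measurable_snd).
Qed.

Lemma sinTD Z Z' : mu2.-integrable setT (EFin \o Z) -> mu2.-integrable setT (EFin \o Z') ->
  sinT (fun z => Z z + Z' z) = fun y => sinT Z y + sinT Z' y.
Proof.
move=> Zi Zi'; apply/funext => y; rewrite /sinT -RintegralD//; try exact: sinT_itg.
by apply: eq_Rintegral => z _; rewrite mulrDl.
Qed.

Lemma sinTZ c Z : mu2.-integrable setT (EFin \o Z) ->
  sinT (fun z => c * Z z) = fun y => c * sinT Z y.
Proof.
move=> Zi; apply/funext => y; rewrite /sinT -RintegralZl//; last exact: sinT_itg.
by apply: eq_Rintegral => z _; rewrite mulrA.
Qed.

Lemma nrm_lift G : L2p G -> nrms (fun x => G x.2) = Num.sqrt b * nrmp G.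
Proof.
by move=> LG; rewrite /nrm (ip_lift b0 LG LG) sqrtrM// ltW.
Qed.

Lemma smooth1_inner n : smooth1 (inner b n). Proof. exact: smooth1_bump. Qed.

Lemma inner_le1 n x : `|inner b n x| <= 1.
Proof. by rewrite ger0_norm ?bump_ge0 ?bump_le1. Qed.

Lemma lk_meas n G : measurable_fun setT G -> measurable_fun setT (lk n G).
Proof.
move=> mG; apply: measurable_funM.
  apply: (measurableT_comp _ measurable_fst); apply: continuous_measurable_fun.
  by apply: smooth1_cont; exact: smooth1_inner.
exact: (measurableT_comp mG measurable_snd).
Qed.

Lemma lk_L2 n G : L2p G -> L2s (lk n G) /\ nrms (lk n G) <= Num.sqrt b * nrmp G.
Proof.
move=> LG; have Ll := L2_lift b0 LG.
have le x : `|lk n G x| <= `|G x.2| by rewrite normrM ler_piMl// inner_le1.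
have L : L2s (lk n G).
  apply: (L2_le mO _ _ Ll).
    by apply: measurable_funTS; apply: lk_meas; exact: L2_meas LG.
  by move=> x _; exact: le.
split => //; rewrite -nrm_lift//; apply: (nrm_le mO) => //; exact: aeW.
Qed.

Lemma bounded_on_plane n Z : bounded_on (K2 n) Z ->
  mu2.-integrable setT (EFin \o Z) /\ L2p Z.
Proof.
have mK : measurable (K2 n : set (mplane R)) by exact: measurable_box2.
have fK : (mu2 (K2 n) < +oo)%E by exact: mu2_box_lty.
move=> bZ; split; first exact: (bounded_on_itg mK fK bZ).
exact: (bounded_on_sqint mT mK fK bZ).
Qed.

Lemma bounded_on_lk n Z : bounded_on (K2 n) Z -> bounded_on (K3 b n) (lk n Z).
Proof.
move=> [mZ [M hM]]; split; first exact: lk_meas.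
exists M => -[x y]; rewrite /lk /= normrM.
have h0 : ~ K3 b n (x, y) -> `|inner b n x| * `|Z y| = 0.
  move=> nK; have [hx|hx] := pselect (- b + n.+1%:R^-1 < x < - n.+1%:R^-1); last first.
    by rewrite /inner bump_out// normr0 mul0r.
  suff : `|Z y| <= 0 by rewrite normr_le0 => /eqP ->; rewrite normr0 mulr0.
  rewrite (le_trans (hM y))// indicE memNset ?mulr0// => hy.
  by apply: nK; split => //=; rewrite in_itv.
rewrite indicE; case: (boolP (_ \in _)) => [/set_mem[_ hy]|/negP nK]; last first.
  by rewrite h0 ?mulr0// => hK; apply: nK; exact/mem_set.
rewrite mulr1 (le_trans (ler_wpM2r _ (inner_le1 _ _)))// mul1r (le_trans (hM y))//.
have M0 : 0 <= M.
  have := hM y; rewrite indicE mem_set// mulr1; exact: le_trans.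
by rewrite ler_piMr// indicE; case: (_ \in _).
Qed.

(** For bumps [lk n Z] is a test function, and both sides pass to bounded limits: the left one by
    dominated convergence, [q] being locally integrable, and the right one by the L^2 bound for
    [sinT]. The imaginary part [q] is the relevant one, because the frequency profiles of the kernel
    gradient are odd. *)
Lemma hfourier_ext f p q n Z : is_hfourier b f p q -> bounded_on (K2 n) Z ->
  \int[mu3]_(x in Omega b) (q x * lk n Z x) = - ips f (lk n (sinT Z)).
Proof.
move=> [Hf lp lq hw]; have Lf : L2s f.
  have h : (dnorm2 mu3 (Omega b) (test3 b) (pd (@dir3 R)) [::] f < +oo)%E.
    by apply: le_lt_trans Hf; exact: (@sob2_ge _ _ _ _ _ _ _ _ 0 0 [tuple]).
  exact: (dnorm2_nil E3 h).
pose P Z := \int[mu3]_(x in Omega b) (q x * lk n Z x) = - ips f (lk n (sinT Z)).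
apply: (@mclass_plane _ (- n%:R) n%:R (- n%:R) n%:R P).
  have iq G : bounded_on (K2 n) G -> mu3.-integrable (Omega b) (EFin \o (fun x => q x * lk n G x)).
    by move=> bG; exact: (locint_bounded_on E3 lq (bounded_on_lk bG)).
  have Ls G : bounded_on (K2 n) G -> L2s (lk n (sinT G)).
    by move=> /bounded_on_plane[Gi LG]; have [LS _] := sinT_L2 Gi LG; have [] := lk_L2 n LS.
  split.
  - move=> g h bg bh Pg Ph; rewrite /P.
    have [gi _] := bounded_on_plane bg; have [hi _] := bounded_on_plane bh.
    rewrite (_ : lk n (sinT _) = fun x => lk n (sinT g) x + lk n (sinT h) x); last first.
      by apply/funext => x; rewrite /lk sinTD// mulrDr.
    rewrite (ipDr mO (Ls _ bg) (Ls _ bh) Lf) opprD -Pg -Ph -(RintegralD mO (iq _ bg) (iq _ bh)).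
    by apply: eq_Rintegral => x _; rewrite /lk; ring.
  - move=> c g bg Pg; rewrite /P; have [gi _] := bounded_on_plane bg.
    rewrite (_ : lk n (sinT _) = fun x => c * lk n (sinT g) x); last first.
      by apply/funext => x; rewrite /lk sinTZ// mulrCA.
    rewrite (ipZr mO c (Ls _ bg) Lf) -mulrN -Pg -(RintegralZl c mO (iq _ bg)).
    by apply: eq_Rintegral => x _; rewrite /lk; ring.
  - move=> g_ g M mg_ gM cg Pg.
    have bg_ m : bounded_on (K2 n) (g_ m) by split => //; exists M.
    have mg : measurable_fun setT g by apply: measurable_fun_cvg (fun x _ => cg x).
    have bg : bounded_on (K2 n) g.
      split => //; exists M => x; exact: norm_lim_le (fun m => gM m x) (cg x).
    pose B : mplane R -> R := fun x => `|M| * \1_(K2 n) x.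
    have bB : bounded_on (K2 n) B.
      apply: bounded_onZ; rewrite -[X in \1_X]setTI; apply: bounded_on_indic => //.
      exact: measurable_box2.
    have gB m x : `|g_ m x| <= B x.
      by rewrite (le_trans (gM m x))// ler_wpM2r ?ler_norm.
    have [Bi LB] := bounded_on_plane bB.
    have [_ c0] := nrm_dct mT mg_ mg LB (aeW _ (fun x _ => cg x)) (aeW _ (fun x _ m => gB m x)).
    have [gi Lg] := bounded_on_plane bg.
    have cS : nrms (fun x => lk n (sinT (g_ m)) x - lk n (sinT g) x) @[m --> \oo] --> 0.
      have c1 : Num.sqrt b * (2 * pi * nrmp (fun x => g_ m x - g x)) @[m --> \oo] -->
          Num.sqrt b * (2 * pi * 0).
        by apply: cvgM; [exact: cvg_cst|apply: cvgM; [exact: cvg_cst|exact: c0]].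
      rewrite !mulr0 in c1.
      apply: (squeeze_cvgr _ (cvg_cst 0) c1); apply: nearW => m; rewrite nrm_ge0/=.
      have [gim Lgm] := bounded_on_plane (bg_ m).
      have di := itgB mT gim gi; have Ld := L2B mT Lgm Lg.
      have [LS hS] := sinT_L2 di Ld.
      have [_ hl] := lk_L2 n LS.
      rewrite (_ : (fun x => _ - _) = lk n (sinT (fun x => g_ m x - g x))); last first.
        apply/funext => x; rewrite /lk -mulrBr; congr (_ * _).
        rewrite /sinT -RintegralB//; try exact: sinT_itg.
        by apply: eq_Rintegral => z _; rewrite mulrBl.
      by rewrite (le_trans hl)// ler_wpM2l ?sqrtr_ge0.
    have cR : - ips f (lk n (sinT (g_ m))) @[m --> \oo] --> - ips f (lk n (sinT g)).
      apply: cvgN; rewrite ipC; under eq_fun do rewrite ipC.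
      by apply: (cvg_ip mO (fun m => Ls _ (bg_ m)) (Ls _ bg) Lf cS).
    have lkB m x : `|q x * lk n (g_ m) x| <= `|q x * lk n B x|.
      rewrite (normrM (q x)) (normrM (q x)) ler_wpM2l// /lk !normrM ler_wpM2l//.
      by rewrite -normrM (le_trans (gB m x.2))// ler_norm.
    have [_ cL] := @Rint_dct _ _ _ mu3 (Omega b) mO (fun m x => q x * lk n (g_ m) x)
      (fun x => q x * lk n g x) (fun x => `|q x * lk n B x|)
      (fun m => itg_meas (iq _ (bg_ m))) (itg_meas (iq _ bg)) (itg_norm (iq _ bB))
      (aeW _ (fun x _ => cvgMl_tmp (cvgMl_tmp (cg x.2))))
      (aeW _ (fun x _ m => lkB m x)).
    exact: (cvg_eq_lim Pg cL cR).
move=> a1 a2 j h1 h2 _; rewrite /P.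
set u := bump a1 _ _; set v := bump a2 _ _.
have t3 : test3 b (tens3 (inner b n) u v).
  apply: (@testfun_tens3 _ (- b + n.+1%:R^-1) (- n.+1%:R^-1) a1 n%:R a2 n%:R);
    try exact: smooth1_bump; try by move=> x; exact: bump_outc.
  move=> [x [y z]] [/=]; rewrite in_itv/= => /andP[k1 k2] _.
  have e0 : 0 < n.+1%:R^-1 :> R by rewrite invr_gt0 ltr0n.
  move: k1 k2; rewrite /Omega/=; set t := n.+1%:R^-1 in e0 * => k1 k2.
  by apply/andP; split; lra.
have [_ E] := hw _ t3; rewrite [LHS]E; congr (- _).
apply: eq_Rintegral => x _; congr (_ * _).
rewrite /sin_transform /lk /sinT -RintegralZl//.
  by apply: eq_Rintegral => z _; exact: esym (mulrA _ _ _).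
apply: sinT_itg.
have bu c : mu1.-integrable setT (EFin \o bump c n%:R j).
  have bb : bounded_on (`]c, n%:R[%classic : set (measurableTypeR R)) (bump c n%:R j).
    split; first by apply: continuous_measurable_fun; apply: smooth1_cont; exact: smooth1_bump.
    exists 1 => t; rewrite mul1r indicE ger0_norm ?bump_ge0//.
    have [ht|ht] := pselect (c < t < n%:R); first by rewrite mem_set ?bump_le1//= in_itv.
    by rewrite bump_out.
  apply: (@bounded_on_itg R _ (measurableTypeR R) mu1 _ _ _ _ bb); [exact: measurable_itv|exact: itv_lty].
by have [] := Rint_tens2 (bu a1) (bu a2).
Qed.

Lemma L2_normp G : L2p G -> L2p (fun x => `|G x|).
Proof.
move=> LG; apply: (L2_le mT _ _ LG); last by move=> x _; rewrite normr_id.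
by apply: measurableT_comp => //; exact: L2_meas LG.
Qed.

Lemma L2_norms f : L2s f -> L2s (fun x => `|f x|).
Proof.
move=> Lf; apply: (L2_le mO _ _ Lf); last by move=> x _; rewrite normr_id.
by apply: measurableT_comp => //; exact: L2_meas Lf.
Qed.

Section multiplier.
Variable sigma : R.
Hypothesis sigma0 : 0 < sigma.
Hypothesis sigma1 : sigma < 1.

Definition mult (z : mplane R) : R := Num.sqrt (dotp z z) `^ sigma.

Lemma dotp_ge0 (z : mplane R) : 0 <= dotp z z.
Proof. by rewrite /dotp -!expr2 addr_ge0 ?sqr_ge0. Qed.

Lemma sqrt_dotp_le (z : mplane R) : Num.sqrt (dotp z z) <= `|z.1| + `|z.2|.
Proof.
have h : 0 <= `|z.1| + `|z.2| by rewrite addr_ge0.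
rewrite -(ler_pXn2r (n := 2))// ?nnegrE ?sqrtr_ge0// sqr_sqrtr ?dotp_ge0//.
rewrite sqrrD !real_normK ?num_real// /dotp -!expr2.
by have := mulr_ge0 (normr_ge0 z.1) (normr_ge0 z.2); lra.
Qed.

Lemma coord_le_sqrt_dotp (z : mplane R) :
  `|z.1| <= Num.sqrt (dotp z z) /\ `|z.2| <= Num.sqrt (dotp z z).
Proof.
have [h1 h2] := (sqr_ge0 z.1, sqr_ge0 z.2).
by split; rewrite -sqrtr_sqr ler_sqrt /dotp -!expr2 ?addr_ge0//; lra.
Qed.

Lemma measurable_mult : measurable_fun setT mult.
Proof.
have md : measurable_fun setT (fun z : mplane R => z.1 * z.1 + z.2 * z.2).
  apply: (measurable_funD (f := fun z : mplane R => z.1 * z.1) (g := fun z : mplane R => z.2 * z.2)).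
    exact: (measurable_funM (f := fun z : mplane R => z.1) (g := fun z : mplane R => z.1) measurable_fst measurable_fst).
  exact: (measurable_funM (f := fun z : mplane R => z.2) (g := fun z : mplane R => z.2) measurable_snd measurable_snd).
have ms : measurable_fun setT (@Num.sqrt R).
  by apply: continuous_measurable_fun; exact: sqrt_continuous.
exact: (measurableT_comp (measurable_powR sigma) (measurableT_comp ms md)).
Qed.

Lemma mult_gt0 (z : mplane R) : 0 < Num.sqrt (dotp z z) -> 0 < mult z.
Proof. exact: powR_gt0. Qed.

Lemma mult_bounded n : exists C : R, forall z, K2 n z -> `|mult z| <= C.
Proof.
exists ((n%:R + n%:R) `^ sigma) => -[x y] [/=]; rewrite !in_itv/= -!ltr_norml => hx hy.
rewrite ger0_norm ?powR_ge0//; apply: ge0_ler_powR; rewrite ?nnegrE ?sqrtr_ge0 ?addr_ge0//.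
  exact: ltW.
by rewrite (le_trans (sqrt_dotp_le _))//=; rewrite lerD// ltW.
Qed.

(** Both sides are, up to sign, the pairing of [lk n Z] with [mult] times the imaginary part of the
    transform of [f]. *)
Lemma Lambda_pairing f w n Z : is_Lambda b sigma f w -> bounded_on (K2 n) Z ->
  ips f (lk n (sinT (fun z => mult z * Z z))) = ips w (lk n (sinT Z)).
Proof.
move=> [p [q [hf hw]]] bZ; have [mZ [M hM]] := bZ.
have [C hC] := mult_bounded n.
have bm : bounded_on (K2 n) (fun z => mult z * Z z).
  split; first by apply: measurable_funM => //; exact: measurable_mult.
  exists (`|C| * `|M|) => z; rewrite (normrM (mult z)).
  have hz := hM z; have [Kz|nKz] := pselect (K2 n z).
    rewrite indicE (mem_set Kz) mulr1 in hz.
    rewrite indicE (mem_set Kz) mulr1; apply: ler_pM => //.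
      exact: le_trans (hC z Kz) (ler_norm _).
    exact: le_trans hz (ler_norm _).
  rewrite indicE (memNset nKz) mulr0 normr_le0 in hz.
  by rewrite indicE (memNset nKz) (eqP hz) normr0 !mulr0.
have e1 := hfourier_ext hf bm; have e2 := hfourier_ext hw bZ.
apply: oppr_inj; apply: (etrans (esym e1)); apply: (etrans _ e2); apply: eq_Rintegral => x _.
change (q x * (inner b n x.1 * (mult x.2 * Z x.2)) = (mult x.2 * q x) * (inner b n x.1 * Z x.2)).
ring.
Qed.

Lemma low_frequency f w Z Z' : is_Lambda b sigma f w -> L2s f -> L2s w ->
  mu2.-integrable setT (EFin \o Z) -> L2p Z -> L2p Z' ->
  (exists C : R, forall z, `|Z' z| <= C) ->
  (forall z, Z z = mult z * Z' z) ->
  `|ips f (fun x => sinT Z x.2)| <= 2 * pi * Num.sqrt b * nrmp Z' * nrms w.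
Proof.
move=> hL Lf Lw Zi LZ LZ' [C hC] ZE.
have [LS _] := sinT_L2 Zi LZ.
have mK n : measurable (K2 n : set (mplane R)) by exact: measurable_box2.
pose c n : mplane R -> R := \1_(K2 n).
have mc n : measurable_fun setT (c n) by exact: measurable_indic.
have c01 n z : 0 <= c n z <= 1 by rewrite /c indicE; case: (_ \in _); rewrite ?lexx ?ler01.
have c1 n z : `|c n z| <= 1 by have /andP[h1 h2] := c01 n z; rewrite ger0_norm.
have cc z : c n z @[n --> \oo] --> (1 : R).
  apply: cvg_near_cst; near=> n; rewrite /c indicE mem_set//.
  have h1 : `|z.1| < n%:R by near: n; exact: nbhs_infty_gtr.
  have h2 : `|z.2| < n%:R by near: n; exact: nbhs_infty_gtr.
  by split => /=; rewrite in_itv/= -ltr_norml.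
have mZ := L2_meas LZ; have mZ' := L2_meas LZ'.
have LcM G n : L2p G -> L2p (fun z => c n z * G z) /\ nrmp (fun z => c n z * G z) <= nrmp G.
  move=> LG; have le z : `|c n z * G z| <= `|G z| by rewrite normrM ler_piMl.
  have L : L2p (fun z => c n z * G z).
    apply: (L2_le mT _ _ LG); first by apply: measurable_funM => //; exact: L2_meas LG.
    by move=> z _; exact: le.
  by split => //; apply: (nrm_le mT L LG); exact: aeW.
have ci n : mu2.-integrable setT (EFin \o (fun z => c n z * Z z)).
  apply: (itg_le mT _ _ (itg_norm Zi)); first exact: measurable_funM.
  by move=> z _; rewrite normrM ler_piMl.
have bc n : bounded_on (K2 n) (fun z => c n z * Z' z).
  split; first exact: measurable_funM.
  exists `|C| => z; rewrite normrM mulrC /c (ger0_norm (proj1 (andP (c01 n z)))).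
  by rewrite ler_wpM2r ?(proj1 (andP (c01 n z)))// (le_trans (hC z))// ler_norm.
have bound n : `|ips f (lk n (sinT (fun z => c n z * Z z)))| <= 2 * pi * Num.sqrt b * nrmp Z' * nrms w.
  have e : (fun z => c n z * Z z) = (fun z => mult z * (c n z * Z' z)).
    by apply/funext => z; rewrite ZE mulrCA.
  rewrite e (Lambda_pairing hL (bc n)).
  have [Zi' LcZ'] := bounded_on_plane (bc n).
  have [LS' hS'] := sinT_L2 Zi' LcZ'.
  have [Lk hk] := lk_L2 n LS'.
  rewrite (le_trans (cauchy_schwarz mO Lw Lk))// mulrC ler_wpM2r ?nrm_ge0//.
  rewrite (le_trans hk)// mulrC -mulrA (mulrC (Num.sqrt b)) mulrA ler_wpM2r ?sqrtr_ge0//.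
  rewrite (le_trans hS')// ler_wpM2l ?mulr_ge0 ?pi_ge0//.
  by have [] := LcM Z' n LZ'.
have dom (n : nat) z : `|c n z * Z z| <= `|Z z| by rewrite normrM ler_piMl.
have [_ cZ] : L2p Z /\ nrmp (fun z => c n z * Z z - Z z) @[n --> \oo] --> 0.
  apply: (nrm_dct mT _ mZ (L2_normp LZ)).
  - by move=> n; exact: measurable_funM.
  - by apply: aeW => z _; rewrite -[X in _ --> X]mul1r; apply: cvgMr_tmp; exact: cc.
  - by apply: aeW => z _ n; exact: dom.
have LlS := L2_lift b0 LS.
have Lkn n : L2s (lk n (sinT (fun z => c n z * Z z))).
  by have [L _] := sinT_L2 (ci n) (proj1 (LcM Z n LZ)); have [] := lk_L2 n L.
have LkS n : L2s (lk n (sinT Z)) by have [] := lk_L2 n LS.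
have [_ ck] : L2s (fun x => sinT Z x.2) /\
    nrms (fun x => lk n (sinT Z) x - sinT Z x.2) @[n --> \oo] --> 0.
  apply: (nrm_dct mO _ (L2_meas LlS) (L2_norms LlS)).
  - by move=> n; exact: L2_meas (LkS n).
  - apply: aeW => x Ox; rewrite -[X in _ --> X]mul1r; apply: cvgMr_tmp.
    exact: inner_cvg.
  - by apply: aeW => x _ n; rewrite normrM ler_piMl// inner_le1.
have cS : nrms (fun x => lk n (sinT (fun z => c n z * Z z)) x - sinT Z x.2) @[n --> \oo] --> 0.
  have cs : Num.sqrt b * (2 * pi * nrmp (fun z => c n z * Z z - Z z)) +
      nrms (fun x => lk n (sinT Z) x - sinT Z x.2) @[n --> \oo] -->
      Num.sqrt b * (2 * pi * 0) + 0.
    by apply: cvgD => //; apply: cvgM; [exact: cvg_cst|apply: cvgM; [exact: cvg_cst|exact: cZ]].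
  rewrite !mulr0 addr0 in cs.
  apply: (squeeze_cvgr _ (cvg_cst 0) cs); apply: nearW => n; rewrite nrm_ge0/=.
  have Ln := proj1 (LcM Z n LZ).
  have [Ld hd] := sinT_L2 (itgB mT (ci n) Zi) (L2B mT Ln LZ).
  have [Lk hk] := lk_L2 n Ld.
  (* The error splits into the one from truncating [Z] and the one from the vertical cutoff. *)
  have e : (fun x => lk n (sinT (fun z => c n z * Z z)) x - sinT Z x.2) =
      (fun x => lk n (sinT (fun z => c n z * Z z - Z z)) x + (lk n (sinT Z) x - sinT Z x.2)).
    apply/funext => x; rewrite /lk.
    have -> : sinT (fun z => c n z * Z z - Z z) x.2 = sinT (fun z => c n z * Z z) x.2 - sinT Z x.2.
      rewrite /sinT -RintegralB//; [|exact: sinT_itg (ci n)|exact: sinT_itg].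
      by apply: eq_Rintegral => z _; rewrite mulrBl.
    by ring.
  rewrite e; apply: (le_trans (nrmD mO Lk (L2B mO (LkS n) LlS))).
  by rewrite lerD2r (le_trans hk)// ler_wpM2l ?sqrtr_ge0.
apply: (norm_lim_le bound).
rewrite ipC; under eq_fun do rewrite ipC.
exact: (cvg_ip mO Lkn LlS Lf cS).
Unshelve. all: by end_near. Qed.

End multiplier.

End fourier_duality.

(** * The flux bound at frequencies of size 1/r *)

Lemma powR_le_expR (R : realType) (s t : R) : 0 < s -> s < 1 -> 0 < t ->
  t `^ (1 - s) <= 2 * expR (t / 2).
Proof.
move=> s0 s1 tp; apply: (@le_trans _ _ (1 + t)).
  apply: (@le_trans _ _ ((1 + t) `^ (1 - s))).
    by apply: ge0_ler_powR; rewrite ?nnegrE; lra.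
  rewrite -[leRHS]powRr1; last lra.
  by apply: ler_powR; lra.
by have := expR_ge1Dx (t / 2); lra.
Qed.

Fact half_sum_le (R : realFieldType) (r x a c : R) : r * x <= r * (a + c) ->
  r * x / 2 + (- (r / 2 * a) - r / 2 * c) <= 0.
Proof. by lra. Qed.

Lemma dexp_le1 (R : realType) (e t : R) : 0 <= e -> dexp e t <= 1.
Proof.
move=> e0; rewrite -[leRHS](expR0 R) ler_expR oppr_le0; exact: mulr_ge0.
Qed.

Section flux.
Variables (R : realType) (b : R).
Hypothesis b0 : 0 < b.
Local Notation mu1 := (@lebesgue_measure R).
Local Notation mu2 := (@mu2 R).
Local Notation mu3 := (@mu3 R).
Local Notation L2s := (L2 mu3 (Omega b)).
Local Notation L2p := (L2 mu2 setT).
Local Notation ips := (ip mu3 (Omega b)).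
Local Notation nrms := (nrm mu3 (Omega b)).
Local Notation nrmp := (nrm mu2 setT).
Local Notation isw := (is_wderiv mu3 (Omega b) (test3 b) (pd (@dir3 R))).

Let mO : measurable (Omega b : set (mspace R)) := measurable_Omega b.
Let mT : measurable (setT : set (mplane R)) := measurableT.

Variables (sigma r : R).
Hypothesis sigma0 : 0 < sigma.
Hypothesis sigma1 : sigma < 1.
Hypothesis r1 : 1 <= r.

Let r0 : 0 < r. Proof. exact: lt_le_trans r1. Qed.

(** Frequency profiles in one coordinate: the cosine transform of [psi1] is [kern r], and the sine
    transform of [psix] is minus its derivative. *)
Definition psi1 (t : R) : R := r / 2 * dexp r t.
Definition psix (t : R) : R := r / 2 * (t * dexp r t).

Lemma kern_derive y : derive1 (kern r) y = - (2 * r ^+ 2 * y / (r ^+ 2 + y ^+ 2) ^+ 2).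
Proof.
have c1 := sqr_ge1 r1; have D0 : 0 < r ^+ 2 + y ^+ 2 by have := sqr_ge0 y; lra.
have h := is_deriveZ (r ^+ 2) (is_derive_pw (-1) 1 y c1).
have e : kern r = fun x => r ^+ 2 * ((1 : {poly R}).[x] * pw (r ^+ 2) (-1) x).
  by apply/funext => x; rewrite hornerC mul1r.
rewrite e derive1E (@derive_val _ _ _ _ _ _ _ h) /GRing.scale/= /pw_next derivC mul0r add0r.
rewrite hornerZ hornerM hornerX hornerC mulr1 /pw.
have -> : (-1 - 1 : R) = - 2%:R by ring.
rewrite powRN powR_mulrn ?(ltW D0)//; field.
by rewrite gt_eqF.
Qed.

Lemma psi_transforms y :
  [/\ \int[mu1]_t (psi1 t * cos (y * t)) = kern r y,
      \int[mu1]_t (psi1 t * sin (y * t)) = 0 &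
      \int[mu1]_t (psix t * sin (y * t)) = - derive1 (kern r) y].
Proof.
have mc : measurable_fun setT (fun z : R => cos (y * z)).
  exact: (continuous_measurable_fun (@continuous_cosM R y)).
have ms : measurable_fun setT (fun z : R => sin (y * z)).
  exact: (continuous_measurable_fun (@continuous_sinM R y)).
have ic := dexpM_itg r0 mc (fun t => norm_cos_le1 _).
have is_ := dexpM_itg r0 ms (fun t => norm_sin_le1 _).
have ix := dexpX_itg r0 ms (fun t => norm_sin_le1 _).
have [C S X] := dexp_transforms y r0.
have D0 : r ^+ 2 + y ^+ 2 != 0 by rewrite gt_eqF// ltr_pwDl ?sqr_ge0// exprn_gt0.
split.
- transitivity (\int[mu1]_t (r / 2 * (dexp r t * cos (y * t)))).
    by apply: eq_Rintegral => t _; rewrite /psi1 mulrA.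
  by rewrite RintegralZl// C kernE//; field.
- transitivity (\int[mu1]_t (r / 2 * (dexp r t * sin (y * t)))).
    by apply: eq_Rintegral => t _; rewrite /psi1 mulrA.
  by rewrite RintegralZl// S mulr0.
- transitivity (\int[mu1]_t (r / 2 * (t * dexp r t * sin (y * t)))).
    by apply: eq_Rintegral => t _; rewrite /psix; exact: esym (mulrA _ _ _).
  by rewrite RintegralZl// X kern_derive; field.
Qed.

Lemma psi_itg : mu1.-integrable setT (EFin \o psi1) /\ mu1.-integrable setT (EFin \o psix).
Proof.
have n1 (z : R) : `|1 : R| <= 1 by rewrite normr1.
have ix : mu1.-integrable setT (EFin \o (fun t => t * dexp r t)).
  have := dexpX_itg r0 (measurable_cst _) n1.
  by apply: eq_integrable => // t _ /=; rewrite mulr1.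
by split; [exact: (itgZ measurableT (r / 2) (dexp_itg r0))|exact: (itgZ measurableT (r / 2) ix)].
Qed.

Lemma dexp_sq (e t : R) : dexp (e / 2) t * dexp (e / 2) t = dexp e t.
Proof. by rewrite /dexp -expRD; congr expR; field. Qed.

Lemma dexp_L2 (e : R) : 0 < e -> L2 mu1 setT (dexp (e / 2)).
Proof.
move=> e0; split; first exact: measurable_dexp.
under eq_integral do rewrite expr2 dexp_sq.
by rewrite (itgE measurableT (dexp_itg e0)) ltry.
Qed.

Lemma psi_L2 : L2 mu1 setT psi1 /\ L2 mu1 setT psix.
Proof.
have h := dexp_L2 r0.
have hr : r / 2 <= r by clear h; move: r0; lra.
have e (t : R) : dexp r t <= dexp (r / 2) t.
  by rewrite /dexp ler_expR lerN2 ler_wpM2r.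
have m := @measurable_dexp R r.
have L : L2 mu1 setT (dexp r).
  apply: (L2_le measurableT _ _ h); first exact: measurable_dexp.
  by move=> t _; rewrite !ger0_norm ?dexp_ge0.
have Lx : L2 mu1 setT (fun t => t * dexp r t).
  apply: (L2_le measurableT _ _ (L2Z measurableT (2 / r) h)).
    exact: measurable_funM.
  move=> t _; rewrite normrM (ger0_norm (dexp_ge0 r t)) (le_trans (norm_dexp_le t r0))//.
  exact: ler_norm.
by split; [exact: (L2Z measurableT (r / 2) L)|exact: (L2Z measurableT (r / 2) Lx)].
Qed.

(** The sine of a sum splits into two products, and parity leaves one of them. So the horizontal
    derivatives of the product kernel, up to sign, are sine transforms of explicit functions. *)
Lemma sinT_psi : sinT (tens2 psix psi1) = (fun y => - tens2 (derive1 (kern r)) (kern r) y) /\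
  sinT (tens2 psi1 psix) = (fun y => - tens2 (kern r) (derive1 (kern r)) y).
Proof.
have [i1 ix] := psi_itg.
have mc c : measurable_fun setT (fun z : R => cos (c * z)).
  exact: (continuous_measurable_fun (@continuous_cosM R c)).
have ms c : measurable_fun setT (fun z : R => sin (c * z)).
  exact: (continuous_measurable_fun (@continuous_sinM R c)).
have ic f c : mu1.-integrable setT (EFin \o f) -> mu1.-integrable setT (EFin \o (fun t => f t * cos (c * t))).
  by move=> fi; exact: (bounded_kernel_itg fi (mc c) (fun t => norm_cos_le1 (c * t))).
have is_ f c : mu1.-integrable setT (EFin \o f) -> mu1.-integrable setT (EFin \o (fun t => f t * sin (c * t))).
  by move=> fi; exact: (bounded_kernel_itg fi (ms c) (fun t => norm_sin_le1 (c * t))).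
have key f g y : mu1.-integrable setT (EFin \o f) -> mu1.-integrable setT (EFin \o g) ->
    sinT (tens2 f g) y =
    (\int[mu1]_t (f t * sin (y.1 * t))) * (\int[mu1]_t (g t * cos (y.2 * t))) +
    (\int[mu1]_t (f t * cos (y.1 * t))) * (\int[mu1]_t (g t * sin (y.2 * t))).
  move=> fi gi.
  have [j1 E1] := Rint_tens2 (is_ f y.1 fi) (ic g y.2 gi).
  have [j2 E2] := Rint_tens2 (ic f y.1 fi) (is_ g y.2 gi).
  rewrite -E1 -E2 -RintegralD//; apply: eq_Rintegral => z _.
  by rewrite /tens2 /dotp sinD; ring.
split; apply/funext => y; rewrite key//.
  have [C1 S1 X1] := psi_transforms y.1; have [C2 S2 X2] := psi_transforms y.2.
  by rewrite X1 C2 S2 mulr0 addr0 /tens2 mulNr.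
have [C1 S1 X1] := psi_transforms y.1; have [C2 S2 X2] := psi_transforms y.2.
by rewrite S1 C1 X2 mul0r add0r /tens2 mulrN.
Qed.

Lemma weight_L2 (e : R) : 0 < e -> L2p (weight (e / 2)) /\ nrmp (weight (e / 2)) = 2 / e.
Proof.
move=> e0; have L := L2_tens2 (dexp_L2 e0) (dexp_L2 e0); split; first exact: L.
rewrite /nrm /ip.
have -> : \int[mu2]_y (weight (e / 2) y * weight (e / 2) y) = (2 / e) ^+ 2.
  (* The mass of the weight is its cosine transform at the origin. *)
  transitivity (\int[mu2]_y (weight e y * cos (dotp y (0, 0)))).
    apply: eq_Rintegral => y _; rewrite /dotp/= !mulr0 addr0 cos0 mulr1 /weight.
    by rewrite -(dexp_sq e y.1) -(dexp_sq e y.2) mulrACA.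
  rewrite weight_cos// /poisson2 /poisson /= expr0n addr0; field.
  by rewrite gt_eqF.
by rewrite sqrtr_sqr ger0_norm// divr_ge0// ltW.
Qed.

(** With [rho = |z|], division by [rho^sigma] leaves [rho^(1 - sigma)]. The bound [(r rho)^(1 -
    sigma) <= 2 expR (r rho / 2)] is absorbed by half of the exponential weight, as
    [rho <= |z_1| + |z_2|], and turns [r^2] into [r^(sigma + 1)]. *)
Lemma multiplier_bound (c : mplane R -> R) z :
  `|c z| <= Num.sqrt (dotp z z) ->
  `|c z * ((r / 2) ^+ 2 * weight r z) / mult sigma z| <=
    r `^ (sigma + 1) / 2 * weight (r / 2) z.
Proof.
set rho := Num.sqrt (dotp z z) => hc.
have W0 := ltW (weight_gt0 (r / 2) z).
have r20 : 0 <= r `^ (sigma + 1) / 2 by rewrite divr_ge0 ?powR_ge0.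
have : 0 <= rho by exact: sqrtr_ge0.
rewrite le_eqVlt => /predU1P[rz|rp].
  (* At the origin the bound on [c] makes the left-hand side 0, whatever the value of [mult]
     there. *)
  move: hc; rewrite -rz normr_le0 => /eqP ->.
  by rewrite !mul0r normr0 mulr_ge0.
have mp : 0 < mult sigma z by exact: mult_gt0.
rewrite normrM normfV (gtr0_norm mp) ler_pdivrMr// normrM.
rewrite (ger0_norm (_ : 0 <= (r / 2) ^+ 2 * weight r z)); last first.
  by rewrite mulr_ge0 ?sqr_ge0// ltW// weight_gt0.
have t0 : 0 < r * rho by rewrite mulr_gt0.
have h1 := powR_le_expR sigma0 sigma1 t0.
have h2 : expR (r * rho / 2) * weight (r / 2) z <= 1.
  have hz := sqrt_dotp_le z; rewrite -/rho in hz.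
  have hr : r * rho <= r * (`|z.1| + `|z.2|) by rewrite ler_wpM2l// ltW.
  rewrite /weight /dexp -!expRD; apply: (@le_trans _ _ (expR 0)); last by rewrite expR0.
  by rewrite ler_expR; exact: half_sum_le hr.
have wE : weight r z = weight (r / 2) z * weight (r / 2) z.
  by rewrite /weight -(dexp_sq r z.1) -(dexp_sq r z.2) mulrACA.
have e1 : rho = rho `^ (1 - sigma) * mult sigma z.
  by rewrite /mult -/rho -powRD ?subrK ?powRr1 ?(gt_eqF rp) ?implybT// ltW.
have e2 : r `^ (sigma + 1) * (r * rho) `^ (1 - sigma) = r ^+ 2 * rho `^ (1 - sigma).
  rewrite powRM ?(ltW rp) ?(ltW r0)// mulrA -powRD ?(gt_eqF r0) ?implybT//.
  by rewrite (_ : sigma + 1 + (1 - sigma) = 2%:R) ?powR_mulrn ?(ltW r0)//; ring.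
apply: (@le_trans _ _ (rho * ((r / 2) ^+ 2 * weight r z))).
  by rewrite ler_wpM2r// mulr_ge0 ?sqr_ge0// ltW// weight_gt0.
rewrite {1}e1 wE.
have -> : rho `^ (1 - sigma) * mult sigma z * ((r / 2) ^+ 2 * (weight (r / 2) z * weight (r / 2) z)) =
  (r ^+ 2 * rho `^ (1 - sigma)) * weight (r / 2) z * (weight (r / 2) z * mult sigma z / 4) by field.
rewrite -e2.
have -> : r `^ (sigma + 1) / 2 * weight (r / 2) z * mult sigma z =
  (r `^ (sigma + 1) * 2) * (weight (r / 2) z * mult sigma z / 4) by field.
apply: ler_wpM2r; first by rewrite divr_ge0// mulr_ge0// ltW.
rewrite -mulrA; apply: ler_wpM2l; first exact: powR_ge0.
apply: (@le_trans _ _ (2 * expR (r * rho / 2) * weight (r / 2) z)).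
  exact: ler_wpM2r.
by rewrite -mulrA -[leRHS]mulr1 ler_wpM2l.
Qed.

Lemma low_frequency_psi f w (c : mplane R -> R) Z : is_Lambda b sigma f w -> L2s f -> L2s w ->
  mu2.-integrable setT (EFin \o Z) -> L2p Z ->
  (forall z, Z z = c z * ((r / 2) ^+ 2 * weight r z)) ->
  (forall z : mplane R, `|c z| <= Num.sqrt (dotp z z)) ->
  `|ips f (fun x => sinT Z x.2)| <= 2 * pi * Num.sqrt b * r `^ sigma * nrms w.
Proof.
move=> hL Lf Lw Zi LZ ZE hc.
pose Z' z := Z z / mult sigma z.
have hZ' z : `|Z' z| <= r `^ (sigma + 1) / 2 * weight (r / 2) z.
  by rewrite /Z' ZE; exact: multiplier_bound.
have [LW nW] := weight_L2 r0.
have LcW := L2Z mT (r `^ (sigma + 1) / 2) LW.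
have K0 : 0 <= r `^ (sigma + 1) / 2 by rewrite divr_ge0 ?powR_ge0.
have W0 z := ltW (weight_gt0 (r / 2) z).
have LZ' : L2p Z'.
  apply: (L2_le mT _ _ LcW).
    apply: measurable_funM; first exact: L2_meas LZ.
    rewrite (_ : (fun z => _) = fun z => mult (- sigma) z); first exact: measurable_mult.
    by apply/funext => z; rewrite /mult powRN.
  by move=> z _; rewrite (le_trans (hZ' z))// ler_norm.
(* The norm [2/r] of the weight turns [r^(sigma + 1) / 2] into [r^sigma]. *)
have nZ' : nrmp Z' <= r `^ sigma.
  apply: (@le_trans _ _ (nrmp (fun z => r `^ (sigma + 1) / 2 * weight (r / 2) z))).
    apply: (nrm_le mT LZ' LcW); apply: aeW => z _.
    by rewrite (le_trans (hZ' z))// ler_norm.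
  rewrite (nrmZ mT)// nW ger0_norm// powRD ?(gt_eqF r0) ?implybT// powRr1 ?(ltW r0)//.
  by rewrite le_eqVlt; apply/orP; left; apply/eqP; field; rewrite gt_eqF.
have hb : exists C : R, forall z, `|Z' z| <= C.
  exists (r `^ (sigma + 1) / 2) => z; rewrite (le_trans (hZ' z))// ler_piMr//.
  have hr : 0 <= r / 2 by rewrite divr_ge0// ltW.
  by rewrite /weight mulr_ile1 ?dexp_ge0 ?dexp_le1.
have ZZ z : Z z = mult sigma z * Z' z.
  have [z0|zp] := eqVneq (Num.sqrt (dotp z z)) 0.
    have c0 : c z = 0 by apply/eqP; rewrite -normr_le0 -z0; exact: hc.
    by rewrite /Z' ZE c0 !mul0r mulr0.
  rewrite /Z' mulrCA divff ?mulr1// gt_eqF// mult_gt0// lt_neqAle sqrtr_ge0 andbT.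
  by rewrite eq_sym.
have := low_frequency b0 sigma0 hL Lf Lw Zi LZ LZ' hb ZZ.
move=> /le_trans; apply; rewrite ler_wpM2r ?nrm_ge0// ler_wpM2l//.
by rewrite mulr_ge0 ?sqrtr_ge0// mulr_ge0 ?pi_ge0.
Qed.

(** The divergence condition trades [d1] for the horizontal derivatives, which integration by parts
    puts on the kernel; [sinT_psi] then brings [low_frequency_psi] into play, once for each
    horizontal component. *)
Lemma flux_bound v2 v3 w2 w3 d1 d2 d3 :
  L2s v2 -> L2s v3 -> L2s w2 -> L2s w3 -> L2s d1 -> L2s d2 -> L2s d3 ->
  is_Lambda b sigma v2 w2 -> is_Lambda b sigma v3 w3 ->
  isw [:: lift ord0 ord0] v2 d2 -> isw [:: ord_max] v3 d3 ->
  {ae mu3, forall x : mspace R, Omega b x -> d1 x + (d2 x + d3 x) = 0} ->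
  `|ips d1 (tens3 (cst 1) (kern r) (kern r))| <=
    2 * pi * Num.sqrt b * r `^ sigma * (nrms w2 + nrms w3).
Proof.
move=> L2v L3v Lw2 Lw3 Ld1 Ld2 Ld3 h2 h3 i2 i3 dv.
have tk := tame_kern r1; have dk : decays (kern r) := tk 0%N.
have LX := tame_L2 b0 1 tk tk.
have [p2 _] := horizontal_parts b0 L2v Ld2 dk dk.
have [_ p3] := horizontal_parts b0 L3v Ld3 dk dk.
have [i1 ix] := psi_itg; have [L1 Lx] := psi_L2.
have [Za _] := Rint_tens2 ix i1; have [Zb _] := Rint_tens2 i1 ix.
have LZa := L2_tens2 Lx L1; have LZb := L2_tens2 L1 Lx.
have [Sa Sb] := sinT_psi.
have [cc1 cc2] : (forall z : mplane R, `|z.1| <= Num.sqrt (dotp z z)) /\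
    (forall z : mplane R, `|z.2| <= Num.sqrt (dotp z z)).
  by split => z; have [] := coord_le_sqrt_dotp z.
have Ea z : tens2 psix psi1 z = z.1 * ((r / 2) ^+ 2 * weight r z).
  by rewrite /tens2 /psix /psi1 /weight; ring.
have Eb z : tens2 psi1 psix z = z.2 * ((r / 2) ^+ 2 * weight r z).
  by rewrite /tens2 /psix /psi1 /weight; ring.
have Ba := low_frequency_psi h2 L2v Lw2 Za LZa Ea cc1.
have Bb := low_frequency_psi h3 L3v Lw3 Zb LZb Eb cc2.
have N1 : L2s (tens3 (cst 1) (derive1 (kern r)) (kern r)).
  exact: (tame_L2 b0 1 (tame_derive 1 tk) tk).
have N2 : L2s (tens3 (cst 1) (kern r) (derive1 (kern r))).
  exact: (tame_L2 b0 1 tk (tame_derive 1 tk)).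
have ea : ips v2 (fun x => sinT (tens2 psix psi1) x.2) = ips d2 (tens3 (cst 1) (kern r) (kern r)).
  rewrite Sa (_ : (fun x => _) = fun x => -1 * tens3 (cst 1) (derive1 (kern r)) (kern r) x); last first.
    by apply/funext => x; rewrite /tens3 /tens2 /= !mul1r mulN1r.
  by rewrite (ipZr mO (-1) N1 L2v) (p2 i2) mulN1r opprK.
have eb : ips v3 (fun x => sinT (tens2 psi1 psix) x.2) = ips d3 (tens3 (cst 1) (kern r) (kern r)).
  rewrite Sb (_ : (fun x => _) = fun x => -1 * tens3 (cst 1) (kern r) (derive1 (kern r)) x); last first.
    by apply/funext => x; rewrite /tens3 /tens2 /= !mul1r mulN1r.
  by rewrite (ipZr mO (-1) N2 L3v) (p3 i3) mulN1r opprK.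
have e1 : ips d1 (tens3 (cst 1) (kern r) (kern r)) =
    - (ips d2 (tens3 (cst 1) (kern r) (kern r)) + ips d3 (tens3 (cst 1) (kern r) (kern r))).
  rewrite -(ipDl mO Ld2 Ld3 LX); apply/eqP; rewrite -addr_eq0 -(ipDl mO Ld1 (L2D mO Ld2 Ld3) LX).
  apply/eqP; apply: etrans (Rint0 mu3 (Omega b)); apply: (ae_eq_Rint mO).
  - by apply: measurable_funM; [exact: L2_meas (L2D mO Ld1 (L2D mO Ld2 Ld3))|exact: L2_meas LX].
  - exact: measurable_cst.
  - by apply: filterS dv => x + Ox => /(_ Ox) ->; rewrite mul0r.
rewrite e1 normrN (le_trans (ler_normD _ _))// mulrDr.
by apply: lerD; [rewrite -ea|rewrite -eb].
Qed.

End flux.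

(** * From distributional to integrated equations in time *)

Section du_bois_reymond.
Variable R : realType.
Local Notation mu1 := (@lebesgue_measure R).
Local Notation dir1 := (fun _ : 'I_1 => 1 : R^o).
Implicit Types (F g : R -> R).

(** Freezing the value at 0 for negative times extends a function continuous on the half-line to the
    whole line. *)
Lemma continuous_max0 F :
  (forall t : R, 0 <= t -> F s @[s --> within [set s | 0 <= s] (nbhs t)] --> F t) ->
  continuous (fun t : R => F (Num.max t 0)).
Proof.
move=> h t; set t' : R := Num.max t 0.
have t'0 : 0 <= t' by rewrite /t' le_max lexx orbT.
have := h t' t'0; move=> /cvgrPdist_lt hc; apply/cvgrPdist_lt => e e0.
have := hc e e0; rewrite near_withinE => /nbhs_ballP[d /= d0 hd].
apply/nbhs_ballP; exists d => //= s; rewrite /ball/= => ts.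
apply: hd; last by rewrite /= le_max lexx orbT.
rewrite /ball/=; apply: le_lt_trans ts; rewrite /t'.
have [t0|t0] := leP t 0; have [s0|s0] := leP s 0.
- by rewrite subrr normr0.
- by rewrite sub0r normrN gtr0_norm// distrC ger0_norm; lra.
- by rewrite subr0 gtr0_norm// ger0_norm; lra.
- by [].
Qed.

Lemma smooth1_smooth (psi : R -> R) : smooth1 psi -> smooth dir1 psi.
Proof.
move=> s w x.
have -> : foldr (pd dir1) psi w = iter (size w) (@derive1 R R) psi.
  elim: w => //= j w ->; apply/funext => y; rewrite /pd derive1E; reflexivity.
by have [d _] := smooth1_derive (smooth1_iter (size w) s); apply/derivable1_diffP; have [] := d x.
Qed.

(** Rises from 0 at [c + d/(n+1)] to 1 at [c + (d+1)/(n+1)]. With [d = 1] and [c = 0] the support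
    stays away from the initial time. *)
Definition ramp (c d : R) (n : nat) (t : R) : R := step (n.+1%:R * (t - c) - d).
Definition spike (c d : R) (n : nat) (t : R) : R :=
  n.+1%:R * derive1 (@step R) (n.+1%:R * (t - c) - d).

Lemma smooth1_ramp c d n : smooth1 (ramp c d n).
Proof.
have -> : ramp c d n = (fun t => step (n.+1%:R * t + (- n.+1%:R * c - d))).
  by apply/funext => t; rewrite /ramp; congr step; ring.
by apply: smooth1_affine; exact: smooth1_step_fun.
Qed.

Lemma is_derive_ramp c d n t : is_derive t (1 : R) (ramp c d n) (spike c d n t).
Proof.
have [ds _] := smooth1_derive (@smooth1_step_fun R).
have d1 : is_derive t (1 : R) (fun t => n.+1%:R * (t - c) - d) (n.+1%:R : R).
  apply: (is_derive_eq (is_deriveB (is_deriveZ (n.+1%:R : R) (is_deriveB (is_derive_id t (1 : R)) (is_derive_cst c t 1))) (is_derive_cst d t 1))).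
  by rewrite /GRing.scale/= !subr0 mulr1.
apply: (is_derive_eq (@is_derive1_comp _ (@step R) (fun t => n.+1%:R * (t - c) - d) t _ _ (ds _) d1)).
by rewrite /spike mulrC.
Qed.

Lemma ramp_derive c d n : derive1 (ramp c d n) = spike c d n.
Proof. by apply: is_derive_derive1 => t; exact: is_derive_ramp. Qed.

Lemma continuous_spike c d n : continuous (spike c d n).
Proof. by rewrite -ramp_derive; apply: smooth1_cont; have [] := smooth1_derive (smooth1_ramp c d n). Qed.

Lemma step_derive_out (u : R) : ~ (0 <= u <= 1) -> derive1 (@step R) u = 0.
Proof.
move=> hu; rewrite derive1E.
have [u0|u0] := ltP u 0.
  rewrite (@near_eq_derive R R R _ (cst (0 : R))) ?derive_cst//.
  near=> v; rewrite step_le0//; apply: ltW; near: v; exact: lt_nbhsl.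
have u1 : 1 < u by rewrite ltNge; apply/negP => h; apply: hu; rewrite u0.
rewrite (@near_eq_derive R R R _ (cst (1 : R))) ?derive_cst//.
near=> v; rewrite step_ge1//; apply: ltW; near: v; exact: lt_nbhsr.
Unshelve. all: by end_near. Qed.

Lemma spike_ge0 c d n t : 0 <= spike c d n t.
Proof. by rewrite mulr_ge0// step_derive_ge0. Qed.

Lemma spike_out c d n t : 0 <= d <= 1 -> ~ (c <= t <= c + 2 / n.+1%:R) -> spike c d n t = 0.
Proof.
move=> /andP[d0 d1] ht; rewrite /spike step_derive_out ?mulr0// => /andP[h1 h2]; apply: ht.
have n0 : 0 < n.+1%:R :> R by rewrite ltr0n.
apply/andP; split.
  by rewrite -subr_ge0 -(pmulr_rge0 _ n0); lra.
by rewrite -lerBlDl ler_pdivlMr// mulrC; lra.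
Qed.

Fact interval_dist_lt (c a r t : R) : a < r -> c <= t -> t <= c + a -> `|c - t| < r.
Proof. by move=> h1 h2 h3; rewrite distrC ger0_norm; lra. Qed.

(** Spikes are nonnegative, of mass 1, and supported in intervals that shrink to [c] from the
    right. *)
Lemma spike_cvg c d F : 0 <= d <= 1 -> continuous F ->
  (forall n, mu1.-integrable setT (EFin \o (fun t => spike c d n t * F t))) /\
  \int[mu1]_t (spike c d n t * F t) @[n --> \oo] --> F c.
Proof.
move=> hd cF; have d01 := andP hd.
pose I n := `[c, c + 2 / n.+1%:R]%classic : set (measurableTypeR R).
have mI n : measurable (I n) := measurable_itv _.
have n0 n : 0 < n.+1%:R :> R by rewrite ltr0n.
have cI n : c <= c + 2 / n.+1%:R by rewrite lerDl divr_ge0.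
have cM (f g : R -> R) : continuous f -> continuous g -> continuous (fun z => f z * g z).
  by move=> cf cg z; apply: cvgM; [exact: cf|exact: cg].
have sup n G : forall t, ~ I n t -> spike c d n t * G t = 0.
  by move=> t ht; rewrite spike_out ?mul0r// => h; apply: ht; rewrite /I/= in_itv.
have iI n G : continuous G -> mu1.-integrable (I n) (EFin \o (fun t => spike c d n t * G t)).
  by move=> cG; apply: continuous_itv_integrable; apply: cM => //; exact: continuous_spike.
have iT n G : continuous G -> mu1.-integrable setT (EFin \o (fun t => spike c d n t * G t)).
  move=> cG; have h2 := (@integrable_mkcond _ _ _ mu1 (I n) (EFin \o (fun t : R => spike c d n t * G t)) (measurable_itv _)).1 (iI n G cG).
  apply: eq_integrable h2 => // t _ /=; rewrite patchE /=; case: ifPn => // ht.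
  by rewrite sup// => h; move/negP: ht; apply; exact/mem_set.
split; first by move=> n; exact: iT.
have one n : \int[mu1]_(t in I n) spike c d n t = 1.
  rewrite (FTC (is_derive_ramp c d n) (@continuous_spike c d n) (cI n)) /ramp.
  rewrite step_ge1 ?step_le0 ?subr0//; first by rewrite subrr mulr0; lra.
  have -> : n.+1%:R * (c + 2 / n.+1%:R - c) = 2 :> R by field; rewrite nat1r gt_eqF.
  by lra.
apply/cvgrPdist_le => e e0.
have /cvgrPdist_le/(_ e e0)/nbhs_ballP[r /= r0 hr] := cF c.
near=> n.
have hn : 2 / n.+1%:R < r.
  rewrite ltr_pdivrMr// mulrC -ltr_pdivrMr//.
  apply: (@lt_trans _ _ n%:R); last by rewrite ltr_nat.
  by near: n; exact: nbhs_infty_gtr.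
rewrite (Rint_supported mu1 (sup n F)).
have i1 := iI n F cF.
have i2 : mu1.-integrable (I n) (EFin \o (fun t => spike c d n t * F c)).
  by apply: (iI n (fun=> F c)) => z; exact: cvg_cst.
have i3 : mu1.-integrable (I n) (EFin \o spike c d n).
  by apply: continuous_itv_integrable; exact: continuous_spike.
have -> : F c = \int[mu1]_(t in I n) (spike c d n t * F c).
  by rewrite (RintegralZr (F c) (mI n) i3) one mul1r.
have i4 : mu1.-integrable (I n) (EFin \o (fun t : R => spike c d n t * F c - spike c d n t * F t)).
  exact: (@itgB _ _ _ mu1 (I n) (measurable_itv _) _ _ i2 i1).
rewrite -(RintegralB (mI n) i2 i1).
have i6 := itg_norm i4.
have h6 : `|\int[mu1]_(x in I n) (spike c d n x * F c - spike c d n x * F x)| <= \int[mu1]_(x in I n) `|spike c d n x * F c - spike c d n x * F x|.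
  by have := le_norm_Rint (mI n) i4; rewrite (itgE (mI n) i6) lee_fin.
apply: (le_trans h6).
have i5 : mu1.-integrable (I n) (EFin \o (fun t => e * spike c d n t)).
  exact: (itgZ (mI n) e i3).
have -> : e = \int[mu1]_(t in I n) (e * spike c d n t).
  by rewrite (RintegralZl e (mI n) i3) one mulr1.
apply: (le_Rintegral (mI n) i6 i5).
move=> t; rewrite /I /= in_itv/= => /andP[t1 t2].
rewrite -mulrBr normrM (ger0_norm (spike_ge0 _ _ _ _)) mulrC ler_wpM2r ?spike_ge0//.
by apply: hr; exact: (interval_dist_lt hn t1 t2).
Unshelve. all: by end_near. Qed.

(** A smooth approximation of the indicator of []0, t]] with compact support in the open
    half-line. *)
Definition window (t : R) (n : nat) (s : R) : R := ramp 0 1 n s - ramp t 1 n s.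

Lemma window_test t n : 0 <= t -> testfun dir1 [set s | 0 < s] (window t n).
Proof.
move=> t0; have n0 : 0 < n.+1%:R :> R by rewrite ltr0n.
have n1 : 0 < n.+1%:R^-1 :> R by rewrite invr_gt0.
split.
  apply: smooth1_smooth.
  have -> : window t n = (fun s => ramp 0 1 n s + -1 * ramp t 1 n s).
    by apply/funext => s; rewrite /window mulN1r.
  apply: smooth1D; first exact: smooth1_ramp.
  by apply: smooth1M; [exact: smooth1_cst|exact: smooth1_ramp].
exists `[n.+1%:R^-1, t + 2 / n.+1%:R]%classic; split.
- exact: segment_compact.
- by move=> s /=; rewrite in_itv/= => /andP[h _]; exact: lt_le_trans h.
move=> s0 /= hs; rewrite /window /ramp subr0; have [s es] : exists s : R, s = s0 by exists s0.
rewrite -es; rewrite -es in hs; clear es s0.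
have [h1|h1] := ltP s n.+1%:R^-1.
  have : n.+1%:R * s <= 1 by rewrite mulrC -ler_pdivlMr// div1r ltW.
  have : n.+1%:R * (s - t) <= n.+1%:R * s by rewrite ler_wpM2l//; lra.
  by move=> h2 h3; rewrite !step_le0 ?subr0//; lra.
have h2 : t + 2 / n.+1%:R < s.
  by rewrite ltNge; apply/negP => h; apply: hs; rewrite in_itv/= h1.
have h3 : 2 <= n.+1%:R * (s - t).
  by rewrite mulrC -ler_pdivrMr// lerBrDl ltW.
have h4 : n.+1%:R * (s - t) <= n.+1%:R * s by rewrite ler_wpM2l//; lra.
by rewrite !step_ge1 ?subrr//; lra.
Qed.

(** The derivative of a window is a difference of approximate identities at 0 and at [t]: the
    left-hand side tends to [F 0 - F t] and the right-hand side to minus the integral of [g]. *)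
Lemma du_bois_reymond F g : continuous F -> continuous g ->
  (forall psi, testfun dir1 [set t | 0 < t] psi ->
    \int[mu1]_(t in `]0, +oo[) (derive1 psi t * F t) =
    - \int[mu1]_(t in `]0, +oo[) (psi t * g t)) ->
  forall t, 0 <= t -> F t = F 0 + \int[mu1]_(s in `[0, t]) g s.
Proof.
move=> cF cg H t t0.
have win n := H _ (window_test n t0).
have dw (n : nat) (s : R) : derive1 (window t n) s = spike 0 1 n s - spike t 1 n s.
  have d1 := is_derive_ramp 0 1 n s; have d2 := is_derive_ramp t 1 n s.
  by rewrite derive1E (@derive_val _ _ _ _ _ _ _ (is_deriveB d1 d2)).
have supp (n : nat) (s : R) : ~ `]0, +oo[%classic s -> window t n s = 0.
  move=> hs; have [_ [K [_ KU K0]]] := window_test n t0; apply: K0 => /KU /= s0; apply: hs.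
  by rewrite /= in_itv/= s0.
have supp' (n : nat) (s : R) : ~ `]0, +oo[%classic s -> derive1 (window t n) s = 0.
  rewrite dw => hs; have s0 : s <= 0 by rewrite leNgt; apply/negP => h; apply: hs; rewrite /= in_itv/= h.
  have n0 : 0 < n.+1%:R :> R by rewrite ltr0n.
  have h1 : n.+1%:R * s <= 0 by rewrite mulr_ge0_le0// ltW.
  have h2 : n.+1%:R * (s - t) <= 0 by rewrite mulr_ge0_le0 ?(ltW n0)//; lra.
  rewrite /spike subr0 !step_derive_out ?mulr0 ?subrr// => /andP[]; lra.
have d01 : 0 <= (1 : R) <= 1 by rewrite ler01 lexx.
have [i0 c0] := spike_cvg 0 d01 cF; have [it ct] := spike_cvg t d01 cF.
have cL : \int[mu1]_(s in `]0, +oo[) (derive1 (window t n) s * F s) @[n --> \oo] --> F 0 - F t.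
  have -> : (fun n => \int[mu1]_(s in `]0, +oo[) (derive1 (window t n) s * F s)) =
      (fun n => \int[mu1]_s (spike 0 1 n s * F s) - \int[mu1]_s (spike t 1 n s * F s)).
    apply/funext => n; rewrite -RintegralB// -(Rint_supported mu1); last first.
      by move=> s hs; rewrite supp' ?mul0r.
    by apply: eq_Rintegral => s _; rewrite dw mulrBl.
  exact: cvgB.
have mcg : measurable_fun setT g by exact: continuous_measurable_fun.
have cw n : continuous (window t n).
  by move=> s; apply: cvgB; apply: smooth1_cont; exact: smooth1_ramp.
have mw n : measurable_fun setT (window t n) by exact: continuous_measurable_fun.
pose G s := (g \_ (`]0, t]%classic : set (measurableTypeR R))) s.
pose D s := `| (g \_ (`[0, t + 2]%classic : set (measurableTypeR R))) s|.
have iD : mu1.-integrable setT (EFin \o D).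
  have h : mu1.-integrable `[0, t + 2]%classic (EFin \o g) by exact: continuous_itv_integrable.
  have h2 := (@integrable_mkcond _ _ _ mu1 `[0, t + 2]%classic (EFin \o g) (measurable_itv _)).1 h.
  by apply: itg_norm; apply: eq_integrable h2 => // s _ /=; rewrite !patchE; case: ifP.
have mG : measurable_fun setT G.
  by apply/(measurable_restrictT _ (measurable_itv _)); exact: measurable_funTS.
have w01 (n : nat) (s : R) : `|window t n s| <= 1.
  rewrite ler_norml /window; have := step_ge0 (n.+1%:R * (s - 0) - 1); have := step_le1 (n.+1%:R * (s - 0) - 1).
  by have := step_ge0 (n.+1%:R * (s - t) - 1); have := step_le1 (n.+1%:R * (s - t) - 1); rewrite -/(ramp 0 1 n s) -/(ramp t 1 n s) => h1 h2 h3 h4; apply/andP; lra.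
have wout (n : nat) (s : R) : ~ (0 <= s <= t + 2) -> window t n s = 0.
  move=> hs; have [s0|s0] := leP 0 s; last by apply: supp => /=; rewrite in_itv/= andbT; lra.
  have ts : t + 2 < s by rewrite ltNge; apply/negP => h; apply: hs; rewrite s0.
  have n1 : 1 <= n.+1%:R :> R by rewrite ler1n.
  have h1 : s - t <= n.+1%:R * (s - t) by rewrite ler_peMl//; lra.
  have h2 : s <= n.+1%:R * s by rewrite ler_peMl.
  by rewrite /window /ramp !step_ge1 ?subrr//; lra.
have limG (s : R) : window t n s * g s @[n --> \oo] --> G s.
  have [s0|s0] := leP s 0.
    rewrite /G patchE memNset/=; last by rewrite in_itv/=; lra.
    apply: cvg_near_cst; apply: nearW => n; rewrite supp ?mul0r//= in_itv/= andbT.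
    by apply/negP; rewrite -leNgt.
  have big (u : R) : 0 < u -> \forall n \near \oo, step (n.+1%:R * u - 1) = 1.
    move=> u0; near=> n; have h : 2 <= n.+1%:R * u.
      rewrite -ler_pdivrMr//; apply: (@le_trans _ _ n%:R); last by rewrite ler_nat.
      by near: n; exact: nbhs_infty_ger.
    by rewrite step_ge1//; lra.
  have [st|ts] := leP s t.
    rewrite /G patchE mem_set/=; last by rewrite in_itv/= s0.
    apply: cvg_near_cst; have := big s s0; apply: filterS => n h.
    rewrite /window /ramp subr0 h step_le0 ?subr0 ?mul1r//.
    have : n.+1%:R * (s - t) <= 0 by rewrite mulr_ge0_le0//; lra.
    by lra.
  rewrite /G patchE memNset/=; last by rewrite in_itv/=; lra.
  have st : 0 < s - t by lra.
  apply: cvg_near_cst; have := big s s0; have := big _ st; apply: filterS2 => n h1 h2.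
  by rewrite /window /ramp !subr0 h2 h1 subrr mul0r.
have domG (s : R) (n : nat) : `|window t n s * g s| <= D s.
  rewrite /D patchE; case: ifPn => [_|hs].
    by rewrite normrM ler_piMl.
  rewrite wout ?mul0r ?normr0// => h; move/negP: hs; apply; apply/mem_set.
  by rewrite /= in_itv.
have [_ cI] : mu1.-integrable setT (EFin \o G) /\
    \int[mu1]_s (window t n s * g s) @[n --> \oo] --> \int[mu1]_s G s.
  apply: (Rint_dct measurableT _ mG iD).
  - by move=> n; exact: (@measurable_funM _ _ _ setT (window t n) g (mw n) mcg).
  - by apply: aeW => s _; exact: limG.
  - by apply: aeW => s _ n; exact: domG.
have cR : (- \int[mu1]_(s in `]0, +oo[) (window t n s * g s)) @[n --> \oo] --> - \int[mu1]_s G s.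
  apply: cvgN; move: cI; apply: cvg_trans; apply: near_eq_cvg; apply: nearW => n.
  by apply: Rint_supported => s hs; rewrite supp ?mul0r.
have E := cvg_eq_lim win cL cR.
have -> : \int[mu1]_(s in `[0, t]) g s = \int[mu1]_s G s.
  rewrite -[RHS]Rintegral_mkcond Rintegral_itv_obnd_cbnd//.
  apply: (@integrableS _ _ _ mu1 `[0, t]%classic); [exact: measurable_itv|exact: measurable_itv| |].
    exact: subset_itv_oc_cc.
  exact: continuous_itv_integrable.
by rewrite -[\int[mu1]_s G s]opprK -E; ring.
Unshelve. all: by end_near. Qed.

End du_bois_reymond.

(** * Almost everywhere convergence and integrals without measurability *)

Section abstract_measure.
Context (R : realType) (d : measure_display) (T : measurableType d).
Variable mu : {measure set T -> \bar R}.

Lemma sq_cvg0 (u : nat -> R) : (u n) ^+ 2 @[n --> \oo] --> 0 -> u n @[n --> \oo] --> 0.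
Proof.
move=> /cvgrPdist_lt h; apply/cvgrPdist_lt => e e0.
have e2 : 0 < e ^+ 2 by rewrite exprn_gt0.
have := h _ e2; apply: filterS => n; rewrite !sub0r !normrN normrX => hn.
by rewrite -(@ltr_pXn2r _ 2)// ?nnegrE// ltW.
Qed.

Lemma nneseries_lty_cvg0 (u : nat -> R) : (forall n, 0 <= u n) ->
  (\sum_(0 <= n <oo) (u n)%:E < +oo)%E -> u n @[n --> \oo] --> 0.
Proof.
move=> u0 h; apply: cvg_series_cvg_0; apply: nondecreasing_is_cvgn.
  by move=> m n mn; apply: nondecreasing_series => // k _ _.
set S := (X in (X < _)%E) in h.
have S0 : (0 <= S)%E by apply: nneseries_ge0 => n _ _; rewrite lee_fin.
have fS : S \is a fin_num by rewrite ge0_fin_numE.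
exists (fine S) => _ [n _ <-]; rewrite -lee_fin fineK// /series/= -sumEFin.
exact: (@nneseries_lim_ge R (fun k => (u k)%:E) xpredT 0%N n (fun k _ _ => u0 k)).
Qed.

(** The integrals of the squares are summable, so the series of squares is integrable, hence finite
    a.e., and its terms tend to 0. *)
Lemma ae_cvg0 (D : set T) (f_ : nat -> T -> R) (C : R) : measurable D ->
  (forall n, L2 mu D (f_ n)) -> (forall n, nrm mu D (f_ n) <= C / 2 ^+ n) ->
  {ae mu, forall x, D x -> f_ n x @[n --> \oo] --> 0}.
Proof.
move=> mD Lf hf; pose g n x := ((f_ n x) ^+ 2)%:E.
have mg n : measurable_fun D (g n).
  by apply/measurable_EFinP; apply: measurable_funX; exact: L2_meas (Lf n).
have g0 n x : D x -> (0 <= g n x)%E by move=> _; rewrite lee_fin sqr_ge0.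
have e := integral_nneseries mu mD mg g0.
have fin : (\int[mu]_(x in D) (\sum_(0 <= n <oo) g n x) < +oo)%E.
  rewrite e; apply: (@le_lt_trans _ _ (2 * C ^+ 2 / 2 ^+ 0)%:E); last exact: ltry.
  have -> : (2 * C ^+ 2 / 2 ^+ 0)%:E =
      (\sum_(0 <= n <oo) (2 * C ^+ 2 / (2 ^ (n + 1))%:R)%:E)%E :> \bar R.
    exact: (esym (cvg_lim _ (@cvg_geometric_eseries_half R (2 * C ^+ 2) 0))).
  apply: lee_nneseries => [n _ _|n _]; first by apply: integral_ge0 => x Dx; exact: g0.
  rewrite /g ip_EFin// lee_fin -nrm2; apply: (@le_trans _ _ ((C / 2 ^+ n) ^+ 2)).
    by rewrite ler_pXn2r// nnegrE ?nrm_ge0// (le_trans (nrm_ge0 _ _ _) (hf n)).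
  have p0 : 1 <= 2 ^+ n :> R by rewrite exprn_ege1// ler1n.
  rewrite natrX addn1 [2 ^+ n.+1]exprS invfM mulrACA mulfV// mul1r expr_div_n ler_wpM2l ?sqr_ge0//.
  move: p0; set q : R := 2 ^+ n => p0; have q0 : 0 < q := lt_le_trans ltr01 p0.
  by rewrite lef_pV2 ?posrE ?exprn_gt0// expr2 ler_peMr// ltW.
have ms : measurable_fun D (fun x => \sum_(0 <= n <oo) g n x)%E.
  exact: (ge0_emeasurable_sum (P := xpredT) (fun n x Dx _ => g0 n x Dx) (fun n _ => mg n)).
have int : mu.-integrable D (fun x => \sum_(0 <= n <oo) g n x)%E.
  apply/integrableP; split => //; apply: le_lt_trans fin.
  rewrite le_eqVlt; apply/orP; left; apply/eqP; apply: eq_integral => x /set_mem Dx.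
  by rewrite gee0_abs//; apply: nneseries_ge0 => n _ _; exact: g0.
have := integrable_ae mD int; apply: filterS => x h Dx; apply: sq_cvg0.
apply: nneseries_lty_cvg0 => [n|]; first exact: sqr_ge0.
by have := h Dx; rewrite ge0_fin_numE//; apply: nneseries_ge0 => n _ _; exact: g0.
Qed.

(* No measurability: the integral of a nonnegative function is a supremum over
   simple functions. *)
Lemma le_integral_nonmeas (D D' : set T) (f g : T -> \bar R) : D `<=` D' ->
  (forall x, D x -> 0 <= f x)%E -> (forall x, D x -> f x <= g x)%E ->
  (forall x, D' x -> 0 <= g x)%E ->
  (\int[mu]_(x in D) f x <= \int[mu]_(x in D') g x)%E.
Proof.
move=> DD' f0 fg g0; rewrite integral_mkcond [leRHS]integral_mkcond.
have F0 x : (0 <= (f \_ D) x)%E by rewrite patchE; case: ifPn => // /set_mem/f0.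
have G0 x : (0 <= (g \_ D') x)%E by rewrite patchE; case: ifPn => // /set_mem/g0.
rewrite (ge0_integralTE mu F0) (ge0_integralTE mu G0).
apply: ereal_sup_le => _ [h hf <-]; exists h => // x; apply: (le_trans (hf x)).
rewrite !patchE; case: ifPn => [/set_mem Dx|_].
  by rewrite mem_set; [exact: fg|exact: DD'].
by case: ifPn => // /set_mem/g0.
Qed.

(** Applied to a norm [g] whose measurability in time is not known. The exceptional null set is
    removed on the side of the measurable [f] alone; the other side only increases when its domain
    does. *)
Lemma le_integral_ae_nonmeas (D : set T) (f : T -> R) (g : T -> \bar R) : measurable D ->
  measurable_fun D f -> (forall x, D x -> 0 <= f x) -> (forall x, D x -> 0 <= g x)%E ->
  {ae mu, forall x, D x -> (f x)%:E <= g x}%E ->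
  (\int[mu]_(x in D) (f x)%:E <= \int[mu]_(x in D) g x)%E.
Proof.
move=> mD mf f0 g0 [N [mN N0 hN]].
rewrite (ge0_negligible_integral mN mD _ _ N0); first last.
- by move=> x Dx; rewrite lee_fin f0.
- by apply/measurable_EFinP.
apply: le_integral_nonmeas => //.
- by move=> x [Dx _]; rewrite lee_fin f0.
- by move=> x [Dx Nx]; apply: contrapT => h; apply: Nx; apply: hN => /= /(_ Dx).
Qed.

End abstract_measure.

(** * Linearization of the constraint, linear coefficients and growth *)

Section matrix_limits.
Variable R : realType.
Implicit Types (u : nat -> R).

Lemma cvg_prodr (I : Type) (r : seq I) (f : I -> nat -> R) (l : I -> R) :
  (forall i, f i n @[n --> \oo] --> l i) ->
  \prod_(i <- r) f i n @[n --> \oo] --> \prod_(i <- r) l i.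
Proof.
move=> h; elim: r => [|i r IH].
  by rewrite big_nil; under eq_fun do rewrite big_nil; exact: cvg_cst.
by rewrite big_cons; under eq_fun do rewrite big_cons; apply: cvgM; [exact: h|exact: IH].
Qed.

Lemma cvg_det m (A_ : nat -> 'M[R]_m) (A : 'M[R]_m) :
  (forall i j, A_ n i j @[n --> \oo] --> A i j) -> \det (A_ n) @[n --> \oo] --> \det A.
Proof.
move=> h; rewrite /determinant; apply: cvg_sumr => s.
by apply: cvgM; [exact: cvg_cst|apply: cvg_prodr => i; exact: h].
Qed.

Lemma cvg_adj m (A_ : nat -> 'M[R]_m) (A : 'M[R]_m) i j :
  (forall i j, A_ n i j @[n --> \oo] --> A i j) ->
  (\adj (A_ n)) i j @[n --> \oo] --> (\adj A) i j.
Proof.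
move=> h; rewrite /adjugate mxE; under eq_fun do rewrite mxE.
rewrite /cofactor; apply: cvgM; first exact: cvg_cst.
by apply: cvg_det => k l; rewrite !mxE; under eq_fun do rewrite !mxE; exact: h.
Qed.

(* Multiplying by J turns A into the adjugate of 1 + G, which is polynomial in G. *)
Lemma Jof_Aof (G : 'M[R]_3) i j : Jof G != 0 -> Jof G * Aof G i j = (\adj (1%:M + G)) j i.
Proof.
move=> J0; rewrite /Aof mxE /invmx unitmxE unitfE -/(Jof G) J0 mxE mulrA -/(Jof G).
by rewrite divff// mul1r.
Qed.

(** Multiplication by [J] leaves an expression polynomial in the gradients; as the displacement
    gradient tends to 0 the adjugate tends to the identity, and the trace of [H] remains. *)
Lemma linearized_incompressibility (G_ H_ : nat -> 'M[R]_3) (H : 'M[R]_3) :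
  (forall i j, G_ n i j @[n --> \oo] --> (0 : R)) ->
  (forall i j, H_ n i j @[n --> \oo] --> H i j) ->
  (forall n, Jof (G_ n) != 0) ->
  (forall n, \sum_(i < 3) \sum_(j < 3) Aof (G_ n) i j * H_ n i j = 0) ->
  \sum_(i < 3) H i i = 0.
Proof.
move=> hG hH J0 hA.
have c : \sum_(i < 3) \sum_(j < 3) (\adj (1%:M + G_ n)) j i * H_ n i j @[n --> \oo] -->
    \sum_(i < 3) \sum_(j < 3) (\adj (1%:M : 'M[R]_3)) j i * H i j.
  apply: cvg_sumr => i; apply: cvg_sumr => j; apply: cvgM; last exact: hH.
  apply: cvg_adj => k l; have c1 : (1%:M : 'M[R]_3) k l + G_ n k l @[n --> \oo] --> (1%:M : 'M[R]_3) k l + 0.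
    by apply: cvgD; [exact: cvg_cst|exact: hG].
  by rewrite addr0 in c1; under eq_fun do rewrite mxE; exact: c1.
have E n : \sum_(i < 3) \sum_(j < 3) (\adj (1%:M + G_ n)) j i * H_ n i j = 0.
  transitivity (Jof (G_ n) * \sum_(i < 3) \sum_(j < 3) Aof (G_ n) i j * H_ n i j); last first.
    by rewrite hA mulr0.
  rewrite mulr_sumr; apply: eq_bigr => i _.
  by rewrite mulr_sumr; apply: eq_bigr => j _; rewrite mulrA Jof_Aof.
have := cvg_eq_lim E c (cvg_cst (0 : R)); rewrite adj1 => e; rewrite -[RHS]e.
apply: eq_bigr => i _; rewrite (bigD1 i)//= big1 ?addr0 ?mxE ?eqxx ?mul1r//.
by move=> j ji; rewrite mxE (negbTE ji) mul0r.
Qed.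

(* The combination cancels the even coefficients and the cubic one. *)
Lemma linear_coefficient_cvg (c e : R) (a1 a2 a3 : R -> R) : 0 < e ->
  (forall eps, `|eps| <= e ->
    eps * c + (eps * a1 t + eps ^+ 2 * a2 t + eps ^+ 3 * a3 t) @[t --> +oo] --> (0 : R)) ->
  a1 t @[t --> +oo] --> - c.
Proof.
move=> e0 h.
pose S (eps t : R) := eps * c + (eps * a1 t + eps ^+ 2 * a2 t + eps ^+ 3 * a3 t).
have cS eps : `|eps| <= e -> S eps t @[t --> +oo] --> (0 : R) := h eps.
have e2 : `|e / 2| <= e by rewrite gtr0_norm; lra.
have e1 : `|e| <= e by rewrite gtr0_norm.
have k : (6 * e)^-1 * (8 * (S (e / 2) t - S (- (e / 2)) t) - (S e t - S (- e) t)) - c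
    @[t --> +oo] --> (6 * e)^-1 * (8 * (0 - 0) - (0 - 0)) - c.
  apply: cvgB; last exact: cvg_cst.
  apply: cvgM; first exact: cvg_cst.
  apply: cvgB; last by apply: cvgB; apply: cS; rewrite ?normrN.
  apply: cvgM; first exact: cvg_cst.
  by apply: cvgB; apply: cS; rewrite ?normrN.
have -> : - c = (6 * e)^-1 * (8 * (0 - 0) - (0 - 0)) - c by ring.
move: k; apply: cvg_trans; apply: near_eq_cvg; apply: nearW => t.
by rewrite /S; field; rewrite gt_eqF.
Qed.

(** Tested at the [r] for which [r^(p - s) = 1 + C2/C1]. *)
Lemma powR_growth (p s C1 C2 : R) : s < p -> 0 < C1 ->
  (forall r, 1 <= r -> C1 * r `^ p <= C2 * r `^ s) -> False.
Proof.
move=> sp C10 h; have ps : 0 < p - s by lra.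
have C20 : 0 < C2 by have := h 1 (lexx _); rewrite !powR1 !mulr1; lra.
pose q := 1 + C2 / C1; have q1 : 1 < q by rewrite /q ltrDl divr_gt0.
have q0 : 0 < q by lra.
have r1 : 1 <= q `^ ((p - s)^-1).
  by rewrite -[leLHS](powRr0 q) ler_powR ?invr_ge0// ltW.
have r0 : 0 < q `^ ((p - s)^-1) by lra.
have rq : (q `^ (p - s)^-1) `^ (p - s) = q.
  by rewrite -powRrM mulVf ?gt_eqF// powRr1// ltW.
have := h _ r1; move: r0 rq; set x := q `^ _ => x0 rq.
have -> : x `^ p = q * x `^ s.
  by rewrite -{1}rq -powRD ?subrK// (gt_eqF x0) implybT.
rewrite mulrA ler_pM2r ?powR_gt0//.
by rewrite /q mulrDr mulr1 mulrCA mulfV ?gt_eqF// mulr1; lra.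
Qed.

End matrix_limits.

(** * Continuity and the fundamental theorem on the time half-line *)

Section time.
Variable R : realType.
Local Notation mu1 := (@lebesgue_measure R).
Local Notation dir1 := (fun _ : 'I_1 => 1 : R^o).

(** Continuity at 0 is one-sided, so that initial values enter the fundamental theorem. *)
Definition cts0 (F : R -> R) :=
  forall t : R, 0 <= t -> F s @[s --> within [set s | 0 <= s] (nbhs t)] --> F t.

Lemma eq_max0 (F : R -> R) t : 0 <= t -> F (Num.max t 0) = F t.
Proof. by move=> t0; rewrite max_l. Qed.

Lemma cts0_itg F t : cts0 F -> mu1.-integrable `[0, t] (EFin \o F).
Proof.
move=> /continuous_max0 h; have := @continuous_itv_integrable R _ 0 t h.
apply: eq_integrable => [|s]; first exact: measurable_itv.
by move=> /set_mem /=; rewrite in_itv/= => /andP[s0 _]; rewrite eq_max0.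
Qed.

Lemma cts0_meas F (D : set (measurableTypeR R)) : measurable D -> D `<=` [set s : R | 0 <= s] ->
  cts0 F -> measurable_fun D F.
Proof.
move=> mD D0 /continuous_max0 h.
have m : measurable_fun setT (fun t : R => F (Num.max t 0)) by exact: continuous_measurable_fun.
apply: (eq_measurable_fun (fun t : R => F (Num.max t 0))); last exact: measurable_funTS.
by move=> s /set_mem /D0 /= s0; rewrite eq_max0.
Qed.

Lemma time_ftc (F g : R -> R) : cts0 F -> cts0 g ->
  (forall psi, testfun dir1 [set t | 0 < t] psi ->
    \int[mu1]_(t in `]0, +oo[) (derive1 psi t * F t) =
    - \int[mu1]_(t in `]0, +oo[) (psi t * g t)) ->
  forall t, 0 <= t -> F t = F 0 + \int[mu1]_(s in `[0, t]) g s.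
Proof.
move=> cF cg H t t0.
have := du_bois_reymond (continuous_max0 cF) (continuous_max0 cg) _ t0.
rewrite /= !eq_max0// => ->; last first.
  move=> psi tpsi; have := H psi tpsi.
  have E (k f : R -> R) : \int[mu1]_(t in `]0, +oo[) (k t * f (Num.max t 0)) =
      \int[mu1]_(t in `]0, +oo[) (k t * f t).
    apply: eq_Rintegral => s /set_mem /=; rewrite in_itv/= andbT => s0.
    by rewrite eq_max0// ltW.
  by rewrite !E.
congr (_ + _); apply: eq_Rintegral => s /set_mem /=; rewrite in_itv/= => /andP[s0 _].
by rewrite eq_max0.
Qed.

(** The extended norm puts no topology on fields; continuity is handed over to scalar functions
    through a Lipschitz bound along the curve. *)
Lemma ccont_cts0 (V : lmodType R) (nrm : V -> \bar R) (u : R -> V) (Phi : V -> R) (C : R) :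
  0 <= C -> ccont nrm u ->
  (forall (s t r : R), 0 <= s -> 0 <= t -> (nrm (u s - u t)%R <= r%:E)%E ->
    `|Phi (u s) - Phi (u t)| <= C * r) ->
  cts0 (fun t => Phi (u t)).
Proof.
move=> C0 [_ cu] h t t0; apply/cvgrPdist_lt => e e0.
have C1 : 0 < C + 1 by lra.
have d0 : 0 < e / (C + 1) by rewrite divr_gt0.
have := cu t t0 [set y : \bar R | (y < (e / (C + 1))%:E)%E].
move=> /(_ (open_ereal_lt' _)) hh.
have {}hh : \forall s \near within [set s | 0 <= s] (nbhs t), (nrm (u s - u t)%R < (e / (C + 1))%:E)%E.
  by apply: hh; rewrite lte_fin.
move: hh; rewrite !near_withinE; apply: filterS => s hs s0.
rewrite distrC; apply: (le_lt_trans (h s t _ s0 t0 (ltW (hs s0)))).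
by rewrite mulrCA gtr_pMr// ltr_pdivrMr//; lra.
Qed.

End time.

(** * L^2 bounds extracted from the extended norms *)

Section norms.
Variables (R : realType) (b : R).
Hypothesis b0 : 0 < b.
Local Notation mu1 := (@lebesgue_measure R).
Local Notation mu2 := (@mu2 R).
Local Notation mu3 := (@mu3 R).
Local Notation space := (R * (R * R))%type.
Local Notation field := ('I_3 -> space -> R).
Local Notation L2s := (L2 mu3 (Omega b)).
Local Notation L2p := (L2 mu2 setT).
Local Notation ips := (ip mu3 (Omega b)).
Local Notation ipp := (ip mu2 setT).
Local Notation nrms := (nrm mu3 (Omega b)).
Local Notation nrmp := (nrm mu2 setT).
Local Notation isw := (is_wderiv mu3 (Omega b) (test3 b) (pd (@dir3 R))).
Local Notation dn3 := (dnorm2 mu3 (Omega b) (test3 b) (pd (@dir3 R))).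
Local Notation dn2 := (dnorm2 mu2 setT (@test2 R) (pd (@dir2 R))).

Let mO : measurable (Omega b : set (mspace R)) := measurable_Omega b.
Let mT : measurable (setT : set (mplane R)) := measurableT.
Let E3 := exhaustion_slab b.
Let E2 := exhaustion_plane R.
Let tD3 : forall w phi, test3 b phi -> test3 b (foldr (pd (@dir3 R)) phi w).
Proof. by move=> w phi; exact: testfun_foldr. Qed.

Lemma nrm_sqrte (d : measure_display) (T : measurableType d)
    (mu : {measure set T -> \bar R}) (D : set T) (f : T -> R) :
  (nrm mu D f)%:E = sqrte (ip mu D f f)%:E.
Proof. by []. Qed.

Lemma Htan_nrms s N (f : mspace R -> R) (w : seq 'I_3) (r : R) : (size w <= s)%N ->
  (sqrte (Htan2 b s N f) <= r%:E)%E ->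
  [/\ isw w f (wd3 b w f), L2s (wd3 b w f) & nrms (wd3 b w f) <= r].
Proof.
move=> ws hr.
have h : (dn3 w f <= Htan2 b s N f)%E by exact: (tan2_ge mu3 (Omega b) (test3 b) (pd (@dir3 R)) (lift ord0) N (in_tuple w) f ws).
have H0 : (0 <= Htan2 b s N f)%E by exact: le_trans (dnorm2_ge0 _ _ _ _ _ _) h.
have fin : (dn3 w f < +oo)%E.
  apply: (le_lt_trans h); rewrite -ge0_fin_numE// -(sqrte_fin_num H0) ge0_fin_numE ?sqrte_ge0//.
  exact: (le_lt_trans hr (ltry _)).
have [hw Lw] := dnorm2_lty fin; split => //.
rewrite -lee_fin nrm_sqrte; apply: le_trans hr; rewrite lee_sqrt//.
by rewrite -(dnorm2_L2 E3 hw Lw).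
Qed.

Lemma Htan_nil s N (f : mspace R -> R) (r : R) : (sqrte (Htan2 b s N f) <= r%:E)%E ->
  L2s f /\ nrms f <= r.
Proof.
move=> h; have [hw Lw hn] := @Htan_nrms s N f [::] r (leq0n s) h.
have Lf : L2s f.
  apply: (L2_ae mO _ _ Lw); first by case: hw => -[mf _] _ _.
  by have := is_wderiv_nil_ae E3 hw; apply: filterS => x hx Dx; rewrite hx.
split => //; rewrite (nrm_ae mO (L2_meas Lf) (L2_meas Lw))//.
exact: (is_wderiv_nil_ae E3 hw).
Qed.

Lemma vnorm_sqrte (N2 : (space -> R) -> \bar R) (f : field) i (r : R) :
  (forall g, 0 <= N2 g)%E -> (vnorm N2 f <= r%:E)%E -> (sqrte (N2 (f i)) <= r%:E)%E.
Proof.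
move=> h; apply: le_trans; rewrite lee_sqrt; first exact: (sume_ge_term i (F := fun i => N2 (f i))).
by apply: sume_ge0 => j _.
Qed.

Lemma Htan2_ge0 s N (f : mspace R -> R) : (0 <= Htan2 b s N f)%E.
Proof.
exact: le_trans (dnorm2_ge0 _ _ _ _ [::] f) (tan2_ge mu3 (Omega b) (test3 b) (pd (@dir3 R)) (lift ord0) N (in_tuple [::]) f (ltn0Sn s)).
Qed.

Lemma vnorm_field s N (f : field) (r : R) i : (vnorm (Htan2 b s N) f <= r%:E)%E ->
  L2s (f i) /\ nrms (f i) <= r.
Proof. by move=> /(vnorm_sqrte i (Htan2_ge0 s N)) /Htan_nil. Qed.

Lemma vnorm_gradient s N (f : field) (r : R) i j : (vnorm (Htan2 b s.+1 N) f <= r%:E)%E ->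
  [/\ isw [:: j] (f i) (wd3 b [:: j] (f i)), L2s (wd3 b [:: j] (f i)) &
      nrms (wd3 b [:: j] (f i)) <= r].
Proof. by move=> /(vnorm_sqrte i (Htan2_ge0 s.+1 N)) h; exact: (@Htan_nrms s.+1 N (f i) [:: j] r isT h). Qed.

Lemma vnorm0tan_vnorm s N (f : field) (r : R) : (vnorm0tan b s N f <= r%:E)%E ->
  (vnorm (Htan2 b s N) f <= r%:E)%E /\ forall i, is_trace b (- b) (f i) (cst 0).
Proof. by rewrite /vnorm0tan; case: ifPn => // /asboolP. Qed.

Lemma lty_le_EFin (x : \bar R) : (0 <= x)%E -> (x < +oo)%E -> exists r : R, (x <= r%:E)%E.
Proof. by move=> x0 xy; exists (fine x); rewrite fineK// ge0_fin_numE. Qed.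

Lemma vnorm0tan_ge0 s N (f : field) : (0 <= vnorm0tan b s N f)%E.
Proof. by rewrite /vnorm0tan; case: ifPn => // _; exact: sqrte_ge0. Qed.

Lemma vnorm_ring_ge0 N (f : field) : (0 <= vnorm_ring b N f)%E.
Proof. by rewrite /vnorm_ring; case: ifPn => // _; exact: sqrte_ge0. Qed.

Lemma on_Sigma0_ge0 (N2 : (R * R -> R) -> \bar R) (f : space -> R) :
  (forall g, 0 <= N2 g)%E -> (0 <= on_Sigma0 b N2 f)%E.
Proof. by move=> h; rewrite /on_Sigma0; case: ifPn. Qed.

Lemma on_Sigma0_trace (N2 : (R * R -> R) -> \bar R) (f : space -> R) (r : R) :
  (forall g, 0 <= N2 g)%E -> (forall g, dn2 [::] g <= N2 g)%E ->
  (sqrte (on_Sigma0 b N2 f) <= r%:E)%E ->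
  (exists phi, trace_approx b 0 f (trace0 b f) phi) /\ nrmp (trace0 b f) <= r.
Proof.
move=> N0 hN h.
have fin : (on_Sigma0 b N2 f < +oo)%E.
  have H0 := on_Sigma0_ge0 f N0.
  rewrite -ge0_fin_numE// -(sqrte_fin_num H0) ge0_fin_numE ?sqrte_ge0//.
  exact: (le_lt_trans h (ltry _)).
move: h fin; rewrite /on_Sigma0; case: ifPn => // /asboolP[g hg] h _.
have [//|phi hphi] := proj1 (is_traceP b 0 f (trace0 b f)); first exact: trace0P hg.
split; first by exists phi.
rewrite -lee_fin nrm_sqrte; apply: le_trans h; rewrite lee_sqrt//.
have L : L2 mu2 setT (trace0 b f : mplane R -> R) := tra_L2g hphi.
by rewrite -(@dnorm2_nilE R _ (mplane R) mu2 setT 2 (@test2 R) (pd (@dir2 R)) _ E2 _ L).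
Qed.

Lemma plane_sob s (g : mplane R -> R) : (0 <= Hplane2 s g)%E /\ (dn2 [::] g <= Hplane2 s g)%E.
Proof.
have h : (dn2 [::] g <= Hplane2 s g)%E by exact: (sob2_ge mu2 setT (@test2 R) (pd (@dir2 R)) (in_tuple [::]) g (ltn0Sn s)).
by split => //; exact: le_trans (dnorm2_ge0 _ _ _ _ [::] g) h.
Qed.

Lemma plane_tan s N (g : mplane R -> R) :
  (0 <= Hplane_tan2 s N g)%E /\ (dn2 [::] g <= Hplane_tan2 s N g)%E.
Proof.
have h : (dn2 [::] g <= Hplane_tan2 s N g)%E by exact: (tan2_ge mu2 setT (@test2 R) (pd (@dir2 R)) id N (in_tuple [::]) g (ltn0Sn s)).
by split => //; exact: le_trans (dnorm2_ge0 _ _ _ _ [::] g) h.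
Qed.

Lemma vnorm_ring_field N (f : field) (r : R) : (vnorm_ring b N f <= r%:E)%E ->
  [/\ forall i, L2s (f i),
      forall i j, isw [:: j] (f i) (wd3 b [:: j] (f i)),
      forall i j, L2s (wd3 b [:: j] (f i)) /\ nrms (wd3 b [:: j] (f i)) <= r,
      exists phi, trace_approx b 0 (f ord0) (trace0 b (f ord0)) phi &
      nrmp (trace0 b (f ord0)) <= r].
Proof.
rewrite /vnorm_ring; case: ifPn => // /asboolP hH.
set S := on_Sigma0 _ _ _; set G := (\sum_(i < 3) _)%E => h.
have S0 : (0 <= S)%E by apply: on_Sigma0_ge0 => g; have [] := plane_tan 1 N g.
have F0 i : (0 <= \sum_(j < 3) Htan2 b 1 N (wd3 b [:: j] (f i)))%E.
  by apply: sume_ge0 => j _; exact: Htan2_ge0.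
have G0 : (0 <= G)%E by apply: sume_ge0 => i _.
have hS : (sqrte S <= r%:E)%E by apply: le_trans h; rewrite lee_sqrt ?adde_ge0// leeDl.
have hG : (sqrte G <= r%:E)%E by apply: le_trans h; rewrite lee_sqrt ?adde_ge0// leeDr.
have [htr hn] := on_Sigma0_trace (fun g => (plane_tan 1 N g).1) (fun g => (plane_tan 1 N g).2) hS.
have hw i (w : seq 'I_3) : (size w < 3)%N -> (dn3 w (f i) < +oo)%E.
  by move=> sw; apply: le_lt_trans (hH i); exact: (sob2_ge mu3 (Omega b) (test3 b) (pd (@dir3 R)) (in_tuple w) (f i) sw).
split => // [i|i j|i j].
- exact: (dnorm2_nil E3 (hw i [::] isT)).
- by have [] := dnorm2_lty (hw i [:: j] isT).
have [_ Lw] := dnorm2_lty (hw i [:: j] isT); split => //.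
suff hT : (sqrte (Htan2 b 1 N (wd3 b [:: j] (f i))) <= r%:E)%E by have [] := Htan_nil hT.
apply: le_trans hG; rewrite lee_sqrt//.
apply: (@le_trans _ _ (\sum_(j < 3) Htan2 b 1 N (wd3 b [:: j] (f i)))%E).
  by apply: (sume_ge_term j (F := fun j => Htan2 b 1 N (wd3 b [:: j] (f i)))) => k; exact: Htan2_ge0.
exact: (sume_ge_term i (F := fun i => (\sum_(j < 3) Htan2 b 1 N (wd3 b [:: j] (f i)))%E)).
Qed.

(** By [trace_poincare]: the trace and the vertical derivative of the first component are both
    controlled by the ringed norm. *)
Lemma vnorm_ring_nrms N (f : field) (r : R) : (vnorm_ring b N f <= r%:E)%E ->
  nrms (f ord0) <= Num.sqrt (2 * b + 4 * b ^+ 2) * r.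
Proof.
move=> h; have [_ _ hd [phi tr] ht] := vnorm_ring_field h.
have [_ hd0] := hd ord0 ord0; have P := trace_poincare b0 tr.
have r0 : 0 <= r := le_trans (nrm_ge0 _ _ _) ht.
have s0 : 0 <= 2 * b + 4 * b ^+ 2.
  by rewrite addr_ge0// mulr_ge0 ?sqr_ge0// ltW.
rewrite -(@ler_pXn2r _ 2)// ?nnegrE ?nrm_ge0// ?mulr_ge0 ?sqrtr_ge0//.
have -> : (Num.sqrt (2 * b + 4 * b ^+ 2) * r) ^+ 2 = 2 * b * r ^+ 2 + 4 * b ^+ 2 * r ^+ 2.
  by rewrite [LHS]exprMn (sqr_sqrtr s0) mulrDl.
apply: (le_trans P); apply: lerD.
  by rewrite ler_wpM2l ?mulr_ge0 ?(ltW b0)// ler_pXn2r ?nnegrE ?nrm_ge0.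
apply: ler_wpM2l; first by apply: mulr_ge0; rewrite ?sqr_ge0.
by rewrite ler_pXn2r ?nnegrE ?nrm_ge0.
Qed.

End norms.

(** * Evolution of the trace of the displacement *)

Fact neg1_cancel (R : realFieldType) (x y z : R) : -1 * x = -1 * y + -1 * z -> x = y + z.
Proof. by move=> h; lra. Qed.

Section evolution.
Variables (R : realType) (b : R).
Hypothesis b0 : 0 < b.
Local Notation mu1 := (@lebesgue_measure R).
Local Notation mu2 := (@mu2 R).
Local Notation mu3 := (@mu3 R).
Local Notation space := (R * (R * R))%type.
Local Notation field := ('I_3 -> space -> R).
Local Notation L2s := (L2 mu3 (Omega b)).
Local Notation ips := (ip mu3 (Omega b)).
Local Notation ipp := (ip mu2 setT).
Local Notation nrms := (nrm mu3 (Omega b)).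
Local Notation nrmp := (nrm mu2 setT).
Local Notation isw := (is_wderiv mu3 (Omega b) (test3 b) (pd (@dir3 R))).
Local Notation ring := (vnorm_ring b 3).
Local Notation tan0 := (vnorm0tan b 1 3).
Implicit Types (u xi v : R -> field) (phi : mspace R -> R).

Let mO : measurable (Omega b : set (mspace R)) := measurable_Omega b.
Let E3 := exhaustion_slab b.
Let tD3 : forall w phi, test3 b phi -> test3 b (foldr (pd (@dir3 R)) phi w).
Proof. by move=> w phi; exact: testfun_foldr. Qed.

Lemma isw_meas w (f g : mspace R -> R) : isw w f g ->
  measurable_fun (Omega b) f /\ measurable_fun (Omega b) g.
Proof. by case=> -[mf _] [mg _] _. Qed.

Lemma cts0_of_le (nrm' : field -> \bar R) (u : R -> field) (A : field -> mspace R -> R) (C : R) phi :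
  0 <= C -> ccont nrm' u -> L2s phi -> (forall t : R, 0 <= t -> L2s (A (u t))) ->
  (forall (s t r : R), 0 <= s -> 0 <= t -> (nrm' (u s - u t)%R <= r%:E)%E ->
    nrms (fun x => A (u s) x - A (u t) x) <= C * r) ->
  cts0 (fun t => ips (A (u t)) phi).
Proof.
move=> C0 cu Lphi LA h.
apply: (@ccont_cts0 R _ nrm' u (fun f => ips (A f) phi) (C * nrms phi) _ cu).
  by rewrite mulr_ge0 ?nrm_ge0.
move=> s t r s0 t0 hr; rewrite -(ipBl mO (LA s s0) (LA t t0) Lphi).
apply: (le_trans (cauchy_schwarz mO (L2B mO (LA s s0) (LA t t0)) Lphi)).
by rewrite mulrAC ler_wpM2r ?nrm_ge0//; exact: h.
Qed.

Lemma wd_diff (f g : mspace R -> R) j (r : R) :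
  isw [:: j] f (wd3 b [:: j] f) -> isw [:: j] g (wd3 b [:: j] g) ->
  L2s (wd3 b [:: j] f) -> L2s (wd3 b [:: j] g) ->
  L2s (wd3 b [:: j] (fun x => f x - g x)) -> nrms (wd3 b [:: j] (fun x => f x - g x)) <= r ->
  nrms (fun x => wd3 b [:: j] f x - wd3 b [:: j] g x) <= r.
Proof.
move=> hf hg Lf Lg Lh; have e := wderiv_ae E3 (is_wderivB E3 tD3 hf hg).
by rewrite (nrm_ae mO (L2_meas Lh) (L2_meas (L2B mO Lf Lg)) e).
Qed.

Lemma ring_fin xi (t : R) : ccont ring xi -> 0 <= t -> exists r : R, (ring (xi t) <= r%:E)%E.
Proof. by move=> [h _] t0; apply: lty_le_EFin; [exact: vnorm_ring_ge0|exact: h]. Qed.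

Lemma tan0_fin v (t : R) : ccont tan0 v -> 0 <= t -> exists r : R, (tan0 (v t) <= r%:E)%E.
Proof. by move=> [h _] t0; apply: lty_le_EFin; [exact: vnorm0tan_ge0|exact: h]. Qed.

Lemma tan0_field (f : field) (r : R) i : (tan0 f <= r%:E)%E -> L2s (f i) /\ nrms (f i) <= r.
Proof. by move=> /vnorm0tan_vnorm[h _]; exact: (vnorm_field i h). Qed.

Lemma tan0_gradient (f : field) (r : R) i j : (tan0 f <= r%:E)%E ->
  [/\ isw [:: j] (f i) (wd3 b [:: j] (f i)), L2s (wd3 b [:: j] (f i)) &
      nrms (wd3 b [:: j] (f i)) <= r].
Proof. by move=> /vnorm0tan_vnorm[h _]; exact: (vnorm_gradient i j h). Qed.

Lemma ring_cts_gradient xi i j phi : ccont ring xi -> L2s phi ->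
  cts0 (fun t => ips (wd3 b [:: j] (xi t i)) phi).
Proof.
move=> c Lphi.
have F (t : R) : 0 <= t -> isw [:: j] (xi t i) (wd3 b [:: j] (xi t i)) /\ L2s (wd3 b [:: j] (xi t i)).
  by move=> t0; have [r hr] := ring_fin c t0; have [_ h1 h2 _ _] := vnorm_ring_field hr; split; [exact: h1|have [] := h2 i j].
apply: (@cts0_of_le ring xi (fun f => wd3 b [:: j] (f i)) 1 phi ler01 c Lphi).
  by move=> t t0; have [] := F t t0.
move=> s t r s0 t0 hr; have [_ _ h _ _] := vnorm_ring_field hr; have [Lh nh] := h i j.
have [is1 Ls] := F s s0; have [it1 Lt] := F t t0; rewrite mul1r.
exact: (wd_diff is1 it1 Ls Lt Lh nh).
Qed.

(** Restricted to the first component, the one whose trace is part of the ringed norm. *)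
Lemma ring_cts_field xi phi : ccont ring xi -> L2s phi -> cts0 (fun t => ips (xi t ord0) phi).
Proof.
move=> c Lphi.
apply: (@cts0_of_le ring xi (fun f => f ord0) (Num.sqrt (2 * b + 4 * b ^+ 2)) phi _ c Lphi).
- exact: sqrtr_ge0.
- by move=> t t0; have [r hr] := ring_fin c t0; have [h _ _ _ _] := vnorm_ring_field hr; exact: h.
by move=> s t r s0 t0 hr; exact: (vnorm_ring_nrms b0 hr).
Qed.

Lemma tan0_cts_field v i phi : ccont tan0 v -> L2s phi -> cts0 (fun t => ips (v t i) phi).
Proof.
move=> c Lphi; apply: (@cts0_of_le tan0 v (fun f => f i) 1 phi ler01 c Lphi).
  by move=> t t0; have [r hr] := tan0_fin c t0; have [] := tan0_field i hr.
by move=> s t r s0 t0 hr; rewrite mul1r; have [_] := tan0_field i hr.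
Qed.

Lemma tan0_cts_gradient v i j phi : ccont tan0 v -> L2s phi ->
  cts0 (fun t => ips (wd3 b [:: j] (v t i)) phi).
Proof.
move=> c Lphi; apply: (@cts0_of_le tan0 v (fun f => wd3 b [:: j] (f i)) 1 phi ler01 c Lphi).
  by move=> t t0; have [r hr] := tan0_fin c t0; have [] := tan0_gradient i j hr.
move=> s t r s0 t0 hr; have [_ Lh nh] := tan0_gradient i j hr.
have [rs hs] := tan0_fin c s0; have [rt ht] := tan0_fin c t0.
have [is1 Ls _] := tan0_gradient i j hs; have [it1 Lt _] := tan0_gradient i j ht; rewrite mul1r.
exact: (wd_diff is1 it1 Ls Lt Lh nh).
Qed.

Lemma cts0_eq (F G : R -> R) : (forall t : R, 0 <= t -> F t = G t) -> cts0 G -> cts0 F.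
Proof.
move=> e cG t t0; rewrite (e t t0); apply: cvg_trans (cG t t0); apply: near_eq_cvg.
by rewrite near_withinE; apply: nearW => s s0; rewrite (e s s0).
Qed.

Lemma cts0N (F : R -> R) : cts0 F -> cts0 (fun t => -1 * F t).
Proof. by move=> cF t t0; apply: cvgM; [exact: cvg_cst|exact: cF]. Qed.

Lemma is_dt_ftc (u g : R -> space -> R) phi : is_dt b u g -> test3 b phi ->
  cts0 (fun t => ips (u t) phi) -> cts0 (fun t => ips (g t) phi) ->
  forall t, 0 <= t -> ips (u t) phi = ips (u 0) phi + \int[mu1]_(s in `[0, t]) ips (g s) phi.
Proof.
move=> [_ h] tphi cu cg; apply: (time_ftc cu cg) => psi tpsi.
by have [_ _] := h psi phi tpsi tphi.
Qed.

(** A derivative of a test function is a test function: the integrated equation is applied to it,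
    and the integration by parts is undone in every term. *)
Lemma is_dt_ftc_gradient xi v i j phi : ccont ring xi -> ccont tan0 v ->
  is_dt b (fun t => xi t i) (fun t => v t i) -> test3 b phi ->
  forall t, 0 <= t -> ips (wd3 b [:: j] (xi t i)) phi =
    ips (wd3 b [:: j] (xi 0 i)) phi + \int[mu1]_(s in `[0, t]) ips (wd3 b [:: j] (v s i)) phi.
Proof.
move=> cx cv hdt tphi t t0; have Lphi := testfun3_L2 mO tphi.
have tp : test3 b (pd (@dir3 R) j phi) := tD3 [:: j] tphi.
have Lp := testfun3_L2 mO tp.
have ex (s : R) : 0 <= s -> ips (xi s i) (pd (@dir3 R) j phi) = -1 * ips (wd3 b [:: j] (xi s i)) phi.
  move=> s0; have [r hr] := ring_fin cx s0; have [_ h _ _ _] := vnorm_ring_field hr.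
  by have [_ _ k] := h i j; have := k phi tphi; rewrite /= expr1.
have ev (s : R) : 0 <= s -> ips (v s i) (pd (@dir3 R) j phi) = -1 * ips (wd3 b [:: j] (v s i)) phi.
  move=> s0; have [r hr] := tan0_fin cv s0; have [h _ _] := tan0_gradient i j hr.
  by have [_ _ k] := h; have := k phi tphi; rewrite /= expr1.
have cx' : cts0 (fun s => ips (xi s i) (pd (@dir3 R) j phi)).
  apply: (@cts0_eq _ (fun s => -1 * ips (wd3 b [:: j] (xi s i)) phi) ex).
  exact: (cts0N (@ring_cts_gradient xi i j phi cx Lphi)).
have := is_dt_ftc hdt tp cx' (@tan0_cts_field v i _ cv Lp) t0.
rewrite (ex t t0) (ex 0 (lexx 0)).
have -> : \int[mu1]_(s in `[0, t]) ips (v s i) (pd (@dir3 R) j phi) =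
    \int[mu1]_(s in `[0, t]) (-1 * ips (wd3 b [:: j] (v s i)) phi).
  by apply: eq_Rintegral => s /set_mem /=; rewrite in_itv/= => /andP[s0 _]; exact: ev.
have mI : measurable (`[0, t]%classic : set (measurableTypeR R)) := measurable_itv _.
rewrite (RintegralZl (-1) mI (cts0_itg t (@tan0_cts_gradient v i j _ cv Lphi))).
by move=> e; exact: (neg1_cancel e).
Qed.

Lemma Rint_ip_le (B : R -> mspace R -> R) (M t : R) phi : 0 <= t ->
  (forall s : R, 0 <= s -> L2s (B s) /\ nrms (B s) <= M) -> L2s phi ->
  cts0 (fun s => ips (B s) phi) ->
  `|\int[mu1]_(s in `[0, t]) ips (B s) phi| <= t * (M * nrms phi).
Proof.
move=> t0 hB Lphi cB; set c := M * nrms phi.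
have mI : measurable (`[0, t]%classic : set (measurableTypeR R)) := measurable_itv _.
have i1 := cts0_itg t cB; have i2 := itg_norm i1.
have cc : continuous (fun _ : R => c) by move=> z; exact: cvg_cst.
have i3 := continuous_itv_integrable 0 t cc.
have d s : is_derive s (1 : R) (fun z : R => c * z) c.
  by apply: (is_derive_eq (is_deriveZ c (is_derive_id s (1 : R)))); rewrite /GRing.scale/= mulr1.
have -> : t * c = \int[mu1]_(s in `[0, t]) c by rewrite (FTC d cc t0) mulr0 subr0 mulrC.
apply: (@le_trans _ _ (\int[mu1]_(s in `[0, t]) `|ips (B s) phi|)).
  by rewrite -lee_fin -(itgE mI i2); exact: (le_norm_Rint mI i1).
apply: (le_Rintegral mI i2 i3) => s; rewrite /= in_itv/= => /andP[s0 _].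
have [LB nB] := hB s s0; apply: (le_trans (cauchy_schwarz mO LB Lphi)).
by rewrite /c ler_wpM2r ?nrm_ge0.
Qed.

(** The lifted kernel is not compactly supported in the slab, so the integrated equation must reach
    all of L^2; the uniform bound [M] controls the time integral under approximation. *)
Lemma ftc_density (A B : R -> mspace R -> R) (M : R) : (forall s : R, 0 <= s -> L2s (A s)) ->
  (forall s : R, 0 <= s -> L2s (B s) /\ nrms (B s) <= M) ->
  (forall phi, L2s phi -> cts0 (fun s => ips (B s) phi)) ->
  (forall phi, test3 b phi -> forall t, 0 <= t ->
    ips (A t) phi = ips (A 0) phi + \int[mu1]_(s in `[0, t]) ips (B s) phi) ->
  forall phi, L2s phi -> forall t, 0 <= t ->
    ips (A t) phi = ips (A 0) phi + \int[mu1]_(s in `[0, t]) ips (B s) phi.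
Proof.
move=> LA hB cB H phi Lphi t t0; have [f [tf Lf cf]] := test_density_seq E3 Lphi.
have mI : measurable (`[0, t]%classic : set (measurableTypeR R)) := measurable_itv _.
have cA (s : R) : 0 <= s -> ips (A s) (f n) @[n --> \oo] --> ips (A s) phi.
  by move=> s0; rewrite ipC; under eq_fun do rewrite ipC; exact: (cvg_ip mO Lf Lphi (LA s s0) cf).
have LB (s : R) : 0 <= s -> L2s (B s) by move=> s0; have [] := hB s s0.
have cI : \int[mu1]_(s in `[0, t]) ips (B s) (f n) @[n --> \oo] --> \int[mu1]_(s in `[0, t]) ips (B s) phi.
  have c0 : t * (M * nrms (fun x => f n x - phi x)) @[n --> \oo] --> t * (M * 0).
    by apply: cvgM; [exact: cvg_cst|apply: cvgM; [exact: cvg_cst|exact: cf]].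
  rewrite !mulr0 in c0; apply/cvgrPdist_le => e e0.
  have /cvgrPdist_le/(_ e e0) := c0; apply: filterS => n; rewrite sub0r normrN => hn.
  have Ld := L2B mO (Lf n) Lphi.
  rewrite distrC -(RintegralB mI (cts0_itg t (cB _ (Lf n))) (cts0_itg t (cB _ Lphi))).
  have -> : \int[mu1]_(s in `[0, t]) (ips (B s) (f n) - ips (B s) phi) =
      \int[mu1]_(s in `[0, t]) ips (B s) (fun x => f n x - phi x).
    apply: eq_Rintegral => s /set_mem /=; rewrite in_itv/= => /andP[s0 _].
    by rewrite (ipBr mO (Lf n) Lphi (LB s s0)).
  apply: (le_trans (Rint_ip_le t0 hB Ld (cB _ Ld))); exact: (le_trans (ler_norm _) hn).
exact: (cvg_eq_lim (fun n => H (f n) (tf n) t t0) (cA t t0) (cvgD (cA 0 (lexx 0)) cI)).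
Qed.

Lemma wd3_lift0 (c : R) g h : tame g -> tame h ->
  {ae mu3, forall x : mspace R, Omega b x -> wd3 b [:: ord0] (tens3 (cst c) g h) x = 0}.
Proof.
move=> tg th; have [sg _ _] := tg 0%N; have [sh _ _] := th 0%N.
have := wderiv_ae E3 (smooth_wderiv3 b [:: ord0] (smooth_tame c tg th)).
apply: filterS => x hx Dx; apply: (eq_trans (hx Dx)).
rewrite [rev _]/= (pd_tens3 [:: ord0] (smooth1_cst c) sg sh).
by rewrite /tens3 /= derive1_cst mul0r.
Qed.

Lemma ip0_ae (f g : mspace R -> R) : measurable_fun (Omega b) f -> measurable_fun (Omega b) g ->
  {ae mu3, forall x : mspace R, Omega b x -> g x = 0} -> ips f g = 0.
Proof.
move=> mf mg g0.
have m0 : measurable_fun (Omega b : set (mspace R)) (fun=> 0 : R) by exact: measurable_cst.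
rewrite ipC (ip_ae mO mg m0 mf g0) /ip.
by rewrite -[RHS](@Rint0 R _ _ mu3 (Omega b)); apply: eq_Rintegral => x _; rewrite mul0r.
Qed.

(* The fundamental theorem of calculus in x_1, weighted by a function vanishing
   on the opposite face. *)
Lemma lift_pairing a f g ph k : a = 0 \/ a = - b -> trace_approx b a f g ph -> tame k ->
  b * ipp g (tens2 k k) =
  ips f (tens3 (cst 1) k k) + ips (wgt b a (tens3 (cst 1) k k)) (wd3 b [:: ord0] f).
Proof.
move=> ha h tk; have dk : decays k := tk 0%N.
have [psi hp] := lift_trace b0 1 ha dk dk; have := trace_bilinear b0 ha h hp.
rewrite (_ : (fun y => 1 * tens2 k k y) = tens2 k k); last by apply/funext => y; rewrite mul1r.
move=> ->; rewrite (ip0_ae _ _ (wd3_lift0 1 tk tk)) ?add0r//.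
  exact: (L2_meas (wgt_L2 b0 ha (tra_L2 h))).
exact: (L2_meas (tra_L2d hp ord0)).
Qed.

(** The weight [x_1 + b] of the identity on Sigma_0 is the weight [x_1] of the one on Sigma_b plus
    the constant [b]. As the velocity has trace 0 on Sigma_b, the second identity cancels all
    velocity terms but [b] times the pairing of the vertical derivative with the kernel. *)
Lemma trace_evolution xi v (M : R) k : ccont ring xi -> ccont tan0 v ->
  (forall t : R, 0 <= t -> (tan0 (v t) <= M%:E)%E) ->
  is_dt b (fun t => xi t ord0) (fun t => v t ord0) -> tame k ->
  forall t, 0 <= t -> let X : mspace R -> R := tens3 (cst 1) k k in
  b * ipp (trace0 b (xi t ord0)) (tens2 k k) =
  ips (xi 0 ord0) X + ips (wd3 b [:: ord0] (xi 0 ord0)) (wgt b 0 X) +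
  b * \int[mu1]_(s in `[0, t]) ips (wd3 b [:: ord0] (v s ord0)) X.
Proof.
move=> cx cv hM hdt tk t t0 X.
have a0 : (0 : R) = 0 \/ (0 : R) = - b by left.
have ab : - b = 0 \/ - b = - b by right.
have LX : L2s X := tame_L2 b0 1 tk tk.
have LW := wgt_L2 b0 a0 LX; have LV := wgt_L2 b0 ab LX.
have [r hr] := ring_fin cx t0; have [_ _ _ [phi tr] _] := vnorm_ring_field hr.
rewrite (lift_pairing a0 tr tk) -/X [ips (wgt b 0 X) _]ipC.
have Lx (s : R) : 0 <= s -> L2s (xi s ord0).
  by move=> s0; have [rs hs] := ring_fin cx s0; have [h _ _ _ _] := vnorm_ring_field hs; exact: h.
have Lg (s : R) : 0 <= s -> L2s (wd3 b [:: ord0] (xi s ord0)).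
  by move=> s0; have [rs hs] := ring_fin cx s0; have [_ _ h _ _] := vnorm_ring_field hs; have [] := h ord0 ord0.
have Bv (s : R) : 0 <= s -> L2s (v s ord0) /\ nrms (v s ord0) <= M.
  by move=> s0; exact: (tan0_field ord0 (hM s s0)).
have Bg (s : R) : 0 <= s -> L2s (wd3 b [:: ord0] (v s ord0)) /\ nrms (wd3 b [:: ord0] (v s ord0)) <= M.
  by move=> s0; have [_ ? ?] := tan0_gradient ord0 ord0 (hM s s0).
have e1 := ftc_density Lx Bv (fun f Lf => @tan0_cts_field v ord0 f cv Lf) (fun f tf =>
  is_dt_ftc hdt tf (@ring_cts_field xi f cx (testfun3_L2 mO tf)) (@tan0_cts_field v ord0 _ cv (testfun3_L2 mO tf))) LX t0.
have e2 := ftc_density Lg Bg (fun f Lf => @tan0_cts_gradient v ord0 ord0 f cv Lf)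
  (fun f tf => is_dt_ftc_gradient ord0 cx cv hdt tf) LW t0.
rewrite e1 e2.
have mI : measurable (`[0, t]%classic : set (measurableTypeR R)) := measurable_itv _.
have iv := cts0_itg t (@tan0_cts_field v ord0 _ cv LX).
have ig := cts0_itg t (@tan0_cts_gradient v ord0 ord0 _ cv LW).
have iX := cts0_itg t (@tan0_cts_gradient v ord0 ord0 _ cv LX).
rewrite addrACA -(RintegralD mI iv ig) -(RintegralZl b mI iX); congr (_ + _).
apply: eq_Rintegral => s /set_mem /=; rewrite in_itv/= => /andP[s0 _].
have [_ /(_ ord0) trv] := vnorm0tan_vnorm (hM s s0).
have [phi' tv] := proj1 (is_traceP b (- b) (v s ord0) (cst 0)) trv.
have := lift_pairing ab tv tk; rewrite -/X.
have -> : ipp (cst 0) (tens2 k k) = 0.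
  by rewrite /ip -[RHS](@Rint0 R _ _ mu2 setT); apply: eq_Rintegral => x _; rewrite /cst mul0r.
rewrite mulr0 [ips (wgt b (- b) X) _]ipC => e3.
have [Lw _] := Bg s s0.
have -> : wgt b 0 X = (fun x => wgt b (- b) X x + b * X x).
  by apply/funext => x; rewrite /wgt; ring.
by rewrite (ipDr mO LV (L2Z mO b LX) Lw) (ipZr mO b LX Lw) addrA -e3 add0r.
Qed.

Lemma scaled_gradient (f g : mspace R -> R) (c : R) j : isw [:: j] g (wd3 b [:: j] g) ->
  measurable_fun (Omega b) f -> {ae mu3, forall x : mspace R, Omega b x -> f x = c * g x} ->
  {ae mu3, forall x : mspace R, Omega b x -> wd3 b [:: j] f x = c * wd3 b [:: j] g x}.
Proof.
move=> hg mf e; have hz := is_wderivZ E3 tD3 c hg; have [mg mg'] := isw_meas hz.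
apply: (wderiv_ae E3); apply: (is_wderiv_ae E3 tD3 mf mg' _ _ hz); last by apply: aeW.
by apply: filterS e => x h Dx; rewrite h.
Qed.

(** Duality with test functions turns the integrated equation for the gradients into an L^2 bound,
    linear in [|eps|] at each fixed time. *)
Lemma gradient_bound xi v (th : field) (eps C : R) : 0 <= C -> (ring th < +oo)%E ->
  ccont ring xi -> ccont tan0 v -> (forall i, is_dt b (fun t => xi t i) (fun t => v t i)) ->
  {ae mu3, forall x : mspace R, Omega b x -> forall i, xi 0 i x = eps * th i x} ->
  (forall s : R, 0 <= s -> forall i j, nrms (wd3 b [:: j] (v s i)) <= `|eps| * C) ->
  forall t : R, 0 <= t -> forall i j,
    nrms (wd3 b [:: j] (xi t i)) <= `|eps| * (nrms (wd3 b [:: j] (th i)) + t * C).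
Proof.
move=> C0 fth cx cv hdt hi hv t t0 i j.
have [rt ht] := lty_le_EFin (vnorm_ring_ge0 b 3 th) fth.
have [_ ith Lth _ _] := vnorm_ring_field ht; have [Lt _] := Lth i j.
have F (s : R) : 0 <= s -> isw [:: j] (xi s i) (wd3 b [:: j] (xi s i)) /\ L2s (wd3 b [:: j] (xi s i)).
  by move=> s0; have [r hr] := ring_fin cx s0; have [_ h1 h2 _ _] := vnorm_ring_field hr; split; [exact: h1|have [] := h2 i j].
have [i0 L0] := F 0 (lexx 0); have [it Lx] := F t t0.
have n0 : 0 <= nrms (wd3 b [:: j] (th i)) + t * C by rewrite addr_ge0 ?nrm_ge0 ?mulr_ge0.
apply: (nrm_le_test E3 Lx); first by rewrite mulr_ge0.
move=> phi tphi; have Lphi := testfun3_L2 mO tphi.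
rewrite (is_dt_ftc_gradient j cx cv (hdt i) tphi t0).
have e0 : {ae mu3, forall x : mspace R, Omega b x -> wd3 b [:: j] (xi 0 i) x = eps * wd3 b [:: j] (th i) x}.
  apply: (scaled_gradient (ith i j)); first by have [] := isw_meas i0.
  by apply: filterS hi => x h Dx; exact: h.
rewrite (ip_ae mO (L2_meas L0) (L2_meas (L2Z mO eps Lt)) (L2_meas Lphi) e0) (ipZl mO eps Lt Lphi).
apply: (le_trans (ler_normD _ _)); rewrite mulrDr mulrDl; apply: lerD.
  by rewrite normrM -mulrA ler_wpM2l//; exact: (cauchy_schwarz mO Lt Lphi).
have hB (s : R) : 0 <= s -> L2s (wd3 b [:: j] (v s i)) /\ nrms (wd3 b [:: j] (v s i)) <= `|eps| * C.
  move=> s0; have [r hr] := tan0_fin cv s0; have [_ ? _] := tan0_gradient i j hr.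
  by split; [|exact: hv].
apply: (le_trans (Rint_ip_le t0 hB Lphi (@tan0_cts_gradient v i j _ cv Lphi))).
by rewrite mulrA (mulrCA t).
Qed.

(** Weak derivatives inherit the expansion by linearity and uniqueness; for [|eps| <= 1] the higher
    powers are bounded by [|eps|]. *)
Lemma expansion_gradient (f f1 f2 f3 : field) (eps r r1 r2 r3 : R) i j :
  (tan0 f <= r%:E)%E -> (tan0 f1 <= r1%:E)%E -> (tan0 f2 <= r2%:E)%E -> (tan0 f3 <= r3%:E)%E ->
  {ae mu3, forall x : mspace R, Omega b x -> forall i,
     f i x = eps * f1 i x + eps ^+ 2 * f2 i x + eps ^+ 3 * f3 i x} ->
  {ae mu3, forall x : mspace R, Omega b x -> wd3 b [:: j] (f i) x =
     eps * wd3 b [:: j] (f1 i) x + eps ^+ 2 * wd3 b [:: j] (f2 i) x + eps ^+ 3 * wd3 b [:: j] (f3 i) x} /\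
  (`|eps| <= 1 -> nrms (wd3 b [:: j] (f i)) <= `|eps| * (r1 + r2 + r3)).
Proof.
move=> h h1 h2 h3 e.
have [d L _] := tan0_gradient i j h; have [d1 L1 n1] := tan0_gradient i j h1.
have [d2 Lb n2] := tan0_gradient i j h2; have [d3 L3 n3] := tan0_gradient i j h3.
have D := is_wderivD E3 tD3 (is_wderivD E3 tD3 (is_wderivZ E3 tD3 eps d1) (is_wderivZ E3 tD3 (eps ^+ 2) d2))
  (is_wderivZ E3 tD3 (eps ^+ 3) d3).
have [mf _] := isw_meas d; have [_ mD'] := isw_meas D.
have E : {ae mu3, forall x : mspace R, Omega b x -> wd3 b [:: j] (f i) x =
     eps * wd3 b [:: j] (f1 i) x + eps ^+ 2 * wd3 b [:: j] (f2 i) x + eps ^+ 3 * wd3 b [:: j] (f3 i) x}.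
  apply: (wderiv_ae E3); apply: (is_wderiv_ae E3 tD3 mf mD' _ _ D); last by apply: aeW.
  by apply: filterS e => x k Dx; rewrite k.
split => // e1; have Z1 := L2Z mO eps L1; have Z2 := L2Z mO (eps ^+ 2) Lb; have Z3 := L2Z mO (eps ^+ 3) L3.
have Z12 := L2D mO Z1 Z2.
rewrite (nrm_ae mO (L2_meas L) (L2_meas (L2D mO Z12 Z3)) E).
apply: (le_trans (nrmD mO Z12 Z3)); rewrite mulrDr; apply: lerD; last first.
  rewrite (nrmZ mO _ L3) normrX; apply: ler_pM; rewrite ?exprn_ge0 ?nrm_ge0//.
  by rewrite exprS ler_piMr// exprn_ile1.
apply: (le_trans (nrmD mO Z1 Z2)); rewrite mulrDr; apply: lerD.
  by rewrite (nrmZ mO _ L1) ler_wpM2l.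
rewrite (nrmZ mO _ Lb) normrX; apply: ler_pM; rewrite ?exprn_ge0 ?nrm_ge0//.
by rewrite expr2 ler_piMr.
Qed.

End evolution.

(** * The contradiction along a curve of solutions *)

Section obstruction.
Variables (R : realType) (b nu sigma0 : R).
Hypothesis b0 : 0 < b.
Hypothesis s0_gt : 2^-1 < sigma0.
Hypothesis s0_lt : sigma0 < 1.
Local Notation mu1 := (@lebesgue_measure R).
Local Notation mu2 := (@mu2 R).
Local Notation mu3 := (@mu3 R).
Local Notation space := (R * (R * R))%type.
Local Notation field := ('I_3 -> space -> R).
Local Notation L2s := (L2 mu3 (Omega b)).
Local Notation ips := (ip mu3 (Omega b)).
Local Notation ipp := (ip mu2 setT).
Local Notation nrms := (nrm mu3 (Omega b)).
Local Notation nrmp := (nrm mu2 setT).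
Local Notation isw := (is_wderiv mu3 (Omega b) (test3 b) (pd (@dir3 R))).
Local Notation ring := (vnorm_ring b 3).
Local Notation tan0 := (vnorm0tan b 1 3).

Let mO : measurable (Omega b : set (mspace R)) := measurable_Omega b.
Let E3 := exhaustion_slab b.
Let tD3 : forall w phi, test3 b phi -> test3 b (foldr (pd (@dir3 R)) phi w).
Proof. by move=> w phi; exact: testfun_foldr. Qed.

Lemma ae_imp2 (d : measure_display) (T : measurableType d) (mu : {measure set T -> \bar R})
    (P Q S : T -> Prop) : {ae mu, forall x, P x} -> {ae mu, forall x, Q x} ->
  (forall x, P x -> Q x -> S x) -> {ae mu, forall x, S x}.
Proof. by move=> hP hQ h; apply: filterS2 hP hQ => x; exact: h. Qed.

Lemma ae_ord (d : measure_display) (T : measurableType d) (mu : {measure set T -> \bar R})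
    n (P : 'I_n.+1 -> T -> Prop) :
  (forall i, {ae mu, forall x, P i x}) -> {ae mu, forall x, forall i, P i x}.
Proof.
move=> h; have := ae_foralln (fun m : nat => h (inord m)).
by apply: filterS => x k i; have := k i; rewrite inord_val.
Qed.

Lemma sum_ord3 (F : 'I_3 -> R) :
  \sum_(i < 3) F i = F ord0 + (F (lift ord0 ord0) + F ord_max).
Proof.
rewrite !big_ord_recl big_ord0 addr0; congr (_ + (_ + F _)); exact: val_inj.
Qed.

Definition solution_curve (delta : R) (th : field) (v xi : R -> R -> field)
    (q : R -> R -> space -> R) (v1 v2 v3 : R -> field) :=
  forall eps : R, `|eps| < delta -> [/\ ccont ring (xi eps), cbcont tan0 (v eps),
    VSW b nu (fun i x => eps * th i x) (fun _ _ => 0) (xi eps) (v eps) (q eps),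
    snorm (on_Sigma0 b (Hplane2 2)) (xi eps t ord0) @[t --> +oo] --> 0%E &
    forall t : R, 0 <= t -> {ae mu3, forall x : space, Omega b x -> forall i,
      v eps t i x = eps * v1 t i x + eps ^+ 2 * v2 t i x + eps ^+ 3 * v3 t i x}].

Section curve.
Variables (delta M1 M2 M3 : R) (th : field) (v xi : R -> R -> field).
Variables (q : R -> R -> space -> R) (v1 v2 v3 : R -> field).
Hypothesis d0 : 0 < delta.
Hypothesis fth : (ring th < +oo)%E.
Hypothesis H : solution_curve delta th v xi q v1 v2 v3.
Hypothesis c1 : ccont tan0 v1.
Hypothesis c2 : ccont tan0 v2.
Hypothesis c3 : ccont tan0 v3.
Hypothesis B1 : forall t : R, 0 <= t -> (tan0 (v1 t) <= M1%:E)%E.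
Hypothesis B2 : forall t : R, 0 <= t -> (tan0 (v2 t) <= M2%:E)%E.
Hypothesis B3 : forall t : R, 0 <= t -> (tan0 (v3 t) <= M3%:E)%E.

(** Strictly below [delta], so that the closed range [|eps| <= e] is admissible, and at most 1, so
    that higher powers of [eps] are bounded by [|eps|]. *)
Let e := Num.min delta 1 / 2.

Let e0 : 0 < e. Proof. by rewrite divr_gt0// lt_min d0 ltr01. Qed.

Let e_small (eps : R) : `|eps| <= e -> `|eps| < delta /\ `|eps| <= 1.
Proof.
move=> he; have m0 : 0 < Num.min delta 1 by rewrite lt_min d0 ltr01.
have h : e < Num.min delta 1 by rewrite /e; lra.
have := le_lt_trans he h; rewrite lt_min => /andP[? h1]; split => //; exact: ltW.
Qed.

Let C := M1 + M2 + M3.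

Let M0 (w : R -> field) (M : R) : (forall t : R, 0 <= t -> (tan0 (w t) <= M%:E)%E) -> 0 <= M.
Proof. by move=> h; rewrite -lee_fin; exact: (le_trans (vnorm0tan_ge0 b 1 3 _) (h 0 (lexx 0))). Qed.

Let C0 : 0 <= C. Proof. by rewrite !addr_ge0// ?(M0 B1) ?(M0 B2) ?(M0 B3). Qed.

Let v_gradient (eps t : R) i j : `|eps| <= e -> 0 <= t ->
  {ae mu3, forall x : mspace R, Omega b x -> wd3 b [:: j] (v eps t i) x =
     eps * wd3 b [:: j] (v1 t i) x + eps ^+ 2 * wd3 b [:: j] (v2 t i) x +
     eps ^+ 3 * wd3 b [:: j] (v3 t i) x} /\
  nrms (wd3 b [:: j] (v eps t i)) <= `|eps| * C.
Proof.
move=> /e_small[h1 h2] t0; have [_ [cv _] _ _ hv] := H h1.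
have [r hr] := tan0_fin cv t0.
by have [? k] := expansion_gradient i j hr (B1 t0) (B2 t0) (B3 t0) (hv t t0); split => //; exact: k.
Qed.

Let eps_ (n : nat) : R := e * 2^-1 ^+ n.

Let eps_gt0 n : 0 < eps_ n. Proof. by rewrite mulr_gt0// exprn_gt0// invr_gt0. Qed.

Let eps_le n : `|eps_ n| <= e.
Proof.
rewrite gtr0_norm// /eps_ ler_piMr ?(ltW e0)// exprn_ile1 ?invr_ge0//.
by rewrite invf_le1// ler1n.
Qed.

Let eps_cvg : eps_ n @[n --> \oo] --> (0 : R).
Proof.
have h : `|2^-1 : R| < 1 by rewrite gtr0_norm ?invr_gt0// invf_lt1// ltr1n.
have := cvgM (cvg_cst e) (cvg_expr h); rewrite mulr0; exact.
Qed.

(* Along eps_n = e / 2^n the displacement gradients are O(2^-n) in L^2, hence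
   tend to 0 a.e. *)
Lemma first_order_div_free : {ae mu1, forall t : R, 0 <= t ->
  {ae mu3, forall x : mspace R, Omega b x -> wd3 b [:: ord0] (v1 t ord0) x +
    (wd3 b [:: lift ord0 ord0] (v1 t (lift ord0 ord0)) x + wd3 b [:: ord_max] (v1 t ord_max) x) = 0}}.
Proof.
pose P n (t : R) := 0 <= t -> {ae mu3, forall x : mspace R, Omega b x ->
  Jof (grad b (xi (eps_ n) t) x) != 0 /\
  \sum_(i < 3) \sum_(j < 3) Aof (grad b (xi (eps_ n) t) x) i j * grad b (v (eps_ n) t) x i j = 0}.
have hP n : {ae mu1, forall t : R, P n t}.
  have [h1 _] := e_small (eps_le n); have [_ _ sol _ _] := H h1.
  have [dtv [_ hm]] := vsw_momentum sol; have hi := vsw_incompressible sol.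
  apply: (ae_imp2 hm hi) => t k1 k2 t0; have [_ {}k1] := k1 t0; have {}k2 := k2 t0.
  by apply: (ae_imp2 k1 k2) => x l1 l2 Dx; have [J _] := l1 Dx; split; [exact: J|exact: l2].
have := ae_foralln hP; apply: filterS => t ht t0.
have hx : {ae mu3, forall x : mspace R, forall n, Omega b x ->
  Jof (grad b (xi (eps_ n) t) x) != 0 /\
  \sum_(i < 3) \sum_(j < 3) Aof (grad b (xi (eps_ n) t) x) i j * grad b (v (eps_ n) t) x i j = 0}.
  by apply: ae_foralln => n; exact: (ht n t0).
have hG : {ae mu3, forall x : mspace R, forall i j, Omega b x ->
    wd3 b [:: j] (xi (eps_ n) t i) x @[n --> \oo] --> (0 : R)}.
  apply: ae_ord => i; apply: ae_ord => j.
  pose K := e * (nrms (wd3 b [:: j] (th i)) + t * C).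
  apply: (@ae_cvg0 R _ _ mu3 (Omega b) (fun n => wd3 b [:: j] (xi (eps_ n) t i)) K mO) => n.
    have [h1 _] := e_small (eps_le n); have [cx _ _ _ _] := H h1.
    by have [r hr] := ring_fin cx t0; have [_ _ h _ _] := vnorm_ring_field hr; have [] := h i j.
  have [h1 _] := e_small (eps_le n); have [cx [cv _] sol _ _] := H h1.
  have hgb := gradient_bound C0 fth cx cv (vsw_displacement sol) (vsw_init_xi sol).
  apply: (le_trans (hgb _ t t0 i j)).
    by move=> s s0 i' j'; have [_] := v_gradient i' j' (eps_le n) s0.
  by rewrite gtr0_norm// /eps_ exprVn /K mulrAC.
have hV : {ae mu3, forall x : mspace R, forall n i j, Omega b x ->
    wd3 b [:: j] (v (eps_ n) t i) x = eps_ n * wd3 b [:: j] (v1 t i) x +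
      eps_ n ^+ 2 * wd3 b [:: j] (v2 t i) x + eps_ n ^+ 3 * wd3 b [:: j] (v3 t i) x}.
  apply: ae_foralln => n; apply: ae_ord => i; apply: ae_ord => j.
  by have [] := v_gradient i j (eps_le n) t0.
apply: (filterS3 _ _ hx hG hV) => x k1 k2 k3 Dx.
(* The velocity gradient divided by [eps_ n], which tends to the gradient of [v1]. The constraint is
   linear in it and thus survives the division. *)
pose Hn n : 'M[R]_3 := \matrix_(i, j) (wd3 b [:: j] (v1 t i) x +
  (eps_ n * wd3 b [:: j] (v2 t i) x + eps_ n ^+ 2 * wd3 b [:: j] (v3 t i) x)).
have := @linearized_incompressibility R (fun n => grad b (xi (eps_ n) t) x) Hn (grad b (v1 t) x).
rewrite sum_ord3 !mxE; apply.
- by move=> i j; under eq_fun do rewrite mxE; exact: k2.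
- move=> i j; rewrite mxE; under eq_fun do rewrite mxE.
  have k : wd3 b [:: j] (v1 t i) x + (eps_ n * wd3 b [:: j] (v2 t i) x +
      eps_ n * eps_ n * wd3 b [:: j] (v3 t i) x) @[n --> \oo] -->
    wd3 b [:: j] (v1 t i) x + (0 * wd3 b [:: j] (v2 t i) x + 0 * 0 * wd3 b [:: j] (v3 t i) x).
    apply: cvgD; first exact: cvg_cst.
    apply: cvgD; apply: cvgM; [exact: eps_cvg|exact: cvg_cst| |exact: cvg_cst].
    by apply: cvgM; exact: eps_cvg.
  by rewrite !mul0r !addr0 in k; exact: k.
- by move=> n; have [] := k1 n Dx.
move=> n; have [_ k] := k1 n Dx; apply: (mulfI (lt0r_neq0 (eps_gt0 n))).
rewrite mulr0 -[RHS]k mulr_sumr; apply: eq_bigr => i _; rewrite mulr_sumr; apply: eq_bigr => j _.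
by rewrite [Hn n i j]mxE [in RHS]/grad [in RHS]mxE (k3 n i j Dx); ring.
Qed.

Section frequency.
Variables (a k : R -> R).
Hypothesis tk : tame k.
Hypothesis ta : tame a.
Hypothesis thE : th = profile a.

Let X : mspace R -> R := tens3 (cst 1) k k.
Let I_ (w : R -> field) (t : R) := \int[mu1]_(s in `[0, t]) ips (wd3 b [:: ord0] (w s ord0)) X.

Let LX : L2s X. Proof. exact: (tame_L2 b0 1 tk tk). Qed.

(** As [theta^1] does not depend on [x_1], its pairing over the slab is [b] times the one in the
    plane, and the term with the vertical derivative vanishes. *)
Let initial_pairing (eps : R) : `|eps| <= e ->
  ips (xi eps 0 ord0) X = eps * (b * ipp (tens2 a a) (tens2 k k)) /\
  ips (wd3 b [:: ord0] (xi eps 0 ord0)) (wgt b 0 X) = 0.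
Proof.
move=> /e_small[h1 _]; have [cx _ sol _ _] := H h1.
have [r hr] := ring_fin cx (lexx 0); have [Lx _ Lg _ _] := vnorm_ring_field hr.
have [rt ht] := lty_le_EFin (vnorm_ring_ge0 b 3 th) fth.
have [Lth ith _ _ _] := vnorm_ring_field ht.
have hi : {ae mu3, forall x : mspace R, Omega b x -> xi eps 0 ord0 x = eps * th ord0 x}.
  by apply: (ae_imp2 (vsw_init_xi sol) (vsw_init_xi sol)) => x h _ Dx; exact: h.
have [_ La _] := ta 0%N; have [_ Lk _] := tk 0%N.
have ea : th ord0 = (fun x => tens2 a a x.2).
  by apply/funext => x; rewrite thE /profile /tens3 /tens2 /= ?eqxx mul1r.
have ek : X = (fun x => tens2 k k x.2).
  by apply/funext => x; rewrite /X /tens3 /tens2 /= mul1r.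
have Lt := Lth ord0; split.
  rewrite (ip_ae mO (L2_meas (Lx ord0)) (L2_meas (L2Z mO eps Lt)) (L2_meas LX) hi) (ipZl mO eps Lt LX).
  by congr (_ * _); rewrite ea ek; exact: (ip_lift b0 (L2_tens2 La La) (L2_tens2 Lk Lk)).
have a0 : (0 : R) = 0 \/ (0 : R) = - b by left.
rewrite ipC; apply: (ip0_ae _ _); [exact: (L2_meas (wgt_L2 b0 a0 LX))|by have [/L2_meas] := Lg ord0 ord0|].
have h2 := scaled_gradient (ith ord0 ord0) (L2_meas (Lx ord0)) hi.
have h3 : {ae mu3, forall x : mspace R, Omega b x -> wd3 b [:: ord0] (th ord0) x = 0}.
  by rewrite thE; exact: (wd3_lift0 b _ ta ta).
by apply: filterS2 h2 h3 => x k1 k2 Dx; rewrite (k1 Dx) (k2 Dx) mulr0.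
Qed.

(** The initial terms of [trace_evolution] reduce to the overlap of profile and kernel, and
    linearity in the velocity splits the flux into its three orders. *)
Let trace_formula (eps t : R) : `|eps| <= e -> 0 <= t ->
  ipp (trace0 b (xi eps t ord0)) (tens2 k k) =
  eps * ipp (tens2 a a) (tens2 k k) +
  (eps * I_ v1 t + eps ^+ 2 * I_ v2 t + eps ^+ 3 * I_ v3 t).
Proof.
move=> he t0; have [h1 _] := e_small he; have [cx [cv [M hM]] sol _ _] := H h1.
have LW (w : R -> field) (s : R) : ccont tan0 w -> 0 <= s -> L2s (wd3 b [:: ord0] (w s ord0)).
  by move=> cw s0; have [r hr] := tan0_fin cw s0; have [] := tan0_gradient ord0 ord0 hr.
have [p1 p2] := initial_pairing he.
have := trace_evolution b0 cx cv hM (vsw_displacement sol ord0) tk t0.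
rewrite -/X /= p1 p2 addr0.
have mI : measurable (`[0, t]%classic : set (measurableTypeR R)) := measurable_itv _.
have itgW (w : R -> field) : ccont tan0 w ->
    mu1.-integrable `[0, t] (EFin \o (fun s => ips (wd3 b [:: ord0] (w s ord0)) X)).
  move=> cw; apply: cts0_itg; exact: (tan0_cts_gradient (v := w) (i := ord0) (j := ord0) cw LX).
have i1 := itgW v1 c1; have i2 := itgW v2 c2; have i3 := itgW v3 c3.
have z1 := itgZ mI eps i1; have z2 := itgZ mI (eps ^+ 2) i2; have z3 := itgZ mI (eps ^+ 3) i3.
have z12 := itgD mI z1 z2.
have -> : \int[mu1]_(s in `[0, t]) ips (wd3 b [:: ord0] (v eps s ord0)) X =
    eps * I_ v1 t + eps ^+ 2 * I_ v2 t + eps ^+ 3 * I_ v3 t.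
  rewrite /I_ -(RintegralZl eps mI i1) -(RintegralZl (eps ^+ 2) mI i2) -(RintegralZl (eps ^+ 3) mI i3).
  rewrite -(RintegralD mI z1 z2) -(RintegralD mI z12 z3).
  apply: eq_Rintegral => s /set_mem /=; rewrite in_itv/= => /andP[s0 _].
  have La := L2Z mO eps (LW v1 s c1 s0); have Lb := L2Z mO (eps ^+ 2) (LW v2 s c2 s0).
  have Lc := L2Z mO (eps ^+ 3) (LW v3 s c3 s0); have Lab := L2D mO La Lb.
  have [hg _] := v_gradient ord0 ord0 he s0.
  rewrite (ip_ae mO (L2_meas (LW (v eps) s cv s0)) (L2_meas (L2D mO Lab Lc)) (L2_meas LX) hg).
  rewrite (ipDl mO Lab Lc LX) (ipDl mO La Lb LX) (ipZl mO _ (LW v1 s c1 s0) LX).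
  by rewrite (ipZl mO _ (LW v2 s c2 s0) LX) (ipZl mO _ (LW v3 s c3 s0) LX).
by rewrite mulrCA -mulrDr => /(mulfI (lt0r_neq0 b0)).
Qed.

Let trace_cvg (eps : R) : `|eps| <= e ->
  ipp (trace0 b (xi eps t ord0)) (tens2 k k) @[t --> +oo] --> (0 : R).
Proof.
move=> he; have [h1 _] := e_small he; have [_ _ _ hs _] := H h1.
have [_ Lk _] := tk 0%N; have Lkk := L2_tens2 Lk Lk.
pose N := nrmp (tens2 k k); have N0 : 0 <= N := nrm_ge0 _ _ _.
apply/cvgrPdist_lt => d dp; have dN : 0 < d / (N + 1) by rewrite divr_gt0// ltr_wpDl.
have := hs [set y : \bar R | (y < (d / (N + 1))%:E)%E]; move=> /(_ (open_ereal_lt' _)) hh.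
have {}hh : \forall t \near +oo, (snorm (on_Sigma0 b (Hplane2 2)) (xi eps t ord0) < (d / (N + 1))%:E)%E.
  by apply: hh; rewrite lte_fin.
move: hh; apply: filterS => t /ltW ht.
have [[ph tr] nt] := on_Sigma0_trace (fun g => (plane_sob 2 g).1) (fun g => (plane_sob 2 g).2) ht.
rewrite sub0r normrN; apply: (le_lt_trans (cauchy_schwarz measurableT (tra_L2g tr) Lkk)).
apply: (@le_lt_trans _ _ (d / (N + 1) * N)); first by rewrite ler_wpM2r.
by rewrite mulrAC ltr_pdivrMr ?ltr_wpDl// ltr_pM2l// ltrDl.
Qed.

(** For every small [eps] the trace pairing is cubic in [eps] and tends to 0 in time, which
    determines the limit of its linear coefficient. *)
Lemma first_order_trace_cvg : I_ v1 t @[t --> +oo] --> - ipp (tens2 a a) (tens2 k k).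
Proof.
apply: (@linear_coefficient_cvg R (ipp (tens2 a a) (tens2 k k)) e (I_ v1) (I_ v2) (I_ v3) e0) => eps he.
apply: cvg_trans (trace_cvg he); apply: near_eq_cvg; near=> t.
by apply: trace_formula => //; near: t; apply: nbhs_pinfty_ge; exact: num_real.
Unshelve. all: by end_near. Qed.

End frequency.

(** At almost every time the flux is bounded by [r^sigma0] times the norm of [Lambda_h^sigma0 v1],
    up to a constant. The time integral [S] of this norm is finite because [v1] lies in the weighted
    L^1 space, and it does not depend on [r]. *)
Lemma overlap_upper (a : R -> R) : tame a -> th = profile a ->
  bochner_Lp_Lambda b 1 sigma0 (vnorm (Htan2 b 2 2)) v1 ->
  exists L : R, forall r, 1 <= r ->
    ipp (tens2 a a) (tens2 (kern r) (kern r)) <= L * r `^ sigma0.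
Proof.
move=> ta thE [w [[_ fin] hL]].
pose g (s : R) : \bar R := vnorm (Htan2 b 2 2) (w s).
have g0 s : (0 <= g s)%E by exact: sqrte_ge0.
pose S := (\int[mu1]_(s in `[0%R, +oo[) g s)%E.
have S0 : (0 <= S)%E by apply: integral_ge0 => s _.
have fS : S \is a fin_num by rewrite ge0_fin_numE.
exists (4 * pi * Num.sqrt b * fine S) => r r1; have tk := tame_kern r1.
have rp : 0 < r := lt_le_trans ltr01 r1.
pose K := 2 * pi * Num.sqrt b * r `^ sigma0.
have K0 : 0 < K by rewrite !mulr_gt0 ?pi_gt0 ?sqrtr_gt0 ?powR_gt0.
have K2 : 0 < 2 * K by rewrite mulr_gt0.
pose X : mspace R -> R := tens3 (cst 1) (kern r) (kern r).
have LX : L2s X := tame_L2 b0 1 tk tk.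
have sp : 0 < sigma0 by apply: lt_trans s0_gt; rewrite invr_gt0.
pose J (s : R) := ips (wd3 b [:: ord0] (v1 s ord0)) X.
have cJ : cts0 J := tan0_cts_gradient (v := v1) (i := ord0) (j := ord0) c1 LX.
(* Normalised by [2 K], one [K] for each horizontal component, so that [|j|] is bounded a.e. by the
   norm [g] itself. *)
pose j (s : R) := J s * (2 * K)^-1.
have cj : cts0 j by move=> t t0; apply: cvgM; [exact: cJ|exact: cvg_cst].
have mI : measurable (`[0, +oo[%classic : set (measurableTypeR R)) := measurable_itv _.
have hae : {ae mu1, forall s : R, `[0, +oo[%classic s -> ((`|j s|)%:E <= g s)%E}.
  apply: (ae_imp2 hL first_order_div_free) => s kL kd /=; rewrite in_itv/= andbT => s0.
  have [->|gy] := eqVneq (g s) +oo%E; first exact: leey.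
  have fg : g s \is a fin_num by rewrite ge0_fin_numE// ltey.
  have hw : (g s <= (fine (g s))%:E)%E by rewrite fineK.
  have [Lw2 n2] := vnorm_field (lift ord0 ord0) hw; have [Lw3 n3] := vnorm_field ord_max hw.
  have [rv hv] := tan0_fin c1 s0.
  have [L2v _] := tan0_field (lift ord0 ord0) hv; have [L3v _] := tan0_field ord_max hv.
  have [_ Ld1 _] := tan0_gradient ord0 ord0 hv.
  have [j2 Ld2 _] := tan0_gradient (lift ord0 ord0) (lift ord0 ord0) hv.
  have [j3 Ld3 _] := tan0_gradient ord_max ord_max hv.
  have fb := flux_bound b0 sp s0_lt r1 L2v L3v Lw2 Lw3 Ld1 Ld2 Ld3
    (kL s0 (lift ord0 ord0)) (kL s0 ord_max) j2 j3 (kd s0).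
  rewrite -(fineK fg) lee_fin /j normrM normfV (gtr0_norm K2).
  have fb' : `|J s| <= K * (nrms (w s (lift ord0 ord0)) + nrms (w s ord_max)) := fb.
  rewrite (ler_pdivrMr _ _ K2); apply: (le_trans fb').
  have -> : fine (g s) * (2 * K) = K * (fine (g s) + fine (g s)) by ring.
  by apply: (ler_wpM2l (ltW K0)); exact: lerD.
have hS : (\int[mu1]_(s in `[0%R, +oo[) (`|j s|)%:E <= S)%E.
  apply: (le_integral_ae_nonmeas mI _ _ _ hae) => //.
  apply: measurableT_comp => //; apply: cts0_meas cj => // s /=.
  by rewrite in_itv/= andbT.
have bound (t : R) : 0 <= t -> `|\int[mu1]_(s in `[0, t]) J s| <= 2 * K * fine S.
  move=> t0; have mt : measurable (`[0, t]%classic : set (measurableTypeR R)) := measurable_itv _.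
  have iJ := cts0_itg t cJ; have ij := cts0_itg t cj.
  have : (`|\int[mu1]_(s in `[0, t]) j s|%:E <= S)%E.
    apply: (le_trans (le_norm_Rint mt ij)); apply: (le_trans _ hS).
    have sub : `[0, t]%classic `<=` (`[0, +oo[%classic : set (measurableTypeR R)).
      by move=> s /=; rewrite !in_itv/= andbT => /andP[].
    have n0 (s : measurableTypeR R) : (0 <= (`|j s|)%:E)%E by rewrite lee_fin.
    exact: (@le_integral_nonmeas R _ (measurableTypeR R) mu1 _ _ (fun s => (`|j s|)%:E)
      (fun s => (`|j s|)%:E) sub (fun s _ => n0 s) (fun s _ => lexx _) (fun s _ => n0 s)).
  rewrite /j (RintegralZr _ mt iJ) normrM normfV (gtr0_norm K2).
  by rewrite -(fineK fS) lee_fin (ler_pdivrMr _ _ K2) mulrC.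
have cI := first_order_trace_cvg tk ta thE.
(* Integer times suffice, the bound on the flux being uniform in time. *)
have cn := cvg_comp _ _ (@cvgr_idn R) cI.
have := norm_lim_le (fun n => bound n%:R (ler0n _ n)) cn; rewrite normrN => hc.
apply: (le_trans (ler_norm _)); apply: (le_trans hc).
by rewrite le_eqVlt /K; apply/orP; left; apply/eqP; ring.
Qed.

End curve.
End obstruction.

Theorem theorem3p2 (R : realType) (b nu sigma0 : R)
    (b_gt0 : 0 < b) (nu_gt0 : 0 < nu)
    (sigma0_gt : 2^-1 < sigma0) (sigma0_lt : sigma0 < 1) :
  exists theta : 'I_3 -> R * (R * R) -> R,
    (vnorm_ring b 3 theta < +oo)%E /\
    ~ exists (delta : R) (v xi : R -> R -> 'I_3 -> R * (R * R) -> R)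
             (q : R -> R -> R * (R * R) -> R)
             (v1 v2 v3 : R -> 'I_3 -> R * (R * R) -> R),
        [/\ 0 < delta,
            spaceE b sigma0 v1, spaceE b sigma0 v2, spaceE b sigma0 v3 &
            forall eps : R, `|eps| < delta ->
              [/\ [/\ spaceE b sigma0 (v eps),
                      bochner_L2loc (snorm (Htan2 b 1 3)) (q eps),
                      ccont (vnorm_ring b 3) (xi eps),
                      cbcont (vnorm (on_Sigma0 b (Hplane2 4))) (xi eps) &
                      cbcont (vnorm_ring b 2) (xi eps)],
                  VSW b nu (fun i x => eps * theta i x) (fun _ _ => 0)
                      (xi eps) (v eps) (q eps),
                  snorm (on_Sigma0 b (Hplane2 2)) (xi eps t ord0)
                    @[t --> +oo] --> 0%E &
                  forall t : R, 0 <= t ->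
                    {ae mu3, forall x : R * (R * R), Omega b x -> forall i,
                       v eps t i x = eps * v1 t i x + eps ^+ 2 * v2 t i x
                                     + eps ^+ 3 * v3 t i x}]].
Proof.
(* With this choice [2 - 4 s = (1 + sigma0) / 2], halfway between [sigma0] and 1. *)
pose s := 4^-1 + (1 - sigma0) / 8.
have hs : 4^-1 < s by rewrite /s; lra.
have ta : tame (pw 1 (- s)) by apply: tame_pw => //; rewrite ltrN2.
exists (profile (pw 1 (- s))); split; first exact: vnorm_ring_profile.
move=> [delta [v [xi [q [v1 [v2 [v3 [d0 E1 E2 E3 H]]]]]]]].
have [[c1 [M1 B1]] _ hL _] := E1; have [[c2 [M2 B2]] _ _ _] := E2.
have [[c3 [M3 B3]] _ _ _] := E3.
have Hs : solution_curve b nu delta (profile (pw 1 (- s))) v xi q v1 v2 v3.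
  by move=> eps he; have [[[cv _ _ _] _ cx _ _] sol h0 hv] := H eps he.
have [L hL'] := overlap_upper b_gt0 sigma0_gt sigma0_lt d0
  (vnorm_ring_profile b_gt0 3 ta) Hs c1 c2 c3 B1 B2 B3 ta erefl hL.
apply: (@powR_growth R (2 - 4 * s) sigma0 ((2^-1 * 2 `^ (- s)) ^+ 2) L).
- by rewrite /s; lra.
- by rewrite exprn_gt0// mulr_gt0 ?invr_gt0 ?powR_gt0.
by move=> r r1; exact: (le_trans (overlap_lower r1 hs) (hL' r r1)).
Qed.
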